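(* Let $U\subset\mathbb{C}^d$ be a non-empty connected open set admitting a non-constant bounded holomorphic function, and let $\omega:U\to(0,\infty)$ be a Borel function such that $\operatorname{essinf}_{z\in B}\omega(z)>0$ for every relatively compact subset $B\subset U$ of positive Lebesgue measure, and such that $A^2(U,\omega)\neq\{0\}$. Let $\mathbb{P}_{K_\omega}$ be the determinantal point process on $U$ induced by the reproducing kernel $K_\omega$ of $A^2(U,\omega)$. Then $\mathbb{P}_{K_\omega}$ is $\mathrm{Diff}_c(U)$-quasi-invariant: for every $F\in\mathrm{Diff}_c(U)$ the image measure $F_*(\mathbb{P}_{K_\omega})$ of $\mathbb{P}_{K_\omega}$ under the map $\mathrm{Conf}(U)\to\mathrm{Conf}(U)$, $\mathfrak{X}\mapsto F(\mathfrak{X})=\{F(z):z\in\mathfrak{X}\}$, is equivalent to (mutually absolutely continuous with) $\mathbb{P}_{K_\omega}$.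
   Context: $V$ is Lebesgue measure on $\mathbb{C}^d$, and $A^2(U,\omega)$ is the space of holomorphic $f:U\to\mathbb{C}$ with $\int_U|f|^2\omega\,dV<\infty$; under the assumption on $\omega$ it is a closed subspace of $L^2(U,\omega\,dV)$ with a reproducing kernel $K_\omega$, and the orthogonal projection onto it is locally of trace class. $\mathrm{Diff}_c(U)$ is the group of $C^1$-diffeomorphisms $F:U\to U$ such that $\{z\in U:F(z)\ne z\}$ is relatively compact in $U$. A configuration on $U$ is a locally finite collection of points of $U$; $\mathrm{Conf}(U)$ is the space of configurations with the smallest sigma-algebra making all maps $\mathfrak{X}\mapsto\#(\mathfrak{X}\cap B)$, $B$ relatively compact Borel, measurable. $\mathbb{P}_{K_\omega}$ is the unique simple point process (probability measure on $\mathrm{Conf}(U)$) whose $l$-th correlation measure is $\det(K_\omega(x_i,x_j))_{1\le i,j\le l}\prod_{i=1}^l\omega(x_i)dV(x_i)$ for every $l\ge1$. *)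

(* Defs.v *)
From HB Require Import structures.
From mathcomp Require Import all_boot all_order all_algebra.
From mathcomp Require Import complex ring lra.
From mathcomp Require Import all_classical all_reals all_analysis.
From mathcomp Require Import measurable_realfun ess_sup_inf.

Set Implicit Arguments.
Unset Strict Implicit.
Unset Printing Implicit Defensive.

Import Order.TTheory GRing.Theory Num.Theory.
Import numFieldNormedType.Exports.
Import ComplexField.Normc.

Local Open Scope classical_set_scope.
Local Open Scope complex_scope.
Local Open Scope ring_scope.

(* The complex numbers get the topology and norm that the library puts on
   every numFieldType, so that [differentiable] is over [R[i]]. *)
HB.instance Definition _ (R : realType) :=
  PseudoPointedMetric.copy R[i] R[i]^o.
HB.instance Definition _ (R : realType) := NormedModule.copy R[i] R[i]^o.

Section pushforward_iso.
Context d1 d2 (T1 : measurableType d1) (T2 : measurableType d2) (R : realType).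
Variables (mu : {sigma_finite_measure set T1 -> \bar R}).
Variables (f : T1 -> T2) (g : T2 -> T1).
Hypotheses (mf : measurable_fun setT f) (mg : measurable_fun setT g).
Hypothesis fK : cancel f g.

(* The left inverse [g] only serves to make the image measure sigma-finite. *)
Definition pushforward_iso of measurable_fun setT f & measurable_fun setT g &
  cancel f g := pushforward mu f.

Local Notation nu := (pushforward_iso mf mg fK).

Let nu0 : nu set0 = 0%E.
Proof. by rewrite /nu /pushforward preimage_set0 measure0. Qed.

Let nu_ge0 A : (0 <= nu A)%E.
Proof. exact: measure_ge0. Qed.

Let nu_sigma_additive : semi_sigma_additive nu.
Proof. exact: (@measure_semi_sigma_additive _ _ _ (pushforward mu f)). Qed.

HB.instance Definition _ := isMeasure.Build _ _ _ nu
  nu0 nu_ge0 nu_sigma_additive.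

Let nu_sigma_finite : sigma_finite setT nu.
Proof.
have [F UF mF] := sigma_finiteT mu; exists (fun i => g @^-1` F i).
  by rewrite -preimage_bigcup -UF preimage_setT.
move=> i; split.
  by rewrite -[X in measurable X]setTI; apply: mg => //; exact: (mF i).1.
rewrite /nu /pushforward -comp_preimage (_ : g \o f = id) ?preimage_id ?(mF i).2//.
exact/funext.
Qed.

HB.instance Definition _ := Measure_isSigmaFinite.Build _ _ _ nu
  nu_sigma_finite.

End pushforward_iso.

Section product_sigma_finite.
Context d1 d2 (T1 : measurableType d1) (T2 : measurableType d2) (R : realType).
Variable m1 : {sigma_finite_measure set T1 -> \bar R}.
Variable m2 : {sigma_finite_measure set T2 -> \bar R}.

(* The sigma-finite structure that the library puts on [m1 \x m2] is only found
   for subprobabilities, hence this alias. *)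
Definition sigma_product : set (T1 * T2) -> \bar R := (m1 \x m2)%E.

HB.instance Definition _ := Measure.on sigma_product.

Let sigma_product_sigma_finite : sigma_finite setT sigma_product.
Proof.
have /sigma_finiteP[F [TF ndF Foo]] := sigma_finiteT m1.
have /sigma_finiteP[G [TG ndG Goo]] := sigma_finiteT m2.
exists (fun n => F n `*` G n).
  rewrite -setXTT TF TG predeqE => -[x y]; split.
    move=> [/= [n _ Fnx] [k _ Gky]]; exists (maxn n k) => //; split.
    - by move: x Fnx; exact/subsetPset/ndF/leq_maxl.
    - by move: y Gky; exact/subsetPset/ndG/leq_maxr.
  by move=> [n _ []/= ? ?]; split; exists n.
move=> k; have [? ?] := Foo k; have [? ?] := Goo k.
split; first exact: measurableX.
by rewrite /sigma_product product_measure1E// lte_mul_pinfty// ge0_fin_numE.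
Qed.

HB.instance Definition _ := Measure_isSigmaFinite.Build _ _ _ sigma_product
  sigma_product_sigma_finite.

End product_sigma_finite.

Section tuple_measure.
Context d (T : measurableType d) (R : realType).

Definition tuple_cons n (p : T * n.-tuple T) : n.+1.-tuple T :=
  [tuple of p.1 :: p.2].

Definition tuple_uncons n (t : n.+1.-tuple T) : T * n.-tuple T :=
  (thead t, [tuple of behead t]).

Lemma measurable_tuple_cons n : measurable_fun setT (@tuple_cons n).
Proof. exact: measurable_cons. Qed.

Lemma measurable_tuple_uncons n : measurable_fun setT (@tuple_uncons n).
Proof.
by apply: measurable_fun_pair; [exact: measurable_tnth|exact: measurable_behead].
Qed.

Lemma tuple_consK n : cancel (@tuple_cons n) (@tuple_uncons n).
Proof. by case=> x t; congr pair; exact/val_inj. Qed.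

Fixpoint tuple_measure (mu : {sigma_finite_measure set T -> \bar R}) n :
    {sigma_finite_measure set (n.-tuple T) -> \bar R} :=
  if n is n'.+1 then
    pushforward_iso (sigma_product mu (tuple_measure mu n'))
      (@measurable_tuple_cons n') (@measurable_tuple_uncons n') (@tuple_consK n')
  else \d_ ([tuple] : 0.-tuple T).

End tuple_measure.

Section complex_space.
Context (R : realType) (d : nat).

Definition Cspace := g_sigma_algebraType (@open 'rV[R[i]]_d).

Local Notation RR := (measurableTypeR R).

Definition Cspace_of_tuple (t : d.-tuple (RR * RR)) : Cspace :=
  \row_j ((tnth t j).1 +i* (tnth t j).2).

Definition tuple_of_Cspace (z : Cspace) : d.-tuple (RR * RR) :=
  [tuple (complex.Re ((z : 'rV[R[i]]_d) ord0 j),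
          complex.Im ((z : 'rV[R[i]]_d) ord0 j)) | j < d].

Lemma Cspace_of_tupleK : cancel Cspace_of_tuple tuple_of_Cspace.
Proof.
move=> t; apply: eq_from_tnth => j.
by rewrite tnth_mktuple mxE/=; case: (tnth t j).
Qed.

Lemma normC_ReIm_lt (z : R[i]) (e : R) :
  `|complex.Re z| < e / 2 -> `|complex.Im z| < e / 2 -> `|z| < e%:C.
Proof.
move=> re im; rewrite normc_def ltcR.
have e0 : 0 < e by have := le_lt_trans (normr_ge0 _) re; lra.
rewrite -[ltRHS]gtr0_norm// -sqrtr_sqr ltr_sqrt ?exprn_gt0//.
have h (x : R) : `|x| < e / 2 -> x ^+ 2 < e ^+ 2 / 4.
  move=> xe; rewrite -real_normK ?num_real//.
  rewrite (_ : e ^+ 2 / 4 = (e / 2) ^+ 2); last by field.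
  by rewrite ltr_pXn2r// ?nnegrE// divr_ge0// ltW.
have := h _ re; have := h _ im; have := exprn_gt0 2 e0; lra.
Qed.

Lemma continuous_Re : continuous (@complex.Re R).
Proof.
move=> z; apply/(@cvgrPdist_lt _ _ _ _ (nbhs_filter z)) => e e0.
apply/nbhs_ballP; exists e%:C; first by rewrite /= ltcR.
move=> w; rewrite -ball_normE/= -raddfB/= -ltcR; apply: le_lt_trans.
exact: normc_ge_Re.
Qed.

Lemma continuous_Im : continuous (@complex.Im R).
Proof.
move=> z; apply/(@cvgrPdist_lt _ _ _ _ (nbhs_filter z)) => e e0.
apply/nbhs_ballP; exists e%:C; first by rewrite /= ltcR.
move=> w; rewrite -ball_normE/= -raddfB/= -ltcR; apply: le_lt_trans.
rewrite normc_def lecR -sqrtr_sqr ler_wsqrtr// lerDr sqr_ge0//.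
Qed.

Lemma measurable_Cspace_of_tuple : measurable_fun setT Cspace_of_tuple.
Proof.
apply: (measurability (@open 'rV[R[i]]_d : set (set Cspace)) erefl).
move=> _ [A oA <-]; rewrite setTI.
pose Q := (d.-tuple (rat * rat) * nat)%type.
pose box (q : Q) : set (d.-tuple (RR * RR)) :=
  \bigcap_(j in [set: 'I_d]) (fun t => tnth t j) @^-1`
    ([set x : RR | `|x - ratr (tnth q.1 j).1| < q.2.+1%:R^-1] `*`
     [set x : RR | `|x - ratr (tnth q.1 j).2| < q.2.+1%:R^-1]).
have mitv (r e : R) : measurable [set x : RR | `|x - r| < e].
  rewrite (_ : [set _ | _] = `]r - e, r + e[%classic)//.
  by apply/seteqP; split => x /=; rewrite in_itv/= ltr_distl.
have mbox q : measurable (box q).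
  apply: fin_bigcap_measurable => // j _.
  by rewrite -[X in measurable X]setTI; apply: measurable_tnth => //; exact: measurableX.
pose F q := if pselect (box q `<=` Cspace_of_tuple @^-1` A) then box q else set0.
suff -> : Cspace_of_tuple @^-1` A = \bigcup_q F q.
  apply: countable_bigcupT_measurable; first exact: (@countableP (d.-tuple (rat * rat) * nat)%type).
  by move=> q; rewrite /F; case: pselect => /= _; [exact: mbox|exact: measurable0].
apply/seteqP; split => [t At|t [q _]]; last first.
  by rewrite /F; case: pselect => //= + qt; exact.
have /nbhs_ballP[e /= e0 eA] : nbhs (Cspace_of_tuple t : 'rV[R[i]]_d) A.
  exact: open_nbhs_nbhs.
have [r r0 er] : exists2 r : R, 0 < r & e = r%:C.
  by case: e e0 {eA} => a b; rewrite ltcE/= => /andP[/eqP-> a0]; exists a.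
have [|n] := @ltr_add_invr R 0 (r / 4); first exact: divr_gt0.
rewrite add0r => nr.
have h (x : R) : {q : rat | `|x - ratr q| < n.+1%:R^-1}.
  apply/cid; have [] := @rat_in_itvoo R (x - n.+1%:R^-1) (x + n.+1%:R^-1).
    by rewrite ltrD2l gtrN// invr_gt0.
  by move=> q; rewrite in_itv/= -ltr_distl distrC; exists q.
have hP x : `|x - ratr (sval (h x))| < n.+1%:R^-1 by case: (h x).
pose q : Q := ([tuple (sval (h (tnth t j).1), sval (h (tnth t j).2)) | j < d], n).
exists q => //; rewrite /F; case: pselect => [_|] /=; last first.
{ case=> s qs; apply: eA; split => // i j.
  have tri (a b c e' : R) :
      `|a - c| < e' -> `|b - c| < e' -> e' < r / 4 -> `|a - b| < r / 2.
    rewrite !ltr_norml => /andP[? ?] /andP[? ?] ?.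
    by apply/andP; split; lra.
  have [] := qs j I; rewrite /= tnth_mktuple/= => sq1 sq2.
  rewrite (ord1 i) -ball_normE/= !mxE er.
  apply: normC_ReIm_lt; rewrite raddfB/=.
    exact: (tri _ _ _ _ (hP _) sq1 nr).
  exact: (tri _ _ _ _ (hP _) sq2 nr). }
by move=> j _ /=; rewrite tnth_mktuple/=; split; exact: hP.
Qed.

Lemma measurable_continuous_Cspace (f : 'rV[R[i]]_d -> R) :
  continuous f -> measurable_fun setT (f : Cspace -> RR).
Proof.
move=> /continuousP cf.
apply: (measurability _ (RGenOpens.measurableE R)).
move=> _ [_ [a [b ->]] <-]; rewrite setTI.
by apply: sub_sigma_algebra; apply: cf; exact: interval_open.
Qed.

Lemma measurable_tuple_of_Cspace : measurable_fun setT tuple_of_Cspace.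
Proof.
apply/measurable_fun_tnthP => j.
rewrite (_ : _ \o _ = fun z : Cspace =>
  (complex.Re ((z : 'rV[R[i]]_d) ord0 j), complex.Im ((z : 'rV[R[i]]_d) ord0 j)));
  last by apply/funext => z /=; rewrite tnth_mktuple.
apply: measurable_fun_pair; apply: measurable_continuous_Cspace => z.
  apply: continuous_comp; [exact: coord_continuous|exact: continuous_Re].
apply: continuous_comp; [exact: coord_continuous|exact: continuous_Im].
Qed.

(* C^d is identified with (R^2)^d, coordinate by coordinate. *)
Definition Clebesgue : {sigma_finite_measure set Cspace -> \bar R} :=
  pushforward_iso
    (tuple_measure
      (sigma_product (@lebesgue_measure R) (@lebesgue_measure R)) d)
    measurable_Cspace_of_tuple measurable_tuple_of_Cspace Cspace_of_tupleK.

End complex_space.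

Definition relatively_compact (T : topologicalType) (U B : set T) : Prop :=
  compact (closure B) /\ closure B `<=` U.

Section real_coordinates.
Context (R : realType) (d : nat).

Definition real_coord (z : 'rV[R[i]]_d) : 'rV[R]_(d + d) :=
  row_mx (map_mx (@complex.Re R) z) (map_mx (@complex.Im R) z).

Definition of_real_coord (x : 'rV[R]_(d + d)) : 'rV[R[i]]_d :=
  \row_j (x ord0 (lshift d j) +i* x ord0 (rshift d j)).

Lemma real_coordK : cancel real_coord of_real_coord.
Proof.
move=> z; apply/rowP => j.
rewrite mxE /real_coord row_mxEl row_mxEr !mxE.
by case: (z ord0 j).
Qed.

Lemma continuous_mx (T : topologicalType) (S : topologicalType) m n
    (f : T -> 'M[S]_(m, n)) (x : T) :
  (forall i j, {for x, continuous (fun y => f y i j)}) -> {for x, continuous f}.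
Proof.
move=> fc A [P nP PA]; have : \forall y \near x, forall i j, P i j (f y i j).
  apply: filter_forall => i; apply: filter_forall => j.
  exact: (fc i j _ (nP i j)).
by apply: filterS => y Py; exact: PA.
Qed.

Lemma continuous_real_coord : continuous real_coord.
Proof.
move=> z; apply: continuous_mx => i j; rewrite /real_coord.
rewrite (_ : (fun _ => _) = fun y : 'rV[R[i]]_d =>
    match fintype.split j with
    | inl k => complex.Re (y i k)
    | inr k => complex.Im (y i k)
    end); last by apply/funext => y; rewrite mxE; case: fintype.split => k; rewrite mxE.
case: fintype.split => k; apply: continuous_comp; first exact: coord_continuous.
- exact: continuous_Re.
- exact: coord_continuous.
- exact: continuous_Im.
Qed.

Lemma continuous_of_real_coord : continuous of_real_coord.
Proof.
move=> x; apply: continuous_mx => i j.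
apply/(@cvgrPdist_lt _ _ _ _ (nbhs_filter x)) => -[e e'].
rewrite ltcE/= => /andP[/eqP-> e0].
have h k : nbhs x (fun y : 'rV[R]_(d + d) => `|x ord0 k - y ord0 k| < e / 2).
  have /cvgrPdist_lt := @coord_continuous R 1 (d + d) ord0 k x.
  by apply; rewrite divr_gt0.
apply: (@filterS _ (nbhs x) (nbhs_filter x) _ _ _
  (filterI (h (lshift d j)) (h (rshift d j)))) => y [h1 h2].
by apply: normC_ReIm_lt; rewrite !mxE raddfB.
Qed.

(* Real differentiability, hence the passage to R^(2d); [U] is meant to be open. *)
Definition C1_on (U : set 'rV[R[i]]_d) (F : 'rV[R[i]]_d -> 'rV[R[i]]_d) : Prop :=
  let f := real_coord \o F \o of_real_coord in
  forall z, U z -> differentiable f (real_coord z) /\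
                   {for real_coord z, continuous (jacobian f)}.

Lemma C1_on_continuous U F z : C1_on U F -> U z -> {for z, continuous F}.
Proof.
move=> + Uz => /(_ _ Uz)[/differentiable_continuous df _].
rewrite (_ : F = of_real_coord \o
    ((real_coord \o F \o of_real_coord) \o real_coord)); last first.
  by apply/funext => w /=; rewrite !real_coordK.
apply: continuous_comp; last exact: continuous_of_real_coord.
by apply: continuous_comp => //; exact: continuous_real_coord.
Qed.

(* [F] restricts to an element of Diff_c(U); its values outside [U] are
   irrelevant. *)
Definition Diffc (U : set 'rV[R[i]]_d) (F : 'rV[R[i]]_d -> 'rV[R[i]]_d) : Prop :=
  (exists G : 'rV[R[i]]_d -> 'rV[R[i]]_d,
    [/\ forall z, U z -> U (F z) /\ G (F z) = z,
        forall z, U z -> U (G z) /\ F (G z) = z,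
        C1_on U F
      & C1_on U G]) /\
  relatively_compact U [set z | U z /\ F z <> z].

End real_coordinates.

Section configurations.
Context (T : topologicalType).

(* Configurations are multisets, given by the multiplicities of their points. *)
Record configuration (U : set T) := Configuration {
  multiplicity :> T -> nat;
  _ : forall z, multiplicity z != 0%N -> U z;
  _ : forall K, compact K -> K `<=` U ->
        finite_set [set z | K z /\ multiplicity z != 0%N] }.

Context (U : set T).
Implicit Types (X : configuration U) (B : set T).

Lemma configuration_supp X z : X z != 0%N -> U z.
Proof. by case: X => m mU mf /=; exact: mU. Qed.

Lemma configuration_locally_finite X K : compact K -> K `<=` U ->
  finite_set [set z | K z /\ X z != 0%N].
Proof. by case: X => m mU mf /=; exact: mf. Qed.

Lemma configuration0_finite (K : set T) :
  compact K -> K `<=` U -> finite_set [set z | K z /\ 0%N != 0%N].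
Proof.
by move=> _ _; rewrite (_ : [set _ | _] = set0)//; apply/seteqP; split=> z // [].
Qed.

Definition configuration0 : configuration U :=
  Configuration (fun z (z0 : 0%N != 0%N) => False_ind (U z) (notF z0))
    configuration0_finite.

HB.instance Definition _ := gen_eqMixin (configuration U).
HB.instance Definition _ := gen_choiceMixin (configuration U).
HB.instance Definition _ := isPointed.Build (configuration U) configuration0.

(* #(X \cap B), a finite sum when B is relatively compact in U *)
Definition config_count X B : nat := \big[addn/0%N]_(z \in B) X z.

Definition config_events : set (set (configuration U)) :=
  [set A | exists B (N : set nat),
    [/\ <<s open >> B, relatively_compact U B
      & A = [set X | N (config_count X B)]]].

Definition Conf := g_sigma_algebraType config_events.

Definition simple_config X : Prop := forall z, (X z <= 1)%N.

(* The number of ways to choose l distinct particles of X, in order, such that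
   their positions form a tuple in A. *)
Definition config_tuples (R : realType) X l (A : set (l.-tuple T)) : \bar R :=
  (\esum_(t in A)
    (\prod_(i < l) (X (tnth t i) -
       \sum_(j < l | (j < i)%N) (tnth t j == tnth t i)))%N%:R%:E)%E.

End configurations.

Section config_image.
Context (R : realType) (d : nat) (U : set 'rV[R[i]]_d).
Variables (F : 'rV[R[i]]_d -> 'rV[R[i]]_d) (hF : Diffc U F).

Definition image_multiplicity (X : configuration U) (w : 'rV[R[i]]_d) : nat :=
  \big[addn/0%N]_(z \in [set z | U z /\ F z = w]) X z.

Lemma image_multiplicity_neq0 X w : image_multiplicity X w != 0%N ->
  exists z, [/\ U z, F z = w & X z != 0%N].
Proof.
apply: contra_neqP => h; rewrite /image_multiplicity fsbig1// => z [Uz Fz].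
by apply/eqP; apply: contra_notT h => Xz; exists z.
Qed.

Lemma image_multiplicity_supp X w : image_multiplicity X w != 0%N -> U w.
Proof.
move=> /image_multiplicity_neq0[z [Uz <- _]].
by have [[G [FG _ _ _]] _] := hF; have [] := FG z Uz.
Qed.

Lemma image_multiplicity_finite X K : compact K -> K `<=` U ->
  finite_set [set w | K w /\ image_multiplicity X w != 0%N].
Proof.
move=> cK KU; have [[G [FG GF _ cG]] _] := hF.
have cGK : compact (G @` K).
  apply: continuous_compact cK; apply: continuous_in_subspaceT => w.
  by rewrite inE => /KU Uw; exact: C1_on_continuous cG Uw.
have GKU : G @` K `<=` U by move=> _ [w /KU /GF[? _] <-].
apply: sub_finite_set (finite_image F (configuration_locally_finite X cGK GKU)).
move=> w [Kw /image_multiplicity_neq0[z [Uz Fz Xz]]]; exists z => //.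
by split => //; exists w => //; rewrite -Fz; have [] := FG z Uz.
Qed.

Definition config_image (X : configuration U) : configuration U :=
  Configuration (@image_multiplicity_supp X) (@image_multiplicity_finite X).

End config_image.

Section bergman.
Context (R : realType) (d : nat).
Local Notation V := (Clebesgue R d).
Local Notation Cd := 'rV[R[i]]_d.

Definition holomorphic_on (U : set Cd) (f : Cd -> R[i]) : Prop :=
  forall z, U z -> differentiable f z.

(* Elements of A^2(U, w); only the values on U matter. *)
Definition bergman (U : set Cd) (w : Cd -> R) (f : Cd -> R[i]) : Prop :=
  holomorphic_on U f /\
  (\int[V]_(z in U) (normc (f z) ^+ 2 * w z)%:E < +oo)%E.

Definition bergman_dot (U : set Cd) (w : Cd -> R) (f g : Cd -> R[i]) : R[i] :=
  (\int[V]_(z in U) (complex.Re (f z * (g z)^*) * w z)) +i*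
  (\int[V]_(z in U) (complex.Im (f z * (g z)^*) * w z)).

Definition reproducing_kernel (U : set Cd) (w : Cd -> R)
    (K : Cd -> Cd -> R[i]) : Prop :=
  forall x, U x -> bergman U w (K ^~ x) /\
    forall f, bergman U w f -> f x = bergman_dot U w f (K ^~ x).

(* The determinants are nonnegative reals when K is a reproducing kernel. *)
Definition determinantal (U : set Cd) (w : Cd -> R) (K : Cd -> Cd -> R[i])
    (P : probability (Conf U) R) : Prop :=
  {ae P, forall X : Conf U, simple_config X} /\
  forall l, (0 < l)%N -> forall A : set (l.-tuple (Cspace R d)), measurable A ->
    (\int[P]_X config_tuples R X A =
     \int[tuple_measure V l]_(t in A `&` [set t | forall i, U (tnth t i)])
       (complex.Re (\det (\matrix_(i, j) K (tnth t i) (tnth t j))) *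
        \prod_(i < l) w (tnth t i))%:E)%E.

Definition Diffc_quasi_invariant (U : set Cd) (P : probability (Conf U) R) : Prop :=
  forall (F : Cd -> Cd) (hF : Diffc U F),
    let FP := pushforward P (config_image hF : Conf U -> Conf U) in
    FP `<< P /\ P `<< FP.

End bergman.

(* Main.v *)
(** The particles of a configuration are moved one at a time.  Let [J] be the
    Janossy densities of the process on a compact set [E] of [U], so that the
    event of having exactly [m] particles in [E] has density [J / m`!].  With
    all but one particle fixed, [J / w] is a limit of sums of squared moduli of
    holomorphic functions, hence its logarithm is plurisubharmonic.  By Jensen's
    inequality and connectedness of [U], the integral of such a function over a
    compact set is at most [e] times its integral over a larger compact set plus
    [C] times its integral over any subset of a given positive measure, where
    [C] depends on [e] and this measure only.  Since a C^1 diffeomorphism does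
    not distort volumes infinitely, this bounds, for every [e > 0], the mass of
    [F @^-1` A], within the points of the support of [F] where [w <= L], by [C]
    times the mass of [A] plus [e] times the mass of a fixed compact set [K1],
    with a constant [C] that depends neither on [A], nor on the other particles,
    nor on [E].  With high probability no particle of the support of [F] has
    [w > L], and the number of particles in [K1] is bounded.  Hence, by
    induction over these particles, [P (F^-1 S) <= c * P S + e] for all events
    [S] that depend on finitely many occupation numbers, with [c] independent of
    [S].  Approximating a null event by such [S], for [P] and for its image at
    once, shows that its preimage is null; the inverse diffeomorphism gives the
    converse. *)
Require Import Defs.
From HB Require Import structures.
From mathcomp Require Import all_boot all_order all_algebra.
From mathcomp Require Import complex.
From mathcomp Require Import all_classical all_reals all_analysis.
From mathcomp Require Import measurable_realfun ess_sup_inf.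
From mathcomp Require Import ring lra zify.

Import Order.TTheory GRing.Theory Num.Theory.
Import numFieldNormedType.Exports.
Import ComplexField.Normc.

Set Implicit Arguments.
Unset Strict Implicit.
Unset Printing Implicit Defensive.

Local Open Scope classical_set_scope.
Local Open Scope complex_scope.
Local Open Scope ring_scope.

(** * Goursat's theorem in logarithmic polar coordinates *)

(** Two obstacles shape the proof. First, [J / w] has no positive lower bound: its zeros may sit
    anywhere, so the ratio of the densities after and before a move is unbounded. What survives is
    that a log-subharmonic function cannot be small on much of a set while having a sizeable share
    of its mass nearby; [controls] quantifies this, with an additive error. Secondly,
    log-subharmonicity is needed for a kernel of infinite rank. The kernel is approximated by the
    projections onto the spans of kernel functions at rational points. For such a projection, the
    Janossy density polarized into a row point [p] and a column point [q] is a positive Hermitian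
    kernel, holomorphic in [p] up to the factor [sqrt (w p)]. Its Cauchy-Schwarz inequality bounds
    the squared modulus of a holomorphic function of [p] by the product of the values of [J / w] at
    [p] and [q], with equality at [p = q], which is all that Jensen's inequality needs. Only two
    integral consequences of it are kept, in [log_submean], because they pass to the limit. *)

Section segment_integral.
Context {R : realType}.
Implicit Types (f : R -> R) (a b c : R).

Definition segint f a b : R := \int[lebesgue_measure]_(t in `[a, b]) f t.

Definition cont_on f a b := forall t, a <= t -> t <= b -> {for t, continuous f}.

Lemma cont_on_integrable f a b : cont_on f a b ->
  lebesgue_measure.-integrable `[a, b] (EFin \o f).
Proof.
move=> cf; apply: continuous_compact_integrable; first exact: segment_compact.
apply: continuous_in_subspaceT => t; rewrite inE/= in_itv/= => /andP[? ?].
exact: cf.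
Qed.

Lemma segint_split f a b c : a <= b -> b <= c -> cont_on f a c ->
  segint f a c = segint f a b + segint f b c.
Proof.
move=> ab bc cf; have ci := cont_on_integrable cf.
have := @Rintegral_itvB _ f (BLeft a) (BRight c) b ci.
rewrite !bnd_simp => /(_ ab bc) E.
rewrite /segint -(@Rintegral_itv_obnd_cbnd _ b); last first.
  apply: integrableS ci => //; apply: subset_itv; rewrite ?bnd_simp//.
by rewrite -E addrC subrK.
Qed.

Lemma segint_bound f a b c (e : R) : a <= b -> cont_on f a b ->
  (forall t, a <= t -> t <= b -> `|f t - c| <= e) ->
  `|segint f a b - c * (b - a)| <= e * (b - a).
Proof.
move=> ab cf fe; have ci := cont_on_integrable cf.
have mI : fine (lebesgue_measure (`[a, b]%classic : set R)) = b - a.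
  by rewrite lebesgue_measure_itv/= lte_fin; case: ltgtP ab => //= ->; rewrite subrr.
have ck k : lebesgue_measure.-integrable `[a, b] (EFin \o (fun=> k : R)).
  by apply: cont_on_integrable => t _ _; exact: cvg_cst.
have cstE k : segint (fun=> k) a b = k * (b - a).
  rewrite /segint (@Rintegral_cst _ _ _ lebesgue_measure `[a, b]%classic) ?mI//.
have ci' : lebesgue_measure.-integrable `[a, b] (EFin \o (fun t => f t - c)).
  by apply: cont_on_integrable => t ? ?; apply: cvgB; [exact: cf|exact: cvg_cst].
rewrite -!cstE /segint -RintegralB//.
apply: (@le_trans _ _ (\int[lebesgue_measure]_(t in `[a, b]) `|f t - c|)).
  by apply: le_normr_Rintegral => //; exact: ci'.
apply: le_Rintegral => //.
- exact: integrable_norm ci'.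
- by move=> t /=; rewrite in_itv/= => /andP[? ?]; exact: fe.
Qed.

Lemma segint_ext f g a b : (forall t, f t = g t) -> segint f a b = segint g a b.
Proof. by move=> fg; apply: eq_Rintegral => t _; exact: fg. Qed.

Lemma segintB f g a b : cont_on f a b -> cont_on g a b ->
  segint (fun t => f t - g t) a b = segint f a b - segint g a b.
Proof. by move=> cf cg; rewrite /segint RintegralB//; exact: cont_on_integrable. Qed.

End segment_integral.

Section goursat.
Context {R : realType}.
Variables P Q : R -> R -> R.

(** Differentiability of the form [P dx + Q dy] at one point, with [p = P_x], [q = Q_y] and a single
    [c] for [P_y] and [Q_x]: this equality makes the form closed. The derivatives are not assumed
    continuous, which is Goursat's setting. *)
Definition closed_form_at (x y : R) := exists p q c : R, forall e : R, 0 < e ->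
  exists2 d : R, 0 < d & forall h k : R, `|h| < d -> `|k| < d ->
   `|P (x + h) (y + k) - (P x y + p * h + c * k)| <= e * (`|h| + `|k|) /\
   `|Q (x + h) (y + k) - (Q x y + c * h + q * k)| <= e * (`|h| + `|k|).

Hypothesis dPQ : forall x y : R, x <= 0 -> closed_form_at x y.

Let cP (x y : R) : x <= 0 -> {for x, continuous (P ^~ y)}.
Proof.
move=> /(@dPQ _ y) [p [q [c H]]].
have [d d0 Hd] := H 1 ltr01.
apply/cvgrPdist_le => e e0.
exists (Num.min d (e / (1 + `|p|))).
  by rewrite /= lt_min d0 divr_gt0// ltr_pwDl.
move=> t /=; rewrite lt_min distrC => /andP[td te].
have -> : t = x + (t - x) by ring.
have [|+ _] := Hd (t - x) 0 td; first by rewrite normr0.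
rewrite normr0.
rewrite !addr0 mulr0 addr0 mul1r => E.
rewrite distrC (_ : _ - _ = (P (x + (t - x)) y - (P x y + p * (t - x))) + p * (t - x)); last by ring.
apply: (le_trans (ler_normD _ _)); rewrite normrM.
apply: (le_trans (lerD E (lexx _))).
rewrite -[X in X + _]mul1r -mulrDl.
have p1 : 0 < 1 + `|p| by rewrite ltr_pwDl.
by rewrite mulrC -ler_pdivlMr// ltW.
Qed.

Lemma closed_form_contQ (x y : R) : x <= 0 -> {for y, continuous (Q x)}.
Proof.
move=> /(@dPQ _ y) [p [q [c H]]].
have [d d0 Hd] := H 1 ltr01.
apply/cvgrPdist_le => e e0.
exists (Num.min d (e / (1 + `|q|))).
  by rewrite /= lt_min d0 divr_gt0// ltr_pwDl.
move=> t /=; rewrite lt_min distrC => /andP[td te].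
have -> : t = y + (t - y) by ring.
have [|_] := Hd 0 (t - y) _ td; first by rewrite normr0.
rewrite !addr0 normr0 mulr0 addr0 mul1r add0r => E.
rewrite distrC (_ : _ - _ = (Q x (y + (t - y)) - (Q x y + q * (t - y))) + q * (t - y)); last by ring.
apply: (le_trans (ler_normD _ _)); rewrite normrM.
apply: (le_trans (lerD E (lexx _))).
rewrite -[X in X + _]mul1r -mulrDl.
have p1 : 0 < 1 + `|q| by rewrite ltr_pwDl.
by rewrite mulrC -ler_pdivlMr// ltW.
Qed.

(** The integral of [P dx + Q dy] along the boundary of the rectangle, counterclockwise. *)
Definition circulation x0 x1 y0 y1 :=
  (segint (P ^~ y0) x0 x1 - segint (P ^~ y1) x0 x1) +
  (segint (Q x1) y0 y1 - segint (Q x0) y0 y1).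

Let cPo (y a b : R) : b <= 0 -> cont_on (P ^~ y) a b.
Proof. by move=> b0 t _ tb; apply: cP; exact: le_trans b0. Qed.

Let cQo (x a b : R) : x <= 0 -> cont_on (Q x) a b.
Proof. by move=> b0 t _ tb; apply: closed_form_contQ. Qed.

Let circ_splitx x0 x1 x2 y0 y1 : x0 <= x1 -> x1 <= x2 -> x2 <= 0 ->
  circulation x0 x2 y0 y1 = circulation x0 x1 y0 y1 + circulation x1 x2 y0 y1.
Proof.
move=> h1 h2 h3; rewrite /circulation.
rewrite (segint_split h1 h2 (@cPo _ _ _ h3)) (segint_split h1 h2 (@cPo _ _ _ h3)).
by ring.
Qed.

Let circ_splity x0 x1 y0 y1 y2 : y0 <= y1 -> y1 <= y2 -> x0 <= 0 -> x1 <= 0 ->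
  circulation x0 x1 y0 y2 = circulation x0 x1 y0 y1 + circulation x0 x1 y1 y2.
Proof.
move=> h1 h2 h3 h4; rewrite /circulation.
rewrite (segint_split h1 h2 (@cQo _ _ _ h3)) (segint_split h1 h2 (@cQo _ _ _ h4)).
by ring.
Qed.

(** The affine part of a closed form has zero circulation, so only the remainder counts: it is at
    most [e / 2 * D] on each of the four sides, where [D] is half the perimeter. *)
Let local_bound (x y : R) (xl : x <= 0) (e : R) : 0 < e -> exists2 d : R, 0 < d &
  forall x0 x1 y0 y1 : R, x0 <= x -> x <= x1 -> x1 <= 0 -> y0 <= y -> y <= y1 ->
   x1 - x0 < d -> y1 - y0 < d ->
   `|circulation x0 x1 y0 y1| <= e * (x1 - x0 + (y1 - y0)) ^+ 2.
Proof.
move=> e0; have [p [q [c H]]] := dPQ y xl.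
have [d d0 Hd] := H (e / 2) (divr_gt0 e0 (ltr0n _ 2)).
exists d => // x0 x1 y0 y1 h1 h2 h3 h4 h5 xd yd.
set D := x1 - x0 + (y1 - y0).
have x01 : x0 <= x1 := le_trans h1 h2. have y01 : y0 <= y1 := le_trans h4 h5.
have x00 : x0 <= 0 := le_trans x01 h3.
have bd (t s : R) : x0 <= t -> t <= x1 -> y0 <= s -> s <= y1 -> `|t - x| < d /\ `|s - y| < d /\ `|t - x| + `|s - y| <= D.
  move=> ht1 ht2 hs1 hs2.
  have ht : `|t - x| <= x1 - x0 by rewrite ler_norml opprB (lerB ht1 h2) (lerB ht2 h1).
  have hs : `|s - y| <= y1 - y0 by rewrite ler_norml opprB (lerB hs1 h5) (lerB hs2 h4).
  by rewrite (le_lt_trans ht xd) (le_lt_trans hs yd) (lerD ht hs).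
have B (t s : R) : x0 <= t -> t <= x1 -> y0 <= s -> s <= y1 ->
   `|P t s - (P x y + p * (t - x) + c * (s - y))| <= e / 2 * D /\
   `|Q t s - (Q x y + c * (t - x) + q * (s - y))| <= e / 2 * D.
  move=> ht1 ht2 hs1 hs2; have [htd [hsd hD]] := bd _ _ ht1 ht2 hs1 hs2.
  have [] := Hd _ _ htd hsd; rewrite (addrC x) subrK (addrC y) subrK => b1 b2.
  have eD : e / 2 * (`|t - x| + `|s - y|) <= e / 2 * D by rewrite ler_pM2l// divr_gt0.
  by split; [exact: le_trans b1 eD|exact: le_trans b2 eD].
have BP : `|segint (fun t => P t y0 - P t y1) x0 x1 - (c * (y0 - y1)) * (x1 - x0)|
    <= (e * D) * (x1 - x0).
  apply: segint_bound => //.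
    by move=> t _ tx; apply: cvgB; apply: cP; exact: le_trans tx h3.
  move=> t ht1 ht2; have [b1 _] := B t y0 ht1 ht2 (lexx _) y01.
  have [b2 _] := B t y1 ht1 ht2 y01 (lexx _).
  rewrite (_ : _ - _ = (P t y0 - (P x y + p * (t - x) + c * (y0 - y))) - (P t y1 - (P x y + p * (t - x) + c * (y1 - y)))); last by ring.
  by apply: (le_trans (ler_normB _ _)); apply: (le_trans (lerD b1 b2)); rewrite -mulrDl -splitr.
have BQ : `|segint (fun t => Q x1 t - Q x0 t) y0 y1 - (c * (x1 - x0)) * (y1 - y0)|
    <= (e * D) * (y1 - y0).
  apply: segint_bound => //.
    by move=> t _ _; apply: cvgB; apply: closed_form_contQ.
  move=> t ht1 ht2; have [_ b1] := B x1 t x01 (lexx _) ht1 ht2.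
  have [_ b2] := B x0 t (lexx _) x01 ht1 ht2.
  rewrite (_ : _ - _ = (Q x1 t - (Q x y + c * (x1 - x) + q * (t - y))) - (Q x0 t - (Q x y + c * (x0 - x) + q * (t - y)))); last by ring.
  by apply: (le_trans (ler_normB _ _)); apply: (le_trans (lerD b1 b2)); rewrite -mulrDl -splitr.
rewrite /circulation -(segintB (@cPo _ _ _ h3) (@cPo _ _ _ h3)) -(segintB (@cQo _ _ _ h3) (@cQo _ _ _ x00)).
set I1 := segint _ _ _ in BP *; set I2 := segint _ _ _ in BQ *.
rewrite (_ : I1 + I2 = (I1 - c * (y0 - y1) * (x1 - x0)) + (I2 - c * (x1 - x0) * (y1 - y0))); last by ring.
apply: (le_trans (ler_normD _ _)); apply: (le_trans (lerD BP BQ)).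
by rewrite -mulrDr -/D expr2 mulrA.
Qed.

Theorem goursat x0 y0 L M : 0 <= L -> 0 <= M -> x0 + L <= 0 ->
  circulation x0 (x0 + L) y0 (y0 + M) = 0.
Proof.
move=> L0 M0 xL0; apply/eqP; rewrite -normr_le0; apply/ler_addgt0Pl => e e0; rewrite addr0.
rewrite leNgt; apply/negP => bad0.
pose l n : R := L / 2 ^+ n; pose m n : R := M / 2 ^+ n.
have lS n : l n = l n.+1 + l n.+1 by rewrite /l exprS; field; rewrite expf_neq0.
have mS n : m n = m n.+1 + m n.+1 by rewrite /m exprS; field; rewrite expf_neq0.
have l0 n : 0 <= l n by rewrite /l divr_ge0// exprn_ge0.
have m0 n : 0 <= m n by rewrite /m divr_ge0// exprn_ge0.
(* Bisection: a triple [(x, y, n)] is bad when the rectangle with lower left corner [(x, y)] and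
   sides [L / 2 ^ n], [M / 2 ^ n] has circulation above [e / 4 ^ n]; then one of its four quarters
   is bad at level [n + 1]. *)
pose bad (s : R * R * nat) := s.1.1 + l s.2 <= 0 /\
  e / 4 ^+ s.2 < `|circulation s.1.1 (s.1.1 + l s.2) s.1.2 (s.1.2 + m s.2)|.
pose rl (s t : R * R * nat) := [/\ t.2 = s.2.+1,
  s.1.1 <= t.1.1, t.1.1 <= s.1.1 + l s.2.+1, s.1.2 <= t.1.2 & t.1.2 <= s.1.2 + m s.2.+1].
have step (s : {s | bad s}) : {t : {s | bad s} | rl (sval s) (sval t)}.
  apply/cid; case: s => -[[a b] n] [/= sn sb].
  have := lS n; have := mS n; have := l0 n.+1; have := m0 n.+1.
  set ln := l n.+1; set mn := m n.+1 => h1 h2 h3 h4.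
    have p1 : a <= a + ln by rewrite lerDl.
  have p2 : a + ln <= a + l n by rewrite h4 lerD2l lerDl.
  have p3 : a + ln <= 0 := le_trans p2 sn.
  have q1 : b <= b + mn by rewrite lerDl.
  have q2 : b + mn <= b + m n by rewrite h3 lerD2l lerDl.
  have E : circulation a (a + l n) b (b + m n) =
    circulation a (a + ln) b (b + mn) + circulation a (a + ln) (b + mn) (b + mn + mn) +
    (circulation (a + ln) (a + ln + ln) b (b + mn) + circulation (a + ln) (a + ln + ln) (b + mn) (b + mn + mn)).
    rewrite (circ_splitx _ _ p1 p2 sn).
    rewrite (circ_splity q1 q2 (le_trans p1 p3) p3).
    rewrite (circ_splity q1 q2 p3 sn).
    by rewrite h3 h4 !addrA.
  have e4 : e / 4 ^+ n = e / 4 ^+ n.+1 * 4 by rewrite exprS; field; rewrite expf_neq0.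
  have H a' b' : a' = a \/ a' = a + ln -> b' = b \/ b' = b + mn ->
      e / 4 ^+ n.+1 < `|circulation a' (a' + ln) b' (b' + mn)| ->
      exists t : {s | bad s}, rl (a, b, n) (sval t).
    move=> ha hb hbad; have bt : bad (a', b', n.+1) by split => //=; rewrite -/ln; case: ha => ->; clear -h1 h2 h3 h4 sn; lra.
    by exists (exist _ _ bt); clear -ha hb h1 h2; split => //=; rewrite -/ln -/mn; [case: ha|case: ha|case: hb|case: hb] => ->; lra.
  have [c1|c1] := ltP (e / 4 ^+ n.+1) `|circulation a (a + ln) b (b + mn)|.
    by apply: (H a b) => //; left.
  have [c2|c2] := ltP (e / 4 ^+ n.+1) `|circulation a (a + ln) (b + mn) (b + mn + mn)|.
    by apply: (H a (b + mn)) => //; [left|right].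
  have [c3|c3] := ltP (e / 4 ^+ n.+1) `|circulation (a + ln) (a + ln + ln) b (b + mn)|.
    by apply: (H (a + ln) b) => //; [right|left].
  have [c4|c4] := ltP (e / 4 ^+ n.+1) `|circulation (a + ln) (a + ln + ln) (b + mn) (b + mn + mn)|.
    by apply: (H (a + ln) (b + mn)) => //; right.
  exfalso; move: sb; rewrite E e4 => /lt_geF/negbT/negP; apply.
  apply: (le_trans (ler_normD _ _)); have := ler_normD (circulation a (a + ln) b (b + mn)) (circulation a (a + ln) (b + mn) (b + mn + mn)).
  have := ler_normD (circulation (a + ln) (a + ln + ln) b (b + mn)) (circulation (a + ln) (a + ln + ln) (b + mn) (b + mn + mn)).
  by clear -c1 c2 c3 c4; lra.
have b0 : bad (x0, y0, 0%N) by split; rewrite /= /l /m expr0 !divr1.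
have [s [s0 sr]] := dependent_choice step (exist _ _ b0).
pose u n := (sval (s n)).1.1; pose v n := (sval (s n)).1.2.
have sn n : (sval (s n)).2 = n.
  by elim: n => [|n IH]; rewrite ?s0//; have [-> _ _ _ _] := sr n; rewrite IH.
have uS n : u n <= u n.+1 /\ u n.+1 + l n.+1 <= u n + l n.
  by have [_] := sr n; rewrite -/(u n) -/(u n.+1) sn; have := lS n => ? ? ? _ _; split; lra.
have vS n : v n <= v n.+1 /\ v n.+1 + m n.+1 <= v n + m n.
  by have [_] := sr n; rewrite -/(v n) -/(v n.+1) sn; have := mS n => ? _ _ ? ?; split; lra.
have nested (w r : nat -> R) : (forall n, 0 <= r n) -> (forall n, w n <= w n.+1 /\ w n.+1 + r n.+1 <= w n + r n) ->
    exists z, forall n, w n <= z /\ z <= w n + r n.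
  move=> r0 wr.
  have nd : {homo w : i j / (i <= j)%N >-> i <= j} by apply/nondecreasing_seqP => n; have [] := wr n.
  have ni : forall i j, (i <= j)%N -> w j + r j <= w i + r i.
    move=> i j; apply: (@homo_leq _ (fun n => w n + r n) (fun a b => b <= a)) => //; first by move=> ? ? ? h1 h2; exact: le_trans h2 h1.
    by move=> n; have [] := wr n.
  have ub i j : w i <= w j + r j.
    have [ij|/ltnW ji] := leqP i j; first by have := nd _ _ ij; have := r0 j; lra.
    by have := ni _ _ ji; have := r0 i; lra.
  exists (sup (range w)) => n; split.
    apply: ub_le_sup; last by exists n.
    by exists (w 0 + r 0) => _ [i _ <-].
  apply: ge_sup; first by exists (w 0), 0.
  by move=> _ [i _ <-].
have [a Ha] := nested u l l0 uS; have [b Hb] := nested v m m0 vS.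
have a0 : a <= 0.
  have [_ /le_trans] := Ha 0; apply; rewrite /u s0/= /l expr0 divr1//.
pose D := L + M + 1.
have D0 : 0 < D by rewrite ltr_wpDl// addr_ge0.
have LD : L <= D by rewrite /D -addrA lerDl addr_ge0.
have MD : M <= D by rewrite /D (addrC L) -addrA lerDl addr_ge0.
(* The bad rectangles shrink to [(a, b)] and at level [n] have half-perimeter at most [D / 2 ^ n].
   With [e / D ^ 2] the local bound becomes [e / 4 ^ n], against badness. *)
have [d d0 Hd] := local_bound b a0 (divr_gt0 e0 (exprn_gt0 2 D0)).
have [n nd] : exists n, D / 2 ^+ n < d.
  have : (D * 2^-1 ^+ n) @[n --> \oo] --> (0 : R).
    by rewrite -[X in _ --> X](mulr0 D); apply: cvgMr; apply: cvg_expr; rewrite gtr0_norm ?invr_gt0// invf_lt1// ltr1n.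
  move=> /cvgrPdist_lt/(_ _ d0)[n _ /(_ n (leqnn _))].
  rewrite sub0r normrN => /(le_lt_trans (ler_norm _)) h; exists n; by rewrite -exprVn.
have p2 : (0 : R) < 2 ^+ n by exact: exprn_gt0.
have [un1 un2] := Ha n; have [vn1 vn2] := Hb n.
have [bn1 bn2] := svalP (s n); rewrite -/(u n) -/(v n) sn in bn1 bn2.
have ln : l n < d by apply: le_lt_trans nd; rewrite /l ler_pM2r ?invr_gt0.
have mn : m n < d by apply: le_lt_trans nd; rewrite /m ler_pM2r ?invr_gt0.
have := Hd (u n) (u n + l n) (v n) (v n + m n) un1 un2 bn1 vn1 vn2.
have e1 : u n + l n - u n = l n by rewrite addrC addKr.
have e2 : v n + m n - v n = m n by rewrite addrC addKr.
rewrite e1 e2 => /(_ ln mn).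
move=> /(lt_le_trans bn2);
apply/negP; rewrite -leNgt.
have lmD : l n + m n <= D / 2 ^+ n by rewrite /l /m -mulrDl ler_pM2r ?invr_gt0// lerDl ler01.
have -> : e / 4 ^+ n = e / D ^+ 2 * (D / 2 ^+ n) ^+ 2.
  rewrite expr_div_n mulrA divfK ?expf_neq0 ?gt_eqF//.
  by rewrite -exprM mulnC exprM (_ : 2 ^+ 2 = 4 :> R)//; ring.
rewrite ler_pM2l ?divr_gt0 ?exprn_gt0// ler_sqr ?nnegrE ?addr_ge0//.
by rewrite divr_ge0// ltW.
Qed.

End goursat.

(** * The maximum modulus principle on a disc *)

Section complex_differentiability.
Context {R : realType}.
Implicit Types (z h c : R[i]) (F : R[i] -> R[i]).

Lemma normc_ge0 z : 0 <= normc z. Proof. by case: z => a b; exact: sqrtr_ge0. Qed.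

Lemma normc_gt0 z : z != 0 -> 0 < normc z.
Proof. by move=> z0; rewrite lt_neqAle normc_ge0 andbT eq_sym; apply: contra z0 => /eqP /eq0_normc ->. Qed.

Lemma normcE z : `|z| = (normc z)%:C. Proof. by []. Qed.

Lemma normc_Re z : `|complex.Re z| <= normc z.
Proof. by have := normc_ge_Re z; rewrite normcE lecR. Qed.

Lemma normc_Im z : `|complex.Im z| <= normc z.
Proof. by case: z => a b; rewrite /= -sqrtr_sqr ler_wsqrtr// lerDr sqr_ge0. Qed.

Lemma normc_ler_ReIm z : normc z <= `|complex.Re z| + `|complex.Im z|.
Proof.
case: z => a b /=; rewrite -[leRHS]ger0_norm ?addr_ge0// -sqrtr_sqr ler_wsqrtr//.
by rewrite sqrrD !real_normK ?num_real// -addrA lerD2l lerDr mulrn_wge0// mulr_ge0.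
Qed.

Lemma normcD_le z1 z2 : normc (z1 + z2) <= normc z1 + normc z2.
Proof. by rewrite -lecR rmorphD/= -!normcE ler_normD. Qed.

Lemma normcMr z1 z2 : normc (z1 * z2) = normc z1 * normc z2.
Proof. exact: normcM. Qed.

Definition cdiff F z := exists c, forall e : R, 0 < e -> exists2 d : R, 0 < d &
  forall h, normc h < d -> normc (F (z + h) - F z - c * h) <= e * normc h.

Lemma differentiable_cdiff F z : differentiable F z -> cdiff F z.
Proof.
move=> /derivable1_diffP; rewrite /derivable => /cvg_ex[/= c Fc].
exists c => e e0.
have e0C : 0 < e%:C by rewrite ltcR.
move/cvgrPdist_le: Fc => /(_ _ e0C)[[d d'] /=]; rewrite ltcE/= => /andP[/eqP-> d0] H.
exists d => // h hd.
have [->|h0] := eqVneq h 0; first by rewrite addr0 subrr mulr0 subr0 normc0 mulr0.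
have := H h; rewrite /ball_/= sub0r normrN normcE ltcR => /(_ hd h0).
rewrite /GRing.scale/= mulr1 normcE lecR => E.
rewrite (_ : _ - _ - _ = (- h) * (c - h^-1 * (F (h + z) - F z))); last first.
  by rewrite mulrBr mulrA [- h * h^-1]mulNr divff// (addrC h); ring.
rewrite normcMr mulrC normcN ler_pM2r//.
exact: normc_gt0.
Qed.

Lemma cdiffZ F z c : cdiff F z -> cdiff (fun x => c * F x) z.
Proof.
move=> [a Ha]; exists (c * a) => e e0.
have k0 : 0 < 1 + normc c by rewrite ltr_pwDl// normc_ge0.
have [d d0 Hd] := Ha (e / (1 + normc c)) (divr_gt0 e0 k0).
exists d => // h /Hd H.
rewrite (_ : _ - _ - _ = c * (F (z + h) - F z - a * h)); last by ring.
rewrite normcMr; apply: (le_trans (ler_wpM2l (normc_ge0 _) H)).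
rewrite !mulrA ler_wpM2r ?normc_ge0// ler_pdivrMr// mulrC ler_pM2l//.
by rewrite lerDr.
Qed.

(** The exponential of [x + iy]. These coordinates turn the punctured closed unit disc into the
    half-plane [x <= 0] and the circles about [0] into vertical segments, so that Goursat's theorem
    for rectangles compares the means over two circles. *)
Definition cexp (x y : R) : R[i] := (expR x * cos y) +i* (expR x * sin y).

Lemma cexpD (x y h k : R) : cexp (x + h) (y + k) = cexp x y * cexp h k.
Proof.
by apply/eqP; rewrite /cexp eq_complex/= expRD cosD sinD; apply/andP; split; apply/eqP; ring.
Qed.

Lemma normc_cexp (x y : R) : normc (cexp x y) = expR x.
Proof.
by rewrite /cexp/= !exprMn -mulrDr cos2Dsin2 mulr1 sqrtr_sqr ger0_norm// expR_ge0.
Qed.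

Lemma is_derive_small (f : R -> R) (x a : R) : is_derive x 1 f a ->
  forall e : R, 0 < e -> exists2 d : R, 0 < d &
  forall h : R, `|h| < d -> `|f (x + h) - f x - a * h| <= e * `|h|.
Proof.
move=> [df fa] e e0.
have : (fun h : R => h^-1 *: (f (h *: 1 + x) - f x)) @ 0^' --> a by rewrite -fa.
move/cvgrPdist_le => /(_ _ e0)[d /= d0 H]; exists d => // h hd.
have [->|h0] := eqVneq h 0; first by rewrite addr0 subrr mulr0 subr0 normr0 mulr0.
have := H h; rewrite /= sub0r normrN => /(_ hd h0).
rewrite /GRing.scale/= mulr1 => E.
rewrite (_ : _ - _ - _ = (- h) * (a - h^-1 * (f (h + x) - f x))); last first.
  by rewrite mulrBr mulrA [- h * h^-1]mulNr divff// (addrC h); ring.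
by rewrite normrM normrN mulrC ler_wpM2r.
Qed.

Lemma cexp_small (e : R) : 0 < e -> exists2 d : R, 0 < d &
  forall h k : R, `|h| < d -> `|k| < d ->
   normc (cexp h k - 1 - (h +i* k)) <= e * (`|h| + `|k|).
Proof.
move=> e0; pose e' : R := Num.min 1 (e / 8).
have e'0 : 0 < e' by rewrite /e' lt_min ltr01 divr_gt0.
have e'1 : e' <= 1 by rewrite /e' ge_min lexx.
have e'e : e' <= e / 8 by rewrite /e' ge_min lexx orbT.
have [d1 d10 H1] := is_derive_small (is_derive_expR 0) e'0.
have [d2 d20 H2] := is_derive_small (is_derive_cos 0) e'0.
have [d3 d30 H3] := is_derive_small (is_derive_sin 0) e'0.
exists (Num.min (Num.min d1 d2) (Num.min d3 (Num.min 1 e'))).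
  by rewrite !lt_min d10 d20 d30 ltr01/= divr_gt0.
move=> h k; rewrite !lt_min => /andP[/andP[h1 h2] /and3P[h3 h4 h5]].
move=> /andP[/andP[k1 k2] /and3P[k3 k4 k5]].
have := H1 _ h1; have := H2 _ k2; have := H3 _ k3.
rewrite !add0r expR0 cos0 sin0 !mul1r !oppr0 mul0r addr0 subr0 => S C E.
apply: (le_trans (normc_ler_ReIm _)); rewrite /cexp/= subr0.
set X := expR h in E *; set c := cos k in C *; set s := sin k in S *.
have hc : `|c| <= 1 by rewrite /c ler_norml cos_le1 cos_geN1.
have hs : `|s| <= 2 * `|k|.
  have -> : s = (s - k) + k by ring.
  apply: (le_trans (ler_normD _ _)); rewrite mulrDl mul1r lerD2r.
  by apply: (le_trans S); rewrite ler_piMl.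
have hX : `|X - 1| <= 2 * e'.
  have -> : X - 1 = (X - 1 - h) + h by ring.
  apply: (le_trans (ler_normD _ _)); rewrite mulrDl mul1r; apply: lerD.
    by apply: (le_trans E); rewrite ler_piMr ?ltW.
  by case/andP: h5 => a1 a2; rewrite ltW// lt_min a1.
have h1' : `|1 + h| <= 2.
  by apply: (le_trans (ler_normD _ _)); rewrite normr1 lerD2l ltW.
have A1 : `|X * c - 1 - h| <= e' * `|h| + 2 * (e' * `|k|).
  rewrite (_ : _ - _ = (X - 1 - h) * c + (1 + h) * (c - 1)); last by ring.
  apply: (le_trans (ler_normD _ _)); rewrite !normrM lerD//.
    by apply: (le_trans _ E); rewrite ler_piMr.
  by apply: ler_pM.
have A2 : `|X * s - k| <= 2 * e' * (2 * `|k|) + e' * `|k|.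
  rewrite (_ : _ - _ = (X - 1) * s + (s - k)); last by ring.
  by apply: (le_trans (ler_normD _ _)); rewrite !normrM lerD// ler_pM.
have nh : 0 <= `|h| by []. have nk : 0 <= `|k| by [].
have B1 : e' * `|h| <= e / 8 * `|h| by rewrite ler_wpM2r.
have B2 : e' * `|k| <= e / 8 * `|k| by rewrite ler_wpM2r.
have n1 : 0 <= e * `|h| by rewrite mulr_ge0// ltW.
have n2 : 0 <= e * `|k| by rewrite mulr_ge0// ltW.
move: A1 A2 B1 B2 n1 n2.
rewrite mulrDr; set u := e * `|h|; set v := e * `|k|.
rewrite (_ : e / 8 * `|h| = u / 8); last by rewrite /u; ring.
rewrite (_ : e / 8 * `|k| = v / 8); last by rewrite /v; ring.
rewrite (_ : 2 * e' * (2 * `|k|) = 4 * (e' * `|k|)); last by ring.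
clear -e; lra.
Qed.

(** The pair is the imaginary part of [F z dz / z] for [z = exp (x + iy)]. The composite of [F] with
    the exponential has the complex derivative [C = c * z], and the Cauchy-Riemann equations read
    the four partial derivatives off [C]. *)
Lemma cdiff_cexp_closed F (x y : R) : cdiff F (cexp x y) ->
  closed_form_at (fun x y => complex.Im (F (cexp x y))) (fun x y => complex.Re (F (cexp x y))) x y.
Proof.
set z := cexp x y => -[c Hc]; pose C := c * z.
exists (complex.Im C), (- complex.Im C), (complex.Re C) => e e0.
have nz : 0 < normc z by rewrite normc_cexp expR_gt0.
have nC : 0 < 1 + normc C by rewrite ltr_pwDl// normc_ge0.
have [e1 [e10 e11 e1C]] : exists e1 : R, [/\ 0 < e1, e1 <= 1 & normc C * e1 <= e / 2].
  exists (Num.min 1 (e / 2 / (1 + normc C))); split.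
  - by rewrite lt_min ltr01 !divr_gt0.
  - by rewrite ge_min lexx.
  - apply: (@le_trans _ _ (normc C * (e / 2 / (1 + normc C)))).
      by rewrite ler_wpM2l ?normc_ge0// ge_min lexx orbT.
    rewrite mulrA ler_pdivrMr// mulrC ler_wpM2l ?divr_ge0 ?ltW//.
    by rewrite ltrDr.
have e20 : 0 < e / 2 / (normc z * 2) by rewrite !divr_gt0// mulr_gt0.
have [d1 d10 H1] := Hc _ e20; have [d2 d20 H2] := cexp_small e10.
have d30 : 0 < d1 / (normc z * 2) / 2 by rewrite !divr_gt0// mulr_gt0.
exists (Num.min d2 (d1 / (normc z * 2) / 2)); first by rewrite lt_min d20.
move=> h k; rewrite !lt_min => /andP[h1 h2] /andP[k1 k2].
have E := H2 h k h1 k1.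
set r := cexp h k - 1 - (h +i* k) in E; pose l := h +i* k.
have ln : normc l <= `|h| + `|k| by exact: normc_ler_ReIm.
pose eta := z * (cexp h k - 1).
have etaE : eta = z * (l + r) by rewrite /eta /r /l; congr (_ * _); ring.
have hk0 : 0 <= `|h| + `|k| by rewrite addr_ge0.
have eta_le : normc eta <= normc z * 2 * (`|h| + `|k|).
  rewrite etaE normcMr -mulrA ler_wpM2l ?normc_ge0//.
  apply: (le_trans (normcD_le _ _)); rewrite mulrDl mul1r lerD//.
  by apply: (le_trans E); rewrite ler_piMl.
have eta_d : normc eta < d1.
  apply: (le_lt_trans eta_le); rewrite mulrC -ltr_pdivlMr ?mulr_gt0//.
  by move: h2 k2; set q := d1 / _; lra.
have -> : cexp (x + h) (y + k) = z + eta by rewrite cexpD /eta -/z; ring.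
have B : normc (F (z + eta) - F z - C * l) <= e * (`|h| + `|k|).
  rewrite (_ : _ - C * l = (F (z + eta) - F z - c * eta) + C * r); last by rewrite etaE /C; ring.
  apply: (le_trans (normcD_le _ _)); rewrite normcMr.
  apply: (@le_trans _ _ (e / 2 * (`|h| + `|k|) + e / 2 * (`|h| + `|k|))); last by lra.
  apply: lerD.
    apply: (le_trans (H1 _ eta_d)); apply: (le_trans (ler_wpM2l (ltW e20) eta_le)).
    by rewrite mulrA divfK ?gt_eqF ?mulr_gt0.
  apply: (le_trans (ler_wpM2l (normc_ge0 _) E)); rewrite mulrA ler_wpM2r//.
have := le_trans (normc_Im _) B; have := le_trans (normc_Re _) B.
have [C1 [C2 ->]] : exists C1 C2 : R, C = C1 +i* C2 by exists (complex.Re C), (complex.Im C); case: (C).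
rewrite /l -/z /= => B1 B2; split.
- apply: le_trans B2; rewrite le_eqVlt; apply/orP; left; apply/eqP; congr (`| _ |).
  by move: (F (z + eta)) (F z) => [? ?] [? ?] /=; ring.
- apply: le_trans B1; rewrite le_eqVlt; apply/orP; left; apply/eqP; congr (`| _ |).
  by move: (F (z + eta)) (F z) => [? ?] [? ?] /=; ring.
Qed.

(** The mean value property. On [[- L, 0] x [0, 2 pi]] the horizontal sides cancel by periodicity,
    so the integral of the real part over the unit circle equals that over the circle of radius
    [r = exp (- L)], which is close to [2 pi] times the value at [0]. *)
Lemma max_Re F (M : R) : (forall z, normc z <= 1 -> cdiff F z) ->
  (forall t, 0 <= t -> t <= 2 * pi -> complex.Re (F (cexp 0 t)) <= M) ->
  complex.Re (F 0) <= M.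
Proof.
move=> dF FM; apply/ler_addgt0Pr => e e0.
have [c /(_ 1 ltr01)[d d0 Hd]] : cdiff F 0 by apply: dF; rewrite normc0.
have k0 : 0 < 1 + normc c by rewrite ltr_pwDl// normc_ge0.
pose P x y := complex.Im (F (cexp x y)); pose Q x y := complex.Re (F (cexp x y)).
have dPQ x y : x <= 0 -> closed_form_at P Q x y.
  by move=> x0; apply: cdiff_cexp_closed; apply: dF; rewrite normc_cexp -expR0 ler_expR.
(* [r < d] puts the small circle where the linear approximation at [0] holds, and
   [(1 + normc c) * r <= e] bounds the deviation of [F] from [F 0] there. *)
pose r := Num.min (Num.min 1 (d / 2)) (e / (1 + normc c)).
have r0 : 0 < r by rewrite !lt_min ltr01 !divr_gt0.
have rd : r < d by rewrite /r !gt_min; apply/orP; left; apply/orP; right; rewrite ltr_pdivrMr// ltr_pMr// ltr1n.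
have re : (1 + normc c) * r <= e by rewrite mulrC -ler_pdivlMr// !ge_min lexx orbT.
have p0 : 0 < 2 * pi :> R := mulr_gt0 (ltr0Sn _ 1) (pi_gt0 R).
pose L := - ln r.
have L0 : 0 <= L by rewrite oppr_ge0 ln_le0// !ge_min lexx.
have pi2 := ltW p0.
have := @goursat R P Q dPQ (- L) 0 L (2 * pi) L0 pi2.
rewrite addNr add0r => /(_ (lexx _)).
rewrite /circulation (@segint_ext _ (P ^~ 0) (P ^~ (2 * pi))); last first.
  by move=> t; rewrite /P /cexp -[2 * pi]add0r mulr_natl cosD2pi sinD2pi.
rewrite subrr add0r => /eqP; rewrite subr_eq0 => /eqP EQ.
have cQ x : x <= 0 -> cont_on (Q x) 0 (2 * pi).
  by move=> x0 t _ _; exact: (closed_form_contQ dPQ).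
have eL : expR (- L) = r by rewrite /L opprK lnK.
have B1 : `|segint (Q (- L)) 0 (2 * pi) - complex.Re (F 0) * (2 * pi - 0)| <= e * (2 * pi - 0).
  apply: segint_bound; [exact: ltW|by apply: cQ; rewrite oppr_le0|].
  move=> t _ _; rewrite /Q -raddfB/=; apply: (le_trans (normc_Re _)).
  set z := cexp _ _; have nz : normc z = r by rewrite normc_cexp eL.
  have zd : normc z < d by rewrite nz.
  have := Hd _ zd; rewrite add0r mul1r => H.
  rewrite (_ : _ - _ = (F z - F 0 - c * z) + c * z); last by ring.
  apply: (le_trans (normcD_le _ _)); apply: (le_trans (lerD H (lexx _))).
  by rewrite normcMr -[X in X + _]mul1r -mulrDl nz.
have B2 : segint (Q 0) 0 (2 * pi) <= M * (2 * pi).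
  have cM : cont_on (fun=> M) 0 (2 * pi) by move=> t _ _; exact: cvg_cst.
  have : `|segint (fun=> M) 0 (2 * pi) - M * (2 * pi - 0)| <= 0 * (2 * pi - 0).
    by apply: (segint_bound pi2 cM) => t _ _; rewrite subrr normr0.
  rewrite mul0r normr_le0 subr_eq0 subr0 => /eqP <-.
  apply: le_Rintegral; [exact: measurable_itv|exact/cont_on_integrable/cQ|exact: cont_on_integrable|].
  by move=> t; rewrite /= in_itv/= => /andP[]; exact: FM.
move: B1; rewrite -EQ subr0 ler_norml => /andP[B1 _].
rewrite -(ler_pM2r p0); move: p0 B1 B2; move: (2 * pi) => t t0; rewrite mulrDl.
move: (complex.Re _ * _) (M * _) (e * _) => u v w; clear -t; lra.
Qed.

(** Multiplication by the unit number [c] that makes [c * F 0] positive reduces the modulus to the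
    real part. *)
Lemma max_modulus F (M : R) : (forall z, normc z <= 1 -> cdiff F z) ->
  (forall t, 0 <= t -> t <= 2 * pi -> normc (F (cexp 0 t)) <= M) ->
  normc (F 0) <= M.
Proof.
move=> dF FM.
have [F0|F0] := eqVneq (F 0) 0.
  by rewrite F0 normc0; apply: le_trans (FM 0 (lexx _) (mulr_ge0 _ (pi_ge0 _))) => //; exact: normc_ge0.
have n0 : 0 < normc (F 0) by exact: normc_gt0.
pose c : R[i] := (normc (F 0))^-1%:C * (F 0)^*%C.
have nc : normc c = 1.
  rewrite /c normcMr; case: (F 0) n0 => a b /= n0.
  rewrite sqrrN expr0n/= addr0 sqrtr_sqr ger0_norm ?invr_ge0 ?ltW//.
  by rewrite mulVf// gt_eqF.
have -> : normc (F 0) = complex.Re (c * F 0).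
  rewrite /c; case: (F 0) n0 => a b /= n0.
  set s := Num.sqrt _ in n0 *.
  have s2 : s ^+ 2 = a ^+ 2 + b ^+ 2 by rewrite sqr_sqrtr// addr_ge0// sqr_ge0.
  apply: (mulfI (lt0r_neq0 n0)); rewrite -expr2 s2; field.
  by rewrite gt_eqF.
apply: (@max_Re (fun z => c * F z)); first by move=> z /dF; exact: cdiffZ.
move=> t t0 t1; apply: (le_trans (ler_norm _)); apply: (le_trans (normc_Re _)).
by rewrite normcMr nc mul1r; exact: FM.
Qed.

End complex_differentiability.

(** * Jensen's inequality *)

Section jensen.
Context {R : realType}.
Implicit Types (z c : R[i]) (h : R[i] -> R[i]).

Lemma sum_shift_periodic (g : nat -> R) N j : (forall k, g (k + N)%N = g k) ->
  \sum_(k < N) g (k + j)%N = \sum_(k < N) g k.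
Proof.
move=> gN; elim: j => [|j IH]; first by apply: eq_bigr => k _; rewrite addn0.
rewrite -IH; case: N gN IH => [|N] gN IH; first by rewrite !big_ord0.
rewrite big_ord_recr [in RHS]big_ord_recl/= addrC; congr (_ + _).
  by rewrite -[in RHS]gN; congr g; lia.
by apply: eq_bigr => k _; congr g; rewrite /bump; lia.
Qed.

Lemma unif_continuous_segment (f : R -> R) (a b : R) : continuous f ->
  forall e : R, 0 < e -> exists2 d : R, 0 < d &
  forall s t : R, a <= s -> s <= b -> `|s - t| < d -> `|f s - f t| <= e.
Proof.
move=> cf e e0.
have /compact_near_coveringP nc := @segment_compact R a b.
have := nc R 0^'+ (fun d s => forall t, `|s - t| < d -> `|f s - f t| <= e) _.
case.
- move=> x _.
  have /cvgrPdist_lt/(_ _ (divr_gt0 e0 (ltr0n _ 2)))[r /= r0 Hr] := cf x.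
  have r2 : 0 < r / 2 by rewrite divr_gt0.
  exists (ball x (r / 2), [set d | 0 < d /\ d < r / 2]) => /=.
    split; first exact: nbhsx_ballx.
    exists (r / 2) => // d /=; rewrite sub0r normrN => dr d0; split => //.
    by apply: le_lt_trans dr; exact: ler_norm.
  move=> [x' d]/= [xx' [d0 dr]] t x't.
  have h1 : `|f x - f x'| < e / 2.
    by apply: Hr => /=; apply: lt_trans xx' _; rewrite ltr_pdivrMr// ltr_pMr// ltr1n.
  have h2 : `|f x - f t| < e / 2.
    apply: Hr => /=; rewrite (_ : x - t = (x - x') + (x' - t)); last by ring.
    by apply: (le_lt_trans (ler_normD _ _)); rewrite [r]splitr ltrD// (lt_trans x't).
  rewrite (_ : _ - _ = (f x - f t) - (f x - f x')); last by ring.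
  by apply: (le_trans (ler_normB _ _)); rewrite [e]splitr lerD// ltW.
- move=> r /= r0 H; exists (r / 2); first by rewrite divr_gt0.
  move=> s t sa sb; apply: (H (r / 2)) => /=.
  + by rewrite sub0r normrN gtr0_norm ?divr_gt0// ltr_pdivrMr// ltr_pMr// ltr1n.
  + by rewrite divr_gt0.
  + by rewrite in_itv/= sa.
Qed.

Lemma cexp_continuous : continuous (cexp 0 : R -> R[i]).
Proof.
move=> t; apply/(@cvgrPdist_le _ _ _ _ (nbhs_filter t)) => -[e e'].
rewrite ltcE/= => /andP[/eqP-> e0].
have e2 : 0 < e / 2 by rewrite divr_gt0.
have /cvgrPdist_le/(_ _ e2) H1 := @continuous_cos R t.
have /cvgrPdist_le/(_ _ e2) H2 := @continuous_sin R t.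
apply: filterS2 H1 H2 => s h1 h2.
rewrite normcE lecR; apply: (le_trans (normc_ler_ReIm _)).
by rewrite /cexp expR0 !mul1r/= [e]splitr lerD.
Qed.

Lemma normc_continuous : continuous (@normc R).
Proof.
move=> z; apply/(@cvgrPdist_le _ _ _ _ (nbhs_filter z)) => e e0.
have e0C : 0 < e%:C by rewrite ltcR.
have := proj1 (@cvgrPdist_le _ _ _ _ (nbhs_filter z) id z) (@cvg_id _ (nbhs z)).
move=> /(_ _ e0C); apply: filterS => w; rewrite normcE lecR => H.
have T (a b : R[i]) : normc a - normc b <= normc (a - b).
  by rewrite lerBlDr -{1}[a](subrK b) normcD_le.
rewrite ler_norml; apply/andP; split; last exact: le_trans (T _ _) H.
by rewrite lerNl opprB; apply: (le_trans (T _ _)); rewrite -normcN opprB.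
Qed.

Lemma cexp_periodic (t : R) n : cexp 0 (t + 2 * pi *+ n) = cexp 0 t.
Proof.
elim: n => [|n IH]; first by rewrite mulr0n addr0.
by rewrite mulrSr addrA -[RHS]IH /cexp mulr_natl cosD2pi sinD2pi.
Qed.

Lemma cexp0D (s t : R) : cexp 0 (s + t) = cexp 0 s * cexp 0 t.
Proof. by rewrite -cexpD addr0. Qed.

(* The product [\prod_(k < N) h (w ^+ k * z)], with [w] a primitive [N]-th root
   of unity, turns the maximum principle into Jensen's inequality. *)
Lemma jensen_roots h (eps : R) : (forall z, normc z <= 1 -> differentiable h z) ->
  0 < eps -> h 0 != 0 -> forall e : R, 0 < e -> exists N0, forall N, (N0 <= N)%N ->
  N%:R * (ln (normc (h 0)) - e) <=
  \sum_(k < N) ln (Num.max (normc (h (cexp 0 (2 * pi * k%:R / N%:R)))) eps).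
Proof.
move=> dh eps0 h0 e e0.
pose phi t : R := ln (Num.max (normc (h (cexp 0 t))) eps).
have n1 t : normc (cexp 0 t : R[i]) = 1 by rewrite normc_cexp expR0.
have mx0 t : 0 < Num.max (normc (h (cexp 0 t))) eps by rewrite lt_max eps0 orbT.
have cphi : continuous phi.
  move=> t; rewrite /phi; apply: (continuous_comp (f := fun t => Num.max (normc (h (cexp 0 t))) eps)); last first.
    by apply: continuous_ln.
  apply: continuous_max; last exact: cvg_cst.
  apply: (continuous_comp (f := fun t => h (cexp 0 t))); last exact: normc_continuous.
  apply: continuous_comp; first exact: cexp_continuous.
  by apply: differentiable_continuous; apply: dh; rewrite n1.
have e2 : 0 < e / 2 by rewrite divr_gt0.
have p0 : 0 < 2 * pi :> R by rewrite mulr_gt0// pi_gt0.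
have [d d0 Hd] := @unif_continuous_segment phi 0 (4 * pi) cphi _ e2.
have nh0 := normc_gt0 h0.
(* For such [N] the grid step [2 * pi / N] is below [d], which belongs to the precision [e / 2] in
   the uniform continuity of [phi]. *)
exists (Num.truncn (2 * pi / d)).+1 => N N0.
have Npos : (0 < N)%N by case: N N0.
have NR : 0 < N%:R :> R by rewrite ltr0n.
have Nd : 2 * pi / N%:R < d.
  rewrite ltr_pdivrMr// -ltr_pdivrMl// mulrC.
  by apply: (lt_le_trans (truncnS_gt _)); rewrite ler_nat.
pose w k : R[i] := cexp 0 (2 * pi * k%:R / N%:R).
pose G n z := \prod_(k < n) h (w k * z). pose F := G N.
have dF z : normc z <= 1 -> differentiable F z.
  move=> z1; rewrite /F; elim: (N) => [|n IH].
    by rewrite (_ : G 0%N = fun=> 1); [exact: differentiable_cst|apply/funext => x; rewrite /G big_ord0].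
  rewrite (_ : G n.+1 = G n * (fun z => h (w n * z))); last first.
    by apply/funext => x; rewrite /G big_ord_recr.
  apply: differentiableM; first exact: IH.
  apply: (@differentiable_comp _ _ _ _ (fun z => w n * z) h).
    by apply: differentiableM; [exact: differentiable_cst|exact: ex_diff].
  by apply: dh; rewrite normcMr n1 mul1r.
pose M : R := expR (N%:R * (ln (normc (h 0)) - e / 2)).
(* By the maximum principle [F] exceeds [M] in modulus somewhere on the circle, as [F 0] is the
   [N]-th power of [h 0]. *)
have [t [t0 t1 tM]] : exists t, [/\ 0 <= t, t <= 2 * pi & M < normc (F (cexp 0 t))].
  apply: contrapT => nex.
  have : normc (F 0) <= M.
    apply: max_modulus => [z z1|t t0 t1]; first exact/differentiable_cdiff/dF.
    by rewrite leNgt; apply/negP => tM; apply: nex; exists t.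
  have -> : normc (F 0) = expR (N%:R * ln (normc (h 0))).
    rewrite mulrC expRM_natr lnK// /F /G.
    under eq_bigr do rewrite mulr0.
    rewrite prodr_const card_ord; elim: (N) => [|n IH]; first by rewrite !expr0 normc1.
    by rewrite !exprS normcMr IH.
  rewrite /M ler_expR ler_pM2l// lerBrDr gerDl; lra.
have NF : normc (F (cexp 0 t)) = \prod_(k < N) normc (h (cexp 0 (t + 2 * pi * k%:R / N%:R))).
  rewrite /F /G (big_morph _ (@normcM R) (@normc1 R)).
  by apply: eq_bigr => k _; rewrite /w -cexp0D addrC.
have S1 : N%:R * (ln (normc (h 0)) - e / 2) <= \sum_(k < N) phi (t + 2 * pi * k%:R / N%:R).
  rewrite -ler_expR -/M; apply: (le_trans (ltW tM)); rewrite NF expR_sum.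
  by apply: ler_prod => k _; rewrite normc_ge0/= /phi lnK ?posrE// le_max lexx.
(* The point [t] is not known. Rotating back by [j] grid steps permutes the roots and leaves an
   angle [s] below one grid step; uniform continuity then replaces [s] by [0]. *)
pose j := Num.truncn (t * N%:R / (2 * pi)).
pose s := t - 2 * pi * j%:R / N%:R.
have tN : 0 <= t * N%:R / (2 * pi) by rewrite (divr_ge0 _ (ltW p0))// mulr_ge0.
have [s0 s1] : 0 <= s /\ s < 2 * pi / N%:R.
  have j1 : j%:R <= t * N%:R / (2 * pi) by rewrite truncn_le.
  have j2 : t * N%:R / (2 * pi) < j.+1%:R by exact: truncnS_gt.
  split.
    rewrite subr_ge0 ler_pdivrMr// mulrC -ler_pdivlMr//.
  rewrite ltrBlDr -mulrDl -[X in X + _]mulr1 -mulrDr ltr_pdivlMr// mulrC -ltr_pdivrMl// mulrC.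
  have -> : (2 * pi)^-1 * (t * N%:R) = t * N%:R / (2 * pi) by rewrite mulrC.
  have -> : 1 + j%:R = j.+1%:R :> R by rewrite addrC natr1.
  exact: j2.
have S2 : \sum_(k < N) phi (t + 2 * pi * k%:R / N%:R) = \sum_(k < N) phi (s + 2 * pi * k%:R / N%:R).
  rewrite -(@sum_shift_periodic (fun k => phi (s + 2 * pi * k%:R / N%:R)) N j).
    by apply: eq_bigr => k _; congr phi; rewrite /s natrD; ring.
  move=> k; rewrite /phi natrD mulrDr mulrDl mulfK ?gt_eqF// addrA.
  by have := cexp_periodic (s + 2 * pi * k%:R / N%:R) 1; rewrite mulr1n => ->.
apply: (@le_trans _ _ (N%:R * (ln (normc (h 0)) - e / 2) - N%:R * (e / 2))).
  by rewrite -mulrBr ler_pM2l//; lra.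
rewrite lerBlDr; apply: (le_trans S1); rewrite S2.
have -> : N%:R * (e / 2) = \sum_(k < N) (e / 2) by rewrite sumr_const card_ord mulr_natl.
rewrite -big_split/=; apply: ler_sum => k _.
rewrite -lerBlDl; apply: (le_trans (ler_norm _)); rewrite distrC.
apply: Hd.
- by rewrite divr_ge0// mulr_ge0// ltW.
- rewrite ler_pdivrMr// (@le_trans _ _ (2 * pi * N%:R))//.
    by rewrite ler_pM2l// ler_nat ltnW.
  by rewrite ler_pM2r// ler_pM2r ?pi_gt0// ler_nat.
- by rewrite opprD addrCA subrr addr0 normrN ger0_norm// (lt_trans s1).
Qed.

End jensen.

(** * Invariance properties of Lebesgue measure *)

Section preserves.
Context d (T : measurableType d) (R : realType).

Definition preserves (mu : set T -> \bar R) (f : T -> T) :=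
  measurable_fun setT f /\ forall A, measurable A -> mu (f @^-1` A) = mu A.

Lemma preserves_comp (mu : set T -> \bar R) f g :
  preserves mu f -> preserves mu g -> preserves mu (f \o g).
Proof.
move=> [mf fE] [mg gE]; split; first exact: measurableT_comp.
move=> A mA; rewrite comp_preimage gE ?fE// -[X in measurable X]setTI; exact: mf.
Qed.

Lemma preserves_integral (mu : {measure set T -> \bar R}) f (h : T -> \bar R) :
  preserves mu f -> measurable_fun setT h -> (forall x, 0 <= h x)%E ->
  (\int[mu]_x h (f x) = \int[mu]_x h x)%E.
Proof.
move=> [mf fE] mh h0.
have := @ge0_integral_pushforward _ _ _ _ R f mf mu setT h measurableT mh.
rewrite preimage_setT => <-; last by move=> y _; exact: h0.
by apply: eq_measure_integral => A mA _; exact: fE.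
Qed.

End preserves.

Lemma preserves_prod d1 d2 (T1 : measurableType d1) (T2 : measurableType d2)
    (R : realType) (m1 : {sigma_finite_measure set T1 -> \bar R})
    (m2 : {sigma_finite_measure set T2 -> \bar R}) f g :
  preserves m1 f -> preserves m2 g ->
  preserves (sigma_product m1 m2) (fun p => (f p.1, g p.2)).
Proof.
move=> [mf fE] [mg gE].
have mfg : measurable_fun setT (fun p : T1 * T2 => (f p.1, g p.2)).
  by apply: measurable_fun_pair; exact: measurableT_comp.
split=> // A mA; rewrite /sigma_product.
apply/esym/(@product_measure_unique _ _ _ _ _ m1 m2 (pushforward (m1 \x m2)%E (fun p => (f p.1, g p.2)))) => //.
move=> B C mB mC.
rewrite [LHS](_ : _ = (m1 \x m2)%E ((f @^-1` B) `*` (g @^-1` C)))//.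
have mfB : measurable (f @^-1` B) by rewrite -[X in measurable X]setTI; exact: mf.
have mgC : measurable (g @^-1` C) by rewrite -[X in measurable X]setTI; exact: mg.
by rewrite product_measure1E//; congr (_ * _)%E; [exact: fE|exact: gE].
Qed.

Section preserves_tuple.
Context d (T : measurableType d) (R : realType).
Variable mu : {sigma_finite_measure set T -> \bar R}.

Definition tuple_mapi n (phi : nat -> T -> T) (t : n.-tuple T) : n.-tuple T :=
  [tuple phi i (tnth t i) | i < n].

Lemma measurable_tuple_mapi n (phi : nat -> T -> T) :
  (forall i, measurable_fun setT (phi i)) ->
  measurable_fun setT (@tuple_mapi n phi).
Proof.
move=> mphi; apply/measurable_fun_tnthP => j.
rewrite (_ : _ \o _ = phi j \o (fun t : n.-tuple T => tnth t j)); last first.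
  by apply/funext => t /=; rewrite tnth_mktuple.
by apply: measurableT_comp => //; exact: measurable_tnth.
Qed.

Lemma tuple_mapi_cons n (phi : nat -> T -> T) (p : T * n.-tuple T) :
  tuple_mapi phi (tuple_cons p) =
  tuple_cons (phi 0%N p.1, tuple_mapi (fun i => phi i.+1) p.2).
Proof.
apply: eq_from_tnth => i; rewrite tnth_mktuple.
by case: (unliftP ord0 i) => [j ->|->]; rewrite ?tnth0// !tnthS tnth_mktuple.
Qed.

Lemma preserves_tuple n (phi : nat -> T -> T) :
  (forall i, preserves mu (phi i)) ->
  preserves (tuple_measure mu n) (@tuple_mapi n phi).
Proof.
elim: n phi => [|n IH] phi Hphi; (split; first by apply: measurable_tuple_mapi => i; have [] := Hphi i).
  by move=> A mA; congr (_ _); apply/funext => t /=; rewrite [t]tuple0 [tuple_mapi _ _]tuple0.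
move=> A mA; rewrite /= /pushforward_iso /pushforward.
have mcA : measurable (@tuple_cons _ T n @^-1` A).
  by rewrite -[X in measurable X]setTI; exact: measurable_tuple_cons.
have [_ /(_ _ mcA) <-] := preserves_prod (Hphi 0%N) (IH (fun i => phi i.+1) (fun i => Hphi i.+1)).
by congr (sigma_product _ _ _); apply/funext => p; rewrite /preimage/= tuple_mapi_cons.
Qed.

Lemma measurable_rect n (B : nat -> set T) : (forall i, measurable (B i)) ->
  measurable [set t : n.-tuple T | forall j : 'I_n, B j (tnth t j)].
Proof.
move=> mB; have -> : [set t : n.-tuple T | forall j : 'I_n, B j (tnth t j)] =
    \bigcap_(i in [set: 'I_n]) ((fun t : n.-tuple T => tnth t i) @^-1` B i).
  by apply/seteqP; split => t /= H i; [move=> _; exact: H|exact: H].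
apply: fin_bigcap_measurable => // i _.
by rewrite -[X in measurable X]setTI; exact: measurable_tnth.
Qed.

Lemma tuple_measure_rect n (B : nat -> set T) : (forall i, measurable (B i)) ->
  tuple_measure mu n [set t | forall i : 'I_n, B i (tnth t i)] =
  (\prod_(i < n) mu (B i))%E.
Proof.
elim: n B => [|n IH] B mB.
  rewrite big_ord0/= diracE (_ : _ \in _)// inE/=; by case.
rewrite big_ord_recl /= /pushforward_iso /pushforward.
rewrite (_ : _ @^-1` _ = B 0%N `*` [set t : n.-tuple T | forall i : 'I_n, B i.+1 (tnth t i)]); last first.
  apply/seteqP; split => [[x t] /= H|[x t] /= [Bx Bt] i].
    by split => [|i]; [have := H ord0; rewrite tnth0|have := H (lift ord0 i); rewrite tnthS].
  by case: (unliftP ord0 i) => [j ->|->]; rewrite ?tnth0// tnthS; exact: Bt.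
rewrite /sigma_product product_measure1E//; last first.
  by apply: (@measurable_rect n (fun i => B i.+1)) => i; exact: mB.
by congr (_ * _)%E; apply: (IH (fun i => B i.+1)).
Qed.

End preserves_tuple.

Section plane.
Context (R : realType).
Local Notation RR := (measurableTypeR R).
Local Notation leb := (@lebesgue_measure R).
Local Notation leb2 := (sigma_product leb leb).

Lemma measurable_addr (a : R) : measurable_fun setT (fun x : RR => a + x : RR).
Proof. by apply: measurable_funD; [exact: measurable_cst|exact: measurable_id]. Qed.

Lemma preserves_translation (a : R) : preserves leb (fun x : RR => a + x : RR).
Proof.
split; first exact: measurable_addr.
move=> A mA; apply/esym/(@lebesgue_measure_unique _ (pushforward leb (fun x : RR => a + x : RR))) => //.
  exact: measurable_addr.
move=> Hyp0 _ [[b c] _ <-].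
rewrite [RHS](_ : _ = leb `](b - a), (c - a)]%classic); last first.
  congr (leb _); apply/seteqP; split => x /=; by rewrite !in_itv/= ltrBlDl lerBrDl.
rewrite !lebesgue_measure_itv/= !lte_fin ltrD2r; case: ifP => // _.
by rewrite -!EFinD; congr EFin; ring.
Qed.

Lemma preserves_translation2 (a : R * R) :
  preserves leb2 (fun p : RR * RR => (a.1 + p.1, a.2 + p.2) : RR * RR).
Proof. exact: (preserves_prod (preserves_translation a.1) (preserves_translation a.2)). Qed.

Lemma preserves_sheary (t : R) :
  preserves leb2 (fun p : RR * RR => (p.1, t * p.1 + p.2) : RR * RR).
Proof.
have mf : measurable_fun setT (fun p : RR * RR => (p.1, t * p.1 + p.2) : RR * RR).
  apply: measurable_fun_pair => //; apply: measurable_funD => //.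
  by apply: measurable_funM => //; exact: measurable_cst.
split=> // A mA; rewrite /sigma_product.
apply/esym/(@product_measure_unique _ _ _ _ _ leb leb (pushforward (leb \x leb)%E (fun p : RR * RR => (p.1, t * p.1 + p.2) : RR * RR))) => //.
move=> B C mB mC; rewrite [LHS](_ : _ = (\int[leb]_x (leb (xsection ((fun p : RR * RR => (p.1, (t * p.1 + p.2)%R) : RR * RR) @^-1` (B `*` C)) x)))%E)//.
rewrite (eq_integral (fun x => (\1_B x)%:E * leb C)%E) => [|x _].
  rewrite ge0_integralZr ?integral_indic ?setIT//; exact: measurableT_comp.
rewrite indicE; have [xB|xB] := boolP (x \in B).
  rewrite mul1e -[RHS]((preserves_translation (t * x)).2 C mC); congr (leb _).
  apply/seteqP; split => y; rewrite /xsection /= inE/=; first by case.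
  by move=> Cy; split => //; rewrite inE in xB.
rewrite mul0e -(measure0 leb); congr (leb _).
apply/seteqP; split => y //; rewrite /xsection /= inE/= => -[Bx _].
by move: xB; rewrite notin_setE => /(_ Bx).
Qed.

Lemma preserves_swap : preserves leb2 (fun p : RR * RR => (p.2, p.1) : RR * RR).
Proof.
have mf : measurable_fun setT (fun p : RR * RR => (p.2, p.1) : RR * RR).
  by apply: measurable_fun_pair.
split=> // A mA; rewrite /sigma_product.
apply/esym/(@product_measure_unique _ _ _ _ _ leb leb (pushforward (leb \x leb)%E (fun p : RR * RR => (p.2, p.1) : RR * RR))) => //.
move=> B C mB mC.
rewrite [LHS](_ : _ = (leb \x leb)%E (C `*` B)); last first.
  congr ((leb \x leb)%E _); apply/seteqP; split => -[x y]/= [//].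
by rewrite product_measure1E// muleC.
Qed.

Lemma preserves_shearx (t : R) :
  preserves leb2 (fun p : RR * RR => (p.1 + t * p.2, p.2) : RR * RR).
Proof.
have := preserves_comp preserves_swap (preserves_comp (preserves_sheary t) preserves_swap).
by congr preserves; apply/funext => -[x y] /=; rewrite addrC.
Qed.

(* A rotation is a product of three shears. *)
Lemma preserves_rotation (a b : R) : a ^+ 2 + b ^+ 2 = 1 ->
  preserves leb2 (fun p : RR * RR => (a * p.1 - b * p.2, a * p.2 + b * p.1) : RR * RR).
Proof.
(* The shears divide by [b]. For [b = 0] the map is the identity or its opposite, and the latter is
   the square of a quarter turn. *)
wlog b0 : a b / b != 0.
  move=> H ab; have [b0|] := eqVneq b 0; last by move=> /H; exact.
  have /orP[/eqP a1|/eqP a1] : (a == 1) || (a == -1).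
  - by rewrite -eqf_sqr expr1n -ab b0 expr0n addr0.
  - have : preserves leb2 id by split => //; exact: measurable_id.
    by congr preserves; apply/funext => -[x y]/=; rewrite b0 a1; congr pair; ring.
  have h01 : (0 : R) ^+ 2 + 1 ^+ 2 = 1 by rewrite expr0n/= expr1n add0r.
  have := preserves_comp (H 0 1 (oner_neq0 _) h01) (H 0 1 (oner_neq0 _) h01).
  by rewrite b0 a1; congr preserves; apply/funext => -[x y]/=; congr pair; ring.
move=> ab.
have := preserves_comp (preserves_shearx ((a - 1) / b)) (preserves_comp (preserves_sheary b) (preserves_shearx ((a - 1) / b))).
congr preserves; apply/funext => -[x y]/=.
have E : b * ((a - 1) / b) = a - 1 by rewrite mulrC divfK.
have E2 : (a - 1) / b * (a - 1) + 2 * ((a - 1) / b) = - b.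
  apply: (mulfI b0); rewrite mulrN -expr2.
  set s := (a - 1) / b in E *.
  rewrite (_ : b * _ = (b * s) * (a - 1) + 2 * (b * s)); last by ring.
  rewrite E.
  have -> : b ^+ 2 = 1 - a ^+ 2 by rewrite -ab addrC addKr.
  by ring.
congr pair.
- set s := (a - 1) / b in E E2 *.
  rewrite (_ : x + s * y + s * (b * (x + s * y) + y) = x + (b * s) * x + (s * (b * s) + 2 * s) * y); last by ring.
  by rewrite E E2; ring.
- by rewrite mulrDr mulrA E; ring.
Qed.

End plane.

(** * Lebesgue measure on complex space, and polydiscs *)

Section complex_lebesgue.
Context (R : realType) (d : nat).
Local Notation V := (Clebesgue R d).
Local Notation Cd := 'rV[R[i]]_d.
Local Notation RR := (measurableTypeR R).
Local Notation leb2 := (sigma_product (@lebesgue_measure R) (@lebesgue_measure R)).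

Lemma preserves_Clebesgue (g : Cspace R d -> Cspace R d) (phi : nat -> RR * RR -> RR * RR) :
  measurable_fun setT g -> (forall i, preserves leb2 (phi i)) ->
  (forall t, g (Cspace_of_tuple t) = Cspace_of_tuple (tuple_mapi phi t)) ->
  preserves V g.
Proof.
move=> mg Hphi gphi; split=> // A mA; rewrite /Clebesgue/= /pushforward_iso /pushforward.
have mA' : measurable (@Cspace_of_tuple R d @^-1` A).
  by rewrite -[X in measurable X]setTI; exact: measurable_Cspace_of_tuple.
have [_ /(_ _ mA') <-] := preserves_tuple d Hphi.
by congr (tuple_measure _ _ _); apply/funext => t; rewrite /preimage/= gphi.
Qed.

Lemma continuous_measurable_Cspace (g : Cd -> Cd) : continuous g ->
  measurable_fun setT (g : Cspace R d -> Cspace R d).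
Proof.
move=> /continuousP cg.
apply: (measurability (@open 'rV[R[i]]_d : set (set (Cspace R d))) erefl).
move=> _ [A oA <-]; rewrite setTI; apply: sub_sigma_algebra; exact: cg.
Qed.

Lemma Clebesgue_translation (a : Cd) : preserves V (fun z => a + z : Cspace R d).
Proof.
pose phi i (p : RR * RR) : RR * RR :=
  if insub i is Some j then (complex.Re (a ord0 (j : 'I_d)) + p.1, complex.Im (a ord0 j) + p.2) else p.
apply: (@preserves_Clebesgue _ phi).
- apply: continuous_measurable_Cspace => z; apply: (@cvgD _ _ _ (nbhs z) _ (fun=> a) id a z); [exact: cvg_cst|exact: cvg_id].
- move=> i; rewrite /phi; case: insub => [j|]; last by split => //; exact: measurable_id.
  exact: (preserves_translation2 (complex.Re (a ord0 j), complex.Im (a ord0 j))).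
- move=> t; apply/rowP => j; rewrite !mxE tnth_mktuple /phi valK/=.
  by case: (a ord0 j) => x y.
Qed.

Lemma Clebesgue_rotation (c : R[i]) : normc c = 1 -> preserves V (fun z => c *: z : Cspace R d).
Proof.
case: c => a b /= nc.
have ab : a ^+ 2 + b ^+ 2 = 1.
  by rewrite -[LHS]sqr_sqrtr ?nc ?expr1n// addr_ge0// sqr_ge0.
apply: (@preserves_Clebesgue _ (fun _ p => (a * p.1 - b * p.2, a * p.2 + b * p.1))).
- apply: continuous_measurable_Cspace => z; apply: (@cvgZ _ _ _ (nbhs z) _ (fun=> a +i* b) id (a +i* b) z); [exact: cvg_cst|exact: cvg_id].
- by move=> i; exact: preserves_rotation.
- move=> t; apply/rowP => j; rewrite !mxE tnth_mktuple.
  by apply/eqP; rewrite eq_complex/=; apply/andP; split; apply/eqP; ring.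
Qed.

Definition cbox (I J : nat -> set RR) : set (Cspace R d) :=
  [set z | forall j : 'I_d, I j (complex.Re ((z : Cd) ord0 j)) /\ J j (complex.Im ((z : Cd) ord0 j))].

Lemma cbox_preimage I J : cbox I J = tuple_of_Cspace (R := R) (d := d) @^-1`
  [set t | forall j : 'I_d, (I j `*` J j) (tnth t j)].
Proof. by apply/seteqP; split => z /= H j; have := H j; rewrite tnth_mktuple. Qed.

Lemma measurable_cbox I J : (forall i, measurable (I i)) -> (forall i, measurable (J i)) ->
  measurable (cbox I J).
Proof.
move=> mI mJ; rewrite cbox_preimage -[X in measurable X]setTI.
apply: measurable_tuple_of_Cspace => //; apply: (@measurable_rect _ _ d (fun j => I j `*` J j)) => i.
exact: measurableX.
Qed.

Lemma Clebesgue_cbox I J : (forall i, measurable (I i)) -> (forall i, measurable (J i)) ->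
  V (cbox I J) = (\prod_(j < d) (lebesgue_measure (I j) * lebesgue_measure (J j)))%E.
Proof.
move=> mI mJ; rewrite /Clebesgue/= /pushforward_iso /pushforward.
have mIJ i : measurable (I i `*` J i) by exact: measurableX.
have := @tuple_measure_rect _ _ R leb2 d (fun j => I j `*` J j) mIJ.
have -> : (\prod_(i < d) leb2 (I i `*` J i) = \prod_(j < d) (lebesgue_measure (I j) * lebesgue_measure (J j)))%E.
  by apply: eq_bigr => i _; rewrite /sigma_product product_measure1E.
move=> <-; congr (tuple_measure _ _ _).
by apply/funext => t; rewrite cbox_preimage /preimage/= Cspace_of_tupleK.
Qed.

Definition pdisc (q : Cd) (r : R) : set Cd := [set z | forall j, normc (z ord0 j - q ord0 j) < r].

Lemma pdisc_ball q r : 0 < r -> pdisc q r = ball q r%:C.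
Proof.
move=> r0; apply/seteqP; split => z.
  move=> H; split; first by rewrite ltcR.
  by move=> i j; rewrite (ord1 i) /ball/= distrC normcE ltcR; exact: H.
by move=> [_ H] j; have := H ord0 j; rewrite /ball/= distrC normcE ltcR.
Qed.

Lemma nbhs_pdisc q (A : set Cd) : nbhs q A <-> exists2 r, 0 < r & pdisc q r `<=` A.
Proof.
split => [/nbhs_ballP[[r r'] /=]|[r r0 H]]; last first.
  by apply/nbhs_ballP; exists r%:C => /=; rewrite ?ltcR -?pdisc_ball.
  by rewrite ltcE/= => /andP[/eqP-> r0] H; exists r => //; rewrite pdisc_ball.
Qed.

Lemma pdisc_center q r : 0 < r -> pdisc q r q.
Proof. by move=> r0 j; rewrite subrr normc0. Qed.

Lemma open_pdisc q r : open (pdisc q r).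
Proof.
have [r0|r0] := ltP 0 r.
  by rewrite pdisc_ball//; apply: ball_open; rewrite ltcR.
(* In dimension [0] the defining condition is empty, so the polydisc is the whole one-point space
   even for [r <= 0]. *)
have [d0|d0] := eqVneq d 0%N.
  rewrite (_ : pdisc q r = setT); first exact: openT.
  by apply/seteqP; split => // z _ j; exfalso; move: j; rewrite d0; case.
rewrite (_ : pdisc q r = set0); first exact: open0.
apply/seteqP; split => // z; have j : 'I_d by case: d d0 => // n _; exact: ord0.
by move=> /(_ j) /(le_lt_trans (normc_ge0 _)); rewrite ltNge r0.
Qed.

Lemma measurable_open (A : set Cd) : open A -> measurable (A : set (Cspace R d)).
Proof. by move=> oA; exact: sub_sigma_algebra. Qed.

Lemma measurable_closed (A : set Cd) : closed A -> measurable (A : set (Cspace R d)).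
Proof. by move=> cA; rewrite -[A]setCK; apply: measurableC; apply: measurable_open; exact: closed_openC. Qed.

Lemma measurable_pdisc q r : measurable (pdisc q r : set (Cspace R d)).
Proof. by apply: measurable_open; exact: open_pdisc. Qed.

Lemma pdisc_translation q r : V (pdisc q r) = V (pdisc 0 r).
Proof.
rewrite -(Clebesgue_translation (q : Cd)).2; last exact: measurable_pdisc.
congr (V _); apply/funext => z; rewrite /preimage/= /pdisc/=; apply/propext; split=> H j; have := H j;
 by rewrite !mxE subr0 (addrC (q ord0 j)) addrK.
Qed.

Lemma Clebesgue_pdisc_le q r : 0 <= r -> (V (pdisc q r) <= ((2 * r) ^+ (2 * d))%:E)%E.
Proof.
move=> r0; rewrite pdisc_translation.
pose I : nat -> set RR := fun _ => `[- r, r]%classic.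
have mI i : measurable (I i) by exact: measurable_itv.
have E : V (cbox I I) = ((2 * r) ^+ (2 * d))%:E.
  have Ie i : lebesgue_measure (I i) = (2 * r)%:E.
    rewrite /I lebesgue_measure_itv/= lte_fin; case: ltP => h.
      by rewrite -EFinD; congr EFin; ring.
    have -> : r = 0 by lra. by rewrite mulr0.
  rewrite Clebesgue_cbox//; under eq_bigr do rewrite Ie -EFinM -expr2.
  by rewrite prodEFin prodr_const card_ord -exprM.
rewrite -E; apply: le_measure; rewrite ?inE; [exact: measurable_pdisc|exact: measurable_cbox|].
move=> z H j; have := ltW (H j); rewrite mxE subr0 => h.
have := le_trans (normc_Re _) h; have := le_trans (normc_Im _) h.
by rewrite !ler_norml /I/= !in_itv/=.
Qed.

Lemma Clebesgue_pdisc_fin q r : (V (pdisc q r) < +oo)%E.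
Proof.
apply: (@le_lt_trans _ _ (V (pdisc q (Num.max r 0)))).
  apply: le_measure; rewrite ?inE; [exact: measurable_pdisc|exact: measurable_pdisc|].
  by move=> z H j; rewrite lt_max H.
apply: le_lt_trans (Clebesgue_pdisc_le _ _) (ltry _); by rewrite le_max lexx orbT.
Qed.

Lemma Clebesgue_pdisc_gt0 q r : 0 < r -> (0 < V (pdisc q r))%E.
Proof.
move=> r0; rewrite pdisc_translation.
pose I : nat -> set RR := fun _ => `[0, r / 4]%classic.
have mI i : measurable (I i) by exact: measurable_itv.
have E : V (cbox I I) = ((r / 4) ^+ (2 * d))%:E.
  have Ie i : lebesgue_measure (I i) = (r / 4)%:E.
    by rewrite /I lebesgue_measure_itv/= lte_fin divr_gt0// sube0.
  rewrite Clebesgue_cbox//; under eq_bigr do rewrite Ie -EFinM -expr2.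
  by rewrite prodEFin prodr_const card_ord -exprM.
apply: (@lt_le_trans _ _ (V (cbox I I))).
  by rewrite E lte_fin exprn_gt0// divr_gt0.
apply: le_measure; rewrite ?inE; [exact: measurable_cbox|exact: measurable_pdisc|].
move=> z H j; have [] := H j; rewrite /I/= !in_itv/= => /andP[a1 a2] /andP[b1 b2].
rewrite mxE subr0; apply: (le_lt_trans (normc_ler_ReIm _)).
rewrite !ger0_norm//; lra.
Qed.

End complex_lebesgue.

(** * Logarithmically subharmonic functions *)

Section fatou_epsilon.
Context d (T : measurableType d) (R : realType) (mu : {measure set T -> \bar R}).
Local Open Scope ereal_scope.

Lemma le_limn_einf (u : (\bar R)^nat) (a : \bar R) N :
  (forall n, (N <= n)%N -> a <= u n) -> a <= limn_einf u.
Proof.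
move=> H; rewrite limn_einf_lim.
have -> : limn (einfs u) = ereal_sup (range (einfs u)).
  by apply/cvg_lim => //; apply: ereal_nondecreasing_cvgn; exact: nondecreasing_einfs.
apply: (@le_trans _ _ (einfs u N)); last by apply: ereal_sup_ubound; exists N.
by apply: le_ereal_inf_tmp => _ [n /= Nn <-]; exact: H.
Qed.

Lemma limn_einf_le (u : (\bar R)^nat) (a : \bar R) N :
  (forall n, (N <= n)%N -> u n <= a) -> limn_einf u <= a.
Proof.
move=> H; rewrite limn_einf_lim.
have -> : limn (einfs u) = ereal_sup (range (einfs u)).
  by apply/cvg_lim => //; apply: ereal_nondecreasing_cvgn; exact: nondecreasing_einfs.
apply: ge_ereal_sup => _ [n _ <-].
apply: (@le_trans _ _ (u (maxn n N))); last by apply: H; exact: leq_maxr.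
by apply: ereal_inf_lbound; exists (maxn n N) => //=; exact: leq_maxl.
Qed.

(** Fatou's lemma, with [g <= liminf f n] spelled out in epsilons: this is the form in which
    Jensen's inequality and strict inequalities between limits supply it. *)
Lemma fatou_epsilon (D : set T) (f : nat -> T -> R) (g : T -> R) (c : \bar R) N0 :
  measurable D -> (forall n, measurable_fun D (f n)) -> measurable_fun D g ->
  (forall n x, D x -> (0 <= f n x)%R) -> (forall x, D x -> (0 <= g x)%R) ->
  (forall x, D x -> forall e : R, (0 < e)%R -> exists N, forall n, (N <= n)%N -> (g x <= f n x + e)%R) ->
  (forall n, (N0 <= n)%N -> \int[mu]_(x in D) (f n x)%:E <= c) ->
  \int[mu]_(x in D) (g x)%:E <= c.
Proof.
move=> mD mf mg f0 g0 fg fc.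
apply: (@le_trans _ _ (\int[mu]_(x in D) limn_einf (fun n => (f n x)%:E))).
  apply: ge0_le_integral => //.
  - exact/measurable_EFinP.
  - apply: (emeasurable_fun_cvg (fun n x => einfs (fun k => (f k x)%:E) n)).
    by move=> n; apply: measurable_fun_einfs => k; exact/measurable_EFinP.
  - by move=> x _; rewrite limn_einf_lim; exact: is_cvg_einfs.
  - move=> x Dx; apply/lee_addgt0Pr => e e0.
    have [N HN] := fg x Dx e e0.
    rewrite -leeBlDr//; apply: (@le_limn_einf _ _ N) => n Nn.
    by rewrite -EFinB lee_fin lerBlDr; exact: HN.
have m1 n : measurable_fun D (fun x => (f n x)%:E) by exact/measurable_EFinP.
have m2 n x : D x -> 0 <= (f n x)%:E by rewrite lee_fin; exact: f0.
exact: le_trans (fatou mu mD m1 m2) (limn_einf_le fc).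
Qed.

End fatou_epsilon.

Lemma ln_sub1 (R : realType) (x : R) : 0 < x -> ln x <= x - 1.
Proof.
move=> x0; rewrite -ler_expR lnK//; apply: le_trans (expR_ge1Dx _).
by rewrite addrC subrK.
Qed.

Section jensen_pdisc.
Context (R : realType) (d : nat).
Local Notation V := (Clebesgue R d).
Local Notation Cd := 'rV[R[i]]_d.
Implicit Types (q p : Cd) (r : R).

Lemma measurable_normc_holo (D : set Cd) (h : Cd -> R[i]) : open D ->
  (forall z, D z -> differentiable h z) ->
  measurable_fun (D : set (Cspace R d)) ((fun z => normc (h z)) : Cspace R d -> measurableTypeR R).
Proof.
move=> oD dh; apply: (measurability _ (RGenOpens.measurableE R)).
move=> _ [_ [a [b ->]] <-]; apply: measurable_open.
have -> : D `&` (fun z => normc (h z)) @^-1` `]a, b[%classic =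
    [set z | nbhs z (D `&` (fun z => normc (h z)) @^-1` `]a, b[%classic)].
  apply/seteqP; split => z /=; last exact: nbhs_singleton.
  move=> [Dz hz]; apply: filterI; first exact: open_nbhs_nbhs.
  have ch : {for z, continuous (fun z => normc (h z))}.
    apply: (@continuous_comp _ _ _ h (@normc R)); last exact: normc_continuous.
    by apply: differentiable_continuous; exact: dh.
  by apply: ch; apply: open_nbhs_nbhs; split => //; exact: interval_open.
exact: open_interior.
Qed.

Lemma pdisc_sub q r (z : Cd) (c : R[i]) : pdisc 0 r z -> normc c <= 1 -> pdisc q r (q + c *: z).
Proof.
move=> zr c1 j; have := zr j; rewrite !mxE subr0 (addrC (q ord0 j)) addrK normcMr.
by apply: le_lt_trans; rewrite ler_piMl ?normc_ge0.
Qed.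

Lemma integral_rotation (G : Cspace R d -> measurableTypeR R) q (c : R[i]) :
  measurable_fun setT G -> (forall z, 0 <= G z) -> normc c = 1 ->
  (\int[V]_z (G (q + c *: (z : Cd)))%:E = \int[V]_z (G z)%:E)%E.
Proof.
move=> mG G0 c1.
have pr := preserves_comp (Clebesgue_translation q) (Clebesgue_rotation d c1).
have mGE : measurable_fun setT (fun z : Cspace R d => (G z)%:E) by apply/measurable_EFinP.
have GE0 (z : Cspace R d) : (0 <= (G z)%:E)%E by rewrite lee_fin.
exact: (preserves_integral pr mGE GE0).
Qed.

(** On each disc [z |-> q + z *: v] through the centre, [jensen_roots] bounds the left side by the
    average [A N v] over roots of unity, up to any [e], for large [N]. Rotations preserve [V], so
    every [A N] has the integral [I], and Fatou's lemma concludes. The truncation at [eps] makes the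
    integrand nonnegative. *)
Lemma jensen_pdisc (h : Cd -> R[i]) q r (eps : R) : 0 < r -> 0 < eps ->
  (forall z, pdisc q r z -> differentiable h z) -> h q != 0 ->
  ((ln (normc (h q)) - ln eps)%:E * V (pdisc q r) <=
   \int[V]_(z in pdisc q r) (ln (Num.max (normc (h z)) eps) - ln eps)%:E)%E.
Proof.
move=> r0 eps0 dh hq.
set D := pdisc q r; pose D0 := pdisc (0 : Cd) r.
have mD : measurable (D : set (Cspace R d)) by exact: measurable_pdisc.
have mD0 : measurable (D0 : set (Cspace R d)) by exact: measurable_pdisc.
pose g z := ln (Num.max (normc (h z)) eps) - ln eps.
have g0 z : 0 <= g z.
  by rewrite /g subr_ge0 ler_ln ?posrE ?lt_max ?eps0 ?orbT// le_max lexx orbT.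
have mg : measurable_fun (D : set (Cspace R d)) (g : Cspace R d -> measurableTypeR R).
  apply: measurable_funB; last exact: measurable_cst.
  apply: measurableT_comp; first exact: measurable_ln.
  by apply: measurable_maxr; [apply: measurable_normc_holo; [exact: open_pdisc|exact: dh]|exact: measurable_cst].
pose G : Cspace R d -> measurableTypeR R := g \_ D.
have mG : measurable_fun setT G by apply/(measurable_restrictT _ _).1.
have G0 z : 0 <= G z by rewrite /G patchE; case: ifP.
rewrite -/(g _) [leRHS](_ : _ = \int[V]_z (G z)%:E)%E; last first.
  by rewrite integral_mkcond; apply: eq_integral => z _; rewrite /G !patchE; case: ifP.
set I := (\int[V]_z (G z)%:E)%E.
have transl := @Clebesgue_translation R d q.
have [mT _] := transl.
pose w N k : R[i] := cexp 0 (2 * pi * k%:R / N%:R).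
have w1 N k : normc (w N k) = 1 by rewrite normc_cexp expR0.
have mrot c : normc c = 1 -> measurable_fun setT ((fun z => G (q + c *: (z : Cd))) : Cspace R d -> measurableTypeR R).
  move=> c1; have [mr _] := Clebesgue_rotation d c1.
  by apply: (measurableT_comp mG); apply: (measurableT_comp mT).
have Irot c : normc c = 1 -> (\int[V]_z (G (q + c *: z)%R)%:E = I)%E.
  by move=> c1; exact: integral_rotation.
pose A N v : R := N.+1%:R^-1 * \sum_(k < N.+1) G (q + w N.+1 k *: v).
have mA N : measurable_fun setT (A N : Cspace R d -> measurableTypeR R).
  apply: measurable_funM; first exact: measurable_cst.
  by apply: measurable_sum => k; exact: mrot.
have A0 N v : 0 <= A N v by rewrite /A mulr_ge0 ?invr_ge0// sumr_ge0.
have IA N : (\int[V]_v (A N v)%:E = I)%E.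
  under eq_integral do rewrite /A EFinM.
  rewrite ge0_integralZl//; last 2 first.
  - by apply/measurable_EFinP; apply: measurable_sum => k; exact: mrot.
  - by move=> v _; rewrite lee_fin sumr_ge0.
  under eq_integral do rewrite -sumEFin.
  rewrite ge0_integral_sum//; last by move=> k z _; rewrite lee_fin.
  under eq_bigr do rewrite Irot//.
  rewrite sumr_const card_ord.
  have [->|Ioo] := eqVneq I +oo%E.
    have -> : (+oo%E *+ N.+1)%R = +oo%E :> \bar R by elim: (N) => // n IH; rewrite mulrS IH.
    by rewrite mulry gtr0_sg ?invr_gt0// mul1e.
  have Ifin : I \is a fin_num.
    by rewrite ge0_fin_numE ?ltey//; apply: integral_ge0 => z _; rewrite lee_fin.
  have nE (x : R) n : (x%:E *+ n.+1)%R = (x *+ n.+1)%:E :> \bar R.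
      by elim: n => // n IH; rewrite mulrS IH -EFinD -mulrS.
    rewrite -(fineK Ifin) nE -EFinM; congr EFin.
    by rewrite -[X in _ * X]mulr_natl mulKf ?pnatr_eq0.
  by move=> k; apply/measurable_EFinP; exact: mrot.
have [c0|c0] := leP (ln (normc (h q)) - ln eps) 0.
  apply: (@le_trans _ _ 0%E); last by apply: integral_ge0 => z _; rewrite lee_fin.
  by rewrite mule_le0_ge0// lee_fin.
rewrite pdisc_translation -/D0.
have -> : ((ln (normc (h q)) - ln eps)%:E * V D0 = \int[V]_(z in D0) (ln (normc (h q)) - ln eps)%:E)%E.
  by rewrite integral_cst.
apply: (@fatou_epsilon _ _ _ V D0 A _ I 0) => //.
- by move=> N; apply: measurable_funS (mA N).
- by move=> *; exact: ltW.
- move=> v vD e e0.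
  pose H (z : R[i]) := h (q + z *: v).
  have dH z : normc z <= 1 -> differentiable H z.
    move=> z1.
    have d2 : differentiable h (q + z *: (v : Cd)) by apply: dh; exact: pdisc_sub.
    have d1 : differentiable (fun z : R[i] => q + z *: (v : Cd)) z.
      apply: (@differentiableD _ _ _ (fun=> q) (fun z : R[i] => z *: (v : Cd))).
        exact: differentiable_cst.
      by apply: differentiableZl; exact: ex_diff.
    exact: (differentiable_comp d1 d2).
  have H0 : H 0 != 0 by rewrite /H scale0r addr0.
  have [N0 HN] := jensen_roots dH eps0 H0 e0.
  exists N0 => N /leqW N0N; have := HN _ N0N.
  have E : H 0 = h q by rewrite /H scale0r addr0.
  rewrite E => J; rewrite /A.
  have -> : \sum_(k < N.+1) G (q + w N.+1 k *: v) =
    \sum_(k < N.+1) ln (Num.max (normc (H (w N.+1 k))) eps) - N.+1%:R * ln eps.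
    rewrite mulr_natl -[X in _ *+ X]card_ord -sumr_const -sumrB; apply: eq_bigr => k _.
    by rewrite /G patchE mem_set//; apply: pdisc_sub => //; rewrite w1.
  have n0 : 0 < N.+1%:R :> R by rewrite ltr0n.
  rewrite -lerBlDr -(ler_pM2l n0) mulrA mulfV ?gt_eqF// mul1r.
  by rewrite lerBrDr; apply: le_trans J; rewrite -mulrDr ler_pM2l//; lra.
- move=> N _; rewrite -(IA N); apply: ge0_subset_integral => //.
    by apply/measurable_EFinP; exact: mA.
  by move=> x _; rewrite lee_fin.
Qed.

(* The second inequality follows from [ln (u q) <= mean of ln u], as
   [ln x <= x]. *)
Definition log_submean (U : set Cd) (u : Cd -> R) :=
  [/\ measurable_fun (U : set (Cspace R d)) (u : Cspace R d -> measurableTypeR R),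
      forall z, U z -> 0 <= u z &
      forall q r, 0 < r -> closure (pdisc q r) `<=` U ->
       ((u q)%:E * V (pdisc q r) <= \int[V]_(p in pdisc q r) (u p)%:E)%E /\
       forall e, 0 < e -> e < 1 ->
        ((u q * - ln e)%:E * V [set p | pdisc q r p /\ (u p < e * u q)%R] <=
         \int[V]_(p in pdisc q r) (u p)%:E)%E].

(** Put [v = normc h ^ 2 / u q ^ 2], so that [v <= u / u q] and [v q = 1]; Jensen's inequality for
    [max (v, e)] is [key]. The first claim follows from [ln x <= x - 1], letting [e] tend to [0].
    For the second, the integrand of [J e] vanishes where [u < e * u q] and is at most [v - ln e]
    elsewhere. *)
Lemma holo_submean (h : Cd -> R[i]) (u : Cd -> R) q r : 0 < r ->
  (forall z, pdisc q r z -> differentiable h z) ->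
  measurable_fun (pdisc q r : set (Cspace R d)) (u : Cspace R d -> measurableTypeR R) ->
  (forall z, pdisc q r z -> 0 <= u z) ->
  (forall z, pdisc q r z -> normc (h z) ^+ 2 <= u z * u q) -> normc (h q) = u q ->
  ((u q)%:E * V (pdisc q r) <= \int[V]_(p in pdisc q r) (u p)%:E)%E /\
  forall e, 0 < e -> e < 1 ->
    ((u q * - ln e)%:E * V [set p | pdisc q r p /\ (u p < e * u q)%R] <=
         \int[V]_(p in pdisc q r) (u p)%:E)%E.
Proof.
move=> r0 dh mu u0 hu hq.
set D := pdisc q r.
have mD : measurable (D : set (Cspace R d)) by exact: measurable_pdisc.
have Dq : D q by exact: pdisc_center.
have I0 : (0 <= \int[V]_(p in D) (u p)%:E)%E by apply: integral_ge0 => z Dz; rewrite lee_fin u0.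
have [uq0|uq0] := eqVneq (u q) 0.
  by rewrite uq0; split => [|e _ _]; rewrite ?mul0r mul0e.
have uq : 0 < u q by rewrite lt_neqAle eq_sym uq0 u0.
have VDfin : V D \is a fin_num by rewrite ge0_fin_numE// Clebesgue_pdisc_fin.
pose v z := normc (h z) ^+ 2 / u q ^+ 2.
have v0 z : 0 <= v z by rewrite /v divr_ge0 ?exprn_ge0// ?normc_ge0// ltW.
have mv : measurable_fun (D : set (Cspace R d)) (v : Cspace R d -> measurableTypeR R).
  apply: measurable_funM; last exact: measurable_cst.
  apply: measurable_funX; apply: measurable_normc_holo; [exact: open_pdisc|exact: dh].
have vu z : D z -> v z <= u z / u q.
  move=> Dz; rewrite /v ler_pdivrMr ?exprn_gt0// expr2 mulrA divfK//; exact: hu.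
have Iv : ((u q)%:E * \int[V]_(p in D) (v p)%:E <= \int[V]_(p in D) (u p)%:E)%E.
  rewrite -ge0_integralZl//.
  - apply: ge0_le_integral => //.
    + by move=> z _; rewrite -EFinM lee_fin mulr_ge0// ltW.
    + by apply: measurable_funeM; exact/measurable_EFinP.
        + exact/measurable_EFinP.
    + by move=> z Dz; rewrite -EFinM lee_fin mulrC -ler_pdivlMr//; exact: vu.
  - exact/measurable_EFinP.
  - by move=> z _; rewrite lee_fin.
  - by rewrite lee_fin ltW.
pose J e : \bar R := (\int[V]_(z in D) (ln (Num.max (v z) e) - ln e)%:E)%E.
have mJ e : 0 < e -> measurable_fun (D : set (Cspace R d)) ((fun z => ln (Num.max (v z) e) - ln e) : Cspace R d -> measurableTypeR R).
  move=> e0; apply: measurable_funB; last exact: measurable_cst.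
  apply: measurableT_comp; first exact: measurable_ln.
  by apply: measurable_maxr => //; exact: measurable_cst.
have J0 e z : 0 < e -> 0 <= ln (Num.max (v z) e) - ln e.
  by move=> e0; rewrite subr_ge0 ler_ln ?posrE ?lt_max ?e0 ?orbT// le_max lexx orbT.
have key e : 0 < e -> ((- ln e)%:E * V D <= J e)%E.
  move=> e0.
  (* [max (v, e)] is the square of [max (normc h, sqrt e * u q) / u q]; hence this truncation level
     and the factor [2] in [JE]. *)
  have s0 : 0 < Num.sqrt e * u q by rewrite mulr_gt0// sqrtr_gt0.
  have hq0 : h q != 0 by apply: contra_eq_neq hq => ->; rewrite normc0 eq_sym.
  have := jensen_pdisc r0 s0 dh hq0.
  have lns : ln (Num.sqrt e) = ln e / 2.
    have se0 : 0 < Num.sqrt e by rewrite sqrtr_gt0.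
    have E2 : ln e = ln (Num.sqrt e) * 2.
      by rewrite -{1}(sqr_sqrtr (ltW e0)) expr2 lnM ?posrE//; ring.
    by rewrite E2 mulfK.
  have -> : ln (normc (h q)) - ln (Num.sqrt e * u q) = (- ln e) / 2.
    by rewrite hq lnM ?posrE ?sqrtr_gt0// lns; ring.
  move=> H.
  have JE : J e = (2%:E * \int[V]_(z in D) (ln (Num.max (normc (h z)) (Num.sqrt e * u q)) - ln (Num.sqrt e * u q))%:E)%E.
    rewrite -ge0_integralZl//.
    - apply: eq_integral => z _; rewrite -EFinM; congr EFin.
      have -> : Num.max (v z) e = (Num.max (normc (h z)) (Num.sqrt e * u q) / u q) ^+ 2.
                have n0 : 0 <= normc (h z) by exact: normc_ge0.
        have [hs|hs] := leP (Num.sqrt e * u q) (normc (h z)).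
          rewrite max_l ?expr_div_n// -{1}(sqr_sqrtr (ltW e0)) /v -expr_div_n ler_sqr ?nnegrE ?divr_ge0 ?sqrtr_ge0 ?(ltW uq)//.
          by rewrite ler_pdivlMr.
                rewrite mulfK// sqr_sqrtr ?(ltW e0)// max_r//.
        rewrite -[leRHS](sqr_sqrtr (ltW e0)) /v -expr_div_n ler_sqr ?nnegrE ?divr_ge0 ?sqrtr_ge0 ?(ltW uq)//.
        by rewrite ler_pdivrMr// ltW.
      have m0 : 0 < Num.max (normc (h z)) (Num.sqrt e * u q) by rewrite lt_max s0 orbT.
      have md0 : 0 < Num.max (normc (h z)) (Num.sqrt e * u q) / u q by rewrite divr_gt0.
      rewrite expr2 lnM ?posrE// ln_div ?posrE// lnM ?posrE ?sqrtr_gt0// lns.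
      by field.
    - apply/measurable_EFinP; apply: measurable_funB; last exact: measurable_cst.
      apply: measurableT_comp; first exact: measurable_ln.
      apply: measurable_maxr; last exact: measurable_cst.
      by apply: measurable_normc_holo; [exact: open_pdisc|exact: dh].
    - move=> z _; rewrite lee_fin subr_ge0 ler_ln ?posrE ?lt_max ?s0 ?orbT//.
      by rewrite le_max lexx orbT.
  rewrite JE (_ : - ln e = 2 * (- ln e / 2)); last by field.
  by rewrite EFinM -muleA lee_pmul2l.
split; last first.
  move=> e e0 e1.
  set S := [set p | _].
  have mS : measurable (S : set (Cspace R d)).
    rewrite (_ : S = D `&` [set p | u p < e * u q])//.
    rewrite (_ : [set p | _] = (u : Cspace R d -> measurableTypeR R) @^-1` [set x | x < e * u q])//.
    by apply: mu => //; rewrite -set_itvNyo; exact: measurable_itv.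
  have le0 : 0 <= - ln e by rewrite oppr_ge0 ln_le0// ltW.
  have SD : S `<=` D by move=> z [].
  have VSfin : V S \is a fin_num.
    by rewrite ge0_fin_numE// (le_lt_trans _ (Clebesgue_pdisc_fin q r))// le_measure// inE.
  have B : (J e <= \int[V]_(z in D) (v z)%:E + (- ln e)%:E * V (D `\` S))%E.
    have mDS : measurable (D `\` S : set (Cspace R d)) by exact: measurableD.
    have -> : ((- ln e)%:E * V (D `\` S) = \int[V]_(z in D) ((- ln e) * \1_(D `\` S) z)%:E)%E.
      under eq_integral do rewrite EFinM.
      rewrite ge0_integralZl//; last by apply/measurable_EFinP; exact: measurable_indic.
      by rewrite integral_indic// setIidl//; exact: subDsetl.
    rewrite -ge0_integralD//.
    - apply: ge0_le_integral => //.
      + by move=> z _; rewrite lee_fin J0.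
      + by apply/measurable_EFinP; exact: mJ.
      + apply/measurable_EFinP; apply: measurable_funD => //.
        by apply: measurable_funM; [exact: measurable_cst|exact: measurable_indic].
      + move=> z Dz; rewrite -EFinD lee_fin.
        have [ve|ve] := ltP (v z) e.
          by rewrite subrr addr_ge0// mulr_ge0.
        have nS : ~ S z.
          move=> [_]; rewrite -ltr_pdivrMr// => /(le_lt_trans (vu _ Dz)).
          by rewrite ltNge ve.
        rewrite indicE mem_set// mulr1 lerD2r.
        have vp : 0 < v z by exact: lt_le_trans ve.
        by apply: (le_trans (ln_sub1 vp)); rewrite gerBl.
    - by move=> z _; rewrite lee_fin.
    - exact/measurable_EFinP.
    - by move=> z _; rewrite lee_fin mulr_ge0.
    - apply/measurable_EFinP; apply: measurable_funM; [exact: measurable_cst|exact: measurable_indic].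
  have := le_trans (key e e0) B.
    have -> : V (D `\` S) = (fine (V D) - fine (V S))%:E.
    rewrite measureD//; last by rewrite -ge0_fin_numE.
    by rewrite (setIidr SD) EFinB !fineK.
  move: Iv.
  have [->|/eqP vfin] := eqVneq (\int[V]_(z in D) (v z)%:E)%E +oo%E.
    by rewrite mulry gtr0_sg// mul1e leye_eq => /eqP -> _; rewrite leey.
  have iv : (\int[V]_(z in D) (v z)%:E)%E \is a fin_num.
    by rewrite ge0_fin_numE ?integral_ge0// ?ltey; [exact/eqP|move=> z _; rewrite lee_fin].
  move=> Iv KB; apply: le_trans Iv; move: KB.
  rewrite -(fineK iv) -(fineK VDfin) -(fineK VSfin) -?EFinN -?EFinD -?EFinM -?EFinD !lee_fin => KB.
  rewrite -mulrA ler_pM2l//; move: KB; rewrite mulrBr; lra.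
have B e : 0 < e -> (J e <= \int[V]_(z in D) (v z)%:E + (e - 1 - ln e)%:E * V D)%E.
  move=> e0; have c0 : 0 <= e - 1 - ln e by rewrite subr_ge0; exact: ln_sub1.
  have -> : ((e - 1 - ln e)%:E * V D = \int[V]_(z in D) (e - 1 - ln e)%:E)%E.
    by rewrite integral_cst.
  rewrite -ge0_integralD//.
  - apply: ge0_le_integral => //.
    + by move=> z _; rewrite lee_fin J0.
    + by apply/measurable_EFinP; exact: mJ.
    + by apply/measurable_EFinP; apply: measurable_funD.
    + move=> z Dz; rewrite -EFinD lee_fin addrA lerD2r.
      have m0 : 0 < Num.max (v z) e by rewrite lt_max e0 orbT.
      apply: (le_trans (ln_sub1 m0)); rewrite addrA lerD2r ge_max.
      by rewrite lerDl ltW// lerDr v0.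
  - by move=> z _; rewrite lee_fin.
  - exact/measurable_EFinP.
move: Iv; have [->|/eqP vfin] := eqVneq (\int[V]_(z in D) (v z)%:E)%E +oo%E.
  by rewrite mulry gtr0_sg// mul1e leye_eq => /eqP ->; rewrite leey.
have iv : (\int[V]_(z in D) (v z)%:E)%E \is a fin_num.
  by rewrite ge0_fin_numE ?integral_ge0// ?ltey; [exact/eqP|move=> z _; rewrite lee_fin].
move=> Iv; apply: le_trans Iv; rewrite lee_pmul2l//.
apply/lee_addgt0Pr => e e0.
have x0 : 0 <= fine (V D) by rewrite fine_ge0.
pose e' := e / (1 + fine (V D)).
have e'0 : 0 < e' by rewrite divr_gt0// ltr_pwDl.
have e'e : e' * fine (V D) <= e.
  by rewrite /e' mulrAC ler_pdivrMr ?ltr_pwDl// ler_pM2l// lerDr.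
have := le_trans (key e' e'0) (B e' e'0).
rewrite -(fineK iv) -(fineK VDfin) -!EFinM -!EFinD !lee_fin.
move: e'e; set x := fine (V D); set y := fine _; rewrite mulrBl mulrBl mulNr; lra.
Qed.

End jensen_pdisc.

(** * Approximation of measurable sets *)

Section outer_approximation.
Context d (T : measurableType d) (R : realType) (mu : {finite_measure set T -> \bar R}).
Variable A : set (set T).
Hypotheses (A0 : A set0) (mA : A `<=` measurable) (AC : forall X, A X -> A (~` X))
  (AU : forall X Y, A X -> A Y -> A (X `|` Y)).
Implicit Types X Y : set T.
Local Open Scope ereal_scope.

Definition outer_approximable X := forall e : R, (0 < e)%R -> exists Oc : (set T)^nat,
  [/\ forall i, A (Oc i), X `<=` \bigcup_i Oc i & mu (\bigcup_i Oc i `\` X) < e%:E].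

Let AI X Y : A X -> A Y -> A (X `&` Y).
Proof. by move=> aX aY; rewrite -[X]setCK -[Y]setCK -setCU; apply: AC; apply: AU; exact: AC. Qed.

Let mO (Oc : (set T)^nat) : (forall i, A (Oc i)) -> measurable (\bigcup_i Oc i).
Proof. by move=> aO; apply: bigcup_measurable => i _; exact: mA. Qed.

Let approxI X Y : measurable X -> measurable Y ->
  outer_approximable X -> outer_approximable Y -> outer_approximable (X `&` Y).
Proof.
move=> mX mY aX aY e e0; have e2 : (0 < e / 2)%R by rewrite divr_gt0.
have [Oc [AO XO Oe]] := aX _ e2; have [Q [AQ YQ Qe]] := aY _ e2.
pose Z n := if unpickle n is Some ij then Oc (ij : nat * nat).1 `&` Q ij.2 else set0.
have ZE : \bigcup_n Z n = \bigcup_i Oc i `&` \bigcup_i Q i.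
  apply/seteqP; split => x.
    move=> [n _]; rewrite /Z; case: unpickle => [[i j] /= [? ?]|//].
    by split; [exists i|exists j].
  by move=> [[i _ Oi] [j _ Qj]]; exists (pickle (i, j)) => //; rewrite /Z pickleK.
exists Z; rewrite ZE; split.
- by move=> n; rewrite /Z; case: unpickle => [[i j]|] //=; exact: AI.
- by apply: setISS.
- have mOO := mO AO; have mQQ := mO AQ.
  apply: (@le_lt_trans _ _ (mu ((\bigcup_i Oc i `\` X) `|` (\bigcup_i Q i `\` Y)))).
    apply: le_measure; rewrite ?inE.
    + by apply: measurableD; exact: measurableI.
    + by apply: measurableU; exact: measurableD.
    + move=> x [[? ?] /not_andP[?|?]]; [by left|by right].
  apply: (le_lt_trans (measureU2 _ _ _)); [exact: measurableD|exact: measurableD|].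
  by rewrite [e]splitr EFinD lteD.
Qed.

Let finite_union_close (F : (set T)^nat) (e : R) : (forall k, measurable (F k)) -> (0 < e)%R ->
  exists n, mu (\bigcup_k F k `\` \big[setU/set0]_(k < n) F k) < e%:E.
Proof.
move=> mF e0; pose Fn n := \big[setU/set0]_(k < n) F k.
have mFn n : measurable (Fn n) by exact: bigsetU_measurable.
have mU : measurable (\bigcup_k F k) by exact: bigcup_measurable.
have cv : mu \o Fn @ \oo --> mu (\bigcup_k F k).
    rewrite (_ : \bigcup_k F k = \bigcup_n Fn n); last first.
    apply/seteqP; split => x [k _ h].
      by exists k.+1 => //; rewrite /Fn big_ord_recr; right.
    by move: h; rewrite /Fn -bigcup_mkord => -[i _ Fi]; exists i.
  apply: nondecreasing_cvg_mu => //; first exact: bigcup_measurable.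
  by move=> n m nm; apply/subsetPset; exact: subset_bigsetU.
have fU : mu (\bigcup_k F k) \is a fin_num by exact: fin_num_measure.
move: cv; rewrite -(fineK fU) => /fine_cvgP[_]/cvgrPdist_lt/(_ _ e0)[n _ /(_ n (leqnn _))] H.
exists n; rewrite measureD//; [|exact: mFn|by rewrite ltey_eq fU].
have FnU : Fn n `<=` \bigcup_k F k.
  by rewrite /Fn -bigcup_mkord; apply: bigcup_sub => k _; exact: bigcup_sup.
rewrite (setIidr FnU).
have fn : mu (Fn n) \is a fin_num by exact: fin_num_measure.
move: H => /=; rewrite -(fineK fU) -(fineK fn) -EFinB lte_fin.
exact: le_lt_trans (ler_norm _).
Qed.

Let approx_bigcup (F : (set T)^nat) : (forall k, measurable (F k)) ->
  (forall k, outer_approximable (F k)) -> outer_approximable (\bigcup_k F k).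
Proof.
move=> mF aF e e0.
have ek k : (0 < e / 2 / (2 ^ k.+1)%:R)%R by rewrite !divr_gt0// ltr0n expn_gt0.
have /choice[Oc HO] := fun k => aF k _ (ek k).
have AO k i : A (Oc k i) by have [] := HO k.
have FO k : F k `<=` \bigcup_i Oc k i by have [] := HO k.
have Oe k : mu (\bigcup_i Oc k i `\` F k) < (e / 2 / (2 ^ k.+1)%:R)%:E by have [] := HO k.
pose Z n := if unpickle n is Some ki then Oc (ki : nat * nat).1 ki.2 else Oc 0%N 0%N.
have ZE : \bigcup_n Z n = \bigcup_k \bigcup_i Oc k i.
  apply/seteqP; split => x.
    by move=> [n _]; rewrite /Z; case: unpickle => [[k i] /= ?|?]; [exists k => //; exists i|exists 0%N => //; exists 0%N].
  by move=> [k _ [i _ Oki]]; exists (pickle (k, i)) => //; rewrite /Z pickleK.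
exists Z; rewrite ZE; split.
- by move=> n; rewrite /Z; case: unpickle.
- by move=> x [k _ Fk]; exists k => //; exact: FO.
- have mD k : measurable (\bigcup_i Oc k i `\` F k) by apply: measurableD => //; exact: mO.
  apply: (@le_lt_trans _ _ (mu (\bigcup_k (\bigcup_i Oc k i `\` F k)))).
    apply: le_measure; rewrite ?inE.
    + by apply: measurableD; apply: bigcup_measurable => k _ //; exact: mO.
    + exact: bigcup_measurable.
    + move=> x [[k _ Ok] nF]; exists k => //; split => // Fk; apply: nF; by exists k.
  apply: (@le_lt_trans _ _ (\sum_(k <oo) mu (\bigcup_i Oc k i `\` F k))).
    by apply: (measure_sigma_subadditive mu) => //; exact: bigcup_measurable.
  apply: (@le_lt_trans _ _ (e / 2)%:E); last by rewrite lte_fin ltr_pdivrMr// ltr_pMr// ltr1n.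
  have e2 : (0 <= e / 2)%R by rewrite divr_ge0// ltW.
  apply: (@le_trans _ _ _ _ _ _ (epsilon_trick0 xpredT e2)).
  by apply: lee_nneseries => // k _; rewrite ltW.
Qed.

(** The sets that are approximable together with their complements form a sigma-algebra. The
    complement of a countable union is the delicate case: as [mu] is finite, a finite subunion has
    almost the same mass, and its complement is a finite intersection. *)
Lemma sigma_outer_approximable X : <<s A >> X -> outer_approximable X.
Proof.
pose G := [set Y | [/\ measurable Y, outer_approximable Y & outer_approximable (~` Y)]].
suff : <<s A >> `<=` G by move=> H /H[].
have approxA Y : A Y -> outer_approximable Y.
  move=> aY e e0; exists (fun=> Y).
  rewrite bigcup_const; last by exists 0%N.
  by split=> //; rewrite setDv measure0 lte_fin.
apply: smallest_sub; last first.
  by move=> Y aY; split; [exact: mA|exact: approxA|apply: approxA; exact: AC].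
have GC Y : G Y -> G (~` Y).
  by move=> [mY aY aCY]; split => //; [exact: measurableC|rewrite setCK].
have aset0 : outer_approximable set0.
    exact: approxA.
have asetT : outer_approximable setT.
    by apply: approxA; rewrite -setC0; exact: AC.
split.
- by split => //; rewrite setC0.
- by move=> Y GY; rewrite setTD; exact: GC.
- move=> F GF; have mF k : measurable (F k) by have [] := GF k.
  split; first exact: bigcup_measurable.
    by apply: approx_bigcup => // k; have [] := GF k.
  move=> e e0; have e2 : (0 < e / 2)%R by rewrite divr_gt0.
  pose Fn n := \big[setU/set0]_(k < n) F k.
  have mFn n : measurable (Fn n) by exact: bigsetU_measurable.
  have mU : measurable (\bigcup_k F k) by exact: bigcup_measurable.
  have aFn n : outer_approximable (~` Fn n).
    elim: n => [|n IH]; first by rewrite /Fn big_ord0 setC0.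
    rewrite /Fn big_ord_recr/= setCU; apply: approxI => //; [exact: (measurableC (mFn n))|exact: measurableC|].
    by have [] := GF n.
  have [n Hn] := finite_union_close mF e2.
  have [Oc [AO FO Oe]] := aFn n _ e2.
  have mOO := mO AO.
  exists Oc; split=> //.
    apply: subset_trans FO; apply: subsetC.
    by rewrite /Fn -bigcup_mkord; apply: bigcup_sub => k _; exact: bigcup_sup.
  apply: (@le_lt_trans _ _ (mu ((\bigcup_i Oc i `\` ~` Fn n) `|` (\bigcup_k F k `\` Fn n)))).
    apply: le_measure; rewrite ?inE.
    + by apply: measurableD => //; exact: measurableC.
    + by apply: measurableU; apply: measurableD => //; exact: measurableC.
    + move=> x [Ox /contrapT Fx]; have [h|h] := pselect (Fn n x).
        by left; split => //; exact.
      by right.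
  apply: (le_lt_trans (measureU2 _ _ _)); [by apply: measurableD => //; exact: measurableC|exact: measurableD|].
  by rewrite [e]splitr EFinD lteD.
Qed.

(** The countable outer cover is cut after finitely many terms; finiteness of [mu] makes the rest
    small. *)
Lemma sigma_approximable X : <<s A >> X -> forall e : R, (0 < e)%R ->
  exists Y, [/\ A Y, mu (X `\` Y) < e%:E & mu (Y `\` X) < e%:E].
Proof.
move=> sX e e0; have mX : measurable X.
  by apply: sX; split; [exact: sigma_algebra_measurable|].
have [Oc [AO XO Oe]] := sigma_outer_approximable sX e0.
have [n Hn] := finite_union_close (fun k => mA (AO k)) e0.
have mOO := mO AO; set Y := \big[setU/set0]_(k < n) Oc k in Hn *.
have mY : measurable Y by apply: bigsetU_measurable => k _; exact: mA.
have YO : Y `<=` \bigcup_i Oc i.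
  by rewrite /Y -bigcup_mkord; apply: bigcup_sub => k _; exact: bigcup_sup.
exists Y; split.
- by apply: big_ind => // k _; exact: AO.
- by apply: le_lt_trans Hn; apply: le_measure; rewrite ?inE; [exact: measurableD|exact: measurableD|exact: setSD].
- by apply: le_lt_trans Oe; apply: le_measure; rewrite ?inE; [exact: measurableD|exact: measurableD|exact: setSD].
Qed.

End outer_approximation.

(** * Images of null sets under differentiable maps *)

Section null_image.
Context (R : realType) (d : nat).
Local Notation V := (Clebesgue R d).
Local Notation Cd := 'rV[R[i]]_d.
Local Notation rc := (@real_coord R d).

(** The index of the half-open dyadic cube of side [2 ^- n] that contains [z], in real
    coordinates. *)
Definition dcode (n : nat) (z : Cd) : {ffun 'I_(d + d) -> int} :=
  [ffun j => Num.floor (2 ^+ n * rc z ord0 j)].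

(** Unions of dyadic cubes of one common level. They form an algebra because a cube of a finer level
    lies in a single cube of a coarser one. *)
Definition dyadic : set (set (Cspace R d)) :=
  [set X | exists n, forall z z', dcode n z = dcode n z' -> X z -> X z'].

Lemma dcode_mono n k z z' : dcode (n + k) z = dcode (n + k) z' -> dcode n z = dcode n z'.
Proof.
move=> H; apply/ffunP => j; have := congr1 (fun f : {ffun _ -> _} => f j) H.
rewrite !ffunE => E; apply/eqP; rewrite eq_le.
have h (x y : R) : Num.floor (2 ^+ (n + k) * x) = Num.floor (2 ^+ (n + k) * y) ->
    Num.floor (2 ^+ n * x) <= Num.floor (2 ^+ n * y).
  move=> Exy; rewrite floor_ge_int.
  have := floor_le (2 ^+ n * x); rewrite -(ler_pM2l (exprn_gt0 k (ltr0Sn R 1))).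
  rewrite mulrA -exprD addnC.
  have -> m : 2 ^+ k * m%:~R = (2 ^+ k * m)%:~R :> R by rewrite intrM rmorphXn.
  move=> h; have : 2 ^+ k * Num.floor (2 ^+ n * x) <= Num.floor (2 ^+ (n + k) * x) by rewrite floor_ge_int.
  rewrite Exy floor_ge_int intrM rmorphXn/= addnC exprD -mulrA.
  by rewrite (ler_pM2l (exprn_gt0 k (ltr0Sn R 1))).
by rewrite !h.
Qed.

Lemma dcode_dist n z z' : dcode n z = dcode n z' -> `|rc z - rc z'| < 2 ^- n.
Proof.
move=> H; have n0 : 0 < 2 ^- n :> R by rewrite invr_gt0 exprn_gt0.
suff : ball (rc z) (2 ^- n) (rc z') by rewrite -ball_normE.
split => // i j; rewrite (ord1 i) /ball/=.
have := congr1 (fun f : {ffun _ -> _} => f j) H; rewrite !ffunE => E.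
have h (x y : R) : Num.floor x = Num.floor y -> x - y < 1.
  by move=> e; have := floor_itv x; have := floor_le y; rewrite -e intrD /=; lra.
rewrite -(ltr_pM2l (exprn_gt0 n (ltr0Sn R 1))) mulfV ?expf_neq0//.
rewrite -[X in X * _]gtr0_norm ?exprn_gt0// -normrM mulrBr ltr_norml.
by rewrite h // andbT ltrNl opprB h.
Qed.

Lemma dyadic0 : dyadic set0.
Proof. by exists 0%N. Qed.

Lemma dyadicC X : dyadic X -> dyadic (~` X).
Proof. by move=> [n H]; exists n => z z' E nX Xz'; apply: nX; apply: H Xz'. Qed.

Lemma dyadic_level X m : dyadic X -> exists2 n, (m <= n)%N & forall z z', dcode n z = dcode n z' -> X z -> X z'.
Proof.
move=> [n H]; exists (n + m)%N; first exact: leq_addl.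
by move=> z z' /dcode_mono; exact: H.
Qed.

Lemma dyadicU X Y : dyadic X -> dyadic Y -> dyadic (X `|` Y).
Proof.
move=> [n HX] /(@dyadic_level _ n)[m /subnKC <- HY]; exists (n + (m - n))%N => z z' E [Xz|Yz].
  by left; apply: HX Xz; exact: dcode_mono E.
by right; exact: HY Yz.
Qed.

Definition dcell n c : set (Cspace R d) := [set z | dcode n z = c].

Lemma dcell_cbox n c : dcell n c =
  cbox (fun i => if insub i is Some j then [set x | Num.floor (2 ^+ n * x) = c (lshift d j)] else set0)
       (fun i => if insub i is Some j then [set x | Num.floor (2 ^+ n * x) = c (rshift d j)] else set0).
Proof.
apply/seteqP; split => z /=.
  move=> <- j; rewrite valK !ffunE /= /real_coord row_mxEl row_mxEr !mxE.
  by [].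
move=> H; apply/ffunP => i; rewrite ffunE /real_coord.
by case: (split_ordP i) => j ->; rewrite ?(row_mxEl, row_mxEr) mxE; have := H j; rewrite valK => -[].
Qed.

Lemma floor_itvE n (m : int) : [set x : R | Num.floor (2 ^+ n * x) = m] =
  `[m%:~R / 2 ^+ n, (m%:~R + 1) / 2 ^+ n[%classic.
Proof.
apply/seteqP; split => x /=; rewrite in_itv/= ler_pdivrMr ?ltr_pdivlMr ?exprn_gt0// mulrC.
  by move=> <-; have := floor_itv (2 ^+ n * x); rewrite intrD mulrC.
by move=> H; apply/eqP; rewrite floor_eq intrD.
Qed.

Lemma measurable_dcell n c : measurable (dcell n c).
Proof.
rewrite dcell_cbox; apply: measurable_cbox => i; case: insub => [j|] //=;
  by rewrite floor_itvE; exact: measurable_itv.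
Qed.

Lemma Clebesgue_dcell n c : V (dcell n c) = ((2 ^- n) ^+ (2 * d))%:E.
Proof.
have L m : lebesgue_measure [set x : R | Num.floor (2 ^+ n * x) = m] = (2 ^- n)%:E.
  rewrite floor_itvE lebesgue_measure_itv/= lte_fin ltr_pM2r ?invr_gt0 ?exprn_gt0// ltrDl ltr01.
  by rewrite -EFinB -mulrBl addrAC subrr add0r div1r.
rewrite dcell_cbox Clebesgue_cbox.
- rewrite (eq_bigr (fun _ => (2 ^- n * 2 ^- n)%:E)).
    by rewrite prodEFin prodr_const card_ord -expr2 -exprM.
  by move=> j _; rewrite valK !L.
- by move=> i; case: insub => [j|] //=; rewrite floor_itvE; exact: measurable_itv.
- by move=> i; case: insub => [j|] //=; rewrite floor_itvE; exact: measurable_itv.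
Qed.

Lemma dyadic_bigcup n X : (forall z z', dcode n z = dcode n z' -> X z -> X z') ->
  X = \bigcup_k (if pickle_inv k is Some c then (if pselect (X `&` dcell n c !=set0) then dcell n c else set0) else set0).
Proof.
move=> H; apply/seteqP; split => [z Xz|z [k _]].
  exists (pickle (dcode n z)) => //; rewrite pickleK_inv; case: pselect => //= -[]; by exists z.
case: pickle_inv => // c; case: pselect => //= -[z' [Xz' cz']] cz.
by apply: H Xz'; rewrite cz'.
Qed.

Lemma measurable_dyadic : dyadic `<=` measurable.
Proof.
move=> X [n /dyadic_bigcup ->]; apply: bigcup_measurable => k _.
case: pickle_inv => // c; case: pselect => //= _; exact: measurable_dcell.
Qed.

Lemma sigma_dyadic (X : set (Cspace R d)) : measurable X -> <<s dyadic >> X.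
Proof.
have sD := @smallest_sigma_algebra (Cspace R d) setT dyadic.
apply: smallest_sub => //; move=> A oA.
suff -> : A = \bigcup_n [set z | dcell n (dcode n z) `<=` A].
  apply: sigma_algebra_bigcup => // n; apply: sub_sigma_algebra; exists n => z z' E h.
  by rewrite /= -E.
apply/seteqP; split => [z Az|z [n _]]; last by apply.
have : nbhs (rc z) (@of_real_coord R d @^-1` A).
  apply: continuous_of_real_coord; rewrite real_coordK; exact: open_nbhs_nbhs.
move=> /nbhs_ballP[e /= e0 eA].
have [n ne] : exists n, 2 ^- n < e.
    have [n _ /(_ n (leqnn _))] := near_infty_natSinv_expn_lt (PosNum e0); rewrite div1r.
  by exists n.
exists n => // z' /= E; rewrite -(real_coordK z'); apply: eA.
by rewrite -ball_normE /=; apply: lt_trans ne; apply: dcode_dist.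
Qed.

(* The set where [G] is [2^m]-Lipschitz at scale [2^-m]; over all [m], these
   sets exhaust the points at which [G] is real-differentiable. *)
Definition lip_points (G : Cd -> Cd) m : set (Cspace R d) := [set z | forall z', `|rc z - rc z'| < 2 ^- m ->
  `|rc (G z) - rc (G z')| <= 2 ^+ m * `|rc z - rc z'| ].

Lemma differentiable_lip_points (G : Cd -> Cd) (z : Cd) :
  differentiable (rc \o G \o @of_real_coord R d) (rc z) -> exists m, lip_points G m z.
Proof.
move=> dG; set f := rc \o G \o _ in dG.
have [dfc] := (diff_locallyP _ _).1 dG.
set df := 'd f (rc z); set o := 'o _ => E.
have [k k0 dfk] := linear_lipschitz dfc.
have := littleoP o ltr01.
move=> /nbhs_ballP[e /= e0 oe].
have [n _ Hn] := near_infty_natSinv_expn_lt (PosNum e0).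
have [n' Hn'] : exists n' : nat, k + 1 <= 2 ^+ n'.
  exists (Num.bound (k + 1)); apply: ltW; apply: (lt_le_trans (archi_boundP _)); first by rewrite addr_ge0// ltW.
  by rewrite -natrX ler_nat ltnW// ltn_expl.
exists (maxn n n') => z' zz'.
have zz : `|rc z' - rc z| < e.
  rewrite distrC; apply: (lt_trans zz'); rewrite -div1r; apply: Hn; exact: leq_maxl.
have := congr1 (fun h => h (rc z' - rc z)) E.
rewrite /= subrK /f /= !real_coordK => EE.
rewrite distrC.
have -> : rc (G z') - rc (G z) = df (rc z' - rc z) + o (rc z' - rc z).
    rewrite EE (_ : (_ + o) _ = rc (G z) + df (rc z' - rc z) + o (rc z' - rc z))//.
  by rewrite -[X in X - _]addrA [X in X - _]addrC addrK.
apply: (le_trans (ler_normD _ _)).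
have h1 := dfk (rc z' - rc z).
have h2 : `|o (rc z' - rc z)| <= 1 * `|rc z' - rc z|.
  by apply: oe; rewrite -ball_normE /= sub0r normrN.
apply: (le_trans (lerD h1 h2)); rewrite -mulrDl [`|rc z - _|]distrC ler_wpM2r//.
by apply: (le_trans Hn'); rewrite ler_eXn2l ?leq_maxr// ltr1n.
Qed.

Section cover.
Variables (G : Cd -> Cd) (m : nat).
(** The image of a cube of side [2 ^- n] lies in a polydisc of radius [r = 2 * 2 ^ m * 2 ^- n], one
    factor [2] passing from real coordinates to moduli. Its volume is at most [(2 * r) ^ (2 * d)],
    which is [C] times that of the cube. *)
Let C : R := (4 * 2 ^+ m) ^+ (2 * d).
Let covered (X : set (Cspace R d)) := exists W : set (Cspace R d),
  [/\ measurable W, G @` (X `&` lip_points G m) `<=` W & (V W <= C%:E * V X)%E].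

Let C0 : 0 <= C.
Proof. by rewrite exprn_ge0// mulr_ge0// exprn_ge0. Qed.

Let covered0 : covered set0.
Proof. by exists set0; split => //; [move=> _ [z [[] ]]|rewrite measure0 mule_ge0 ?lee_fin]. Qed.

Let covered_dcell n c : (m <= n)%N -> covered (dcell n c).
Proof.
move=> mn; have [[z0 [cz0 lz0]]|N] := pselect (dcell n c `&` lip_points G m !=set0); last first.
  by exists set0; split => //; [move=> y [z H _]; exfalso; apply: N; exists z; exact: H|rewrite measure0 mule_ge0 ?lee_fin].
have n0 : 0 < 2 ^- n :> R by rewrite invr_gt0 exprn_gt0.
pose r : R := 2 * 2 ^+ m * 2 ^- n.
exists (pdisc (G z0) r); split; first exact: measurable_pdisc.
  move=> _ [z [cz lz] <-] j.
  have zz : `|rc z0 - rc z| < 2 ^- n by apply: dcode_dist; rewrite cz0 cz.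
  have : `|rc (G z0) - rc (G z)| < 2 ^+ m * 2 ^- n.
    apply: le_lt_trans (lz0 z _) _; last by rewrite ltr_pM2l// exprn_gt0.
    by apply: (lt_le_trans zz); rewrite lef_pV2 ?posrE ?exprn_gt0// ler_eXn2l// ltr1n.
  rewrite distrC => h.
  have : ball (rc (G z)) (2 ^+ m * 2 ^- n) (rc (G z0)) by rewrite -ball_normE.
  move=> [_ H]; have := H ord0 (lshift d j); have := H ord0 (rshift d j).
  rewrite /ball/= /real_coord !row_mxEl !row_mxEr !mxE => h1 h2.
  have := @normC_ReIm_lt R (G z ord0 j - G z0 ord0 j) r.
  rewrite normcE ltcR; apply; rewrite raddfB /r /=.
    by rewrite -mulrA [2 * _]mulrC mulfK.
  by rewrite -mulrA [2 * _]mulrC mulfK.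
apply: le_trans (Clebesgue_pdisc_le _ _) _; first by rewrite /r !mulr_ge0// ?exprn_ge0// ltW.
by rewrite Clebesgue_dcell -EFinM lee_fin /C -exprMn /r !mulrA -natrM.
Qed.

Let covered_bigcup (F : (set (Cspace R d))^nat) : (forall k, measurable (F k)) -> trivIset setT F ->
  (forall k, covered (F k)) -> covered (\bigcup_k F k).
Proof.
move=> mF tF /choice[W HW]; have mW k : measurable (W k) by have [] := HW k.
exists (\bigcup_k W k); split; first exact: bigcup_measurable.
  move=> _ [z [[k _ Fz] lz] <-]; exists k => //; have [_ s _] := HW k; apply: s; by exists z.
apply: (@le_trans _ _ (\sum_(k <oo) V (W k))%E).
  by apply: measure_sigma_subadditive => //; exact: bigcup_measurable.
rewrite measure_bigcup// -nneseriesZl; last by move=> *; exact: measure_ge0.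
rewrite [leRHS](@eq_eseriesl _ _ xpredT); last by move=> i; rewrite in_setT.
apply: lee_nneseries => // k _; by have [] := HW k.
Qed.

Let covered_dyadic X : dyadic X -> covered X.
Proof.
move=> /(@dyadic_level _ m)[n mn /dyadic_bigcup ->]; apply: covered_bigcup => [k|i j _ _|k].
- case: pickle_inv => // c; case: pselect => //= _; exact: measurable_dcell.
- move=> [z []]; case Ei : (pickle_inv i) => [c|//]; case: pselect => //= _ cz.
  case Ej : (pickle_inv j) => [c'|//]; case: pselect => //= _ cz'.
  have cc : c = c' by rewrite -cz -cz'.
  have := @pickle_invK {ffun 'I_(d + d) -> int} i; have := @pickle_invK {ffun 'I_(d + d) -> int} j.
  by rewrite Ei Ej /= cc => <- <-.
- by case: pickle_inv => // c; case: pselect => //= _; exact: covered_dcell.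
Qed.

(** Pieces of finite volume that exhaust the space, on which outer approximation for finite measures
    applies. *)
Let bounded_cell k : set (Cspace R d) := [set z | forall j, - k%:Z <= dcode 0 z j < k%:Z].

Let dyadic_bounded_cell k : dyadic (bounded_cell k).
Proof. by exists 0%N => z z' E H j; rewrite -E. Qed.

Let bounded_cell_fin k : (V (bounded_cell k) < +oo)%E.
Proof.
apply: le_lt_trans (Clebesgue_pdisc_fin 0 (2 * k.+1%:R)).
apply: le_measure; rewrite ?inE; [exact: (measurable_dyadic (dyadic_bounded_cell k))|exact: measurable_pdisc|].
have key (x : R) : - k%:Z <= Num.floor x < k%:Z -> `|x| < 2 * k.+1%:R / 2.
  move=> /andP[]; rewrite floor_ge_int intrN => h1; rewrite ltNge floor_ge_int -ltNge => h2.
  rewrite mulrAC mulfV// mul1r ltr_norml -natr1; move: h1 h2; rewrite -!pmulrn => *; apply/andP; split; lra.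
move=> z H j; rewrite mxE subr0 -ltcR -normcE.
apply: normC_ReIm_lt.
    have := H (lshift d j); rewrite ffunE expr0 mul1r /real_coord row_mxEl mxE.
  exact: key.
have := H (rshift d j); rewrite ffunE expr0 mul1r /real_coord row_mxEr mxE.
exact: key.
Qed.

(** A null set has dyadic covers of small volume; cut into cubes of level at least [m], such a cover
    has an image of comparable volume as far as Lipschitz points go. Passing to [seqD] makes the
    cover disjoint, so that the volumes of its pieces add up. *)
Lemma lip_image_negligible (a : set (Cspace R d)) : measurable a -> V a = 0%E ->
  V.-negligible (G @` (a `&` lip_points G m) : set (Cspace R d)).
Proof.
move=> ma a0.
have key k : V.-negligible (G @` (a `&` bounded_cell k `&` lip_points G m) : set (Cspace R d)).
  have mB := measurable_dyadic (dyadic_bounded_cell k).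
  pose mu : {finite_measure set (Cspace R d) -> \bar R} := mfrestr mB (bounded_cell_fin k).
  have cov (e : R) : 0 < e -> exists W : set (Cspace R d), [/\ measurable W,
      G @` (a `&` bounded_cell k `&` lip_points G m) `<=` W & (V W <= e%:E)%E].
    move=> e0; have e1 : 0 < e / (C + 1) by rewrite divr_gt0// ltr_wpDl.
    have [Oc [DO aO Oe]] := sigma_outer_approximable mu dyadic0 measurable_dyadic
      dyadicC dyadicU (sigma_dyadic ma) e1.
    pose Q := seqD (fun i => \big[setU/set0]_(j < i.+1) (Oc j `&` bounded_cell k)).
    have DI X Y : dyadic X -> dyadic Y -> dyadic (X `&` Y).
      by move=> dX dY; rewrite -[X]setCK -[Y]setCK -setCU; apply: dyadicC; apply: dyadicU; exact: dyadicC.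
    have DQ i : dyadic (Q i).
      have DD n : dyadic (\big[setU/set0]_(j < n) (Oc j `&` bounded_cell k)).
        by elim/big_ind: _ => [|? ?|j _]; [exact: dyadic0|exact: dyadicU|exact: DI].
      case: i => [|i]; first exact: DD.
      by rewrite /Q/= setDE; apply: DI; [exact: (DD i.+2)|apply: dyadicC; exact: (DD i.+1)].
    have QE : \bigcup_i Q i = \bigcup_i Oc i `&` bounded_cell k.
      by apply: etrans (eq_bigcup_seqD_bigsetU (fun j => Oc j `&` bounded_cell k)) _; rewrite setI_bigcupl.
    have [W [mW sW Wle]] : covered (\bigcup_i Q i).
      apply: covered_bigcup => [i||i]; [exact: measurable_dyadic| |exact: covered_dyadic].
      by apply: trivIset_seqD => i j ij; apply/subsetPset; exact: (@subset_bigsetU _ (fun j => Oc j `&` bounded_cell k) i.+1 j.+1 ij).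
    have mO : measurable (\bigcup_i Oc i) by apply: bigcup_measurable => i _; exact: measurable_dyadic.
    exists W; split => //.
      apply: subset_trans sW => _ [z [[az bz] lz] <-]; exists z => //; split => //.
      by rewrite QE; split => //; exact: aO.
    apply: (le_trans Wle).
    have VQ : (V (\bigcup_i Q i) <= (e / (C + 1))%:E)%E.
      rewrite QE; apply: (@le_trans _ _ (V (((\bigcup_i Oc i `\` a) `&` bounded_cell k) `|` a))).
        apply: le_measure; rewrite ?inE; [exact: measurableI| |].
          by apply: measurableU => //; apply: measurableI => //; exact: measurableD.
        by move=> z [Oz bz]; have [?|?] := pselect (a z); [right|left].
      apply: (le_trans (measureU2 _ _ _)) => //; first by apply: measurableI => //; exact: measurableD.
      rewrite [X in (_ + X)%E](_ : _ = 0%E)// adde0; exact: (ltW Oe).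
    apply: (@le_trans _ _ (C%:E * (e / (C + 1))%:E)%E); first by rewrite lee_wpmul2l// lee_fin.
    by rewrite -EFinM lee_fin mulrA ler_pdivrMr ?ltr_wpDl// mulrC ler_wpM2l ?lerDl// ltW.
  have cov' (n : nat) : exists W : set (Cspace R d), [/\ measurable W,
      G @` (a `&` bounded_cell k `&` lip_points G m) `<=` W & (V W <= (2 ^- n)%:E)%E].
    by apply: cov; rewrite invr_gt0 exprn_gt0.
  have [W HW] := choice cov'; have mW n : measurable (W n) by have [] := HW n.
  exists (\bigcap_n W n); split; [exact: bigcapT_measurable| |].
    apply/eqP; rewrite eq_le measure_ge0 andbT; apply/lee_addgt0Pr => e e0; rewrite add0e.
    have [n _ /(_ n (leqnn _))] := near_infty_natSinv_expn_lt (PosNum e0); rewrite div1r /= => ne.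
    have [_ _ Wn] := HW n; apply: (@le_trans _ _ (V (W n))).
      by apply: le_measure; rewrite ?inE; [exact: bigcapT_measurable|exact: mW|move=> z; exact].
    by apply: (le_trans Wn); rewrite lee_fin ltW.
  by move=> z Hz n _; have [_ s _] := HW n; exact: s.
apply: (negligibleS _ (negligible_bigcup key)).
move=> _ [z [az lz] <-].
have [k kz] : exists k, bounded_cell k z.
  exists (\sum_j `|dcode 0 z j|%N).+1 => j.
    have : (`|dcode 0 z j| < (\sum_j `|dcode 0 z j|).+1)%N by rewrite ltnS (bigD1 j)//= leq_addr.
  by rewrite -ltz_nat abszE ltr_norml => /andP[/ltW -> ->].
by exists k => //; exists z.
Qed.

End cover.

Lemma negligible_image (U : set Cd) (G : Cd -> Cd) (a : set (Cspace R d)) :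
  (forall z, U z -> differentiable (rc \o G \o @of_real_coord R d) (rc z)) ->
  measurable a -> V a = 0%E -> V.-negligible (G @` (a `&` U) : set (Cspace R d)).
Proof.
move=> dG ma a0; apply: (negligibleS _ (negligible_bigcup (fun m => lip_image_negligible G m ma a0))).
move=> _ [z [az Uz] <-]; have [m lm] := differentiable_lip_points (dG _ Uz).
by exists m => //; exists z.
Qed.

End null_image.

(** * Distortion of volume *)

Section absolute_continuity_integral.
Context d (T : measurableType d) (R : realType) (mu nu : {finite_measure set T -> \bar R}).
Local Open Scope ereal_scope.
Hypothesis numu : forall A, measurable A -> mu A = 0 -> nu A = 0.

Let eps_delta (e : R) : (0 < e)%R -> exists2 t : R, (0 < t)%R &
  forall A, measurable A -> mu A < t%:E -> nu A < e%:E.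
Proof.
move=> e0; pose nuc : {charge set T -> \bar R} := charge_of_finite_measure nu.
have [P [N nuPN]] := Hahn_decomposition nuc.
have dom : nuc `<< mu.
  move=> N' N0 A mA AN; apply: numu => //; exact: N0.
have [t [t0 Ht]] := charge_variation_continuous nuPN dom e0.
exists t => // A mA At; apply: le_lt_trans (Ht _ mA At).
by apply: le_trans (abse_charge_variation nuPN mA); rewrite gee0_abs// measure_ge0.
Qed.

(** One constant serves all [g]. If the set where [g > s] has [mu]-mass below [t], its [nu]-mass is
    below [e / 2], and the rest contributes at most [s] times the total mass. Otherwise Markov's
    inequality gives [g] a [mu]-integral of at least [s * t], and the total [nu]-mass is at most [C]
    times that integral. *)
Lemma abs_continuous_integral (e : R) : (0 < e)%R -> exists2 C : R, (0 <= C)%R &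
  forall g : T -> R, measurable_fun setT g -> (forall x, 0 <= g x <= 1)%R ->
    \int[nu]_x (g x)%:E <= e%:E + C%:E * \int[mu]_x (g x)%:E.
Proof.
move=> e0; have fT : nu setT \is a fin_num by exact: fin_num_measure.
pose M := fine (nu setT); have M0 : (0 <= M)%R by rewrite fine_ge0// measure_ge0.
pose s : R := (e / 2 / (M + 1))%R.
have s0 : (0 < s)%R by rewrite !divr_gt0// ltr_wpDl.
have [t t0 Ht] := eps_delta (divr_gt0 e0 (ltr0Sn R 1)).
exists (M / (s * t))%R; first by rewrite divr_ge0// mulr_ge0// ltW.
move=> g mg g01; have g0 x : (0 <= g x)%R by have /andP[] := g01 x.
pose A := [set x | s < g x]%R.
have mA : measurable A.
  rewrite (_ : A = setT `&` g @^-1` `]s, +oo[%classic); last by apply/seteqP; split=> x; rewrite setTI /A/= in_itv/= andbT.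
  exact: mg.
have mi : measurable_fun setT (EFin \o \1_A : T -> \bar R) by apply/measurable_EFinP.
have [At|At] := ltP (mu A) t%:E.
  apply: (@le_trans _ _ (\int[nu]_x (s%:E + (\1_A x)%:E))).
    apply: ge0_le_integral => //.
    - by move=> x _; rewrite lee_fin.
    - exact/measurable_EFinP.
    - by apply: emeasurable_funD => //; exact: measurable_cst.
    - move=> x _; rewrite -EFinD lee_fin indicE; case: (boolP (x \in A)) => [_|].
        by have /andP[_ ?] := g01 x; rewrite ler_wpDl// ltW.
      by rewrite notin_setE /A/= => /negP; rewrite -leNgt addr0.
  rewrite ge0_integralD//; last by move=> x _; rewrite lee_fin ltW.
  rewrite integral_cst// integral_indic// setIT.
  apply: (@le_trans _ _ e%:E); last first.
    rewrite leeDl// mule_ge0//; first by rewrite lee_fin divr_ge0// mulr_ge0// ltW.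
    by apply: integral_ge0 => x _; rewrite lee_fin.
  rewrite [e]splitr EFinD leeD//; last by rewrite ltW// Ht.
  rewrite [X in (_ * X)%E](_ : _ = M%:E); last by rewrite /M fineK.
  rewrite -EFinM lee_fin /s mulrAC ler_pdivrMr ?ltr_wpDl// ler_wpM2l ?lerDl//.
  by rewrite divr_ge0// ltW.
have sm : (s * t)%:E <= \int[mu]_x (g x)%:E.
  apply: (@le_trans _ _ (\int[mu]_x (s%:E * (\1_A x)%:E))).
    rewrite ge0_integralZl//; [|by rewrite lee_fin ltW].
    rewrite integral_indic// setIT EFinM; apply: lee_wpmul2l => //; rewrite lee_fin; exact: ltW.
  apply: ge0_le_integral => //.
  - by move=> x _; rewrite -EFinM lee_fin mulr_ge0// ltW.
  - by apply: measurable_funeM.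
  - exact/measurable_EFinP.
  - move=> x _; rewrite -EFinM lee_fin indicE; case: (boolP (x \in A)); last by rewrite mulr0.
    by rewrite inE mulr1 => /ltW.
apply: (@le_trans _ _ (\int[nu]_x 1)).
  apply: ge0_le_integral => //; first by move=> x _; rewrite lee_fin.
    exact/measurable_EFinP.
  by move=> x _; rewrite lee_fin; have /andP[] := g01 x.
rewrite integral_cst// mul1e [leLHS](_ : _ = M%:E); last by rewrite /M fineK.
apply: (@le_trans _ _ ((M / (s * t))%:E * (s * t)%:E)).
  by rewrite -EFinM lee_fin divfK// mulf_neq0// gt_eqF.
apply: (@le_trans _ _ ((M / (s * t))%:E * \int[mu]_x (g x)%:E)).
  by apply: lee_wpmul2l => //; rewrite lee_fin divr_ge0// mulr_ge0// ltW.
by rewrite leeDr// lee_fin ltW.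
Qed.

End absolute_continuity_integral.

Section finite_pushforward.
Context d1 d2 (T1 : measurableType d1) (T2 : measurableType d2) (R : realType).
Variables (mu : {finite_measure set T1 -> \bar R}) (f : T1 -> T2) (mf : measurable_fun setT f).

Definition finite_pushforward of measurable_fun setT f := pushforward mu f.
Local Notation nu := (finite_pushforward mf).

Let nu0 : nu set0 = 0%E.
Proof. by rewrite /nu /pushforward preimage_set0 measure0. Qed.

Let nu_ge0 A : (0 <= nu A)%E.
Proof. exact: measure_ge0. Qed.

Let nu_sigma_additive : semi_sigma_additive nu.
Proof. exact: (@measure_semi_sigma_additive _ _ _ (pushforward mu f)). Qed.

HB.instance Definition _ := isMeasure.Build _ _ _ nu nu0 nu_ge0 nu_sigma_additive.

Let nu_fin : fin_num_fun nu.
Proof.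
move=> A mA; rewrite /nu /pushforward; apply: fin_num_measure.
by rewrite -[X in measurable X]setTI; exact: mf.
Qed.

HB.instance Definition _ := Measure_isFinite.Build _ _ _ nu nu_fin.

End finite_pushforward.

Section distortion.
Context (R : realType) (d : nat).
Local Notation V := (Clebesgue R d).
Local Notation Cd := 'rV[R[i]]_d.

Lemma measurable_fun_C1 (U : set Cd) (F : Cd -> Cd) : open U -> C1_on U F ->
  measurable_fun (U : set (Cspace R d)) (F : Cspace R d -> Cspace R d).
Proof.
move=> oU cF; apply: (measurability (@open 'rV[R[i]]_d : set (set (Cspace R d))) erefl).
move=> _ [A oA <-]; apply: measurable_open; rewrite openE => z [Uz Az].
apply: filterI; first exact: open_nbhs_nbhs.
by apply: (C1_on_continuous cF Uz); exact: open_nbhs_nbhs.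
Qed.

(** No Jacobian enters: as [G] maps null sets to null sets, the image under [F] of the measure on
    [B] is absolutely continuous, and the previous lemma makes this quantitative. [F'] extends [F]
    from [B] by the identity in order to be measurable everywhere. *)
Lemma distortion (U : set Cd) (F G : Cd -> Cd) (B : set (Cspace R d)) (e : R) :
  open U -> (forall z, U z -> U (F z) /\ G (F z) = z) ->
  C1_on U F -> C1_on U G -> measurable B -> B `<=` U -> (V B < +oo)%E ->
  (forall z, B z -> B (F z)) -> 0 < e ->
  exists2 C : R, 0 <= C & forall g : Cspace R d -> R, measurable_fun setT g -> (forall x, 0 <= g x <= 1) ->
    (\int[V]_(z in B) (g (F z))%:E <= e%:E + C%:E * \int[V]_(z in B) (g z)%:E)%E.
Proof.
move=> oU FG cF cG mB BU fB BF e0.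
pose F' : Cspace R d -> Cspace R d := fun z => if z \in B then F z else z.
have mF' : measurable_fun setT F'.
  move=> _ Y mY; rewrite setTI (_ : F' @^-1` Y = (B `&` F @^-1` Y) `|` (Y `\` B)); last first.
    apply/seteqP; split => z; rewrite /F'/=; case: ifPn; rewrite ?notin_setE ?inE => zB; by [left|right|move=> [[]|[]]].
  apply: measurableU; last exact: measurableD.
  have -> : B `&` F @^-1` Y = B `&` (U `&` F @^-1` Y) by rewrite setIA (setIidl BU).
  by apply: measurableI => //; apply: (measurable_fun_C1 oU cF) => //; exact: measurable_open.
pose mu : {finite_measure set (Cspace R d) -> \bar R} := mfrestr mB fB.
pose nu : {finite_measure set (Cspace R d) -> \bar R} := finite_pushforward mu mF'.
have numu A : measurable A -> mu A = 0%E -> nu A = 0%E.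
  move=> mA A0.
  have ng : V.-negligible (G @` ((A `&` B) `&` U) : set (Cspace R d)).
    apply: negligible_image => //; last exact: measurableI.
    by move=> z Uz; have [] := cG z Uz.
    apply: (negligible_null_set ng).
        apply: measurableI => //; rewrite -[X in measurable X]setTI; exact: (mF' measurableT A mA).
  move=> z [+ Bz]; rewrite /F' /= mem_set// => AFz; have [UFz GFz] := FG z (BU _ Bz).
  by exists (F z) => //; split => //; split => //; exact: BF.
have [C C0 HC] := abs_continuous_integral numu e0.
have muE (h : Cspace R d -> R) : measurable_fun setT h -> (forall x, 0 <= h x) ->
    (\int[mu]_z (h z)%:E = \int[V]_(z in B) (h z)%:E)%E.
  move=> mh h0; have mhE : measurable_fun setT (EFin \o h : Cspace R d -> \bar R) by exact/measurable_EFinP.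
  rewrite -(setUv B) ge0_integral_setU//=; first last.
  - by apply/disj_setPCl.
  - by move=> x _; rewrite lee_fin.
  - by rewrite setUv.
  - exact: measurableC.
  rewrite [X in (_ + X)%E]null_set_integral ?adde0//.
  - by apply: eq_measure_integral => A mA AB; rewrite /mu/= /mfrestr /mrestr setIidl.
  - exact: measurableC.
  - exact: measurable_funS mhE.
  - by rewrite /= /mfrestr /mrestr setICl measure0.
exists C => // g mg g01; have g0 x : 0 <= g x by have /andP[] := g01 x.
have := HC g mg g01.
rewrite (muE g)// [X in (X <= _)%E](@ge0_integral_pushforward _ _ _ _ R F' mF' mu setT)//=.
- rewrite preimage_setT (muE (g \o F')); [|exact: (measurableT_comp mg mF')|by move=> x; exact: g0].
  rewrite (_ : (\int[V]_(z in B) _)%E = (\int[V]_(z in B) (g (F z))%:E)%E)//.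
  by apply: eq_integral => z zB; rewrite /= /F' zB.
- exact/measurable_EFinP.
- by move=> x _; rewrite lee_fin.
Qed.

End distortion.

(** * Propagation of bounds along chains of polydiscs *)

Section chain.
Context (R : realType) (d : nat).
Local Notation V := (Clebesgue R d).
Local Notation Cd := 'rV[R[i]]_d.
Local Notation RR := (measurableTypeR R).
Implicit Types (U A B K Y : set Cd).

Lemma compact_pdisc (K : set Cd) q r : closed K -> K `<=` pdisc q r -> compact K.
Proof.
move=> cK Kq; pose c := real_coord q.
pose B : set 'rV[R]_(d + d) := [set x | forall k, `[c ord0 k - r, c ord0 k + r]%classic (x ord0 k)].
have cB : compact B by apply: (@rV_compact R (d + d) (fun k => `[c ord0 k - r, c ord0 k + r]%classic)) => k; exact: segment_compact.
have coB : compact (@of_real_coord R d @` B).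
  by apply: continuous_compact cB; apply: continuous_subspaceT; exact: continuous_of_real_coord.
apply: (subclosed_compact cK coB) => z /Kq H; exists (real_coord z); last exact: real_coordK.
have key (x y : R) : `|x - y| < r -> x \in `[y - r, y + r].
  by rewrite in_itv/= -ler_distl => /ltW.
move=> k; apply: key; case: (split_ordP k) => j ->; rewrite /c /real_coord ?(row_mxEl, row_mxEr) !mxE;
  apply: le_lt_trans (H j); case: (z ord0 j) => a b; case: (q ord0 j) => a' b'.
  exact: (@normc_Re _ ((a +i* b) - (a' +i* b'))).
exact: (@normc_Im _ ((a +i* b) - (a' +i* b'))).
Qed.

(** Heine-Borel as an induction principle. It serves below for volumes, for [controls] in each of
    its two sets, and for pointwise bounds. *)
Lemma compact_local (P : set Cd -> Prop) U K : P set0 ->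
  (forall Y1 Y2, P Y1 -> P Y2 -> P (Y1 `|` Y2)) ->
  (forall x, U x -> exists2 r, 0 < r & P (pdisc x r)) ->
  compact K -> K `<=` U -> exists2 Y, K `<=` Y & P Y.
Proof.
move=> P0 PU Px cK KU.
have /choice[r Hr] : forall x, exists r, U x -> 0 < r /\ P (pdisc x r).
  by move=> x; have [/Px[r ? ?]|nU] := pselect (U x); [exists r|exists 0].
move: cK; rewrite compact_cover => /(_ Cd K (fun x => pdisc x (r x))).
case.
- by move=> x _; exact: open_pdisc.
- by move=> x Kx; exists x => //; apply: pdisc_center; have [] := Hr x (KU _ Kx).
move=> D DK KD; have /finite_seqP[s Ds] := finite_fset D.
move: KD; rewrite Ds /cover bigcup_seq => KD.
exists (\big[setU/set0]_(i <- s) pdisc i (r i)) => //.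
have sU x : x \in s -> U x.
    move=> xs; apply: KU; have /= e := congr1 (fun A : set Cd => A x) Ds.
  by move: xs; rewrite -[is_true _]/(is_true (x \in s)) -e => /DK; rewrite inE.
rewrite big_seq; apply: big_ind => // x /sU Ux; by have [] := Hr x Ux.
Qed.

Lemma compact_Clebesgue_fin K : compact K -> (V K < +oo)%E.
Proof.
move=> cK; have mK : measurable (K : set (Cspace R d)).
  by apply: measurable_closed; apply: compact_closed.
have [] := @compact_local (fun Y => exists2 W : set (Cspace R d), measurable W /\ (V W < +oo)%E & Y `<=` W) setT K _ _ _ cK.
- by exists set0 => //; rewrite measure0.
- move=> Y1 Y2 [W1 [m1 f1] s1] [W2 [m2 f2] s2]; exists (W1 `|` W2); last exact: setUSS.
  split; first exact: measurableU.
  by apply: le_lt_trans (measureU2 _ m1 m2) _; rewrite lte_add_pinfty.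
- move=> x _; exists 1 => //; exists (pdisc x 1) => //.
  by split; [exact: measurable_pdisc|exact: Clebesgue_pdisc_fin].
- by [].
- move=> Y KY [W [mW fW] YW]; apply: le_lt_trans fW.
  by apply: le_measure; rewrite ?inE //; exact: subset_trans YW.
Qed.

(** Real-valued, so that linear arithmetic applies; [JintE] shows that nothing is lost on subsets of
    a compact set. *)
Definition Jint A (h : Cd -> R) : R := fine (\int[V]_(z in (A : set (Cspace R d))) (h z)%:E).

Definition locint U (h : Cd -> R) := [/\ measurable_fun (U : set (Cspace R d)) (h : Cspace R d -> RR),
  forall z, U z -> 0 <= h z & forall K, compact K -> K `<=` U -> (\int[V]_(z in (K : set (Cspace R d))) (h z)%:E < +oo)%E].

Lemma locintD U h h' : open U -> locint U h -> locint U h' -> locint U (fun z => h z + h' z).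
Proof.
move=> oU [mh h0 fh] [mh' h0' fh']; split; first exact: measurable_funD.
  by move=> z Uz; rewrite addr_ge0 ?h0 ?h0'.
move=> K cK KU; have mK : measurable (K : set (Cspace R d)) by apply: measurable_closed; apply: compact_closed.
have mU : measurable (U : set (Cspace R d)) by exact: measurable_open.
under eq_integral do rewrite EFinD.
rewrite ge0_integralD//=.
- by rewrite lte_add_pinfty ?fh ?fh'.
- by move=> z /KU Uz; rewrite lee_fin h0.
- by apply/measurable_EFinP; apply: measurable_funS mh.
- by move=> z /KU Uz; rewrite lee_fin h0'.
- by apply/measurable_EFinP; apply: measurable_funS mh'.
Qed.

Lemma locint_dom U h h' : open U -> measurable_fun (U : set (Cspace R d)) (h : Cspace R d -> RR) ->
  (forall z, U z -> 0 <= h z <= h' z) -> locint U h' -> locint U h.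
Proof.
move=> oU mh hh [mh' h0' fh']; split => //; first by move=> z /hh /andP[].
move=> K cK KU; have mK : measurable (K : set (Cspace R d)) by apply: measurable_closed; apply: compact_closed.
have mU : measurable (U : set (Cspace R d)) by exact: measurable_open.
apply: le_lt_trans (fh' K cK KU); apply: ge0_le_integral => //.
- by move=> z /KU /hh /andP[? _]; rewrite lee_fin.
- by apply/measurable_EFinP; apply: measurable_funS mh.
- by apply/measurable_EFinP; apply: measurable_funS mh'.
- by move=> z /KU /hh /andP[_ ?]; rewrite lee_fin.
Qed.

Lemma locint_cst U (c : R) : 0 <= c -> locint U (fun=> c).
Proof.
move=> c0; split => //.
move=> K cK KU; have mK : measurable (K : set (Cspace R d)) by apply: measurable_closed; apply: compact_closed.
rewrite integral_cst// lte_mul_pinfty ?lee_fin//; exact: compact_Clebesgue_fin.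
Qed.

Lemma locintZ U h (c : R) : open U -> 0 <= c -> locint U h -> locint U (fun z => c * h z).
Proof.
move=> oU c0 [mh h0 fh]; split; first exact: measurable_funM.
  by move=> z Uz; rewrite mulr_ge0 ?h0.
move=> K cK KU; have mK : measurable (K : set (Cspace R d)) by apply: measurable_closed; apply: compact_closed.
have mU : measurable (U : set (Cspace R d)) by exact: measurable_open.
under eq_integral do rewrite EFinM.
rewrite ge0_integralZl//=.
- by rewrite lte_mul_pinfty ?lee_fin ?fh.
- by apply/measurable_EFinP; apply: measurable_funS mh.
- by move=> z /KU Uz; rewrite lee_fin h0.
Qed.

Section Jint_theory.
Variables (U K : set Cd).
Hypotheses (oU : open U) (cK : compact K) (KU : K `<=` U).
Implicit Types h : Cd -> R.

Let mK : measurable (K : set (Cspace R d)).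
Proof. by apply: measurable_closed; apply: compact_closed. Qed.

Lemma locint_measurable A h : locint U h -> A `<=` K ->
  measurable_fun (A : set (Cspace R d)) (EFin \o h : Cspace R d -> \bar R).
Proof.
move=> [mh _ _] AK; apply/measurable_EFinP; apply: measurable_funS mh; first exact: measurable_open.
by apply: subset_trans KU.
Qed.

Lemma Jint_sub_ereal A A' h : locint U h -> measurable (A : set (Cspace R d)) -> measurable (A' : set (Cspace R d)) -> A `<=` A' -> A' `<=` K ->
  (\int[V]_(z in (A : set (Cspace R d))) (h z)%:E <= \int[V]_(z in (A' : set (Cspace R d))) (h z)%:E)%E.
Proof.
move=> lh mA mA' AA' AK; have [_ h0 _] := lh.
apply: ge0_subset_integral => //; first exact: locint_measurable.
by move=> z /AK /KU Uz; rewrite lee_fin h0.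
Qed.

Lemma JintE A h : locint U h -> measurable (A : set (Cspace R d)) -> A `<=` K ->
  (\int[V]_(z in (A : set (Cspace R d))) (h z)%:E)%E = (Jint A h)%:E.
Proof.
move=> lh mA AK; have [_ h0 hK] := lh; rewrite /Jint fineK// ge0_fin_numE.
  by apply: le_lt_trans (hK K cK KU); exact: Jint_sub_ereal.
by apply: integral_ge0 => z /AK /KU Uz; rewrite lee_fin h0.
Qed.

Lemma Jint_ge0 A h : locint U h -> A `<=` U -> 0 <= Jint A h.
Proof. by move=> [_ h0 _] AU; rewrite fine_ge0// integral_ge0// => z /AU Uz; rewrite lee_fin h0. Qed.

Lemma Jint_sub A A' h : locint U h -> measurable (A : set (Cspace R d)) -> measurable (A' : set (Cspace R d)) -> A `<=` A' -> A' `<=` K ->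
  Jint A h <= Jint A' h.
Proof.
move=> lh mA mA' AA' AK; rewrite -lee_fin -!JintE//; first exact: Jint_sub_ereal.
exact: subset_trans AK.
Qed.

Lemma Jint_setU A A' h : locint U h -> measurable (A : set (Cspace R d)) -> measurable (A' : set (Cspace R d)) -> A `<=` K -> A' `<=` K ->
  Jint (A `|` A') h <= Jint A h + Jint A' h.
Proof.
move=> lh mA mA' AK AK'; have [_ h0 _] := lh.
rewrite -lee_fin EFinD -!JintE//; [|exact: measurableU|by move=> z [/AK|/AK']].
rewrite (_ : A `|` A' = A `|` (A' `\` A)); last by apply/seteqP; split=> z; [move=> [Az|A'z]; have [h'|h'] := pselect (A z); try (by left); by right|by move=> [Az|[A'z _]]; [left|right]].
rewrite ge0_integral_setU//=; first last.
- by rewrite disj_set2E setIC setDKI.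
- by move=> z [/AK /KU Uz|[/AK' /KU Uz _]]; rewrite lee_fin h0.
- by apply: (locint_measurable lh) => z [/AK|[/AK']].
- exact: measurableD.
rewrite leeD2l//; apply: Jint_sub_ereal => //; exact: measurableD.
Qed.

Lemma Jint_le A h h' : locint U h -> locint U h' -> measurable (A : set (Cspace R d)) -> A `<=` K ->
  (forall z, A z -> h z <= h' z) -> Jint A h <= Jint A h'.
Proof.
move=> lh lh' mA AK hh; rewrite -lee_fin -!JintE//; have [_ h0 _] := lh.
apply: ge0_le_integral => //.
- by move=> z /AK /KU Uz; rewrite lee_fin h0.
- exact: (locint_measurable lh AK).
- exact: (locint_measurable lh' AK).
Qed.

Lemma JintD A h h' : locint U h -> locint U h' -> measurable (A : set (Cspace R d)) -> A `<=` K ->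
  Jint A (fun z => h z + h' z) = Jint A h + Jint A h'.
Proof.
move=> lh lh' mA AK; apply: EFin_inj; rewrite EFinD -!JintE//.
  have [_ h0 _] := lh; have [_ h0' _] := lh'.
  rewrite -ge0_integralD//=.
  - by move=> z /AK /KU Uz; rewrite lee_fin h0.
  - exact: locint_measurable lh AK.
  - by move=> z /AK /KU Uz; rewrite lee_fin h0'.
  - exact: locint_measurable lh' AK.
exact: locintD.
Qed.

Lemma JintZ A h (c : R) : 0 <= c -> locint U h -> measurable (A : set (Cspace R d)) -> A `<=` K ->
  Jint A (fun z => c * h z) = c * Jint A h.
Proof.
move=> c0 lh mA AK; apply: EFin_inj; rewrite EFinM -!JintE//; last exact: locintZ.
have [_ h0 _] := lh; rewrite -ge0_integralZl//=.
- exact: locint_measurable lh AK.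
- by move=> z /AK /KU Uz; rewrite lee_fin h0.
Qed.

Lemma Jint_cst A (c : R) : 0 <= c -> measurable (A : set (Cspace R d)) -> A `<=` K ->
  Jint A (fun=> c) = c * fine (V A).
Proof.
move=> c0 mA AK; rewrite -[c in LHS]mulr1 JintZ//; last exact: locint_cst.
by rewrite /Jint integral_cst// mul1e.
Qed.

End Jint_theory.

(** Test functions in place of sets: they will be indicators of events, seen as functions of one
    particle with the others fixed. *)
Definition unit_fun (g : Cd -> R) := measurable_fun setT (g : Cspace R d -> RR) /\ forall z, 0 <= g z <= 1.

Lemma locint_unit U g : open U -> unit_fun g -> locint U g.
Proof.
move=> oU [mg g01]; apply: (locint_dom oU _ _ (locint_cst U ler01)) => //.
by apply: measurable_funS mg.
Qed.

Lemma locint_unitM U g u : open U -> unit_fun g -> locint U u -> locint U (fun z => g z * u z).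
Proof.
move=> oU [mg g01] lu; have [mu u0 _] := lu; apply: (locint_dom oU _ _ lu).
  by apply: measurable_funM => //; apply: measurable_funS mg.
by move=> z Uz; have /andP[g0 g1] := g01 z; rewrite mulr_ge0 ?u0//= ler_piMl ?u0.
Qed.

Lemma unit_indic (A : set (Cspace R d)) : measurable A -> unit_fun (\1_A).
Proof.
move=> mA; split=> [|z]; first exact: measurable_indic.
by rewrite indicE; case: (_ \in _); rewrite ?lexx ler01.
Qed.

Lemma unit_funM g h : unit_fun g -> unit_fun h -> unit_fun (fun z => g z * h z).
Proof.
move=> [mg g01] [mh h01]; split; first exact: measurable_funM.
move=> z; have /andP[g0 g1] := g01 z; have /andP[h0 h1] := h01 z.
by rewrite mulr_ge0//= -[leRHS]mulr1 ler_pM.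
Qed.

(** When [g] is the indicator of a part of [A], this bounds the mass of [u] on [Y] by its mass on
    that part, up to an error of [e] times the mass on [K]. The factor [Jint A g] on the left keeps
    [C] independent of [g]: the bound loses its strength only as the part gets small. *)
Definition controls U A Y := [/\ measurable (A : set (Cspace R d)), measurable (Y : set (Cspace R d)) &
  exists K, [/\ compact K, K `<=` U, A `<=` K, Y `<=` K & forall e : R, 0 < e ->
    exists2 C : R, 0 <= C & forall u g, log_submean U u -> locint U u -> unit_fun g ->
      Jint A g * Jint Y u <= e * Jint K u + C * Jint A (fun z => g z * u z)]].

Lemma closure_pdisc (x : Cd) r r' : r < r' -> closure (pdisc x r) `<=` pdisc x r'.
Proof.
move=> rr z Cz; have s0 : 0 < r' - r by rewrite subr_gt0.
have [y [xy zy] j] : pdisc x r `&` pdisc z (r' - r) !=set0.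
  by apply: Cz; apply/nbhs_pdisc; exists (r' - r).
have := normcD_le (z ord0 j - y ord0 j) (y ord0 j - x ord0 j); rewrite addrA subrK.
move=> h; apply: (le_lt_trans h); rewrite -normcN opprB.
by have := zy j; have := xy j; lra.
Qed.

(** Fix [q] in the disc. Where [u >= t * u q], the product [g * u q] is at most [g * u / t]; the
    other points form the set [m], whose volume times [u q * L] is at most the mass of [u] on [K],
    by [log_submean]. Integrating over [q] gives the claim. *)
Lemma controls_local U x r : open U -> 0 < r -> pdisc x (4 * r) `<=` U -> controls U (pdisc x r) (pdisc x r).
Proof.
move=> oU r0 DU; have mD := measurable_pdisc x r; split => //.
(* A disc of radius [2 * r] about a point [q] of the small disc contains the small disc and stays
   within radius [3 * r] of [x]; the closure costs one more [r]. *)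
pose K := closure (pdisc x (3 * r)).
have KD : K `<=` pdisc x (4 * r) by apply: closure_pdisc; lra.
have cK : compact K by apply: (compact_pdisc _ KD); exact: closed_closure.
have KU : K `<=` U by exact: subset_trans DU.
have DK : pdisc x r `<=` K.
  by move=> z H; apply: subset_closure => j; have := H j; lra.
have mK : measurable (K : set (Cspace R d)) by apply: measurable_closed; exact: closed_closure.
exists K; split => // e e0.
set v := fine (V (pdisc x r)).
have v0 : 0 <= v by rewrite fine_ge0// measure_ge0.
have VE : V (pdisc x r) = v%:E by rewrite /v fineK// ge0_fin_numE ?measure_ge0// Clebesgue_pdisc_fin.
(* Chosen so that [v / L <= e]; with [t = exp (- L)] the factor [- ln t] in [log_submean] is [L]. *)
pose L := v / e + 1; have L0 : 0 < L by rewrite ltr_wpDl// divr_ge0// ltW.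
pose t := expR (- L); have t0 : 0 < t by exact: expR_gt0.
have t1 : t < 1 by rewrite -expR0 ltr_expR oppr_lt0.
exists (v / t); first by rewrite divr_ge0// ltW.
move=> u g su lu ug; have [mu u0 sm] := su; have [mg g01] := ug.
have lg := locint_unit oU ug; have lgu := locint_unitM oU ug lu.
pose M := t^-1 * Jint (pdisc x r) (fun z => g z * u z) + L^-1 * Jint K u.
have M0 : 0 <= M.
  by rewrite addr_ge0// mulr_ge0 ?invr_ge0 ?(Jint_ge0 lgu) ?(Jint_ge0 lu) ?ltW// => z /DK /KU.
have key q : pdisc x r q -> Jint (pdisc x r) g * u q <= M.
  move=> xq; have uq0 : 0 <= u q by apply: u0; apply: KU; exact: DK.
  have qK : pdisc q (2 * r) `<=` K.
    move=> z H; apply: subset_closure => j; have := normcD_le (z ord0 j - q ord0 j) (q ord0 j - x ord0 j).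
    by rewrite addrA subrK; have := H j; have := xq j; lra.
  have qKU : closure (pdisc q (2 * r)) `<=` U.
    by apply: subset_trans KU; rewrite [X in _ `<=` X]((closure_id K).1 _)//; [exact: closure_subset|exact: closed_closure].
  have [|_ /(_ t t0 t1)] := sm q (2 * r) _ qKU; first by rewrite mulr_gt0.
  set m := [set p | _]; rewrite expRK opprK => Hm.
  have mm : measurable (m : set (Cspace R d)).
    rewrite (_ : m = pdisc q (2 * r) `&` u @^-1` `]-oo, t * u q[%classic); last first.
      by apply/seteqP; split=> z [? ?]; split => //; move: H0; rewrite /= in_itv.
    have : measurable_fun (pdisc q (2 * r) : set (Cspace R d)) (u : Cspace R d -> RR).
      by apply: measurable_funS mu; [exact: measurable_open|exact: subset_trans KU].
    apply; [exact: measurable_pdisc|exact: measurable_itv].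
  have mK' : m `<=` K by move=> z [/qK].
  pose f z := u q * \1_m z.
  have lf : locint U f by apply: locintZ => //; apply: locint_unit => //; exact: unit_indic.
  have Jf : Jint (pdisc x r) f <= L^-1 * Jint K u.
    rewrite ler_pdivlMl// -lee_fin.
    apply: (@le_trans _ _ ((u q * L)%:E * V m)%E).
      rewrite EFinM -(JintE oU cK KU lf)//.
      under eq_integral do rewrite EFinM.
      rewrite ge0_integralZl//; last by apply/measurable_EFinP; exact: measurable_indic.
      rewrite integral_indic// muleA -EFinM [L * _]mulrC; apply: lee_wpmul2l; first by rewrite lee_fin mulr_ge0// ltW.
      by apply: le_measure; rewrite ?inE//; exact: measurableI.
    apply: (le_trans Hm); rewrite -(JintE oU cK KU lu)//.
    exact: (Jint_sub_ereal oU KU lu (measurable_pdisc q (2 * r)) mK qK (fun z Kz => Kz)).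
  apply: (@le_trans _ _ (Jint (pdisc x r) (fun z => t^-1 * (g z * u z) + f z))); last first.
    rewrite (JintD oU cK KU)//; last by apply: locintZ => //; rewrite invr_ge0 ltW.
    have ti0 : 0 <= t^-1 by rewrite invr_ge0 ltW.
    by rewrite (JintZ oU cK KU)// lerD2l.
  rewrite mulrC -(JintZ oU cK KU)//; apply: (Jint_le oU cK KU) => //.
  - exact: locintZ.
  - by apply: locintD => //; apply: locintZ => //; rewrite invr_ge0 ltW.
  - move=> z xz; have uz0 : 0 <= u z by apply: u0; apply: KU; exact: DK.
    have ti0 : 0 <= t^-1 by rewrite invr_ge0 ltW.
    have /andP[gz0 gz1] := g01 z; rewrite /f indicE.
    have [h|h] := ltP (u z) (t * u q).
      rewrite mem_set ?mulr1; last first.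
        split => // j; have := normcD_le (z ord0 j - x ord0 j) (x ord0 j - q ord0 j).
        rewrite addrA subrK -[normc (x _ _ - _)]normcN opprB; have := xz j; have := xq j; lra.
      apply: (@le_trans _ _ (u q)); first by rewrite ler_piMr.
      by rewrite lerDr mulr_ge0 ?mulr_ge0.
    apply: (@le_trans _ _ (t^-1 * (g z * u z))); last by rewrite lerDl mulr_ge0.
    rewrite mulrCA [u q * _]mulrC; apply: ler_wpM2l => //; rewrite ler_pdivlMl//.
have Jg0 : 0 <= Jint (pdisc x r) g by apply: (Jint_ge0 lg) => // z /DK /KU.
have Ju0 : 0 <= Jint K u by exact: (Jint_ge0 lu).
rewrite -(JintZ oU cK KU)//.
apply: (@le_trans _ _ (Jint (pdisc x r) (fun=> M))).
  apply: (Jint_le oU cK KU) => //; last exact: locint_cst.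
  exact: locintZ.
rewrite (Jint_cst oU cK KU)// -/v /M mulrDl addrC lerD//; last by rewrite mulrAC [t^-1 * v]mulrC.
rewrite mulrAC ler_wpM2r//.
by rewrite mulrC ler_pdivrMr// /L mulrDr mulr1 mulrCA divff ?gt_eqF// mulr1 lerDl ltW.
Qed.

Lemma Jint_indic U K A A' h : open U -> compact K -> K `<=` U -> locint U h -> measurable (A : set (Cspace R d)) ->
  measurable (A' : set (Cspace R d)) -> A' `<=` A -> A `<=` K -> Jint A (fun z => \1_A' z * h z) = Jint A' h.
Proof.
move=> oU cK KU lh mA mA' AA AK; rewrite /Jint; congr fine.
rewrite -[in RHS](setIidr AA) integral_mkcondr.
by apply: eq_integral => z _; rewrite patchE indicE; case: (_ \in _); rewrite ?mul1r ?mul0r.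
Qed.

Lemma controls_sub U A Y A' Y' : open U -> controls U A Y -> measurable (A' : set (Cspace R d)) ->
  measurable (Y' : set (Cspace R d)) -> A' `<=` A -> Y' `<=` Y -> controls U A' Y'.
Proof.
move=> oU [mA mY [K [cK KU AK YK H]]] mA' mY' AA YY; split => //.
exists K; split=> //; [exact: subset_trans AK|exact: subset_trans YK|move=> e /H[C C0 HC]].
exists C => // u g su lu ug.
have := HC u _ su lu (unit_funM (unit_indic mA') ug).
rewrite (Jint_indic oU cK KU)//; last exact: locint_unit.
under [X in _ + _ * Jint _ X]eq_fun do rewrite -mulrA.
rewrite (Jint_indic oU cK KU)//; last exact: locint_unitM.
apply: le_trans; apply: ler_wpM2l; last exact: (Jint_sub oU cK KU).
by apply: (Jint_ge0 (locint_unit oU ug)) => z /AA /AK /KU.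
Qed.

Lemma controlsUl U A1 A2 Y : open U -> controls U A1 Y -> controls U A2 Y -> controls U (A1 `|` A2) Y.
Proof.
move=> oU [mA1 mY [K1 [cK1 KU1 AK1 YK1 H1]]] [mA2 _ [K2 [cK2 KU2 AK2 YK2 H2]]].
have cK : compact (K1 `|` K2) by exact: compactU.
have KU : K1 `|` K2 `<=` U by move=> z [/KU1|/KU2].
have mK1 : measurable (K1 : set (Cspace R d)) by apply: measurable_closed; exact: compact_closed.
have mK2 : measurable (K2 : set (Cspace R d)) by apply: measurable_closed; exact: compact_closed.
have mK : measurable (K1 `|` K2 : set (Cspace R d)) by exact: measurableU.
have mA : measurable (A1 `|` A2 : set (Cspace R d)) by exact: measurableU.
have AK : A1 `|` A2 `<=` K1 `|` K2 by exact: setUSS.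
split => //; exists (K1 `|` K2); split=> //; first by apply: (subset_trans YK1); exact: subsetUl.
move=> e e0; have [C1 C10 HC1] := H1 _ (divr_gt0 e0 (ltr0Sn R 1)); have [C2 C20 HC2] := H2 _ (divr_gt0 e0 (ltr0Sn R 1)).
exists (C1 + C2); first exact: addr_ge0.
move=> u g su lu ug; have lg := locint_unit oU ug; have lgu := locint_unitM oU ug lu.
have YU : Y `<=` U by exact: subset_trans KU1.
have := HC1 u g su lu ug; have := HC2 u g su lu ug.
have : Jint (A1 `|` A2) g * Jint Y u <= (Jint A1 g + Jint A2 g) * Jint Y u.
  apply: ler_wpM2r; first exact: (Jint_ge0 lu).
  by apply: (Jint_setU oU cK KU) => //; apply: subset_trans AK; [exact: subsetUl|exact: subsetUr].
have k1 : e / 2 * Jint K1 u <= e / 2 * Jint (K1 `|` K2) u.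
  apply: ler_wpM2l; [by rewrite divr_ge0// ltW|]; apply: (Jint_sub oU cK KU) => //; exact: subsetUl.
have k2 : e / 2 * Jint K2 u <= e / 2 * Jint (K1 `|` K2) u.
  apply: ler_wpM2l; [by rewrite divr_ge0// ltW|]; apply: (Jint_sub oU cK KU) => //; exact: subsetUr.
have a1 : C1 * Jint A1 (fun z => g z * u z) <= C1 * Jint (A1 `|` A2) (fun z => g z * u z).
  apply: ler_wpM2l => //; apply: (Jint_sub oU cK KU) => //; exact: subsetUl.
have a2 : C2 * Jint A2 (fun z => g z * u z) <= C2 * Jint (A1 `|` A2) (fun z => g z * u z).
  apply: ler_wpM2l => //; apply: (Jint_sub oU cK KU) => //; exact: subsetUr.
rewrite !mulrDl; lra.
Qed.

Lemma controlsUr U A Y1 Y2 : open U -> controls U A Y1 -> controls U A Y2 -> controls U A (Y1 `|` Y2).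
Proof.
move=> oU [mA mY1 [K1 [cK1 KU1 AK1 YK1 H1]]] [_ mY2 [K2 [cK2 KU2 AK2 YK2 H2]]].
have cK : compact (K1 `|` K2) by exact: compactU.
have KU : K1 `|` K2 `<=` U by move=> z [/KU1|/KU2].
have mK1 : measurable (K1 : set (Cspace R d)) by apply: measurable_closed; exact: compact_closed.
have mK2 : measurable (K2 : set (Cspace R d)) by apply: measurable_closed; exact: compact_closed.
have mK : measurable (K1 `|` K2 : set (Cspace R d)) by exact: measurableU.
have YK : Y1 `|` Y2 `<=` K1 `|` K2 by exact: setUSS.
split => //; first exact: measurableU.
exists (K1 `|` K2); split=> //; first by apply: (subset_trans AK1); exact: subsetUl.
move=> e e0; have [C1 C10 HC1] := H1 _ (divr_gt0 e0 (ltr0Sn R 1)); have [C2 C20 HC2] := H2 _ (divr_gt0 e0 (ltr0Sn R 1)).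
exists (C1 + C2); first exact: addr_ge0.
move=> u g su lu ug; have lg := locint_unit oU ug.
have := HC1 u g su lu ug; have := HC2 u g su lu ug.
have : Jint A g * Jint (Y1 `|` Y2) u <= Jint A g * (Jint Y1 u + Jint Y2 u).
  apply: ler_wpM2l; first by apply: (Jint_ge0 lg); exact: subset_trans KU1.
  by apply: (Jint_setU oU cK KU) => //; apply: subset_trans YK; [exact: subsetUl|exact: subsetUr].
have k1 : e / 2 * Jint K1 u <= e / 2 * Jint (K1 `|` K2) u.
  apply: ler_wpM2l; [by rewrite divr_ge0// ltW|]; apply: (Jint_sub oU cK KU) => //; exact: subsetUl.
have k2 : e / 2 * Jint K2 u <= e / 2 * Jint (K1 `|` K2) u.
  apply: ler_wpM2l; [by rewrite divr_ge0// ltW|]; apply: (Jint_sub oU cK KU) => //; exact: subsetUr.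
rewrite mulrDr mulrDl; lra.
Qed.

(** [D'] controls [Y] with the indicator of [W] as test function, and the mass on [W] is at most the
    mass on [D], which [A] controls. The positive volume of [W] is what may be divided by. *)
Lemma controls_trans U A D D' Y (W : set (Cspace R d)) : open U -> controls U A D -> controls U D' Y ->
  measurable W -> W `<=` D -> W `<=` D' -> (0 < V W)%E -> controls U A Y.
Proof.
move=> oU [mA mD [K1 [cK1 KU1 AK1 DK1 H1]]] [mD' mY [K2 [cK2 KU2 DK2 YK2 H2]]] mW WD WD' W0.
have cK : compact (K1 `|` K2) by exact: compactU.
have KU : K1 `|` K2 `<=` U by move=> z [/KU1|/KU2].
have mK1 : measurable (K1 : set (Cspace R d)) by apply: measurable_closed; exact: compact_closed.
have mK2 : measurable (K2 : set (Cspace R d)) by apply: measurable_closed; exact: compact_closed.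
have mK : measurable (K1 `|` K2 : set (Cspace R d)) by exact: measurableU.
split => //; exists (K1 `|` K2); split=> //.
- by apply: (subset_trans AK1); exact: subsetUl.
- by apply: (subset_trans YK2); exact: subsetUr.
move=> e e0.
have VW : V W = (Jint W (fun=> 1))%:E.
  rewrite -(JintE oU cK1 KU1) ?integral_cst ?mul1e//; first exact: locint_cst.
  exact: subset_trans DK1.
set v := Jint W _ in VW; have v0 : 0 < v by rewrite -lte_fin -VW.
pose a := Jint A (fun=> 1); have a0 : 0 <= a.
  by apply: (Jint_ge0 (locint_cst _ ler01)); exact: subset_trans KU1.
(* [e2] comes first: its constant [C2] enters the choice of [e1]. Each of the two errors is at most
   half of [e], after division by [v]; the summands [1] avoid a division by zero. *)
pose e2 := e * v / (2 * (a + 1)).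
have e20 : 0 < e2 by rewrite divr_gt0 ?mulr_gt0// ltr_wpDl.
have [C2 C20 HC2] := H2 _ e20.
pose e1 := e * v / (2 * (C2 + 1)).
have e10 : 0 < e1 by rewrite divr_gt0 ?mulr_gt0// ltr_wpDl.
have [C1 C10 HC1] := H1 _ e10.
exists (C2 * C1 / v); first by rewrite divr_ge0 ?mulr_ge0// ltW.
move=> u g su lu ug; have lg := locint_unit oU ug; have lgu := locint_unitM oU ug lu.
have AU : A `<=` U by exact: subset_trans KU1.
have Jg0 : 0 <= Jint A g by exact: (Jint_ge0 lg).
have Jga : Jint A g <= a.
  apply: (Jint_le oU cK1 KU1) => //; [exact: locint_cst|by move=> z _; have [_ /(_ z)/andP[]] := ug].
have JK0 : 0 <= Jint (K1 `|` K2) u by exact: (Jint_ge0 lu).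
have Jgu0 : 0 <= Jint A (fun z => g z * u z) by exact: (Jint_ge0 lgu).
have k1 : Jint K1 u <= Jint (K1 `|` K2) u by apply: (Jint_sub oU cK KU) => //; exact: subsetUl.
have k2 : Jint K2 u <= Jint (K1 `|` K2) u by apply: (Jint_sub oU cK KU) => //; exact: subsetUr.
have h1 := HC1 u g su lu ug.
have h2 := HC2 u _ su lu (unit_indic mW).
rewrite (Jint_indic oU cK2 KU2)// in h2.
have vE : Jint D' (\1_W) = v.
  rewrite /v -(Jint_indic oU cK2 KU2 (locint_cst _ ler01) mD' mW)//.
  by congr Jint; apply/funext => z; rewrite mulr1.
rewrite vE in h2.
have h3 : Jint W u <= Jint D u by exact: (Jint_sub oU cK1 KU1).
have h2' : v * Jint Y u <= e2 * Jint (K1 `|` K2) u + C2 * Jint D u.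
  by apply: (le_trans h2); apply: lerD; apply: ler_wpM2l => //; exact: ltW.
have h1' : Jint A g * Jint D u <= e1 * Jint (K1 `|` K2) u + C1 * Jint A (fun z => g z * u z).
  by apply: (le_trans h1); rewrite lerD2r; apply: ler_wpM2l => //; exact: ltW.
rewrite -(ler_pM2l v0).
apply: (@le_trans _ _ (Jint A g * (e2 * Jint (K1 `|` K2) u + C2 * Jint D u))).
  by rewrite mulrCA; exact: ler_wpM2l.
rewrite mulrDr; apply: (@le_trans _ _ (a * (e2 * Jint (K1 `|` K2) u) + C2 * (e1 * Jint (K1 `|` K2) u + C1 * Jint A (fun z => g z * u z)))).
  apply: lerD; first by apply: ler_wpM2r => //; rewrite mulr_ge0// ltW.
  by rewrite mulrCA; exact: ler_wpM2l.
have b1 : a * e2 <= e * v / 2.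
  rewrite /e2 invfM -!mulrA mulrCA; apply: ler_wpM2l; first exact: ltW.
  rewrite [a * _]mulrCA; apply: ler_wpM2l; first exact: ltW.
  by rewrite mulrCA ler_piMr// ler_pdivrMr ?ltr_wpDl// mul1r lerDl.
have b2 : C2 * e1 <= e * v / 2.
  rewrite /e1 invfM -!mulrA mulrCA; apply: ler_wpM2l; first exact: ltW.
  rewrite [C2 * _]mulrCA; apply: ler_wpM2l; first exact: ltW.
  by rewrite mulrCA ler_piMr// ler_pdivrMr ?ltr_wpDl// mul1r lerDl.
have := ler_wpM2r JK0 b1; have := ler_wpM2r JK0 b2.
set Ja := Jint A _; set Jk := Jint (K1 `|` K2) u.
rewrite [X in _ -> _ -> _ <= X](_ : _ = e * v * Jk + C2 * C1 * Ja); last by field; rewrite gt_eqF.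
lra.
Qed.

(** For a small disc about [x], the points [y] with a disc controlled by it form an open and closed
    subset [S] of [U], hence all of [U]. Compactness then assembles discs, first in the controlled
    set and then in the controlling one. *)
Lemma controls_compact U B : open U -> connected U -> compact B -> B `<=` U -> controls U B B.
Proof.
move=> oU cU cB BU.
have mB : measurable (B : set (Cspace R d)) by apply: measurable_closed; exact: compact_closed.
have loc y : U y -> exists r, [/\ 0 < r, pdisc y r `<=` U & controls U (pdisc y r) (pdisc y r)].
  move=> Uy; have /nbhs_pdisc[r r0 rU] : nbhs y U by exact: open_nbhs_nbhs.
  exists (r / 4); split; first by rewrite divr_gt0.
    by move=> z H; apply: rU => j; have := H j; lra.
  by apply: controls_local; rewrite ?divr_gt0// mulrC divfK.
have key x y : U x -> U y -> exists r s, [/\ 0 < r, 0 < s & controls U (pdisc x r) (pdisc y s)].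
  move=> Ux Uy; have [r [r0 rU cr]] := loc x Ux.
  pose S := [set y | U y /\ exists2 s, 0 < s & controls U (pdisc x r) (pdisc y s)].
  suff SU : S = U by (have [_ [s s0 cs]] : S y by rewrite SU); exists r, s.
  (* One disc about [z] serves for openness and closedness: if it meets [S], then it is itself
     controlled, through a small disc about the common point, so it lies in [S]. *)
  have near z : U z -> exists2 t, 0 < t & forall y z', pdisc z t y -> S y -> pdisc z t z' -> S z'.
    move=> Uz; have [t [t0 tU ct]] := loc z Uz; exists t => // y1 z' zy [Uy1 [s s0 cs]] zz'.
    have dt (y2 : Cd) : pdisc z t y2 -> exists2 s', 0 < s' & pdisc y2 s' `<=` pdisc z t.
      by move=> zy2; apply/nbhs_pdisc; apply: open_nbhs_nbhs; split; [exact: open_pdisc|].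
    split; first exact: tU.
    have cz : controls U (pdisc x r) (pdisc z t).
      have [s' s'0 ss'] := dt _ zy.
      apply: (controls_trans oU cs ct (measurable_pdisc y1 (Num.min s s'))).
      + by move=> p H j; have := H j; rewrite lt_min => /andP[].
      + by move=> p H; apply: ss' => j; have := H j; rewrite lt_min => /andP[].
      + by apply: Clebesgue_pdisc_gt0; rewrite lt_min s0.
    have [s' s'0 ss'] := dt _ zz'.
    by exists s' => //; apply: (controls_sub oU cz) => //; exact: measurable_pdisc.
  apply: cU.
  - by exists x; split => //; exists r.
  - exists S; last by apply/esym/setIidr => z [].
    rewrite openE => z Sz; have [Uz _] := Sz; have [t t0 Ht] := near z Uz.
    by apply/nbhs_pdisc; exists t => // z'; apply: (Ht z) => //; exact: pdisc_center.
  - exists (~` (U `\` S)).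
      apply: open_closedC; rewrite openE => z [Uz nS]; have [t t0 Ht] := near z Uz.
      have /nbhs_pdisc[t' t'0 tU'] : nbhs z U by exact: open_nbhs_nbhs.
      apply/nbhs_pdisc; exists (Num.min t t'); first by rewrite lt_min t0.
      move=> z' H; split; first by apply: tU' => j; have := H j; rewrite lt_min => /andP[].
      move=> Sz'; apply: nS; apply: (Ht z') => //; last exact: pdisc_center.
      by move=> j; have := H j; rewrite lt_min => /andP[].
    rewrite -setDE setDD; apply/esym/setIidr; by move=> z [].
have cset0 A Y : controls U A Y -> controls U set0 Y /\ controls U A set0.
  move=> c; have [mA mY _] := c.
  by split; apply: (controls_sub oU c) => //; exact: sub0set.
have [->|/set0P[x0 /BU Ux0]] := eqVneq B set0.
  have J0 h : Jint set0 h = 0 by rewrite /Jint integral_set0.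
  split => //; exists set0; split => //; first exact: compact0.
  by move=> e e0; exists 0 => // u g _ _ _; rewrite !J0 !mulr0 addr0.
have step2 x : U x -> exists2 r, 0 < r & controls U (pdisc x r) B.
  move=> Ux; have [r [r0 rU cr]] := loc x Ux; exists r => //.
  have [||y Uy|Y BY cY] := @compact_local (controls U (pdisc x r)) U B _ _ _ cB BU.
  - by have [] := cset0 _ _ cr.
  - by move=> Y1 Y2; exact: controlsUr.
  - have [r' [s [r'0 s0 c]]] := key x y Ux Uy; exists s => //.
    apply: (controls_trans oU cr c (measurable_pdisc x (Num.min r r'))).
    + by move=> p H j; have := H j; rewrite lt_min => /andP[].
    + by move=> p H j; have := H j; rewrite lt_min => /andP[].
    + by apply: Clebesgue_pdisc_gt0; rewrite lt_min r0.
  - by apply: (controls_sub oU cY) => //; exact: measurable_pdisc.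
have [||y Uy|Y BY cY] := @compact_local (fun A => controls U A B) U B _ _ _ cB BU.
- by have [r _ /cset0[]] := step2 _ Ux0.
- by move=> Y1 Y2; exact: controlsUl.
- exact: step2.
- exact: (controls_sub oU cY).
Qed.

Lemma log_submean_bound U B : open U -> compact B -> B `<=` U -> exists K C, [/\ compact K, K `<=` U, 0 <= C &
  forall u q, log_submean U u -> locint U u -> B q -> u q <= C * Jint K u].
Proof.
move=> oU cB BU.
pose P Y := exists K C, [/\ compact K, K `<=` U, 0 <= C & forall u q, log_submean U u -> locint U u -> Y q -> u q <= C * Jint K u].
have [||y Uy|Y BY [K [C [cK KU C0 HC]]]] := @compact_local P U B _ _ _ cB BU.
- by exists set0, 0; split => //; exact: compact0.
- move=> Y1 Y2 [K1 [C1 [cK1 KU1 C10 H1]]] [K2 [C2 [cK2 KU2 C20 H2]]].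
  have cK : compact (K1 `|` K2) by exact: compactU.
  have KU : K1 `|` K2 `<=` U by move=> z [/KU1|/KU2].
  have mK1 : measurable (K1 : set (Cspace R d)) by apply: measurable_closed; exact: compact_closed.
  have mK2 : measurable (K2 : set (Cspace R d)) by apply: measurable_closed; exact: compact_closed.
  have mK : measurable (K1 `|` K2 : set (Cspace R d)) by exact: measurableU.
  exists (K1 `|` K2), (C1 + C2); split; rewrite ?addr_ge0// => u q su lu.
  have JK0 : 0 <= Jint (K1 `|` K2) u by exact: (Jint_ge0 lu).
  have k1 : Jint K1 u <= Jint (K1 `|` K2) u by apply: (Jint_sub oU cK KU) => //; exact: subsetUl.
  have k2 : Jint K2 u <= Jint (K1 `|` K2) u by apply: (Jint_sub oU cK KU) => //; exact: subsetUr.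
  move=> [/(H1 u q su lu)|/(H2 u q su lu)] h; apply: (le_trans h); rewrite mulrDl.
    by rewrite ler_wpDr ?mulr_ge0// ler_wpM2l.
  by rewrite ler_wpDl ?mulr_ge0// ler_wpM2l.
- have /nbhs_pdisc[r r0 rU] : nbhs y U by exact: open_nbhs_nbhs.
  have r4 : 0 < r / 4 by rewrite divr_gt0.
  exists (r / 4) => //; pose K := closure (pdisc y (r / 2)).
  have KD : K `<=` pdisc y r by apply: closure_pdisc; lra.
  have cK : compact K by apply: (compact_pdisc _ KD); exact: closed_closure.
  have KU : K `<=` U by exact: subset_trans rU.
  have mK : measurable (K : set (Cspace R d)) by apply: measurable_closed; exact: closed_closure.
  have := Clebesgue_pdisc_gt0 (0 : Cd) r4; have := Clebesgue_pdisc_fin (0 : Cd) (r / 4).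
  case E : (V (pdisc 0 (r / 4))) => [v||]//; rewrite lte_fin => _ v0.
  exists K, v^-1; split; rewrite ?invr_ge0 ?ltW// => u q su lu yq.
  have qK : pdisc q (r / 4) `<=` K.
    move=> z H; apply: subset_closure => j; have := normcD_le (z ord0 j - q ord0 j) (q ord0 j - y ord0 j).
    by rewrite addrA subrK; have := H j; have := yq j; lra.
  have qKU : closure (pdisc q (r / 4)) `<=` U.
    by apply: subset_trans KU; rewrite [X in _ `<=` X]((closure_id K).1 _)//; [exact: closure_subset|exact: closed_closure].
  have [_ _ /(_ q (r / 4) r4 qKU)[h _]] := su.
  rewrite ler_pdivlMl// mulrC -lee_fin; apply: (@le_trans _ _ ((u q)%:E * V (pdisc q (r / 4)))%E).
    by rewrite pdisc_translation E.
  apply: (le_trans h); rewrite -(JintE oU cK KU lu mK)//.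
  exact: (Jint_sub_ereal oU KU lu (measurable_pdisc q (r / 4)) mK qK (fun z Kz => Kz)).
- by exists K, C; split => // u q su lu /BY; exact: HC.
Qed.

End chain.

(** * Moving one particle *)

Section weight.
Context (R : realType) (d : nat).
Local Notation V := (Clebesgue R d).
Local Notation Cd := 'rV[R[i]]_d.
Local Notation RR := (measurableTypeR R).
Variables (U : set Cd) (w : Cd -> R).
Hypotheses (oU : open U) (mw : measurable_fun (U : set (Cspace R d)) (w : Cspace R d -> R)).
Hypotheses (w0 : forall z, U z -> 0 < w z)
  (wi : forall (B : set (Cspace R d)) (mB : measurable B),
      relatively_compact U B -> (0 < V B)%E ->
      (0 < ess_inf (mrestr V mB) (fun z => (w z)%:E))%E).

Lemma weight_lower (K : set Cd) : compact K -> K `<=` U -> exists2 c : R, 0 < c &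
  {ae V, forall z : Cspace R d, (K : set Cd) z -> c <= w z}.
Proof.
move=> cK KU; have clK : closed K by exact: compact_closed.
have mK : measurable (K : set (Cspace R d)) by exact: measurable_closed.
have rK : relatively_compact U K by rewrite /relatively_compact -((closure_id K).1 clK).
(* The hypothesis on the essential infimum speaks of sets of positive measure; on a null set any [c]
   is a lower bound almost everywhere. *)
have [K0|K0] := eqVneq (V K) 0%E.
  by exists 1 => //; exists K; split=> // z /not_implyP[].
have := wi mK rK; rewrite lt0e K0 measure_ge0 => /(_ isT) e0.
have [c c0 ce] : exists2 c : R, 0 < c & (c%:E <= ess_inf (mrestr V mK) (fun z => (w z)%:E))%E.
  case: (ess_inf _ _) e0 => [r||]// r0; first by exists r.
  by exists 1; rewrite ?leey.
exists c => //; move: ce => /ess_infP[N [mN N0 NN]].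
exists (N `&` K); split; [exact: measurableI|exact: N0|].
move=> z /not_implyP[Kz cz]; split=> //; apply: NN => /=; by rewrite lee_fin.
Qed.

Variable j : Cd -> R.
Hypothesis lj : locint U j.
Let u z := j z / w z.

Lemma measurable_div_weight : measurable_fun (U : set (Cspace R d)) (u : Cspace R d -> RR).
Proof.
have [mj _ _] := lj; apply: measurable_funM => //.
have mU : measurable (U : set (Cspace R d)) by exact: measurable_open.
apply: (eq_measurable_fun (fun z : Cspace R d => expR (0 - ln (w z)))).
  by move=> z; rewrite inE => Uz; rewrite sub0r expRN lnK// posrE w0.
apply: (measurableT_comp (@measurable_expR R)); apply: measurable_funB => //.
by apply: measurableT_comp => //; exact: measurable_ln.
Qed.

Lemma div_weight_ge0 z : U z -> 0 <= u z.
Proof. by have [_ j0 _] := lj; move=> Uz; rewrite divr_ge0 ?j0// ltW// w0. Qed.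

Lemma integral_div_weight (K : set Cd) c (g : Cd -> R) (B : set (Cspace R d)) : compact K -> K `<=` U -> 0 < c ->
  {ae V, forall z : Cspace R d, (K : set Cd) z -> c <= w z} -> unit_fun g -> measurable B -> B `<=` K ->
  (\int[V]_(z in B) (g z * u z)%:E <= (c^-1)%:E * \int[V]_(z in B) (g z * j z)%:E)%E.
Proof.
move=> cK KU c0 cw [mg g01] mB BK; have [mj j0 _] := lj.
have mU : measurable (U : set (Cspace R d)) by exact: measurable_open.
have BU : B `<=` U by exact: subset_trans KU.
have g0 z : 0 <= g z by have /andP[] := g01 z.
have mgj : measurable_fun B (fun z : Cspace R d => (g z * j z)%:E).
  by apply/measurable_EFinP; apply: measurable_funM; [exact: measurable_funS mg|exact: measurable_funS mj].
rewrite -ge0_integralZl ?lee_fin ?invr_ge0 ?(ltW c0)//; last by move=> z /BU Uz; rewrite lee_fin mulr_ge0 ?j0.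
apply: ae_ge0_le_integral => //.
- by move=> z /BU Uz; rewrite lee_fin mulr_ge0// div_weight_ge0.
- apply/measurable_EFinP; apply: measurable_funM; first exact: measurable_funS mg.
  exact: measurable_funS measurable_div_weight.
- by move=> z /BU Uz; rewrite mule_ge0 ?lee_fin ?mulr_ge0 ?j0 ?invr_ge0 ?(ltW c0).
- exact: measurable_funeM.
apply: filterS cw => z cw Bz; rewrite -EFinM lee_fin [c^-1 * _]mulrCA /u; apply: ler_wpM2l => //; rewrite mulrC.
apply: ler_wpM2r; first by rewrite j0//; exact: BU.
by rewrite lef_pV2 ?posrE ?w0 ?cw//; [exact: BK|exact: BU].
Qed.

Lemma locint_div_weight : locint U u.
Proof.
split; [exact: measurable_div_weight|exact: div_weight_ge0|move=> K cK KU].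
have mK : measurable (K : set (Cspace R d)) by apply: measurable_closed; exact: compact_closed.
have [c c0 cw] := weight_lower cK KU.
have u1 : unit_fun (fun _ : Cd => 1 : R) by split => // z; rewrite ler01 lexx.
have := integral_div_weight cK KU c0 cw u1 mK (fun z Kz => Kz).
under eq_integral do rewrite mul1r; under [X in (_ <= _ * X)%E]eq_integral do rewrite mul1r.
move=> h; apply: (le_lt_trans h); rewrite lte_mul_pinfty ?lee_fin ?invr_ge0 ?(ltW c0)//.
by have [_ _ ->] := lj.
Qed.

End weight.

Lemma ler_half_div (R : realType) (x y : R) : 0 <= x -> 0 <= y -> y * (x / (2 * (y + 1))) <= x / 2.
Proof.
move=> x0 y0; have y1 : 0 < y + 1 by lra.
rewrite [leLHS](_ : _ = x / 2 * (y / (y + 1))); last by field; rewrite gt_eqF.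
by rewrite ler_piMr ?divr_ge0// ler_pdivrMr// mul1r lerDl.
Qed.

Section one_step.
Context (R : realType) (d : nat).
Local Notation V := (Clebesgue R d).
Local Notation Cd := 'rV[R[i]]_d.
Local Notation RR := (measurableTypeR R).
Variables (U : set Cd) (w : Cd -> R).
Hypotheses (oU : open U) (cU : connected U) (mw : measurable_fun (U : set (Cspace R d)) (w : Cspace R d -> R)).
Hypotheses (w0 : forall z, U z -> 0 < w z)
  (wi : forall (B : set (Cspace R d)) (mB : measurable B),
      relatively_compact U B -> (0 < V B)%E ->
      (0 < ess_inf (mrestr V mB) (fun z => (w z)%:E))%E).
Variables (F G : Cd -> Cd) (B : set Cd).
Hypotheses (FG : forall z, U z -> U (F z) /\ G (F z) = z) (cF : C1_on U F) (cG : C1_on U G).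
Hypotheses (cB : compact B) (BU : B `<=` U) (BF : forall z, B z -> B (F z)).

Definition tame (L : R) : set (Cspace R d) := [set z | U z /\ w z <= L].

Lemma measurable_tame L : measurable (tame L).
Proof.
rewrite (_ : tame L = U `&` w @^-1` `]-oo, L]%classic).
  by apply: mw; [exact: measurable_open|exact: measurable_itv].
by apply/seteqP; split=> z [Uz]; rewrite /= in_itv/=.
Qed.

(** Put [u = j / w]. On the tame part of [B], [j = w * u] is at most [M = L * C0 * Jint K0 u], so
    only the integral of [g \o F] remains, which [distortion] bounds by [a1 + C1 * Jint B g]. The
    product of [Jint B g] and [Jint K0 u] is what [controls] bounds. The lower bound [c] of [w]
    turns [u] back into [j]. *)
Lemma one_step (L : R) : 0 < L -> exists K, [/\ compact K, K `<=` U, B `<=` K &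
  forall e : R, 0 < e -> exists2 C : R, 0 <= C & forall j g, locint U j -> log_submean U (fun z => j z / w z) ->
    unit_fun g ->
    (\int[V]_(z in (B : set (Cspace R d))) (g (F z) * \1_(tame L) z * j z)%:E <=
     e%:E * \int[V]_(z in (K : set (Cspace R d))) (j z)%:E + C%:E * \int[V]_(z in (B : set (Cspace R d))) (g z * j z)%:E)%E].
Proof.
move=> L0.
have mB : measurable (B : set (Cspace R d)) by apply: measurable_closed; exact: compact_closed.
have [K0 [C0 [cK0 K0U C00 HK0]]] := log_submean_bound oU cB BU.
have mK0 : measurable (K0 : set (Cspace R d)) by apply: measurable_closed; exact: compact_closed.
have cBK0 : compact (B `|` K0) by exact: compactU.
have BK0U : B `|` K0 `<=` U by move=> z [/BU|/K0U].
have [_ _ [K1 [cK1 K1U BK1 _ H1]]] : controls U B K0.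
  by apply: (controls_sub oU (controls_compact oU cU cBK0 BK0U)) => //.
have mK1 : measurable (K1 : set (Cspace R d)) by apply: measurable_closed; exact: compact_closed.
have cK : compact (K0 `|` K1) by exact: compactU.
have KU : K0 `|` K1 `<=` U by move=> z [/K0U|/K1U].
have mK : measurable (K0 `|` K1 : set (Cspace R d)) by exact: measurableU.
have BK : B `<=` K0 `|` K1 by move=> z /BK1; right.
exists (K0 `|` K1); split => // e e0.
have [c c0 cw] := weight_lower wi cK KU.
(* The error is shared between [distortion] and [controls]: [L * C0 * a1] and [L * C0 * C1 * a2] are
   each at most [e * c / 2]. The constant [C1] depends on [a1], so [a2] is chosen after it. *)
pose a1 := e * c / (2 * (L * C0 + 1)).
have LC0 : 0 <= L * C0 by rewrite mulr_ge0// ltW.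
have a10 : 0 < a1 by rewrite divr_gt0 ?mulr_gt0// ltr_wpDl.
have [C1 C10 HF] := distortion oU FG cF cG mB BU (compact_Clebesgue_fin cB) BF a10.
pose a2 := e * c / (2 * (L * C0 * C1 + 1)).
have LC1 : 0 <= L * C0 * C1 by rewrite mulr_ge0.
have a20 : 0 < a2 by rewrite divr_gt0 ?mulr_gt0// ltr_wpDl.
have [C2 C20 H2] := H1 _ a20.
exists (L * C0 * C1 * C2 / c); first by apply: divr_ge0; [exact: mulr_ge0|exact: ltW].
move=> j g lj su ug; have [mg g01] := ug; have g0 z : 0 <= g z by have /andP[] := g01 z.
set u := (fun z => j z / w z) in su; have lu : locint U u by exact: locint_div_weight.
have lgu := locint_unitM oU ug lu; have lgj := locint_unitM oU ug lj; have lg := locint_unit oU ug.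
have u1 : unit_fun (fun _ : Cd => 1 : R) by split => // z; rewrite ler01 lexx.
have ju A : measurable (A : set (Cspace R d)) -> A `<=` K0 `|` K1 -> Jint A u <= c^-1 * Jint A j.
  move=> mA AK; have := integral_div_weight oU mw w0 lj cK KU c0 cw u1 mA AK.
  under eq_integral do rewrite mul1r; under [X in (_ <= _ * X)%E]eq_integral do rewrite mul1r.
  by rewrite (JintE oU cK KU lu mA AK) (JintE oU cK KU lj mA AK) -EFinM lee_fin.
have gju : Jint B (fun z => g z * u z) <= c^-1 * Jint B (fun z => g z * j z).
  have := integral_div_weight oU mw w0 lj cK KU c0 cw ug mB BK.
  by rewrite (JintE oU cK KU lgu mB BK) (JintE oU cK KU lgj mB BK) -EFinM lee_fin.
pose M := L * C0 * Jint K0 u.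
have JK00 : 0 <= Jint K0 u by exact: (Jint_ge0 lu).
have M0 : 0 <= M by rewrite mulr_ge0.
have [_ j0 _] := lj.
have jM z : B z -> tame L z -> j z <= M.
  move=> Bz [Uz wL]; have uz := HK0 u z su lu Bz.
  have -> : j z = w z * u z by rewrite /u mulrCA mulfV ?mulr1// gt_eqF// w0.
  apply: (@le_trans _ _ (L * u z)); first by rewrite ler_wpM2r// (div_weight_ge0 w0 lj).
  by rewrite /M -mulrA ler_wpM2l// ltW.
have mgF : measurable_fun (B : set (Cspace R d)) (fun z : Cspace R d => g (F z)).
  apply: (measurableT_comp mg); apply: measurable_funS (measurable_fun_C1 oU cF) => //; exact: measurable_open.
apply: (@le_trans _ _ (M%:E * \int[V]_(z in (B : set (Cspace R d))) (g (F z))%:E)%E).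
  rewrite -ge0_integralZl ?lee_fin//.
  - apply: ge0_le_integral => //.
    + by move=> z Bz; rewrite lee_fin !mulr_ge0 ?j0//; exact: BU.
    + apply/measurable_EFinP; apply: measurable_funM.
        by apply: measurable_funM => //; exact: measurable_indic (measurable_tame L).
      by have [mj _ _] := lj; apply: measurable_funS mj => //; exact: measurable_open.
    + by apply: measurable_funeM; exact/measurable_EFinP.
    + move=> z Bz; rewrite -EFinM lee_fin indicE; case: (boolP (z \in tame L)) => [|_].
        by rewrite inE mulr1 mulrC => zt; rewrite ler_wpM2r// jM.
      by rewrite mulr0 mul0r mulr_ge0.
  - exact/measurable_EFinP.
  - by move=> z _; rewrite lee_fin.
apply: (@le_trans _ _ (M%:E * (a1%:E + C1%:E * \int[V]_(z in (B : set (Cspace R d))) (g z)%:E))%E).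
  by apply: lee_wpmul2l; [rewrite lee_fin|exact: HF].
rewrite (JintE oU cK KU lg mB BK) (JintE oU cK KU lgj mB BK) (JintE oU cK KU lj mK (fun z Kz => Kz)).
rewrite -!EFinM -!EFinD -?EFinM lee_fin.
have h2 := H2 u g su lu ug.
have k0 : Jint K0 u <= c^-1 * Jint (K0 `|` K1) j.
  apply: (@le_trans _ _ (Jint (K0 `|` K1) u)); last exact: ju.
  by apply: (Jint_sub oU cK KU) => //; exact: subsetUl.
have k1 : Jint K1 u <= c^-1 * Jint (K0 `|` K1) j.
  apply: (@le_trans _ _ (Jint (K0 `|` K1) u)); last exact: ju.
  by apply: (Jint_sub oU cK KU) => //; exact: subsetUr.
have Jj0 : 0 <= c^-1 * Jint (K0 `|` K1) j by exact: le_trans k0.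
set X := c^-1 * Jint _ j in k0 k1 Jj0; set Y := Jint B (fun z => g z * u z) in h2 gju.
set Z := Jint B (fun z => g z * j z) in gju *; set T := Jint B g in h2 *; set S := Jint K0 u in h2 k0 JK00 M M0 jM *.
have -> : Jint (K0 `|` K1) j = c * X by rewrite /X mulrA mulfV ?mul1r// gt_eqF.
have ec0 : 0 <= e * c by rewrite mulr_ge0 ?ltW.
have e1 : L * C0 * S * a1 <= e * c / 2 * X.
  rewrite mulrAC; apply: ler_pM => //; first by rewrite mulr_ge0// ltW.
  exact: ler_half_div.
have e2 : L * C0 * C1 * a2 <= e * c / 2 by exact: ler_half_div.
have e3 : L * C0 * C1 * (T * S) <= e * c / 2 * X + L * C0 * C1 * C2 / c * Z.
  apply: (@le_trans _ _ (L * C0 * C1 * (a2 * X + C2 * (c^-1 * Z)))).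
    apply: ler_wpM2l => //; apply: (le_trans h2); apply: lerD; apply: ler_wpM2l => //; exact: ltW.
  have := ler_wpM2r Jj0 e2; rewrite mulrDr !mulrA; lra.
rewrite /M [leLHS](_ : _ = L * C0 * S * a1 + L * C0 * C1 * (T * S)); last by ring.
rewrite [e * _](_ : _ = e * c / 2 * X + e * c / 2 * X); last by field.
by rewrite -addrA; apply: lerD.
Qed.

End one_step.

(** * Complex integrals *)

Lemma Re_conjc (R : realType) (z : R[i]) : complex.Re z^* = complex.Re z.
Proof. by case: z. Qed.

Section complex_measurable.
Context dT (T : measurableType dT) (R : realType).
Implicit Types (D : set T) (f g : T -> R[i]).

Definition cmeasurable D f := measurable_fun D (fun x => complex.Re (f x) : R) /\
  measurable_fun D (fun x => complex.Im (f x) : R).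

Lemma cmeasurable_cst D c : cmeasurable D (fun=> c).
Proof. by split; exact: measurable_cst. Qed.

Lemma cmeasurableD D f g : cmeasurable D f -> cmeasurable D g -> cmeasurable D (fun x => f x + g x).
Proof. by move=> [? ?] [? ?]; split; under eq_fun do rewrite raddfD; exact: measurable_funD. Qed.

Lemma cmeasurableM D f g : cmeasurable D f -> cmeasurable D g -> cmeasurable D (fun x => f x * g x).
Proof.
move=> [? ?] [? ?]; split.
  rewrite [X in measurable_fun _ X](_ : _ = fun x => complex.Re (f x) * complex.Re (g x) - complex.Im (f x) * complex.Im (g x)).
    by apply: measurable_funB; exact: measurable_funM.
  by apply/funext => x; case: (f x); case: (g x).
rewrite [X in measurable_fun _ X](_ : _ = fun x => complex.Re (f x) * complex.Im (g x) + complex.Im (f x) * complex.Re (g x)).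
  by apply: measurable_funD; exact: measurable_funM.
by apply/funext => x; case: (f x); case: (g x).
Qed.

Lemma cmeasurable_conj D f : cmeasurable D f -> cmeasurable D (fun x => (f x)^*).
Proof.
move=> [? ?]; split; first by under eq_fun do rewrite Re_conjc.
rewrite [X in measurable_fun _ X](_ : _ = fun x => 0 - complex.Im (f x)); first exact: measurable_funB.
by apply/funext => x; case: (f x) => a b /=; rewrite sub0r.
Qed.

Lemma cmeasurable_real D (f : T -> R) : measurable_fun D f -> cmeasurable D (fun x => (f x)%:C).
Proof. by split=> //; exact: measurable_cst. Qed.

Lemma cmeasurable_sum D I (r : seq I) (P : pred I) (F : I -> T -> R[i]) :
  (forall i, cmeasurable D (F i)) -> cmeasurable D (fun x => \sum_(i <- r | P i) F i x).
Proof.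
move=> mF; elim: r => [|i r IH]; first by under eq_fun do rewrite big_nil; exact: cmeasurable_cst.
by under eq_fun do rewrite big_cons; case: (P i) => //; exact: cmeasurableD.
Qed.

Lemma cmeasurable_prod D I (r : seq I) (P : pred I) (F : I -> T -> R[i]) :
  (forall i, cmeasurable D (F i)) -> cmeasurable D (fun x => \prod_(i <- r | P i) F i x).
Proof.
move=> mF; elim: r => [|i r IH]; first by under eq_fun do rewrite big_nil; exact: cmeasurable_cst.
by under eq_fun do rewrite big_cons; case: (P i) => //; exact: cmeasurableM.
Qed.

Lemma cmeasurable_det D n (F : 'I_n -> 'I_n -> T -> R[i]) : (forall i j, cmeasurable D (F i j)) ->
  cmeasurable D (fun x => \det (\matrix_(i, j) F i j x)).
Proof.
move=> mF; apply: cmeasurable_sum => s; apply: cmeasurableM; first exact: cmeasurable_cst.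
by apply: cmeasurable_prod => i; under eq_fun do rewrite mxE.
Qed.

Lemma normc_sqr (z : R[i]) : normc z ^+ 2 = complex.Re z ^+ 2 + complex.Im z ^+ 2.
Proof. by case: z => a b /=; rewrite sqr_sqrtr// addr_ge0// sqr_ge0. Qed.

Lemma mulr_conj (z : R[i]) : z * z^* = (normc z ^+ 2)%:C.
Proof. by rewrite normc_sqr; case: z => a b; apply/eqP; rewrite eq_complex/=; apply/andP; split; apply/eqP; ring. Qed.

Lemma measurable_normc_sqr D f : cmeasurable D f -> measurable_fun D (fun x => normc (f x) ^+ 2).
Proof.
move=> [? ?]; under eq_fun do rewrite normc_sqr.
by apply: measurable_funD; exact: measurable_funX.
Qed.

End complex_measurable.

Lemma cmeasurable_comp d1 d2 (T1 : measurableType d1) (T2 : measurableType d2) (R : realType)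
    (D : set T1) (h : T1 -> T2) (f : T2 -> R[i]) :
  measurable_fun D h -> cmeasurable setT f -> cmeasurable D (fun x => f (h x)).
Proof. by move=> mh [m1 m2]; split; [exact: (measurableT_comp m1 mh)|exact: (measurableT_comp m2 mh)]. Qed.

Section complex_integral.
Context dT (T : measurableType dT) (R : realType) (mu : {measure set T -> \bar R}) (D : set T).
Hypothesis mD : measurable D.
Implicit Types (f g : T -> R[i]).

Definition cintegrable f := mu.-integrable D (EFin \o (fun x => complex.Re (f x))) /\
  mu.-integrable D (EFin \o (fun x => complex.Im (f x))).

Definition Cint f : R[i] := (\int[mu]_(x in D) complex.Re (f x)) +i* (\int[mu]_(x in D) complex.Im (f x)).

Lemma cintegrable_dom f (g : T -> R) : cmeasurable D f -> measurable_fun D g -> (\int[mu]_(x in D) (g x)%:E < +oo)%E ->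
  (forall x, D x -> normc (f x) <= g x) -> cintegrable f.
Proof.
move=> [m1 m2] mg ig fg.
have g0 x : D x -> 0 <= g x by move=> /fg; apply: le_trans; exact: normc_ge0.
have ig' : mu.-integrable D (EFin \o g).
  apply/integrableP; split; first exact/measurable_EFinP.
  rewrite (eq_integral (fun x => (g x)%:E))// => x; rewrite inE => Dx.
  by rewrite /= ger0_norm// g0.
split; apply: le_integrable ig' => //; try exact/measurable_EFinP; move=> x Dx;
  rewrite /= lee_fin [leRHS]ger0_norm ?g0//; apply: le_trans (fg x Dx); [exact: normc_Re|exact: normc_Im].
Qed.

Lemma eq_Cint f g : (forall x, D x -> f x = g x) -> Cint f = Cint g.
Proof.
by move=> fg; rewrite /Cint; congr (_ +i* _); rewrite /Rintegral; congr fine; apply: eq_integral => x; rewrite inE => /fg ->.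
Qed.

Lemma cintegrable0 : cintegrable (fun=> 0).
Proof. by split; exact: integrable0. Qed.

Lemma cintegrableD f g : cintegrable f -> cintegrable g -> cintegrable (fun x => f x + g x).
Proof.
move=> [f1 f2] [g1 g2]; split.
  by apply: eq_integrable (integrableD mD f1 g1) => // x _; rewrite /= raddfD.
by apply: eq_integrable (integrableD mD f2 g2) => // x _; rewrite /= raddfD.
Qed.

Lemma CintD f g : cintegrable f -> cintegrable g -> Cint (fun x => f x + g x) = Cint f + Cint g.
Proof.
move=> [f1 f2] [g1 g2]; apply/eqP; rewrite eq_complex/=; apply/andP; split; apply/eqP.
  by rewrite -RintegralD//; under eq_Rintegral do rewrite raddfD.
by rewrite -RintegralD//; under eq_Rintegral do rewrite raddfD.
Qed.

Lemma cintegrableZ c f : cintegrable f -> cintegrable (fun x => c * f x).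
Proof.
case: c => a b [f1 f2]; split.
  have := integrableB mD (integrableZl mD a f1) (integrableZl mD b f2).
  by apply: eq_integrable => // x _; rewrite /= -EFinB; case: (f x).
have := integrableD mD (integrableZl mD a f2) (integrableZl mD b f1).
by apply: eq_integrable => // x _; rewrite /= -EFinD; case: (f x).
Qed.

Lemma CintZ c f : cintegrable f -> Cint (fun x => c * f x) = c * Cint f.
Proof.
case: c => a b [f1 f2]; have int r h : mu.-integrable D (EFin \o h) -> mu.-integrable D (EFin \o (fun x => r * h x)).
  by move=> ih; have := integrableZl mD r ih; apply: eq_integrable => // x _; rewrite /= EFinM.
apply/eqP; rewrite eq_complex/=; apply/andP; split; apply/eqP.
  rewrite -!RintegralZl// -RintegralB//; try exact: int.
  by apply: eq_Rintegral => x _; case: (f x).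
rewrite -!RintegralZl// -RintegralD//; try exact: int.
by apply: eq_Rintegral => x _; case: (f x).
Qed.

Lemma Cint_conj f : cintegrable f -> Cint (fun x => (f x)^*) = (Cint f)^*.
Proof.
move=> [f1 f2]; apply/eqP; rewrite eq_complex/=; apply/andP; split; apply/eqP.
  by under eq_Rintegral do rewrite Re_conjc.
rewrite -mulN1r -RintegralZl//; apply: eq_Rintegral => x _; case: (f x) => a b /=; by rewrite mulN1r.
Qed.

Lemma cintegrable_sum I (r : seq I) (P : pred I) (F : I -> T -> R[i]) : (forall i, cintegrable (F i)) ->
  cintegrable (fun x => \sum_(i <- r | P i) F i x) /\
  Cint (fun x => \sum_(i <- r | P i) F i x) = \sum_(i <- r | P i) Cint (F i).
Proof.
move=> iF; elim: r => [|i r [IH1 IH2]].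
  under [X in cintegrable X]eq_fun do rewrite big_nil; split; first exact: cintegrable0.
  rewrite big_nil; under [X in Cint X]eq_fun do rewrite big_nil.
  by rewrite /Cint /= /Rintegral integral0.
rewrite big_cons; under [X in cintegrable X]eq_fun do rewrite big_cons.
under [X in Cint X]eq_fun do rewrite big_cons.
by case: (P i) => //; split; [exact: cintegrableD|rewrite CintD// IH2].
Qed.

Lemma Cint_Re f : cintegrable f -> (\int[mu]_(x in D) (complex.Re (f x))%:E)%E = (complex.Re (Cint f))%:E.
Proof. by move=> [f1 _]; rewrite /= /Rintegral fineK//; exact: integrable_fin_num. Qed.

End complex_integral.

(** * Determinants of kernels *)

Section bordered_determinant.

(** Expansion along the border row, then along the border column. It isolates the entries that
    involve the bordering point, which [kdet_int] integrates out. *)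
Lemma det_bordered (R : comRingType) n (A : 'M[R]_n.+1) (M : 'M[R]_n) :
  (forall i j, M i j = A (lift ord0 i) (lift ord0 j)) ->
  \det A = A ord0 ord0 * \det M -
    \sum_i \sum_j A ord0 (lift ord0 j) * A (lift ord0 i) ord0 * cofactor M i j.
Proof.
move=> MA; rewrite (expand_det_row A ord0) big_ord_recl; congr (_ + _).
  rewrite /cofactor /= expr0 mul1r; congr (_ * \det _).
  by apply/matrixP => i j; rewrite !mxE MA.
rewrite exchange_big -sumrN; apply: eq_bigr => j _ /=.
under eq_bigr do rewrite -mulrA; rewrite -mulr_sumr -mulrN; congr (_ * _).
case: n A M MA j => [|n] A M MA j; first by case: (j).
rewrite /cofactor /= /bump /= !add0n; set N := row' _ _.
rewrite (expand_det_col N ord0) exprS mulN1r mulNr; congr (- _).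
rewrite mulr_sumr; apply: eq_bigr => i _.
have -> : N i ord0 = A (lift ord0 i) ord0.
  by rewrite !mxE; congr (A _ _); exact/val_inj.
rewrite mulrCA; congr (_ * _).
rewrite /cofactor /= addn0 mulrA -exprD addnC; congr (_ * \det _).
apply/matrixP => i' j'; rewrite !mxE MA; congr (A _ _); apply/val_inj => //=.
by rewrite /bump /= ltnS; case: leqP => /=; lia.
Qed.

Lemma det_schur (F : fieldType) n (A : 'M[F]_n.+1) (M : 'M[F]_n) : A ord0 ord0 != 0 ->
  (forall i j, M i j = A (lift ord0 i) (lift ord0 j) - A (lift ord0 i) ord0 * A ord0 (lift ord0 j) / A ord0 ord0) ->
  \det A = A ord0 ord0 * \det M.
Proof.
move=> a0 MA; pose B : 'M[F]_(1 + n) := A.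
have e0 (i : 'I_1) : lshift n i = ord0 by apply/val_inj; case: i => -[].
have e1 (i : 'I_n) : rshift 1 i = lift ord0 i by apply/val_inj.
pose a := A ord0 ord0.
have -> : \det A = \det (block_mx (1%:M : 'M[F]_1) 0 (a^-1 *: dlsubmx B) 1%:M *m block_mx (ulsubmx B) (ursubmx B) 0 M).
  congr (\det _); apply: etrans (esym (submxK B)) _.
  rewrite mulmx_block !mul1mx !mul0mx ?addr0 ?add0r; apply: f_equal2.
    by apply/matrixP => i j; rewrite !mxE big_ord1 !mxE !e0 !e1 /B mulrAC mulVf ?mul1r.
  apply/matrixP => i j; rewrite !mxE big_ord1 !mxE !e0 !e1 /B MA /a.
  by field.
by rewrite det_mulmx det_lblock det_ublock !det1 !mul1r det_mx11 !mxE !e0.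
Qed.

End bordered_determinant.

Section kernel_determinant.
Context (R : realType) (T : pointedType).
Local Notation C := R[i].
Implicit Types (k : T -> T -> C) (l : seq (T * T)) (Z : seq T).

(** Rows and columns carry separate points, so that one particle can be polarized into a pair
    [(p, q)] while the others stay on the diagonal. *)
Definition kdet k l : C :=
  \det (\matrix_(i < size l, j < size l) k (nth point l i).1 (nth point l j).2).

Definition diag Z : seq (T * T) := [seq (z, z) | z <- Z].

Lemma kdet_nil k : kdet k [::] = 1. Proof. exact: det_mx00. Qed.

Lemma kdet_perm k l l' : perm_eq l l' -> kdet k l = kdet k l'.
Proof.
move=> pll'; have sl := perm_size pll'.
have /perm.tuple_permP[s es] : perm_eq l (in_tuple l') by [].
rewrite /kdet; case: (size l) / (esym sl) => {sl}.
set M := \matrix_(i, j) k (nth _ l' i).1 _; rewrite [in LHS]es.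
rewrite (_ : \matrix_(i, j) _ = row_perm s (col_perm s M)).
    rewrite row_permE col_permE !det_mulmx !det_perm ?perm.odd_permV.
  by rewrite mulrCA -signr_addb addbb mulr1.
apply/matrixP => i j; rewrite !mxE /=.
by rewrite -!(tnth_nth point (mktuple _)) !tnth_mktuple !(tnth_nth point).
Qed.

Lemma kdet_row_lin k x y l I (r : seq I) (c : I -> C) (P : I -> T) :
  (forall t, k x t = \sum_(a <- r) c a * k (P a) t) ->
  kdet k ((x, y) :: l) = \sum_(a <- r) c a * kdet k ((P a, y) :: l).
Proof.
move=> kx; rewrite /kdet (expand_det_row _ ord0) /=.
have E a : \det (\matrix_(i < (size l).+1, j < (size l).+1) k (nth point ((P a, y) :: l) i).1 (nth point ((P a, y) :: l) j).2) =
    \sum_(j < (size l).+1) k (P a) (nth point ((x, y) :: l) j).2 *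
      cofactor (\matrix_(i < (size l).+1, j < (size l).+1) k (nth point ((x, y) :: l) i).1 (nth point ((x, y) :: l) j).2) ord0 j.
  rewrite (expand_det_row _ ord0) /=; apply: eq_bigr => j _.
  rewrite mxE /=; congr (k _ _ * _); first by case: j => -[].
  rewrite /cofactor; congr (_ * \det _); apply/matrixP => i' j'; rewrite !mxE /=.
  by congr (k _ _); case: (bump j j').
under [RHS]eq_bigr do rewrite E mulr_sumr.
rewrite exchange_big; apply: eq_bigr => j _ /=.
by rewrite mxE /= kx mulr_suml; apply: eq_bigr => a _; rewrite mulrA.
Qed.

(** The Schur complement at [z]: the kernel of the process conditioned to have a particle at [z]. *)
Definition deflate k z x y := k x y - k x z * k z y / k z z.

Lemma kdet_deflate k z l : k z z != 0 -> kdet k ((z, z) :: l) = k z z * kdet (deflate k z) l.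
Proof.
move=> kz; rewrite /kdet; pose A := \matrix_(i < (size l).+1, j < (size l).+1) k (nth point ((z, z) :: l) i).1 (nth point ((z, z) :: l) j).2.
rewrite -/A (@det_schur _ _ A (\matrix_(i, j) deflate k z (nth point l i).1 (nth point l j).2)) ?mxE//.
by move=> i j; rewrite !mxE.
Qed.

Lemma kdet_row0 k z y l : (forall t, k z t = 0) -> kdet k ((z, y) :: l) = 0.
Proof.
move=> kz; rewrite /kdet (expand_det_row _ ord0) big1// => j _.
by rewrite mxE /= kz mul0r.
Qed.

Lemma kdet_bordered k z l :
  kdet k ((z, z) :: l) = k z z * kdet k l -
    \sum_(i < size l) \sum_(j < size l) k (nth point l i).1 z * k z (nth point l j).2 *
      cofactor (\matrix_(i < size l, j < size l) k (nth point l i).1 (nth point l j).2) i j.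
Proof.
rewrite /kdet (@det_bordered _ _ _ (\matrix_(i < size l, j < size l) k (nth point l i).1 (nth point l j).2)).
  rewrite mxE /=; congr (_ - _); apply: eq_bigr => i _; apply: eq_bigr => j _.
  by rewrite !mxE /= [k z _ * _]mulrC.
by move=> i j; rewrite !mxE.
Qed.

End kernel_determinant.

Section gram.
Context (R : realType) (T : pointedType) (N : nat).
Local Notation C := R[i].
Implicit Types (phi psi : 'I_N -> T -> C) (Z : seq T).

Definition gram phi x y : C := \sum_i phi i x * (phi i y)^*.
Definition sqn phi x : R := \sum_i normc (phi i x) ^+ 2.

Lemma gram_diag phi x : gram phi x x = (sqn phi x)%:C.
Proof. by rewrite /gram /sqn rmorph_sum; apply: eq_bigr => i _; rewrite mulr_conj. Qed.

Lemma sqn_ge0 phi x : 0 <= sqn phi x.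
Proof. by apply: sumr_ge0 => i _; exact: sqr_ge0. Qed.

Lemma gram_conj phi x y : gram phi x y = (gram phi y x)^*.
Proof. by rewrite /gram rmorph_sum; apply: eq_bigr => i _; rewrite rmorphM /= conjCK mulrC. Qed.

Lemma sqn_eq0 phi x : sqn phi x = 0 -> forall i, phi i x = 0.
Proof.
move=> /eqP; rewrite psumr_eq0; last by move=> i _; exact: sqr_ge0.
by move=> /allP H i; have := H i (mem_index_enum i); rewrite sqrf_eq0 => /eqP; exact: eq0_normc.
Qed.

Lemma gram_form phi m (c : 'I_m -> C) (p : 'I_m -> T) :
  \sum_a \sum_b c a * (c b)^* * gram phi (p a) (p b) =
  (\sum_i normc (\sum_a c a * phi i (p a)) ^+ 2)%:C.
Proof.
rewrite rmorph_sum /= (eq_bigr (fun i => \sum_a \sum_b c a * phi i (p a) * (c b * phi i (p b))^*)); last first.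
  by move=> i _; rewrite -mulr_conj rmorph_sum big_distrlr.
rewrite [RHS]exchange_big; apply: eq_bigr => a _; rewrite [RHS]exchange_big; apply: eq_bigr => b _.
by rewrite /gram mulr_sumr; apply: eq_bigr => i _; rewrite rmorphM /=; ring.
Qed.

Lemma deflate_gram phi z : sqn phi z != 0 -> exists2 psi, deflate (gram phi) z = gram psi &
  forall x, sqn psi x <= sqn phi x.
Proof.
move=> z0; have kz : gram phi z z != 0 by rewrite gram_diag (inj_eq (@complexI R)).
pose psi i x := phi i x - gram phi x z / gram phi z z * phi i z.
have E : deflate (gram phi) z = gram psi.
  apply/funext => x; apply/funext => y; rewrite /deflate.
  have -> : gram psi x y = gram phi x y - (gram phi y z / gram phi z z)^* * gram phi x z
      - gram phi x z / gram phi z z * gram phi z y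
      + gram phi x z / gram phi z z * (gram phi y z / gram phi z z)^* * gram phi z z.
    rewrite {1}/gram /psi; set al := _ / _; set be := gram phi y z / _.
    rewrite [X in _ = X - _ - _ + _]/gram [gram phi x z in RHS]/gram [gram phi z y]/gram [gram phi z z in RHS]/gram.
    rewrite !mulr_sumr -!sumrB -big_split /=; apply: eq_bigr => i _.
    by rewrite rmorphB rmorphM /=; ring.
  rewrite rmorphM fmorphV /= -!gram_conj.
  by field.
exists psi => // x; have := congr1 (fun k => complex.Re (k x x)) E; rewrite !gram_diag /deflate !gram_diag /= => <-.
rewrite [gram phi z x]gram_conj mulr_conj -fmorphV -rmorphM -rmorphB /=.
by rewrite gerBl mulr_ge0 ?sqr_ge0 ?invr_ge0 ?sqn_ge0.
Qed.

(** Bordered determinants are again Gram kernels, because deflation projects away from one vector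
    and so preserves Gram kernels while decreasing the diagonal. The bound is Hadamard's
    inequality. *)
Lemma kdet_gram phi Z : exists2 psi, forall p q, kdet (gram phi) ((p, q) :: diag Z) = gram psi p q &
  forall p, sqn psi p <= sqn phi p * \prod_(z <- Z) sqn phi z.
Proof.
elim: Z phi => [|z Z IH] phi.
  exists phi; last by move=> p; rewrite big_nil mulr1.
  by move=> p q; rewrite /kdet det_mx11 mxE.
have swap p q : kdet (gram phi) ((p, q) :: diag (z :: Z)) = kdet (gram phi) ((z, z) :: (p, q) :: diag Z).
  by apply: kdet_perm; rewrite /= -[X in perm_eq X]/([:: (p, q)] ++ [:: (z, z)] ++ _) -[X in perm_eq _ X]/([:: (z, z)] ++ [:: (p, q)] ++ _) perm_catCA.
have [z0|z0] := eqVneq (sqn phi z) 0.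
  exists (fun _ _ => 0) => [p q|p].
    rewrite swap kdet_row0; first by rewrite /gram big1// => i _; rewrite mul0r.
    by move=> t; rewrite /gram big1// => i _; rewrite (sqn_eq0 z0) mul0r.
  rewrite [leLHS](_ : _ = 0); first by rewrite mulr_ge0 ?sqn_ge0// prodr_ge0// => i _; exact: sqn_ge0.
  by rewrite /sqn big1// => i _; rewrite normc0 expr0n.
have [phi' E le'] := deflate_gram z0; have [psi Hpsi psile] := IH phi'.
pose s := Num.sqrt (sqn phi z).
have ss : s%:C * s%:C^* = gram phi z z.
  by rewrite gram_diag mulr_conj /= expr0n addr0 sqrtr_sqr ger0_norm ?sqrtr_ge0// sqr_sqrtr// sqn_ge0.
exists (fun i x => s%:C * psi i x) => [p q|p].
  rewrite swap kdet_deflate; last by rewrite gram_diag (inj_eq (@complexI R)).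
  rewrite E Hpsi -ss /gram mulr_sumr; apply: eq_bigr => i _; rewrite rmorphM /=; ring.
rewrite big_cons (mulrCA (sqn phi p)); have -> : sqn (fun i x => s%:C * psi i x) p = sqn phi z * sqn psi p.
  rewrite /sqn mulr_sumr; apply: eq_bigr => i _; rewrite normcMr exprMn; congr (_ * _).
  by rewrite /= expr0n addr0 sqrtr_sqr ger0_norm ?sqrtr_ge0// sqr_sqrtr// sqn_ge0.
apply: ler_wpM2l; first exact: sqn_ge0.
apply: (le_trans (psile p)); apply: ler_pM; rewrite ?sqn_ge0 ?prodr_ge0//; last first.
  by apply: ler_prod => i _; rewrite sqn_ge0 le'.
by move=> i _; exact: sqn_ge0.
Qed.

Lemma psd_cauchy_schwarz (A B : R) (J : C) :
  (forall c1 c2 : C, 0 <= normc c1 ^+ 2 * A + normc c2 ^+ 2 * B + 2 * complex.Re (c1 * c2^* * J)) ->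
  normc J ^+ 2 <= A * B.
Proof.
move=> H; have A0 : 0 <= A by have := H 1 0; rewrite normc0 normc1 conjC0 mulr0 mul0r /= expr1n expr0n /= mul1r mul0r mulr0 !addr0.
have B0 : 0 <= B by have := H 0 1; rewrite normc0 normc1 mul0r mul0r /= expr1n expr0n /= mul1r mul0r mulr0 !addr0 add0r.
have JJ (t : R) : complex.Re (1 * (- (t%:C * J))^* * J) = - (t * normc J ^+ 2).
  by rewrite normc_sqr; case: J {H} => a b /=; ring.
(* For [B = 0] and [J != 0], a multiple of [J] is chosen as [c2] that makes the form equal to
   [A - 2 * (A + 1)], which is negative. *)
have [B00|Bp] := eqVneq B 0.
  rewrite B00 mulr0 leNgt; apply/negP => J0.
  have := H 1 (- (((A + 1) / normc J ^+ 2)%:C * J)).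
  by rewrite B00 JJ normc1 expr1n mul1r mulr0 addr0 divfK ?gt_eqF//; lra.
have := H 1 (- ((B^-1)%:C * J)); rewrite JJ normc1 expr1n mul1r normcN normcMr.
have -> : normc (B^-1)%:C = B^-1 by rewrite /= expr0n addr0 sqrtr_sqr ger0_norm// invr_ge0.
rewrite exprMn.
have -> : A + B^-1 ^+ 2 * normc J ^+ 2 * B + 2 * - (B^-1 * normc J ^+ 2) = (A * B - normc J ^+ 2) / B.
  by field.
by rewrite pmulr_lge0 ?subr_ge0// invr_gt0 lt0r Bp.
Qed.

End gram.

(** * Integration over tuples *)

Section tonelli_in.
Context d1 d2 (T1 : measurableType d1) (T2 : measurableType d2) (R : realType).
Variables (m1 : {sigma_finite_measure set T1 -> \bar R}) (m2 : {sigma_finite_measure set T2 -> \bar R}).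
Variables (A : set T1) (B : set T2) (h : T1 * T2 -> \bar R).
Hypotheses (mA : measurable A) (mB : measurable B) (mh : measurable_fun setT h) (h0 : forall z, (0 <= h z)%E).
Local Open Scope ereal_scope.

Let patchB x : \int[m2]_(y in B) h (x, y) = \int[m2]_y (h \_ (setT `*` B)) (x, y).
Proof.
rewrite integral_mkcond; apply: eq_integral => y _; rewrite !patchE.
by have [yB|yB] := boolP (y \in B); have [|] := boolP ((x, y) \in _) => //; rewrite ?notin_setE ?inE /= => H; exfalso;
  [apply: H; split => //; move: yB; rewrite inE|move: yB; rewrite notin_setE; apply; case: H].
Qed.

Let mpatch C : measurable C -> measurable_fun setT (h \_ C).
Proof. by move=> mC; apply/(measurable_restrictT _ mC); exact: measurable_funS mh. Qed.

Let patch0 C z : 0 <= (h \_ C) z.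
Proof. by rewrite patchE; case: ifP. Qed.

Lemma measurable_integral_in : measurable_fun setT (fun x => \int[m2]_(y in B) h (x, y)).
Proof.
under eq_fun do rewrite patchB.
by apply: (@measurable_fun_fubini_tonelli_F _ _ _ _ _ m2 (h \_ (setT `*` B))) => //; apply: mpatch; exact: measurableX.
Qed.

Lemma tonelli_in1 : \int[(m1 \x m2)]_(z in A `*` B) h z = \int[m1]_(x in A) \int[m2]_(y in B) h (x, y).
Proof.
have mAB : measurable (A `*` B) by exact: measurableX.
rewrite integral_mkcond fubini_tonelli1; [|exact: mpatch|exact: patch0].
rewrite [RHS]integral_mkcond; apply: eq_integral => x _; rewrite /fubini_F patchE.
case: ifPn => xA; last first.
  apply: integral0_eq => y _; rewrite patchE ifF//; apply/negbTE; move: xA.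
    by rewrite !notin_setE => xA [].
rewrite [RHS]integral_mkcond; apply: eq_integral => y _; rewrite !patchE.
by have [yB|yB] := boolP (y \in B); have [|] := boolP ((x, y) \in _) => //; rewrite ?notin_setE ?inE /= => H; exfalso;
  [apply: H; split; [move: xA|move: yB]; rewrite inE|move: yB; rewrite notin_setE; apply; case: H].
Qed.

End tonelli_in.

Lemma tonelli_in d1 d2 (T1 : measurableType d1) (T2 : measurableType d2) (R : realType)
  (m1 : {sigma_finite_measure set T1 -> \bar R}) (m2 : {sigma_finite_measure set T2 -> \bar R})
  (A : set T1) (B : set T2) (h : T1 * T2 -> \bar R) : measurable A -> measurable B ->
  measurable_fun setT h -> (forall z, 0 <= h z)%E ->
  (\int[m1]_(x in A) \int[m2]_(y in B) h (x, y) = \int[m2]_(y in B) \int[m1]_(x in A) h (x, y))%E.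
Proof.
move=> mA mB mh h0; rewrite -tonelli_in1//.
have mAB : measurable (A `*` B) by exact: measurableX.
have mp : measurable_fun setT (h \_ (A `*` B)) by apply/(measurable_restrictT _ mAB); exact: measurable_funS mh.
have p0 z : (0 <= (h \_ (A `*` B)) z)%E by rewrite patchE; case: ifP.
rewrite integral_mkcond fubini_tonelli2; [|exact: mp|exact: p0].
rewrite [RHS]integral_mkcond; apply: eq_integral => y _; rewrite /fubini_G patchE.
case: ifPn => yB; last first.
  apply: integral0_eq => x _; rewrite patchE ifF//; apply/negbTE; move: yB.
  by rewrite !notin_setE => yB [].
rewrite [RHS]integral_mkcond; apply: eq_integral => x _; rewrite !patchE.
by have [xA|xA] := boolP (x \in A); have [|] := boolP ((x, y) \in _) => //; rewrite ?notin_setE ?inE /= => H; exfalso;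
  [apply: H; split; [move: xA|move: yB]; rewrite inE|move: xA; rewrite notin_setE; apply; case: H].
Qed.

Section tuple_integral.
Context d (T : measurableType d) (R : realType) (mu : {sigma_finite_measure set T -> \bar R}).
Implicit Types E : set T.
Local Open Scope ereal_scope.

Definition tset E n : set (n.-tuple T) := [set t | forall i, E (tnth t i)].
Arguments tset E n : clear implicits.

Lemma measurable_tset E n : measurable E -> measurable (tset E n).
Proof. by move=> mE; apply: (@measurable_rect _ _ n (fun=> E)). Qed.

Lemma tset_cons E n x (t : n.-tuple T) : tset E n.+1 [tuple of x :: t] <-> E x /\ tset E n t.
Proof.
split => [H|[Ex Et] i].
  by split => [|i]; [have := H ord0; rewrite tnth0|have := H (lift ord0 i); rewrite tnthS].
by case: (unliftP ord0 i) => [j ->|->]; rewrite ?tnth0// tnthS; exact: Et.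
Qed.

Lemma integral_tuple0 (h : 0.-tuple T -> \bar R) E : \int[tuple_measure mu 0]_(t in tset E 0%N) h t = h [tuple].
Proof.
rewrite (_ : tset E 0%N = setT); last by apply/seteqP; split => // t _ [].
rewrite /= integral_dirac//; first by rewrite diracT mul1e.
move=> _ Y _; rewrite setTI.
have [h0|h0] := pselect (Y (h [tuple])).
  rewrite (_ : _ @^-1` _ = setT)//; apply/seteqP; split => // t _.
  by rewrite /= [t]tuple0.
rewrite (_ : _ @^-1` _ = set0)//; apply/seteqP; split => // t.
by rewrite /= [t]tuple0.
Qed.

Lemma integral_tuple_cons n (h : n.+1.-tuple T -> \bar R) E : measurable E ->
  measurable_fun setT h -> (forall t, 0 <= h t) ->
  \int[tuple_measure mu n.+1]_(t in tset E n.+1) h t =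
  \int[mu]_(x in E) \int[tuple_measure mu n]_(t in tset E n) h [tuple of x :: t].
Proof.
move=> mE mh h0.
have mhc : measurable_fun setT (fun p : T * n.-tuple T => h [tuple of p.1 :: p.2]).
  exact: (measurableT_comp mh (@measurable_tuple_cons _ T n)).
rewrite -(@tonelli_in1 _ _ _ _ _ mu (tuple_measure mu n) E (tset E n) (fun p => h [tuple of p.1 :: p.2]))//; last exact: measurable_tset.
have H := @ge0_integral_pushforward _ _ _ _ R (@tuple_cons _ T n) (@measurable_tuple_cons _ T n)
  (sigma_product mu (tuple_measure mu n)) (tset E n.+1) h (measurable_tset (n := n.+1) mE).
have {}H := H (measurable_funS measurableT (@subsetT _ _) mh) (fun t _ => h0 t).
have E1 : \int[tuple_measure mu n.+1]_(t in tset E n.+1) h t =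
    \int[pushforward (sigma_product mu (tuple_measure mu n)) (@tuple_cons _ T n)]_(t in tset E n.+1) h t.
  by apply: eq_measure_integral => [|mc A _ _] //; exact: measurable_tuple_cons.
apply: (etrans E1); apply: (etrans H).
rewrite (_ : tuple_cons (n := n) @^-1` _ = E `*` tset E n)//.
apply/seteqP; split=> -[x t] /=.
  by move=> /tset_cons[].
by move=> [Ex Et]; apply/tset_cons.
Qed.

End tuple_integral.
Arguments tset {d T} E n _.

(** * Janossy densities *)

Section janossy.
Context d (T : measurableType d) (R : realType) (mu : {sigma_finite_measure set T -> \bar R}).
Variables (f : seq T -> R) (a : R) (E : set T).
Hypotheses (mE : measurable E) (f0 : forall Z, 0 <= f Z) (fP : forall Z Z', perm_eq Z Z' -> f Z = f Z').
Hypothesis fm : forall n X, measurable_fun setT (fun t : n.-tuple T => f (t ++ X)).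
(** The rule by which one particle is integrated out. Correlation functions of a projection kernel
    of rank [N] obey it with [a = N]; the bordered forms [kform] obey it with [a = N - 1]. *)
Hypothesis fI : forall Z, (\int[mu]_z (f (z :: Z))%:E = ((a - (size Z)%:R) * f Z)%:E)%E.

Definition jint D m X : \bar R := (\int[tuple_measure mu m]_(t in tset D m) (f (t ++ X))%:E)%E.

Let vanish Z : a < (size Z)%:R -> f Z = 0.
Proof.
move=> aZ; apply/eqP; rewrite eq_le f0 andbT leNgt; apply/negP => fZ.
have : (0 <= \int[mu]_z (f (z :: Z))%:E)%E by apply: integral_ge0 => z _; rewrite lee_fin.
by rewrite fI lee_fin pmulr_lge0// subr_ge0 leNgt aZ.
Qed.

Let fE n X : measurable_fun setT (fun t : n.-tuple T => (f (t ++ X))%:E).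
Proof. by apply/measurable_EFinP; exact: fm. Qed.

Lemma jint0 D X : jint D 0 X = (f X)%:E.
Proof. by rewrite /jint integral_tuple0. Qed.

Lemma jintS D m X : measurable D -> jint D m.+1 X = (\int[mu]_(z in D) jint D m (z :: X))%E.
Proof.
move=> mD; rewrite /jint integral_tuple_cons; [|by []|exact: fE|by move=> t; rewrite lee_fin].
apply: eq_integral => z _; apply: eq_integral => t _; congr (_%:E); apply: fP.
exact: permEl (perm_catCA [:: z] t X).
Qed.

Let fzt m X : measurable_fun setT (fun p : T * m.-tuple T => (f (p.2 ++ p.1 :: X))%:E).
Proof.
rewrite (_ : (fun _ => _) = (fun t : m.+1.-tuple T => (f (t ++ X))%:E) \o (@tuple_cons _ T m)).
  exact: (measurableT_comp (fE _) (@measurable_tuple_cons _ T m)).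
apply/funext => -[z t] /=; congr (_%:E); apply: fP.
exact: permEl (perm_catCA t [:: z] X).
Qed.

Lemma measurable_jint D m X : measurable D -> measurable_fun setT (fun z => jint D m (z :: X)).
Proof.
move=> mD; apply: (@measurable_integral_in _ _ _ _ R (tuple_measure mu m) (tset D m) (fun p => (f (p.2 ++ p.1 :: X))%:E)) => [||p].
- exact: measurable_tset.
- exact: fzt.
- by rewrite lee_fin.
Qed.

Let jint_ge0 D m X : (0 <= jint D m X)%E.
Proof. by apply: integral_ge0 => t _; rewrite lee_fin. Qed.

Let jint_vanish D m X : a < (m + size X)%:R -> jint D m X = 0%E.
Proof.
move=> am; rewrite /jint; apply: integral0_eq => t _; rewrite vanish//.
by rewrite size_cat size_tuple.
Qed.

Let jintT D m X : measurable D -> (\int[mu]_z jint D m (z :: X) = (a - (m + size X)%:R)%:E * jint D m X)%E.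
Proof.
move=> mD; have mDm : measurable (tset D m) by exact: measurable_tset.
rewrite /jint (@tonelli_in _ _ _ _ _ mu (tuple_measure mu m) setT (tset D m) (fun p => (f (p.2 ++ p.1 :: X))%:E)); first last.
- by move=> p; rewrite lee_fin.
- exact: fzt.
- exact: mDm.
- exact: measurableT.
have E1 t : (\int[mu]_z (f (t ++ z :: X))%:E = ((a - (size (t ++ X))%:R) * f (t ++ X))%:E)%E.
  rewrite -fI; apply: eq_integral => z _; congr (_%:E); apply: fP.
  exact: permEl (perm_catCA t [:: z] X).
under eq_integral => t _ do rewrite /= E1 size_cat size_tuple EFinM.
have [h|h] := leP (m + size X)%:R a.
  rewrite ge0_integralZl//; [exact: measurable_funS (fE _)| |by rewrite lee_fin subr_ge0].
  by move=> t _; rewrite lee_fin.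
rewrite [X in (_ * X)%E](_ : _ = 0%E); last exact: (jint_vanish D h).
rewrite mule0; apply: integral0_eq => t _; rewrite vanish ?mule0//.
by rewrite size_cat size_tuple.
Qed.

Let jint_le D D' m X : measurable D -> measurable D' -> D `<=` D' -> (jint D m X <= jint D' m X)%E.
Proof.
move=> mD mD' DD; apply: ge0_subset_integral; try exact: measurable_tset.
- exact: measurable_funS (fE _).
- by move=> t _; rewrite lee_fin.
- by move=> t H i; apply: DD; exact: H.
Qed.

Lemma jint_fin D m X : measurable D -> (jint D m X < +oo)%E.
Proof.
move=> mD; elim: m X => [|m IH] X; first by rewrite jint0 ltry.
rewrite jintS//; apply: (@le_lt_trans _ _ (\int[mu]_z jint D m (z :: X))%E).
  by apply: ge0_subset_integral => //; exact: measurable_jint.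
rewrite jintT//; have := IH X; have := jint_ge0 D m X; case: (jint D m X) => // r _ _; exact: ltry.
Qed.

Let L m X := fine (jint E m X).
Let LE m X : jint E m X = (L m X)%:E.
Proof. by rewrite /L fineK// ge0_fin_numE// jint_fin. Qed.

Let LC m X : (\int[mu]_(z in ~` E) jint E m (z :: X) = ((a - (m + size X)%:R) * L m X - L m.+1 X)%:E)%E.
Proof.
have mCE : measurable (~` E) by exact: measurableC.
have := jintT m X mE; rewrite -(setUv E) ge0_integral_setU//=; first last.
- by apply/disj_setPCl.
- by rewrite setUv; exact: measurable_jint.
rewrite -jintS// !LE -EFinM EFinB => <-.
by rewrite addeAC subee ?add0e.
Qed.

Let Lint m X : mu.-integrable (~` E) (EFin \o (fun z => L m (z :: X))).
Proof.
apply/integrableP; split.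
  apply: (eq_measurable_fun (fun z => jint E m (z :: X))); first by move=> z _; rewrite LE.
  by apply: measurable_funS (measurable_jint _ _ _) => //; exact: measurableC.
rewrite (eq_integral (fun z => jint E m (z :: X))); first by rewrite LC ltry.
by move=> z _; rewrite LE /= ger0_norm// -lee_fin -LE.
Qed.

(** A partial sum of the inclusion-exclusion series for the density of having particles at [X] and
    no other particle in [E]. *)
Definition jalt M X := \sum_(m < M) (-1) ^+ m / m`!%:R * fine (jint E m X).

(** Integrating one more particle over the complement of [E] telescopes: by [LC] the coefficient of
    [L m] is [a - size X] times the old one, as [(-1) ^ m / m!] times [m] cancels the preceding
    coefficient. Only a boundary term of order [M] is left. *)
Let jalt_rec M X : mu.-integrable (~` E) (EFin \o (fun z => jalt M (z :: X))) /\
  \int[mu]_(z in ~` E) jalt M (z :: X) = (a - (size X)%:R) * jalt M X + M%:R * ((-1) ^+ M / M`!%:R) * L M X.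
Proof.
have mCE : measurable (~` E) by exact: measurableC.
elim: M => [|M [IH1 IH2]].
  split.
    have := @integrable0 _ _ R mu (~` E); apply: eq_integrable => // z _.
    by rewrite /= /jalt big_ord0.
  under eq_Rintegral do rewrite /jalt big_ord0.
  by rewrite /Rintegral integral0 /jalt big_ord0 mulr0 !mul0r addr0.
pose c : R := (-1) ^+ M / M`!%:R.
have JS Y : jalt M.+1 Y = jalt M Y + c * L M Y by rewrite /jalt big_ord_recr.
have i2 : mu.-integrable (~` E) (EFin \o (fun z => c * L M (z :: X))).
  by have := integrableZl mCE c (Lint M X); apply: eq_integrable => // z _; rewrite /= EFinM.
split.
  by have := integrableD mCE IH1 i2; apply: eq_integrable => // z _; rewrite /= JS EFinD.
under eq_Rintegral do rewrite JS.
rewrite RintegralD// IH2 (RintegralZl _ mCE (Lint M X)).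
have -> : \int[mu]_(z in ~` E) L M (z :: X) = (a - (M + size X)%:R) * L M X - L M.+1 X.
  by rewrite /Rintegral; under eq_integral do rewrite -LE; rewrite LC.
rewrite JS natrD.
have -> : (-1) ^+ M.+1 / M.+1`!%:R = - c / M.+1%:R :> R.
  by rewrite exprS factS natrM invfM /c mulN1r !mulNr mulrCA mulrC.
have M0 : M.+1%:R != 0 :> R by rewrite pnatr_eq0.
rewrite -/c [M.+1%:R * _]mulrC divfK//; ring.
Qed.

(** Induction on the number of particles that may still be added. By [jalt_rec], whose boundary term
    vanishes for [M > a], the sum at [X] times [a - size X] is an integral of the sums with one more
    particle outside [E]. Beyond [a] particles everything is zero. *)
Lemma jalt_ge0 M X : a < M%:R -> 0 <= jalt M X.
Proof.
move=> aM; have mCE : measurable (~` E) by exact: measurableC.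
have [n] := ubnP (M - size X)%N; elim: n X => // n IH X nX.
have [aX|aX] := ltP a (size X)%:R.
  rewrite /jalt big1// => m _; rewrite jint_vanish ?mulr0//.
  by apply: (lt_le_trans aX); rewrite ler_nat leq_addl.
have XM : (size X < M)%N by rewrite -(ltr_nat R); exact: le_lt_trans aM.
have [_] := jalt_rec M X; rewrite /L jint_vanish ?mulr0 ?addr0; last first.
  by apply: (lt_le_trans aM); rewrite ler_nat leq_addr.
move=> H.
have : 0 <= (a - (size X)%:R) * jalt M X.
  rewrite -H /Rintegral fine_ge0//; apply: integral_ge0 => z _; rewrite lee_fin.
  by apply: IH; rewrite /= subnS -ltnS prednK ?subn_gt0.
(* For [a = size X] the recursion says nothing, but then all terms with [m > 0] vanish and the sum
   is [f X]. *)
move: aX; rewrite le_eqVlt => /orP[/eqP aX _|aX]; last by rewrite pmulr_rge0 // subr_gt0.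
rewrite /jalt (bigD1 (Ordinal (leq_ltn_trans (leq0n _) XM)))//= big1 ?addr0.
  by rewrite jint0 expr0 fact0 divr1 mul1r /= f0.
move=> m m0; rewrite jint_vanish ?mulr0//.
rewrite -aX ltr_nat -[X in (X < _)%N]add0n ltn_add2r lt0n.
by apply: contra m0 => /eqP m0; apply/eqP/val_inj.
Qed.

End janossy.

Lemma kdetE (R : realType) (T : pointedType) (k : T -> T -> R[i]) l n : size l = n ->
  kdet k l = \det (\matrix_(i < n, j < n) k (nth point l i).1 (nth point l j).2).
Proof. by move=> <-. Qed.

Lemma normc_conj (R : realType) (z : R[i]) : normc z^* = normc z.
Proof. by case: z => a b /=; rewrite sqrrN. Qed.

(** * Janossy densities of projection kernels of finite rank *)

Section finite_rank.
Context d (T : measurableType d) (R : realType) (mu : {sigma_finite_measure set T -> \bar R}).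
Variables (N : nat) (phi : 'I_N -> T -> R[i]) (E : set T).
Hypotheses (mE : measurable E) (mphi : forall i, cmeasurable setT (phi i)).
Hypothesis phi_int : forall i, (\int[mu]_z (normc (phi i z) ^+ 2)%:E < +oo)%E.
Hypothesis phi_on : forall i j, Cint mu setT (fun z => phi i z * (phi j z)^*) = (i == j)%:R.
Local Notation k := (gram phi).

Let phi_ij i j : cintegrable mu setT (fun z => phi i z * (phi j z)^*).
Proof.
have ms n : measurable_fun setT (fun z => normc (phi n z) ^+ 2) by exact: measurable_normc_sqr.
apply: (@cintegrable_dom _ _ _ _ _ measurableT _ (fun z => normc (phi i z) ^+ 2 + normc (phi j z) ^+ 2)).
- by apply: cmeasurableM => //; exact: cmeasurable_conj.
- exact: measurable_funD.
- under eq_integral do rewrite EFinD.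
  rewrite ge0_integralD//; try exact/measurable_EFinP; try by move=> z _; rewrite lee_fin sqr_ge0.
  by rewrite lte_add_pinfty.
- move=> z _; rewrite normcMr normc_conj; set x := normc _; set y := normc _.
  by have := sqr_ge0 (x - y); have := sqr_ge0 x; have := sqr_ge0 y; rewrite sqrrB; lra.
Qed.

Let k_int x y : cintegrable mu setT (fun z => k x z * k z y) /\ Cint mu setT (fun z => k x z * k z y) = k x y.
Proof.
have E1 : (fun z => k x z * k z y) = (fun z => \sum_i \sum_j (phi i x * (phi j y)^*) * (phi j z * (phi i z)^*)).
  apply/funext => z; rewrite /gram big_distrlr /=; apply: eq_bigr => i _; apply: eq_bigr => j _; ring.
have I1 i := cintegrable_sum measurableT (index_enum _) xpredT (fun j => cintegrableZ measurableT (phi i x * (phi j y)^*) (phi_ij j i)).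
have [I2 C2] := cintegrable_sum measurableT (index_enum _) xpredT (fun i => (I1 i).1).
rewrite E1; split => //; rewrite C2 /gram; apply: eq_bigr => i _; rewrite (I1 i).2.
rewrite (bigD1 i)//= big1 ?addr0; first by rewrite CintZ// phi_on eqxx mulr1.
by move=> j ji; rewrite CintZ// phi_on (negbTE ji) mulr0.
Qed.

Let k_trace : cintegrable mu setT (fun z => k z z) /\ Cint mu setT (fun z => k z z) = N%:R.
Proof.
have [I1 C1] := cintegrable_sum measurableT (index_enum _) xpredT (fun i => phi_ij i i).
split => //; apply: (etrans C1); under eq_bigr do rewrite phi_on eqxx.
by rewrite sumr_const card_ord.
Qed.

(** The corner entry integrates to the trace [N]. Each row then contributes [- kdet k l]: by
    orthonormality the two border entries integrate to one entry of the kernel, and the sum becomes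
    a Laplace expansion. *)
Lemma kdet_int l : cintegrable mu setT (fun z => kdet k ((z, z) :: l)) /\
  Cint mu setT (fun z => kdet k ((z, z) :: l)) = (N%:R - (size l)%:R) * kdet k l.
Proof.
pose M := \matrix_(i < size l, j < size l) k (nth point l i).1 (nth point l j).2.
have E1 : (fun z => kdet k ((z, z) :: l)) = (fun z => kdet k l * k z z +
    \sum_(i < size l) \sum_(j < size l) - cofactor M i j * (k (nth point l i).1 z * k z (nth point l j).2)).
  apply/funext => z; rewrite kdet_bordered mulrC; congr (_ + _); rewrite -sumrN; apply: eq_bigr => i _.
  by rewrite -sumrN; apply: eq_bigr => j _; rewrite mulNr mulrC.
have I1 i := cintegrable_sum measurableT (index_enum _) xpredT (fun j : 'I_(size l) =>
  cintegrableZ measurableT (- cofactor M i j) (k_int (nth point l i).1 (nth point l j).2).1).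
have [I2 C2] := cintegrable_sum measurableT (index_enum _) xpredT (fun i => (I1 i).1).
have I3 := cintegrableZ measurableT (kdet k l) k_trace.1.
rewrite E1; split; first exact: cintegrableD.
rewrite CintD// CintZ ?k_trace.2 ?C2//; last exact: k_trace.1.
rewrite mulrBl mulrC; congr (_ + _).
rewrite (eq_bigr (fun=> - kdet k l)); last first.
  move=> i _; rewrite (I1 i).2 /kdet -/M (expand_det_row M i) -sumrN; apply: eq_bigr => j _.
by rewrite (CintZ measurableT _ (k_int _ _).1) (k_int _ _).2 mulNr mulrC mxE.
by rewrite sumr_const card_ord mulNrn mulr_natl.
Qed.

Lemma cmeasurable_kdet n p q X : cmeasurable setT (fun t : n.-tuple T => kdet k ((p, q) :: diag (t ++ X))).
Proof.
have mnth x i : measurable_fun setT (fun t : n.-tuple T => nth point (x :: t ++ X) i).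
  case: i => [|i] /=; first exact: measurable_cst.
  have [h|h] := ltnP i n.
    rewrite (_ : (fun _ => _) = (fun t : n.-tuple T => tnth t (Ordinal h))); first exact: measurable_tnth.
    by apply/funext => t; rewrite nth_cat size_tuple h (tnth_nth point).
  rewrite (_ : (fun _ => _) = (fun=> nth point X (i - n))); first exact: measurable_cst.
  by apply/funext => t; rewrite nth_cat size_tuple ltnNge h.
have E1 (t : n.-tuple T) : kdet k ((p, q) :: diag (t ++ X)) = \det (\matrix_(i < (n + size X).+1, j < (n + size X).+1)
    k (nth point (p :: t ++ X) i) (nth point (q :: t ++ X) j)) :> R[i].
    have st : size (t ++ X) = (n + size X)%N by rewrite size_cat size_tuple.
  rewrite (@kdetE _ _ _ _ (n + size X).+1); last by rewrite /= size_map st.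
  congr (\det _); apply/matrixP => i j; rewrite !mxE; congr (k _ _).
    case: i => -[|i] //= hi; rewrite (nth_map point)// st; exact: hi.
  case: j => -[|j] //= hj; rewrite (nth_map point)// st; exact: hj.
under eq_fun do rewrite E1.
apply: cmeasurable_det => i j; apply: cmeasurable_sum => a; apply: cmeasurableM.
  exact: cmeasurable_comp (mnth p i) (mphi a).
by apply: cmeasurable_conj; exact: cmeasurable_comp (mnth q j) (mphi a).
Qed.

Section positivity.
Variables (r : nat) (c : 'I_r -> R[i]) (p : 'I_r -> T).

(** The quadratic form, in the coefficients [c], of the determinants with border [(p a, p b)]. As a
    function of [Z] it obeys the rule [fI] with one unit of rank spent on the border, so [jalt_ge0]
    yields positive definiteness of [Galt]. *)
Definition kform Z := complex.Re (\sum_a \sum_b c a * (c b)^* * kdet k ((p a, p b) :: diag Z)).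

Lemma kform_ge0 Z : 0 <= kform Z.
Proof.
have [psi Hpsi _] := kdet_gram phi Z; rewrite /kform.
under eq_bigr do under eq_bigr do rewrite Hpsi.
by rewrite gram_form /= sumr_ge0// => i _; exact: sqr_ge0.
Qed.

Lemma kform_perm Z Z' : perm_eq Z Z' -> kform Z = kform Z'.
Proof.
move=> ZZ; rewrite /kform; congr (complex.Re _); apply: eq_bigr => a _; apply: eq_bigr => b _; congr (_ * _).
by apply: kdet_perm; rewrite perm_cons; exact: perm_map.
Qed.

Lemma measurable_kform n X : measurable_fun setT (fun t : n.-tuple T => kform (t ++ X)).
Proof.
have [] : cmeasurable setT (fun t : n.-tuple T => \sum_a \sum_b c a * (c b)^* * kdet k ((p a, p b) :: diag (t ++ X))) => //.
apply: cmeasurable_sum => a; apply: cmeasurable_sum => b; apply: cmeasurableM; first exact: cmeasurable_cst.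
exact: cmeasurable_kdet.
Qed.

Lemma kform_int Z : (\int[mu]_z (kform (z :: Z))%:E = ((N%:R - 1 - (size Z)%:R) * kform Z)%:E)%E.
Proof.
have swap x y z : kdet k ((x, y) :: diag (z :: Z)) = kdet k ((z, z) :: (x, y) :: diag Z).
  by apply: kdet_perm; exact: permEl (perm_catCA [:: (x, y)] [:: (z, z)] (diag Z)).
pose F z := \sum_a \sum_b c a * (c b)^* * kdet k ((z, z) :: (p a, p b) :: diag Z).
have I1 a := cintegrable_sum measurableT (index_enum _) xpredT (fun b =>
  cintegrableZ measurableT (c a * (c b)^*) (kdet_int ((p a, p b) :: diag Z)).1).
have [I2 C2] := cintegrable_sum measurableT (index_enum _) xpredT (fun a => (I1 a).1).
transitivity (\int[mu]_z (complex.Re (F z))%:E)%E.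
  apply: eq_integral => z _; congr (_%:E); congr (complex.Re _).
  by apply: eq_bigr => a _; apply: eq_bigr => b _; rewrite swap.
rewrite (Cint_Re measurableT I2) C2; congr (_%:E).
have Ere (x : R) (z : R[i]) : complex.Re (x%:C * z) = x * complex.Re z by case: z => u v /=; rewrite mul0r subr0.
rewrite -Ere; congr (complex.Re _); rewrite mulr_sumr; apply: eq_bigr => a _.
rewrite (I1 a).2 mulr_sumr; apply: eq_bigr => b _.
rewrite (CintZ measurableT _ (kdet_int _).1) (kdet_int _).2 /= size_map !rmorphB /= rmorph1 !rmorph_nat.
by rewrite mulrCA; congr (_ * _); rewrite -natr1; ring.
Qed.

Lemma kform_fin m X : (jint mu kform E m X < +oo)%E.
Proof.
by apply: (@jint_fin _ _ _ mu kform (N%:R - 1)) => //; [exact: kform_ge0|exact: kform_perm|exact: measurable_kform|exact: kform_int].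
Qed.

Lemma kalt_ge0 M X : (N <= M)%N -> 0 <= jalt mu kform E M X.
Proof.
move=> NM; apply: (@jalt_ge0 _ _ _ mu kform (N%:R - 1)) => //; [exact: kform_ge0|exact: kform_perm|exact: measurable_kform|exact: kform_int|].
by rewrite ltrBlDr natr1 ltr_nat ltnS.
Qed.

End positivity.

Lemma cintegrable_kdet m p q X : cintegrable (tuple_measure mu m) (tset E m) (fun t => kdet k ((p, q) :: diag (t ++ X))).
Proof.
have mEm : measurable (tset E m) by exact: measurable_tset.
pose g x Z := kform (fun _ : 'I_1 => 1) (fun _ => x) Z.
have gE x Z : g x Z = complex.Re (kdet k ((x, x) :: diag Z)) by rewrite /g /kform !big_ord1 rmorph1 !mul1r.
apply: (@cintegrable_dom _ _ _ _ _ mEm _ (fun t => g p (t ++ X) + g q (t ++ X))).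
- have [m1 m2] := @cmeasurable_kdet m p q X; split; [exact: measurable_funS m1|exact: measurable_funS m2].
- by apply: measurable_funD; apply: measurable_funS (@measurable_kform _ _ _ m X).
- under eq_integral do rewrite EFinD.
  rewrite ge0_integralD//.
  + by rewrite lte_add_pinfty// kform_fin.
  + by move=> t _; rewrite lee_fin kform_ge0.
  + by apply/measurable_EFinP; apply: measurable_funS (@measurable_kform _ _ _ m X).
  + by move=> t _; rewrite lee_fin kform_ge0.
  + by apply/measurable_EFinP; apply: measurable_funS (@measurable_kform _ _ _ m X).
- move=> t _; rewrite !gE; have [psi Hpsi _] := kdet_gram phi (t ++ X).
  rewrite !Hpsi !gram_diag /=.
  apply: (@le_trans _ _ (\sum_i (normc (psi i p) ^+ 2 + normc (psi i q) ^+ 2))); last by rewrite big_split.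
  rewrite /gram; elim/big_ind2: _ => [|x1 x2 y1 y2 h1 h2|i _]; first by rewrite normc0.
    by apply: (le_trans (normcD_le _ _)); exact: lerD.
  rewrite normcMr normc_conj; set x := normc _; set y := normc _.
  by have := sqr_ge0 (x - y); have := sqr_ge0 x; have := sqr_ge0 y; rewrite sqrrB; lra.
Qed.

(** The alternating Janossy sum at [p :: X], polarized in its first particle. *)
Definition Galt M p q X : R[i] := \sum_(m < M) ((-1) ^+ m / m`!%:R)%:C *
  Cint (tuple_measure mu m) (tset E m) (fun t => kdet k ((p, q) :: diag (t ++ X))).

Lemma Galt_form r (c : 'I_r -> R[i]) (p : 'I_r -> T) M X : (N <= M)%N ->
  0 <= complex.Re (\sum_a \sum_b c a * (c b)^* * Galt M (p a) (p b) X).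
Proof.
move=> NM; have := kalt_ge0 c p X NM; congr (0 <= _).
have Ere (x : R) (z : R[i]) : complex.Re (x%:C * z) = x * complex.Re z by case: z => u v /=; rewrite mul0r subr0.
have -> : \sum_a \sum_b c a * (c b)^* * Galt M (p a) (p b) X = \sum_(m < M) ((-1) ^+ m / m`!%:R)%:C *
    \sum_a \sum_b c a * (c b)^* * Cint (tuple_measure mu m) (tset E m) (fun t => kdet k ((p a, p b) :: diag (t ++ X))).
  under eq_bigr do under eq_bigr do rewrite /Galt mulr_sumr.
  under eq_bigr do rewrite exchange_big; rewrite exchange_big; apply: eq_bigr => m _ /=.
  by rewrite mulr_sumr; apply: eq_bigr => a _; rewrite mulr_sumr; apply: eq_bigr => b _; rewrite mulrCA.
rewrite (raddf_sum (@complex.Re R)) /jalt; apply: eq_bigr => m _; rewrite [RHS]Ere; congr (_ * _).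
have mEm : measurable (tset E m) by exact: measurable_tset.
have I1 a := cintegrable_sum mEm (index_enum _) xpredT (fun b =>
  cintegrableZ mEm (c a * (c b)^*) (@cintegrable_kdet m (p a) (p b) X)).
have [I2 C2] := cintegrable_sum mEm (index_enum _) xpredT (fun a => (I1 a).1).
rewrite /jint (Cint_Re mEm I2) C2 /=; congr (complex.Re _).
apply: eq_bigr => a _; rewrite (I1 a).2; apply: eq_bigr => b _.
by rewrite (CintZ mEm _ (@cintegrable_kdet m (p a) (p b) X)).
Qed.

Lemma Galt_conj M p q X : Galt M q p X = (Galt M p q X)^*.
Proof.
have mEm m : measurable (tset E m) by exact: measurable_tset.
have E1 m : Cint (tuple_measure mu m) (tset E m) (fun t => kdet k ((q, p) :: diag (t ++ X))) =
    (Cint (tuple_measure mu m) (tset E m) (fun t => kdet k ((p, q) :: diag (t ++ X))))^*.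
  rewrite -(Cint_conj (mEm m) (@cintegrable_kdet m p q X)); apply: eq_Cint => t _.
  by have [psi Hpsi _] := kdet_gram phi (t ++ X); rewrite !Hpsi gram_conj.
rewrite /Galt rmorph_sum; apply: eq_bigr => m _; rewrite E1 [in RHS]rmorphM; congr (_ * _).
by apply/eqP; rewrite eq_complex /= oppr0 !eqxx.
Qed.

Lemma Galt_diag M p X : (N <= M)%N -> 0 <= complex.Re (Galt M p p X) /\ Galt M p p X = (complex.Re (Galt M p p X))%:C.
Proof.
move=> NM; split.
  by have := Galt_form (fun _ : 'I_1 => 1) (fun _ => p) X NM; rewrite !big_ord1 rmorph1 !mul1r.
have := Galt_conj M p p X; case: (Galt M p p X) => a b /eqP; rewrite eq_complex /= => /andP[_ /eqP bb].
by apply/eqP; rewrite eq_complex /= eqxx; apply/eqP; lra.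
Qed.

Lemma Galt_cauchy_schwarz M p q X : (N <= M)%N ->
  normc (Galt M p q X) ^+ 2 <= complex.Re (Galt M p p X) * complex.Re (Galt M q q X).
Proof.
move=> NM; apply: psd_cauchy_schwarz => c1 c2.
have sum2 (F : 'I_2 -> 'I_2 -> R[i]) : \sum_a \sum_b F a b = F ord0 ord0 + F ord0 (lift ord0 ord0) +
    (F (lift ord0 ord0) ord0 + F (lift ord0 ord0) (lift ord0 ord0)).
  by rewrite !big_ord_recl !big_ord0 !addr0.
have [c [y [c0 c1' y0 y1]]] : exists (c : 'I_2 -> R[i]) (y : 'I_2 -> T),
    [/\ c ord0 = c1, c (lift ord0 ord0) = c2, y ord0 = p & y (lift ord0 ord0) = q].
  by exists (fun i => if i == ord0 then c1 else c2), (fun i => if i == ord0 then p else q).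
have := Galt_form c y X NM; rewrite sum2 c0 c1' y0 y1.
have [_ Ep] := Galt_diag p X NM; have [_ Eq] := Galt_diag q X NM.
rewrite (Galt_conj M p q) {1}Ep {1}Eq !mulr_conj; move: (Galt M p q X) (Galt M p p X) (Galt M q q X) => J A B; congr (0 <= _).
rewrite !normc_sqr; move: (c1) (c2) => -[a1 b1] [a2 b2] {c0 c1' c1 c2}; case: J A B => u v [uA vA] [uB vB] /=; ring.
Qed.

(** Determinants are linear in a row. Together with an interpolation formula for the [phi i], this
    exhibits the dependence on [p] as a finite combination of the interpolating functions, which
    will be holomorphic up to the weight. *)
Lemma Galt_span I (s : seq I) (y : I -> T) (l : I -> R[i]) M p q X :
  (forall i, phi i p = \sum_(a <- s) l a * phi i (y a)) ->
  Galt M p q X = \sum_(a <- s) l a * Galt M (y a) q X.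
Proof.
move=> phil.
have kp t : k p t = \sum_(a <- s) l a * k (y a) t.
  rewrite /gram; under eq_bigr do rewrite phil mulr_suml.
  by rewrite exchange_big; apply: eq_bigr => a _; rewrite mulr_sumr; apply: eq_bigr => i _; rewrite mulrA.
under [RHS]eq_bigr do rewrite /Galt mulr_sumr.
rewrite exchange_big; apply: eq_bigr => m _ /=.
have mEm : measurable (tset E m) by exact: measurable_tset.
under [RHS]eq_bigr do rewrite mulrCA; rewrite -mulr_sumr; congr (_ * _).
have [_ C] := cintegrable_sum mEm s xpredT (fun a => cintegrableZ mEm (l a) (@cintegrable_kdet m (y a) q X)).
transitivity (Cint (tuple_measure mu m) (tset E m) (fun t => \sum_(a <- s) l a * kdet k ((y a, q) :: diag (t ++ X)))).
  by apply: eq_Cint => t _; exact: kdet_row_lin.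
rewrite C; apply: eq_bigr => a _; rewrite CintZ//; exact: cintegrable_kdet.
Qed.

End finite_rank.

(** * The Bergman space *)

Section bergman_space.
Context (R : realType) (d : nat).
Local Notation V := (Clebesgue R d).
Local Notation Cd := 'rV[R[i]]_d.
Local Notation RR := (measurableTypeR R).

Lemma measurable_fun_continuous_at (D : set Cd) (g : Cd -> R) : open D -> (forall z, D z -> {for z, continuous g}) ->
  measurable_fun (D : set (Cspace R d)) (g : Cspace R d -> RR).
Proof.
move=> oD cg; apply: (measurability _ (RGenOpens.measurableE R)).
move=> _ [_ [a [b ->]] <-]; apply: measurable_open; rewrite openE => z [Dz gz].
apply: filterI; first exact: open_nbhs_nbhs.
by apply: (cg z Dz); apply: open_nbhs_nbhs; split => //; exact: interval_open.
Qed.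

Variables (U : set Cd) (w : Cd -> R).
Hypotheses (oU : open U) (mw : measurable_fun (U : set (Cspace R d)) (w : Cspace R d -> R)).
Hypotheses (w0 : forall z, U z -> 0 < w z)
  (wi : forall (B : set (Cspace R d)) (mB : measurable B),
      relatively_compact U B -> (0 < V B)%E ->
      (0 < ess_inf (mrestr V mB) (fun z => (w z)%:E))%E).
Local Notation A2 := (bergman U w).
Implicit Types f g h : Cd -> R[i].

Let mU : measurable (U : set (Cspace R d)).
Proof. exact: measurable_open. Qed.

(** The isometry from the weighted space on [U] to the plain square-integrable functions on the
    whole space. *)
Definition wt f (z : Cspace R d) : R[i] := if (z : Cd) \in U then f z * (Num.sqrt (w z))%:C else 0.

Lemma cmeasurable_holo f : holomorphic_on U f -> cmeasurable (U : set (Cspace R d)) (f : Cspace R d -> R[i]).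
Proof.
move=> hf; split; apply: measurable_fun_continuous_at => // z Uz; apply: continuous_comp;
  by [exact: differentiable_continuous (hf z Uz)|exact: continuous_Re|exact: continuous_Im].
Qed.

Lemma cmeasurable_wt f : holomorphic_on U f -> cmeasurable setT (wt f).
Proof.
move=> hf; have ms : measurable_fun (U : set (Cspace R d)) (fun z : Cspace R d => Num.sqrt (w z)).
  apply: (measurableT_comp _ mw); apply: continuous_measurable_fun; exact: sqrt_continuous.
have [m1 m2] := cmeasurableM (cmeasurable_holo hf) (cmeasurable_real ms).
split.
  have /(measurable_restrictT _ mU) := m1; congr (measurable_fun _ _).
  by apply/funext => z; rewrite patchE /wt; case: ifP.
have /(measurable_restrictT _ mU) := m2; congr (measurable_fun _ _).
by apply/funext => z; rewrite patchE /wt; case: ifP.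
Qed.

Lemma normc_wt f z : U z -> normc (wt f z) ^+ 2 = normc (f z) ^+ 2 * w z.
Proof.
move=> Uz; rewrite /wt mem_set// normcMr exprMn; congr (_ * _).
by rewrite normc_sqr /= expr0n addr0 sqr_sqrtr// ltW// w0.
Qed.

Lemma wt_int f : (\int[V]_z (normc (wt f z) ^+ 2)%:E = \int[V]_(z in (U : set (Cspace R d))) (normc (f z) ^+ 2 * w z)%:E)%E.
Proof.
rewrite [RHS]integral_mkcond; apply: eq_integral => z _; rewrite patchE.
case: ifPn => [|zU]; first by rewrite inE => Uz; rewrite normc_wt.
by rewrite /wt (negbTE zU) normc0 expr0n.
Qed.

Lemma wtM_integrable f g : A2 f -> A2 g -> cintegrable V setT (fun z => wt f z * (wt g z)^*).
Proof.
move=> [hf nf] [hg ng]; have cf := cmeasurable_wt hf; have cg := cmeasurable_wt hg.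
have m1 := measurable_normc_sqr cf; have m2 := measurable_normc_sqr cg.
apply: (@cintegrable_dom _ _ _ _ _ measurableT _ (fun z => normc (wt f z) ^+ 2 + normc (wt g z) ^+ 2)).
- by apply: cmeasurableM => //; exact: cmeasurable_conj.
- exact: measurable_funD.
- under eq_integral do rewrite EFinD.
  rewrite ge0_integralD//; try exact/measurable_EFinP; try by move=> z _; rewrite lee_fin sqr_ge0.
  by rewrite !wt_int lte_add_pinfty.
- move=> z _; rewrite normcMr (_ : normc (wt g z)^* = normc (wt g z)); last by case: (wt g z) => a b /=; rewrite sqrrN.
  set x := normc _; set y := normc _.
  by have := sqr_ge0 (x - y); have := sqr_ge0 x; have := sqr_ge0 y; rewrite sqrrB; lra.
Qed.

Definition ip f g : R[i] := Cint V setT (fun z => wt f z * (wt g z)^*).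

Lemma ipE f g : ip f g = bergman_dot U w f g.
Proof.
have E1 z : U z -> wt f z * (wt g z)^* = f z * (g z)^* * (w z)%:C.
  move=> Uz; rewrite /wt mem_set// rmorphM /=.
  have -> : (Num.sqrt (w z))%:C^* = (Num.sqrt (w z))%:C :> R[i] by apply/eqP; rewrite eq_complex /= oppr0 !eqxx.
  by rewrite mulrACA -rmorphM /= -expr2 sqr_sqrtr// ltW// w0.
rewrite /ip /Cint /bergman_dot; congr (_ +i* _); rewrite /Rintegral; congr fine.
  rewrite [RHS]integral_mkcond; apply: eq_integral => z _; rewrite patchE.
  case: ifPn => [|zU]; first by rewrite inE => Uz; rewrite E1//; case: (f z * _) => a b /=; rewrite mulr0 subr0.
  by rewrite /wt (negbTE zU) mul0r.
rewrite [RHS]integral_mkcond; apply: eq_integral => z _; rewrite patchE.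
case: ifPn => [|zU]; first by rewrite inE => Uz; rewrite E1//; case: (f z * _) => a b /=; rewrite mulr0 add0r.
by rewrite /wt (negbTE zU) mul0r.
Qed.

Lemma holomorphic_onD f g : holomorphic_on U f -> holomorphic_on U g -> holomorphic_on U (fun z => f z + g z).
Proof. by move=> hf hg z Uz; apply: differentiableD; [exact: hf|exact: hg]. Qed.

Lemma holomorphic_onZ c f : holomorphic_on U f -> holomorphic_on U (fun z => c * f z).
Proof. by move=> hf z Uz; apply: differentiableM; [exact: differentiable_cst|exact: hf]. Qed.

Let nw_ge0 f z : U z -> 0 <= normc (f z) ^+ 2 * w z.
Proof. by move=> Uz; rewrite mulr_ge0 ?sqr_ge0 ?(ltW (w0 Uz)). Qed.

Lemma bergmanZ c f : A2 f -> A2 (fun z => c * f z).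
Proof.
move=> [hf nf]; split; first exact: holomorphic_onZ.
have mf := measurable_normc_sqr (cmeasurable_holo hf).
rewrite (eq_integral (fun z : Cspace R d => ((normc c ^+ 2)%:E * (normc (f z) ^+ 2 * w z)%:E)%E)).
  rewrite ge0_integralZl//.
  - by rewrite lte_mul_pinfty ?lee_fin ?sqr_ge0.
  - by apply/measurable_EFinP; exact: measurable_funM.
  - by move=> z Uz; rewrite lee_fin mulr_ge0 ?sqr_ge0// ltW// w0.
  - by rewrite lee_fin sqr_ge0.
by move=> z _; rewrite -EFinM mulrA -exprMn -normcMr.
Qed.

Lemma bergmanD f g : A2 f -> A2 g -> A2 (fun z => f z + g z).
Proof.
move=> [hf nf] [hg ng]; split; first exact: holomorphic_onD.
have mf := measurable_normc_sqr (cmeasurable_holo hf); have mg := measurable_normc_sqr (cmeasurable_holo hg).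
have mfg := measurable_normc_sqr (cmeasurable_holo (holomorphic_onD hf hg)).
apply: (@le_lt_trans _ _ (2%:E * (\int[V]_(z in (U : set (Cspace R d))) (normc (f z) ^+ 2 * w z)%:E +
   \int[V]_(z in (U : set (Cspace R d))) (normc (g z) ^+ 2 * w z)%:E))%E).
  rewrite -ge0_integralD//; last 4 first.
  - by move=> z Uz; rewrite lee_fin mulr_ge0 ?sqr_ge0// ltW// w0.
  - by apply/measurable_EFinP; exact: measurable_funM.
  - by move=> z Uz; rewrite lee_fin mulr_ge0 ?sqr_ge0// ltW// w0.
  - by apply/measurable_EFinP; exact: measurable_funM.
  rewrite -ge0_integralZl//; last 2 first.
  - by apply: emeasurable_funD; apply/measurable_EFinP; exact: measurable_funM.
  - by move=> z Uz; rewrite /= -EFinD lee_fin; apply: addr_ge0; exact: nw_ge0.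
  apply: ge0_le_integral => //.
  - by move=> z Uz; rewrite lee_fin mulr_ge0 ?sqr_ge0// ltW// w0.
  - by apply/measurable_EFinP; exact: measurable_funM.
  - by apply: measurable_funeM; apply: emeasurable_funD; apply/measurable_EFinP; exact: measurable_funM.
  move=> z Uz; rewrite -EFinD -EFinM lee_fin -mulrDl mulrA; apply: ler_wpM2r; first by rewrite ltW// w0.
  rewrite !normc_sqr !raddfD /=; set a := complex.Re _; set b := complex.Re _; set a' := complex.Im _; set b' := complex.Im _.
  by have := sqr_ge0 (a - b); have := sqr_ge0 (a' - b'); rewrite !sqrrB !sqrrD; lra.
by rewrite lte_mul_pinfty// lte_add_pinfty.
Qed.

Lemma bergmanB f g : A2 f -> A2 g -> A2 (fun z => f z - g z).
Proof.
move=> Af Ag; have := bergmanD Af (bergmanZ (-1) Ag).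
by congr bergman; apply/funext => z; rewrite mulN1r.
Qed.

Let wtD f g z : wt (fun z => f z + g z) z = wt f z + wt g z.
Proof. by rewrite /wt; case: ifP; rewrite ?mulrDl ?addr0. Qed.

Let wtZ c f z : wt (fun z => c * f z) z = c * wt f z.
Proof. by rewrite /wt; case: ifP; rewrite ?mulrA ?mulr0. Qed.

Lemma ipDl f g h : A2 f -> A2 g -> A2 h -> ip (fun z => f z + g z) h = ip f h + ip g h.
Proof.
move=> Af Ag Ah; rewrite /ip -CintD//; try exact: wtM_integrable.
by apply: eq_Cint => z _; rewrite wtD mulrDl.
Qed.

Lemma ipZl c f h : A2 f -> A2 h -> ip (fun z => c * f z) h = c * ip f h.
Proof.
move=> Af Ah; rewrite /ip -CintZ//; try exact: wtM_integrable.
by apply: eq_Cint => z _; rewrite wtZ mulrA.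
Qed.

Lemma ip_conj f g : A2 f -> A2 g -> ip g f = (ip f g)^*.
Proof.
move=> Af Ag; rewrite /ip -Cint_conj//; last exact: wtM_integrable.
by apply: eq_Cint => z _; rewrite rmorphM /= conjCK mulrC.
Qed.

Lemma ipBl f g h : A2 f -> A2 g -> A2 h -> ip (fun z => f z - g z) h = ip f h - ip g h.
Proof.
move=> Af Ag Ah; have := ipDl Af (bergmanZ (-1) Ag) Ah; rewrite (ipZl (-1) Ag Ah) mulN1r => <-.
by congr ip; apply/funext => z; rewrite mulN1r.
Qed.

Lemma ipZr c f h : A2 f -> A2 h -> ip h (fun z => c * f z) = c^* * ip h f.
Proof.
move=> Af Ah; rewrite (ip_conj (bergmanZ c Af) Ah) ipZl// rmorphM /=; congr (_ * _).
by rewrite -ip_conj.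
Qed.

Lemma ipBr f g h : A2 f -> A2 g -> A2 h -> ip h (fun z => f z - g z) = ip h f - ip h g.
Proof.
move=> Af Ag Ah; rewrite (ip_conj (bergmanB Af Ag) Ah) ipBl// rmorphB /=.
by rewrite -!ip_conj.
Qed.

Lemma ip_norm f : A2 f -> (\int[V]_(z in (U : set (Cspace R d))) (normc (f z) ^+ 2 * w z)%:E = (complex.Re (ip f f))%:E)%E.
Proof.
move=> Af; rewrite -wt_int /ip -Cint_Re//; last exact: wtM_integrable.
by apply: eq_integral => z _; rewrite mulr_conj.
Qed.

(** [normc f ^ 2] is itself log-submean: [holo_submean] applies to [f z * (f q')^*], with equality
    in its hypothesis. The pointwise bound by a mass on a compact set and the lower bound of [w]
    there then give the norm. *)
Lemma point_bound (B : set Cd) : compact B -> B `<=` U -> exists2 C : R, 0 <= C &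
  forall f q, A2 f -> B q -> normc (f q) ^+ 2 <= C * complex.Re (ip f f).
Proof.
move=> cB BU; have [K [C [cK KU C0 HC]]] := log_submean_bound oU cB BU.
have [c c0 cw] := weight_lower wi cK KU.
have mK : measurable (K : set (Cspace R d)) by apply: measurable_closed; exact: compact_closed.
exists (C * c^-1); first by rewrite mulr_ge0// invr_ge0 ltW.
move=> f q Af Bq; have [hf nf] := Af; pose u z := normc (f z) ^+ 2.
have mu := measurable_normc_sqr (cmeasurable_holo hf).
have key (K' : set Cd) c' : compact K' -> K' `<=` U -> 0 < c' -> {ae V, forall z : Cspace R d, (K' : set Cd) z -> c' <= w z} ->
    (\int[V]_(z in (K' : set (Cspace R d))) (u z)%:E <= (c'^-1 * complex.Re (ip f f))%:E)%E.
  move=> cK' KU' c'0 cw'; have mK' : measurable (K' : set (Cspace R d)) by apply: measurable_closed; exact: compact_closed.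
  rewrite EFinM -ip_norm// -ge0_integralZl ?lee_fin ?invr_ge0 ?(ltW c'0)//; last 2 first.
  - by apply/measurable_EFinP; exact: measurable_funM.
  - by move=> z Uz; rewrite lee_fin mulr_ge0 ?sqr_ge0// ltW// w0.
  apply: (@le_trans _ _ (\int[V]_(z in (K' : set (Cspace R d))) ((c'^-1)%:E * (normc (f z) ^+ 2 * w z)%:E))%E); last first.
    apply: ge0_subset_integral => //.
    - by apply: measurable_funeM; apply/measurable_EFinP; exact: measurable_funM.
    - by move=> z Uz; rewrite /= mule_ge0 ?lee_fin ?nw_ge0 ?invr_ge0 ?(ltW c'0).
  apply: ae_ge0_le_integral => //.
  - by move=> z _; rewrite lee_fin sqr_ge0.
  - by apply/measurable_EFinP; apply: measurable_funS mu.
  - by move=> z /KU' Uz; rewrite /= mule_ge0 ?lee_fin ?nw_ge0 ?invr_ge0 ?(ltW c'0).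
  - apply: measurable_funeM; apply/measurable_EFinP; apply: measurable_funM; [exact: measurable_funS mu|exact: measurable_funS mw].
  apply: filterS cw' => z cz Kz; rewrite -EFinM lee_fin mulrCA -[leLHS]mulr1 ler_wpM2l ?sqr_ge0//.
  by rewrite mulrC ler_pdivlMr// mul1r cz.
have lu : locint U u.
  split => // [z _|K' cK' KU']; first exact: sqr_ge0.
  have [c' c'0 cw'] := weight_lower wi cK' KU'.
  exact: le_lt_trans (key K' c' cK' KU' c'0 cw') (ltry _).
have su : log_submean U u.
  split => // [z _|q' r r0 DU]; first exact: sqr_ge0.
  have DU' : pdisc q' r `<=` U by apply: subset_trans DU; exact: subset_closure.
  apply: (@holo_submean _ _ (fun z => f z * (f q')^*)) => //.
  - move=> z /DU' Uz; apply: differentiableM; [exact: hf|exact: differentiable_cst].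
  - by apply: measurable_funS mu.
  - by move=> z _; exact: sqr_ge0.
  - by move=> z _; rewrite normcMr exprMn /u; case: (f q') => a b /=; rewrite sqrrN.
  - by rewrite mulr_conj /u /= expr0n addr0 sqrtr_sqr ger0_norm// sqr_ge0.
apply: (le_trans (HC u q su lu Bq)); rewrite -mulrA ler_wpM2l// -lee_fin -(JintE oU cK KU lu mK)//.
exact: key.
Qed.

Lemma ip_real f : A2 f -> ip f f = (complex.Re (ip f f))%:C.
Proof.
move=> Af; have := ip_conj Af Af; case: (ip f f) => a b /eqP; rewrite eq_complex /= => /andP[_ /eqP bb].
by apply/eqP; rewrite eq_complex /= eqxx; apply/eqP; lra.
Qed.

Lemma ip_ge0 f : A2 f -> 0 <= complex.Re (ip f f).
Proof.
move=> Af; rewrite -lee_fin -ip_norm//; apply: integral_ge0 => z Uz.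
by rewrite lee_fin mulr_ge0 ?sqr_ge0 ?(ltW (w0 Uz)).
Qed.

Section residual.
Variable K : Cd -> Cd -> R[i].
Hypothesis hK : reproducing_kernel U w K.

(* The span of a finite orthonormal list [Phi], its residual kernel [e] and an interpolation
   formula [phi p = \sum_(a <- L) a.2 p * phi a.1] valid on that span. *)
Record approximant := Approximant { onb : seq (Cd -> R[i]); res : Cd -> Cd -> R[i]; interp : seq (Cd * (Cd -> R[i])) }.

Let ph (s : approximant) i := nth (fun=> 0) (onb s) i.

(** [res s] acts as the reproducing kernel of the orthogonal complement of the span, hence [res_K]
    and [res_ip]. Its vanishing at the nodes, [interp_res], makes every function added later vanish
    there, which lets the interpolation formula be extended. *)
Record approximant_spec (s : approximant) : Prop := ApproximantSpec {
  onb_A2 : forall i, (i < size (onb s))%N -> A2 (ph s i);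
  onb_ip : forall i j, (i < size (onb s))%N -> (j < size (onb s))%N -> ip (ph s i) (ph s j) = (i == j)%:R;
  res_A2 : forall x, U x -> A2 (res s ^~ x);
  res_K : forall z x, K z x = res s z x + \sum_(i < size (onb s)) ph s i z * (ph s i x)^*;
  res_onb : forall i x, (i < size (onb s))%N -> U x -> ip (ph s i) (res s ^~ x) = 0;
  res_ip : forall x y, U x -> U y -> ip (res s ^~ x) (res s ^~ y) = res s y x;
  interp_pt : forall a, a \in interp s -> U a.1;
  interp_holo : forall a, a \in interp s -> holomorphic_on U a.2;
  interp_res : forall a x, a \in interp s -> U x -> res s a.1 x = 0;
  interp_onb : forall i p, (i < size (onb s))%N -> ph s i p = \sum_(a <- interp s) a.2 p * ph s i a.1 }.

Definition approximant0 := Approximant [::] K [::].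

Lemma approximant0P : approximant_spec approximant0.
Proof.
split => //=.
- by move=> x Ux; have [] := hK Ux.
- by move=> z x; rewrite big_ord0 addr0.
- by move=> x y Ux Uy; have [Ax _] := hK Ux; have [_ H] := hK Uy; rewrite ipE -H.
Qed.

(** The new node [y] receives the function [phi p / phi y], and the old interpolating functions are
    corrected so as to vanish at [y]. *)
Definition approximant_extend (s : approximant) (y : Cd) (phi : Cd -> R[i]) : approximant :=
  Approximant (rcons (onb s) phi) (fun z x => res s z x - (phi x)^* * phi z)
   (rcons [seq (a.1, fun p => a.2 p - a.2 y * (phi p / phi y)) | a <- interp s] (y, fun p => phi p / phi y)).

(** A Gram-Schmidt step: [res s ^~ y] is the component of the kernel function at [y] orthogonal to
    the span, with squared norm [res s y y]. A zero norm means that there is nothing to add. *)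
Definition approximant_step (s : approximant) (y : Cd) : approximant :=
  if res s y y == 0 then s else
  approximant_extend s y (fun z => ((Num.sqrt (complex.Re (res s y y)))^-1)%:C * res s z y).

Lemma res_conj s x y : approximant_spec s -> U x -> U y -> res s x y = (res s y x)^*.
Proof. by move=> S Ux Uy; rewrite -!(res_ip S)//; apply: ip_conj; exact: (res_A2 S). Qed.

Lemma approximant_stepP s y : U y -> approximant_spec s -> approximant_spec (approximant_step s y).
Proof.
move=> Uy S; rewrite /approximant_step; case: ifPn => [_|ey]; first exact: S.
have Ay := res_A2 S Uy.
have eyr : res s y y = (complex.Re (res s y y))%:C by rewrite -(res_ip S Uy Uy); exact: ip_real.
set r := complex.Re (res s y y) in eyr *.
have r0 : 0 < r.
  rewrite lt0r -(inj_eq (@complexI R)) -eyr ey /=.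
  by have := ip_ge0 Ay; rewrite (res_ip S Uy Uy).
set q := (Num.sqrt r)^-1; have q0 : 0 < q by rewrite invr_gt0 sqrtr_gt0.
have qq : q ^+ 2 * r = 1 by rewrite exprVn sqr_sqrtr ?ltW// mulVf// gt_eqF.
have qc : (q%:C : R[i])^* = q%:C by apply/eqP; rewrite eq_complex /= oppr0 !eqxx.
pose phi z := q%:C * res s z y; rewrite -/phi.
have Aphi : A2 phi by exact: bergmanZ.
have py : phi y != 0 by rewrite /phi mulf_neq0// (inj_eq (@complexI R)) gt_eqF.
have cphi x : U x -> (phi x)^* = q%:C * res s y x by move=> Ux; rewrite /phi rmorphM /= qc -(res_conj S Uy Ux).
have pp : ip phi phi = 1.
  rewrite (ipZl q%:C Ay Aphi) (ipZr q%:C Ay Ay) qc (res_ip S Uy Uy) eyr -!rmorphM /= mulrA -expr2 qq.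
  by [].
have ip1 i : (i < size (onb s))%N -> ip (ph s i) phi = 0.
  by move=> hi; rewrite (ipZr q%:C Ay (onb_A2 S hi)) (res_onb S hi Uy) mulr0.
have ip2 i : (i < size (onb s))%N -> ip phi (ph s i) = 0.
  by move=> hi; rewrite (ip_conj (onb_A2 S hi) Aphi) ip1// conjC0.
have ip3 x : U x -> ip phi (res s ^~ x) = phi x.
  by move=> Ux; rewrite (ipZl q%:C Ay (res_A2 S Ux)) (res_ip S Uy Ux).
have An x : U x -> A2 (fun z => res s z x - (phi x)^* * phi z).
  by move=> Ux; apply: bergmanB; [exact: (res_A2 S)|exact: bergmanZ].
have phn i : (i < size (onb s))%N -> nth (fun=> 0) (rcons (onb s) phi) i = ph s i by move=> hi; rewrite nth_rcons hi.
have phl : nth (fun=> 0) (rcons (onb s) phi) (size (onb s)) = phi by rewrite nth_rcons ltnn eqxx.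
have ltS i : (i < (size (onb s)).+1)%N -> i = size (onb s) \/ (i < size (onb s))%N.
  by rewrite ltnS leq_eqVlt => /orP[/eqP ->|]; [left|right].
split; rewrite /approximant_extend /= ?size_rcons /ph /=.
- by move=> i /ltS[->|hi]; [rewrite phl|rewrite phn//; exact: (onb_A2 S)].
- move=> i j /ltS[->|hi] /ltS[->|hj]; rewrite ?phl ?phn//.
  + by rewrite eqxx.
  + by rewrite ip2// eq_sym (ltn_eqF hj).
  + by rewrite ip1// (ltn_eqF hi).
  + exact: (onb_ip S).
- exact: An.
- move=> z x; rewrite big_ord_recr /= phl (res_K S) -addrA; congr (_ + _).
    rewrite (eq_bigr (fun i : 'I_(size (onb s)) => nth (fun=> 0) (rcons (onb s) phi) i z * (nth (fun=> 0) (rcons (onb s) phi) i x)^*)).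
    by rewrite addrC -addrA [phi z * _]mulrC subrr addr0.
  by move=> i _; rewrite phn.
- move=> i x /ltS[->|hi] Ux; rewrite ?phl ?phn//.
    by rewrite (ipBr (res_A2 S Ux) (bergmanZ _ Aphi) Aphi) ip3// (ipZr _ Aphi Aphi) pp mulr1 conjCK subrr.
  rewrite (ipBr (res_A2 S Ux) (bergmanZ _ Aphi) (onb_A2 S hi)) (res_onb S hi Ux) (ipZr _ Aphi (onb_A2 S hi)).
  by rewrite ip1// mulr0 subr0.
- move=> x z Ux Uz; rewrite (ipBl (res_A2 S Ux) (bergmanZ _ Aphi) (An _ Uz)) (ipZl _ Aphi (An _ Uz)).
  rewrite (ipBr (res_A2 S Uz) (bergmanZ _ Aphi) (res_A2 S Ux)) (ipBr (res_A2 S Uz) (bergmanZ _ Aphi) Aphi).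
  rewrite (res_ip S Ux Uz) (ipZr _ Aphi (res_A2 S Ux)) (ipZr _ Aphi Aphi) pp mulr1 conjCK ip3// subrr mulr0 subr0.
  by rewrite (ip_conj Aphi (res_A2 S Ux)) ip3// mulrC.
- move=> a; rewrite mem_rcons inE => /orP[/eqP ->|/mapP[b hb ->]] //=; exact: (interp_pt S).
- have hq : holomorphic_on U (fun p => phi p / phi y).
    move=> z Uz; apply: differentiableM; last exact: differentiable_cst.
    by have [h _] := Aphi; exact: h.
    move=> a; rewrite mem_rcons inE => /orP[/eqP ->|/mapP[b hb ->]]; first exact: hq.
  move=> z Uz; apply: differentiableB; first exact: (interp_holo S hb).
  by apply: differentiableM; [exact: differentiable_cst|exact: hq].
- move=> a x; rewrite mem_rcons inE => /orP[/eqP ->|/mapP[b hb ->]] /= Ux.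
    rewrite cphi// /phi mulrACA [X in _ - X](_ : _ = (q ^+ 2 * r)%:C * res s y x); last first.
      by rewrite expr2 !rmorphM /= -eyr; ring.
    by rewrite qq mul1r subrr.
  rewrite (interp_res S hb Ux) /phi (interp_res S hb Uy) !mulr0 subrr.
  by [].
- move=> i p /ltS[->|hi]; rewrite ?phl ?phn//.
    rewrite -cats1 big_cat big_seq1 big_map /= divfK// big1_seq ?add0r// => a /andP[_ ha].
    by rewrite /phi (interp_res S ha Uy) !mulr0.
  rewrite -cats1 big_cat big_seq1 big_map /=.
  under [X in _ = X + _]eq_bigr do rewrite mulrBl.
  rewrite sumrB -(interp_onb S p hi) (interp_onb S y hi) mulr_sumr.
  rewrite [X in _ = _ - X + _](_ : _ = \sum_(a <- interp s) phi p / phi y * (a.2 y * ph s i a.1)); first by rewrite subrK.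
  by apply: eq_bigr => a _; ring.
Qed.

End residual.

End bergman_space.

(** * Convergence of finite-rank kernels *)

Section kernel_convergence.
Context (R : realType) (d : nat).
Local Notation V := (Clebesgue R d).
Local Notation Cd := 'rV[R[i]]_d.

Definition ratpt (q : d.-tuple (rat * rat)) : Cd := \row_j (ratr (tnth q j).1 +i* ratr (tnth q j).2).

Lemma ratpt_dense (x : Cd) (r : R) : 0 < r -> exists q, pdisc x r (ratpt q).
Proof.
move=> r0; have h (a : R) : {q : rat | `|ratr q - a| < r / 2}.
  apply/cid; have [] := @rat_in_itvoo R (a - r / 2) (a + r / 2); first lra.
  by move=> q; rewrite in_itv/= -ltr_distl; exists q.
exists [tuple (sval (h (complex.Re (x ord0 j))), sval (h (complex.Im (x ord0 j)))) | j < d] => j.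
rewrite !mxE tnth_mktuple /=.
have := @normC_ReIm_lt R (ratr (sval (h (complex.Re (x ord0 j)))) +i* ratr (sval (h (complex.Im (x ord0 j)))) - x ord0 j) r.
rewrite normcE ltcR; apply; rewrite raddfB /=; first by case: (h _).
by case: (h (complex.Im _)).
Qed.

Variables (U : set Cd) (w : Cd -> R).
Hypotheses (oU : open U) (mw : measurable_fun (U : set (Cspace R d)) (w : Cspace R d -> R)).
Hypotheses (w0 : forall z, U z -> 0 < w z)
  (wi : forall (B : set (Cspace R d)) (mB : measurable B),
      relatively_compact U B -> (0 < V B)%E ->
      (0 < ess_inf (mrestr V mB) (fun z => (w z)%:E))%E).
Local Notation A2 := (bergman U w).
Variable K : Cd -> Cd -> R[i].
Hypothesis hK : reproducing_kernel U w K.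
Local Notation spec := (approximant_spec U w K).
Local Notation ip := (ip U w).

Lemma step_res_vanish s y x : spec s -> U y -> U x -> res (approximant_step s y) y x = 0.
Proof.
move=> S Uy Ux; have S' := approximant_stepP oU mw w0 Uy S.
move: S'; rewrite /approximant_step; case: eqP => [e0 _|_ S'].
  (* When [res s y y = 0], the function [res s ^~ y] has norm zero; evaluation at [x] being bounded,
     it vanishes at [x], and symmetry gives the claim. *)
  have [C C0 HC] := point_bound oU mw w0 wi (@compact_set1 _ x) (fun z (e : z = x) => eq_ind_r U Ux e).
  have := HC _ _ (res_A2 S Uy) erefl; rewrite (res_ip S Uy Uy) e0 mulr0.
  rewrite (res_conj oU mw w0 S Uy Ux) => h; have /eqP : normc (res s x y) ^+ 2 = 0 by apply/eqP; rewrite eq_le h sqr_ge0.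
  by rewrite sqrf_eq0 => /eqP /eq0_normc ->; rewrite conjC0.
set phi := (X in approximant_extend s y X) in S' *.
have H : (y, fun p => phi p / phi y) \in interp (approximant_extend s y phi) by rewrite /= mem_rcons mem_head.
exact: (interp_res S' H Ux).
Qed.

Lemma step_res_keep s y a : spec s -> U y -> U a -> (forall x, U x -> res s a x = 0) ->
  forall x, U x -> res (approximant_step s y) a x = 0.
Proof.
move=> S Uy Ua h x Ux; rewrite /approximant_step; case: ifP => _ /=; first exact: h.
by rewrite !h// !mulr0 subrr.
Qed.

Lemma step_ip s y (g : Cd -> Cd -> R[i]) : spec s -> U y -> (forall x, U x -> A2 (g x)) ->
  (forall x z, U x -> U z -> ip (g x) (res s ^~ z) = res s z x) ->
  forall x z, U x -> U z -> ip (g x) (res (approximant_step s y) ^~ z) = res (approximant_step s y) z x.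
Proof.
move=> S Uy Ag h x z Ux Uz; rewrite /approximant_step; case: ifP => _ /=; first exact: h.
set q := _^-1; have qc : (q%:C : R[i])^* = q%:C by apply/eqP; rewrite eq_complex /= oppr0 !eqxx.
have Ap : A2 (fun t => q%:C * res s t y) by apply: bergmanZ => //; exact: (res_A2 S).
have Ap' c : A2 (fun t => c * (q%:C * res s t y)) by exact: bergmanZ.
rewrite (ipBr oU mw w0 (res_A2 S Uz) (Ap' _) (Ag _ Ux)) (h _ _ Ux Uz).
rewrite (ipZr oU mw w0 _ Ap (Ag _ Ux)) (ipZr oU mw w0 _ (res_A2 S Uy) (Ag _ Ux)) (h _ _ Ux Uy) conjCK qc.
by rewrite rmorphM /= qc -(res_conj oU mw w0 S Uy Ux); congr (_ - _); ring.
Qed.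

(** Runs through all rational points and uses those in [U], so that the residual eventually vanishes
    at each of them. *)
Fixpoint appr n : approximant R d := if n is n'.+1 then
  (if pickle_inv n' is Some q then if ratpt q \in U then approximant_step (appr n') (ratpt q) else appr n' else appr n')
  else approximant0 K.

Lemma apprP n : spec (appr n).
Proof.
elim: n => [|n IH] /=; first exact: approximant0P.
case: (pickle_inv n) => [q|]//; case: ifPn => // /set_mem Uq; exact: approximant_stepP.
Qed.

(** A later residual is a projection of an earlier one, which still reproduces it. *)
Lemma appr_ip n m : (n <= m)%N -> forall x z, U x -> U z -> ip (res (appr n) ^~ x) (res (appr m) ^~ z) = res (appr m) z x.
Proof.
move=> /subnK <-; elim: (m - n)%N => [|k IH] x z Ux Uz; first exact: (res_ip (apprP n)).
rewrite addSn /=; case: (pickle_inv _) => [q|]; last exact: IH.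
case: ifPn => [/set_mem Uq|_]; last exact: IH.
apply: (step_ip (g := fun x => res (appr n) ^~ x)) => //; first exact: apprP.
by move=> t Ut; exact: (res_A2 (apprP n)).
Qed.

Lemma appr_vanish q m x : U (ratpt q) -> (pickle q < m)%N -> U x -> res (appr m) (ratpt q) x = 0.
Proof.
move=> Uq /subnK <-; elim: (m - _)%N x => [|k IH] x Ux.
  by rewrite add0n /= pickleK_inv mem_set//; apply: step_res_vanish => //; exact: apprP.
rewrite addSn /=; case: (pickle_inv _) => [p|]; last exact: IH.
case: ifPn => [/set_mem Up|_]; last exact: IH.
by apply: step_res_keep => //; exact: apprP.
Qed.

(** Pythagoras, by [appr_ip]. *)
Lemma appr_dist n m x : (n <= m)%N -> U x ->
  complex.Re (ip (fun z => res (appr n) z x - res (appr m) z x) (fun z => res (appr n) z x - res (appr m) z x)) =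
  complex.Re (res (appr n) x x) - complex.Re (res (appr m) x x).
Proof.
move=> nm Ux; have An := res_A2 (apprP n) Ux; have Am := res_A2 (apprP m) Ux.
have Anm := bergmanB oU mw w0 An Am.
rewrite (ipBl oU mw w0 An Am Anm) (ipBr oU mw w0 An Am An) (ipBr oU mw w0 An Am Am).
rewrite (res_ip (apprP n) Ux Ux) (res_ip (apprP m) Ux Ux) (ip_conj oU mw w0 An Am) (appr_ip nm Ux Ux).
by rewrite !raddfB /= Re_conjc; ring.
Qed.

Lemma appr_diag_ge0 n x : U x -> 0 <= complex.Re (res (appr n) x x).
Proof. by move=> Ux; rewrite -(res_ip (apprP n))//; apply: ip_ge0 => //; exact: (res_A2 (apprP n)). Qed.

Lemma appr_diag_le n m x : (n <= m)%N -> U x -> complex.Re (res (appr m) x x) <= complex.Re (res (appr n) x x).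
Proof.
move=> nm Ux; rewrite -subr_ge0 -(appr_dist nm Ux); apply: (ip_ge0 oU mw w0).
by apply: (bergmanB oU mw w0); [exact: (res_A2 (apprP n))|exact: (res_A2 (apprP m))].
Qed.

(** The diagonal residuals decrease, so by [appr_dist] late residuals at [x] are close in norm,
    hence uniformly near [x] by [point_bound]. Near [x] there is a rational point where the late
    ones vanish; so the residual of a fixed stage [N'] is small there, and by continuity also at
    [x]. *)
Lemma appr_diag_cvg x : U x -> (fun n => complex.Re (res (appr n) x x)) @ \oo --> (0 : R).
Proof.
move=> Ux; set a := fun n => _.
have ca : cvgn a.
  apply: nonincreasing_is_cvgn; first by move=> n m nm; exact: appr_diag_le.
  by exists 0 => _ [n _ <-]; exact: appr_diag_ge0.
have /nbhs_pdisc[r r0 rU] : nbhs x U by exact: open_nbhs_nbhs.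
have r20 : 0 < r / 2 by rewrite divr_gt0.
have clU : closure (pdisc x (r / 2)) `<=` pdisc x r by apply: closure_pdisc; lra.
have cB : compact (closure (pdisc x (r / 2))) by apply: compact_pdisc clU; exact: closed_closure.
have [C C0 HC] := point_bound oU mw w0 wi cB (subset_trans clU rU).
apply/cvgrPdist_le => e e0; have e20 : 0 < e / 2 by rewrite divr_gt0.
have eta0 : 0 < (e / 2) ^+ 2 / (C + 1) by rewrite divr_gt0 ?exprn_gt0//; lra.
have [N' HN''] : exists N', forall m, (N' <= m)%N -> a N' - a m <= (e / 2) ^+ 2 / (C + 1).
  have /cvgrPdist_le /(_ _ (divr_gt0 eta0 (ltr0Sn R 1))) [M _ HM] := ca.
  exists M => m Mm; have := HM _ Mm; have := HM M (leqnn M); rewrite !ler_norml => /andP[h1 h2] /andP[h3 h4].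
  by move: h1 h2 h3 h4; set u := limn a; set v := _ / (C + 1); lra.
have cN : {for x, continuous (res (appr N') ^~ x)}.
  by have [h _] := res_A2 (apprP N') Ux; exact: differentiable_continuous (h x Ux).
have /nbhs_pdisc[r' r'0 Hr'] : nbhs x (fun y => normc (res (appr N') y x - res (appr N') x x) < e / 2).
  have /cvgrPdist_lt /(_ (e / 2)%:C) := cN; rewrite ltcR => /(_ e20).
  by apply: filterS => y; rewrite normcE ltcR -normcN opprB.
have rr : 0 < Num.min (r / 2) r' by rewrite lt_min r20.
have [q Hq] := @ratpt_dense x (Num.min (r / 2) r')  rr.
have q1 : pdisc x (r / 2) (ratpt q) by move=> j; have := Hq j; rewrite lt_min => /andP[].
have q2 : pdisc x r' (ratpt q) by move=> j; have := Hq j; rewrite lt_min => /andP[].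
have Uq : U (ratpt q) by apply: rU; apply: clU; exact: subset_closure.
exists (maxn N' (pickle q).+1) => // m; rewrite /= geq_max => /andP[Nm qm].
rewrite sub0r normrN ger0_norm ?appr_diag_ge0//; apply: (le_trans (appr_diag_le Nm Ux)).
have := HC _ _ (bergmanB oU mw w0 (res_A2 (apprP N') Ux) (res_A2 (apprP m) Ux)) (subset_closure q1).
rewrite appr_dist// (appr_vanish Uq qm Ux) subr0 => h.
have h2 : normc (res (appr N') (ratpt q) x) <= e / 2.
  rewrite -(ler_pXn2r (ltn0Sn 1)) ?nnegrE ?normc_ge0 ?(ltW e20)//; apply: (le_trans h).
  apply: (@le_trans _ _ (C * ((e / 2) ^+ 2 / (C + 1)))); first by rewrite ler_wpM2l// HN''.
  rewrite mulrCA -[leRHS]mulr1 ler_wpM2l ?sqr_ge0// ler_pdivrMr ?mul1r; lra.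
apply: (le_trans (ler_norm _)); apply: (le_trans (normc_Re _)).
have -> : res (appr N') x x = res (appr N') (ratpt q) x + - (res (appr N') (ratpt q) x - res (appr N') x x) by ring.
by apply: (le_trans (normcD_le _ _)); rewrite normcN; have /ltW := Hr' _ q2; move: h2; lra.
Qed.

Lemma appr_cvg x y : U x -> U y -> (fun n => normc (res (appr n) x y)) @ \oo --> (0 : R).
Proof.
move=> Ux Uy; have [C C0 HC] := point_bound oU mw w0 wi (@compact_set1 _ x) (fun z (e : z = x) => eq_ind_r U Ux e).
apply/cvgrPdist_le => e e0.
have eta0 : 0 < e ^+ 2 / (C + 1) by rewrite divr_gt0 ?exprn_gt0//; lra.
have /cvgrPdist_le /(_ _ eta0) := appr_diag_cvg Uy; apply: filterS => n.
rewrite !sub0r !normrN ger0_norm ?appr_diag_ge0// ger0_norm ?normc_ge0// => h.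
rewrite -(ler_pXn2r (ltn0Sn 1)) ?nnegrE ?normc_ge0 ?(ltW e0)//.
have := HC _ _ (res_A2 (apprP n) Uy) erefl; rewrite (res_ip (apprP n))// => h1; apply: (le_trans h1).
apply: (@le_trans _ _ (C * (e ^+ 2 / (C + 1)))); first by rewrite ler_wpM2l.
rewrite mulrCA -[leRHS]mulr1 ler_wpM2l ?sqr_ge0// ler_pdivrMr ?mul1r; lra.
Qed.

End kernel_convergence.

(** * Tannery's theorem and complex limits *)

Section tannery.
Context (R : realType).

(** The length [M n] of the sums varies with [n]. Beyond a fixed [m0] the majorant makes all tails
    small, and the first [m0] terms converge one by one. *)
Lemma tannery (a : nat -> nat -> R) (l b : nat -> R) (M : nat -> nat) :
  (forall n m, `|a n m| <= b m) -> (forall m, a ^~ m @ \oo --> l m) -> cvgn (series b) ->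
  (forall n, (n <= M n)%N) ->
  cvgn (series l) /\ (fun n => \sum_(0 <= m < M n) a n m) @ \oo --> limn (series l).
Proof.
move=> ab al cb nM.
have b0 m : 0 <= b m by apply: le_trans (ab 0 m).
have lb m : `|l m| <= b m.
  have h : (fun n => `|a n m|) @ \oo --> `|l m| by apply: cvg_norm; exact: al.
  by rewrite -(cvg_lim _ h)//; apply: limr_le; [exact: cvgP h|apply: nearW => n; exact: ab].
have cl : cvgn (series l).
  by apply: normed_cvg; apply: series_le_cvg cb => // m; exact: normr_ge0.
split => //; apply/cvgrPdist_le => e e0.
have e4 : 0 < e / 4 by rewrite divr_gt0.
have [m0 Hb] : exists m0, forall n, (m0 <= n)%N -> \sum_(m0 <= m < n) b m <= e / 4.
  have /cauchy_cvgP/cauchy_seriesP/(_ _ e4)[[P Q] /= [[p _ Hp] [q _ Hq]] PQ] := cb.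
  exists (maxn p q) => n; rewrite geq_max => /andP[pn qn].
  apply: (le_trans (ler_norm _)); apply: ltW; apply: (PQ (maxn p q, n)); split => /=.
    by apply: Hp; rewrite /= leq_maxl.
  exact: Hq.
have tail (u : nat -> R) n : (forall m, `|u m| <= b m) -> (m0 <= n)%N ->
    `|\sum_(0 <= m < n) u m - \sum_(0 <= m < m0) u m| <= e / 4.
  move=> ub mn; rewrite (big_cat_nat _ mn)//= addrAC subrr add0r.
  by apply: (le_trans (ler_norm_sum _ _ _)); apply: le_trans (Hb _ mn); apply: ler_sum.
have H1 : \forall n \near \oo, `|\sum_(0 <= m < m0) l m - \sum_(0 <= m < m0) a n m| <= e / 4.
  have h : (fun n => \sum_(0 <= m < m0) a n m) @ \oo --> \sum_(0 <= m < m0) l m.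
        elim: (m0) => [|k IH]; first by rewrite big_nil; under eq_fun do rewrite big_nil; exact: cvg_cst.
    by rewrite big_nat_recr//=; under eq_fun do rewrite big_nat_recr//=; apply: cvgD.
  by have /cvgrPdist_le := h; apply.
have H2 : `|limn (series l) - \sum_(0 <= m < m0) l m| <= e / 4.
  have h : (fun n => `|series l n - \sum_(0 <= m < m0) l m|) @ \oo --> `|limn (series l) - \sum_(0 <= m < m0) l m|.
    by apply: cvg_norm; apply: cvgB => //; exact: cvg_cst.
  rewrite -(cvg_lim _ h)//; apply: limr_le; first exact: cvgP h.
  by exists m0 => // n mn; exact: tail.
have H3 : \forall n \near \oo, (m0 <= n)%N by exists m0.
apply: filterS2 H1 H3 => n h1 mn; have h3 := tail (a n) (M n) (ab n) (leq_trans mn (nM n)).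
rewrite (_ : _ - _ = limn (series l) - \sum_(0 <= m < m0) l m + (\sum_(0 <= m < m0) l m - \sum_(0 <= m < m0) a n m)
  - (\sum_(0 <= m < M n) a n m - \sum_(0 <= m < m0) a n m)); last ring.
apply: (le_trans (ler_normB _ _)); have := ler_normD (limn (series l) - \sum_(0 <= m < m0) l m)
  (\sum_(0 <= m < m0) l m - \sum_(0 <= m < m0) a n m).
move: h1 h3 H2; set u := `|_|; set v := `|_|; set x := `|_|; set y := `|_|; lra.
Qed.

Definition ccvg (u : nat -> R[i]) (l : R[i]) := (fun n => complex.Re (u n)) @ \oo --> complex.Re l /\
  (fun n => complex.Im (u n)) @ \oo --> complex.Im l.

Lemma ccvg_cst c : ccvg (fun=> c) c. Proof. by split; exact: cvg_cst. Qed.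

Lemma ccvgD u v a b : ccvg u a -> ccvg v b -> ccvg (fun n => u n + v n) (a + b).
Proof.
by move=> [u1 u2] [v1 v2]; split; under eq_fun do rewrite raddfD; rewrite raddfD; exact: cvgD.
Qed.

Lemma ccvgM u v a b : ccvg u a -> ccvg v b -> ccvg (fun n => u n * v n) (a * b).
Proof.
have E (z1 z2 : R[i]) : complex.Re (z1 * z2) = complex.Re z1 * complex.Re z2 - complex.Im z1 * complex.Im z2 /\
  complex.Im (z1 * z2) = complex.Re z1 * complex.Im z2 + complex.Im z1 * complex.Re z2.
  by case: z1 z2 => x y [x' y'].
move=> [u1 u2] [v1 v2]; split.
  by under eq_fun do rewrite (E _ _).1; rewrite (E _ _).1; apply: cvgB; exact: cvgM.
by under eq_fun do rewrite (E _ _).2; rewrite (E _ _).2; apply: cvgD; exact: cvgM.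
Qed.

Lemma ccvg_sum I (r : seq I) (P : pred I) (F : I -> nat -> R[i]) l : (forall i, ccvg (F i) (l i)) ->
  ccvg (fun n => \sum_(i <- r | P i) F i n) (\sum_(i <- r | P i) l i).
Proof.
move=> h; elim: r => [|i r IH].
  by rewrite big_nil; under eq_fun do rewrite big_nil; exact: ccvg_cst.
rewrite big_cons; under eq_fun do rewrite big_cons.
by case: (P i) => //; exact: ccvgD.
Qed.

Lemma ccvg_prod I (r : seq I) (P : pred I) (F : I -> nat -> R[i]) l : (forall i, ccvg (F i) (l i)) ->
  ccvg (fun n => \prod_(i <- r | P i) F i n) (\prod_(i <- r | P i) l i).
Proof.
move=> h; elim: r => [|i r IH].
  by rewrite big_nil; under eq_fun do rewrite big_nil; exact: ccvg_cst.
rewrite big_cons; under eq_fun do rewrite big_cons.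
by case: (P i) => //; exact: ccvgM.
Qed.

Lemma ccvg_det m (F : nat -> 'M[R[i]]_m) (A : 'M[R[i]]_m) : (forall i j, ccvg (fun n => F n i j) (A i j)) ->
  ccvg (fun n => \det (F n)) (\det A).
Proof.
by move=> h; apply: ccvg_sum => s; apply: ccvgM; [exact: ccvg_cst|apply: ccvg_prod => i; exact: h].
Qed.

End tannery.

(** * Janossy densities of a limit of projection kernels *)

Section janossy_density.
Context d (T : measurableType d) (R : realType) (mu : {sigma_finite_measure set T -> \bar R}).
Variables (N : nat -> nat) (phi : forall n, 'I_(N n) -> T -> R[i]) (kk : T -> T -> R[i]).
Variables (E : set T) (tau : R).
Hypotheses (mE : measurable E) (mphi : forall n i, cmeasurable setT (@phi n i)).
Hypothesis phi_int : forall n i, (\int[mu]_z (normc (@phi n i z) ^+ 2)%:E < +oo)%E.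
Hypothesis phi_on : forall n i j, Cint mu setT (fun z => @phi n i z * (@phi n j z)^*) = (i == j)%:R.
Hypothesis kk_cvg : forall x y, ccvg (fun n => gram (@phi n) x y) (kk x y).
Local Notation kappa x := (complex.Re (kk x x)).
Hypothesis phi_le : forall n x, sqn (@phi n) x <= kappa x.
Hypothesis tauE : (\int[mu]_(z in E) (kappa z)%:E = tau%:E)%E.

(** The majorant of the correlation functions given by Hadamard's inequality. Its integrals over [E]
    factor into powers of [tau], so the series for the Janossy density is dominated by the
    exponential series. *)
Definition prodk Z : R := \prod_(z <- Z) kappa z.
Definition corr Z : R := complex.Re (kdet kk (diag Z)).
Let corrn n Z : R := complex.Re (kdet (gram (@phi n)) (diag Z)).

Let kappa0 x : 0 <= kappa x.
Proof. exact: le_trans (sqn_ge0 (@phi 0) x) (phi_le 0 x). Qed.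

Lemma prodk_ge0 Z : 0 <= prodk Z. Proof. by apply: prodr_ge0. Qed.

Let corrn_le n Z : 0 <= corrn n Z <= prodk Z.
Proof.
case: Z => [|z Z]; first by rewrite /corrn kdet_nil /prodk big_nil /= ler01 lexx.
have [psi Hpsi psi_le] := kdet_gram (@phi n) Z; rewrite /corrn /= Hpsi gram_diag /= sqn_ge0 /=.
apply: (le_trans (psi_le z)); rewrite /prodk big_cons ler_pM ?sqn_ge0//.
  by apply: prodr_ge0 => x _; exact: sqn_ge0.
by apply: ler_prod => x _; rewrite sqn_ge0 phi_le.
Qed.

Lemma kdet_cvg l : ccvg (fun n => kdet (gram (@phi n)) l) (kdet kk l).
Proof. by apply: ccvg_det => i j; rewrite mxE; under eq_fun do rewrite mxE; exact: kk_cvg. Qed.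

Let corr_cvg Z : (corrn ^~ Z) @ \oo --> corr Z.
Proof. by have [] := kdet_cvg (diag Z). Qed.

Lemma corr_ge0 Z : 0 <= corr Z.
Proof.
rewrite -(cvg_lim _ (@corr_cvg Z))//; apply: limr_ge; first exact: cvgP (@corr_cvg Z).
by apply: nearW => n; have /andP[] := corrn_le n Z.
Qed.

Lemma corr_le Z : corr Z <= prodk Z.
Proof.
rewrite -(cvg_lim _ (@corr_cvg Z))//; apply: limr_le; first exact: cvgP (@corr_cvg Z).
by apply: nearW => n; have /andP[] := corrn_le n Z.
Qed.

Lemma corr_perm Z Z' : perm_eq Z Z' -> corr Z = corr Z'.
Proof. by move=> ZZ; rewrite /corr; congr complex.Re; apply: kdet_perm; exact: perm_map. Qed.

Let corrn_perm n Z Z' : perm_eq Z Z' -> corrn n Z = corrn n Z'.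
Proof. by move=> ZZ; rewrite /corrn; congr complex.Re; apply: kdet_perm; exact: perm_map. Qed.

Lemma measurable_nth_cat n (X : seq T) i : measurable_fun setT (fun t : n.-tuple T => nth point (t ++ X) i).
Proof.
have [h|h] := ltnP i n.
  rewrite (_ : (fun _ => _) = (fun t : n.-tuple T => tnth t (Ordinal h))); first exact: measurable_tnth.
  by apply/funext => t; rewrite nth_cat size_tuple h (tnth_nth point).
rewrite (_ : (fun _ => _) = (fun=> nth point X (i - n))); first exact: measurable_cst.
by apply/funext => t; rewrite nth_cat size_tuple ltnNge h.
Qed.

Lemma measurable_cat_tuple m n : measurable_fun setT (fun p : m.-tuple T * n.-tuple T => [tuple of p.1 ++ p.2]).
Proof.
apply/measurable_fun_tnthP => i.
rewrite (_ : _ \o _ = fun p : m.-tuple T * n.-tuple T => match fintype.split i with inl k => tnth p.1 k | inr k => tnth p.2 k end).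
  by case: fintype.split => k; [apply: (measurableT_comp (measurable_tnth k) measurable_fst)|
    apply: (measurableT_comp (measurable_tnth k) measurable_snd)].
apply/funext => -[t s] /=; rewrite (tnth_nth point) /= nth_cat size_tuple.
by case: fintype.splitP => k ->; rewrite ?ltn_ord ?ltnNge ?leq_addr/= ?addKn (tnth_nth point).
Qed.

Let measurable_corrn n m X : measurable_fun setT (fun t : m.-tuple T => corrn n (t ++ X)).
Proof.
have E1 (t : m.-tuple T) : kdet (gram (@phi n)) (diag (t ++ X)) = \det (\matrix_(i < m + size X, j < m + size X)
    gram (@phi n) (nth point (t ++ X) i) (nth point (t ++ X) j)) :> R[i].
  have st : size (t ++ X) = (m + size X)%N by rewrite size_cat size_tuple.
  rewrite (@kdetE _ _ _ _ (m + size X)); last by rewrite size_map st.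
  by congr (\det _); apply/matrixP => i j; rewrite !mxE; congr gram; rewrite (nth_map point)// st.
have [] : cmeasurable setT (fun t : m.-tuple T => kdet (gram (@phi n)) (diag (t ++ X))) => //.
under eq_fun do rewrite E1.
apply: cmeasurable_det => i j; apply: cmeasurable_sum => a; apply: cmeasurableM.
  exact: cmeasurable_comp (measurable_nth_cat X i) (mphi a).
by apply: cmeasurable_conj; exact: cmeasurable_comp (measurable_nth_cat X j) (mphi a).
Qed.

Lemma measurable_corr m X : measurable_fun setT (fun t : m.-tuple T => corr (t ++ X)).
Proof. by apply: (measurable_fun_cvg (fun n => @measurable_corrn n m X)) => t _; exact: corr_cvg. Qed.

Lemma measurable_kappa : measurable_fun setT (fun z => kappa z).
Proof.
apply: (@measurable_fun_cvg _ _ _ setT (fun n z => sqn (@phi n) z)).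
  move=> n; apply: measurable_sum => i; exact: measurable_normc_sqr (mphi i).
move=> z _; have [h _] := kk_cvg z z; move: h.
by under eq_fun do rewrite gram_diag.
Qed.

Lemma measurable_prodk m X : measurable_fun setT (fun t : m.-tuple T => prodk (t ++ X)).
Proof.
rewrite (_ : (fun _ => _) = (fun t : m.-tuple T => (\prod_(i < m) kappa (tnth t i)) * prodk X)); last first.
  by apply/funext => t; rewrite /prodk big_cat big_tuple.
apply: measurable_funM; last exact: measurable_cst.
by apply: measurable_prod => i _; apply: (measurableT_comp measurable_kappa); exact: measurable_tnth.
Qed.

Lemma jint_prodk m X : jint mu prodk E m X = (tau ^+ m * prodk X)%:E.
Proof.
elim: m X => [|m IH] X; first by rewrite jint0 expr0 mul1r.
have pP Z Z' : perm_eq Z Z' -> prodk Z = prodk Z' by move=> ZZ; exact: perm_big.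
rewrite (@jintS _ _ _ mu prodk prodk_ge0 pP measurable_prodk _ _ _ mE).
under eq_integral do rewrite IH /prodk big_cons mulrCA mulrC EFinM.
  rewrite ge0_integralZl//.
  + by rewrite tauE -EFinM exprS -/(prodk X); congr (_%:E); ring.
  + by apply/measurable_EFinP; apply: measurable_funS measurable_kappa.
    + move=> z _; rewrite lee_fin; exact: kappa0.
  + rewrite lee_fin; apply: mulr_ge0; last exact: prodk_ge0.
    by apply: exprn_ge0; rewrite -lee_fin -tauE; apply: integral_ge0 => z _; rewrite lee_fin; exact: kappa0.
Qed.

Let tau0 : 0 <= tau.
Proof. by rewrite -lee_fin -tauE; apply: integral_ge0 => z _; rewrite lee_fin. Qed.

Lemma jint_corr_le m X : (jint mu corr E m X <= (tau ^+ m * prodk X)%:E)%E.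
Proof.
rewrite -jint_prodk; apply: ge0_le_integral => //; first exact: measurable_tset.
- by move=> t _; rewrite lee_fin corr_ge0.
- by apply/measurable_EFinP; exact: measurable_funS (measurable_corr X).
- by apply/measurable_EFinP; exact: measurable_funS (measurable_prodk X).
- by move=> t _; rewrite lee_fin corr_le.
Qed.

Let jintn_le n m X : (jint mu (corrn n) E m X <= (tau ^+ m * prodk X)%:E)%E.
Proof.
rewrite -jint_prodk; apply: ge0_le_integral => //; first exact: measurable_tset.
- by move=> t _; rewrite lee_fin; have /andP[] := corrn_le n (t ++ X).
- by apply/measurable_EFinP; exact: measurable_funS (measurable_corrn n X).
- by apply/measurable_EFinP; exact: measurable_funS (measurable_prodk X).
- by move=> t _; rewrite lee_fin; have /andP[] := corrn_le n (t ++ X).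
Qed.

Let jint_ge0 m X : (0 <= jint mu corr E m X)%E.
Proof. by apply: integral_ge0 => t _; rewrite lee_fin corr_ge0. Qed.

Let jintn_ge0 n m X : (0 <= jint mu (corrn n) E m X)%E.
Proof. by apply: integral_ge0 => t _; rewrite lee_fin; have /andP[] := corrn_le n (t ++ X). Qed.

Lemma jint_corr_fin m X : jint mu corr E m X \is a fin_num.
Proof. by rewrite ge0_fin_numE// (le_lt_trans (jint_corr_le m X))// ltry. Qed.

Let jintn_fin n m X : jint mu (corrn n) E m X \is a fin_num.
Proof. by rewrite ge0_fin_numE// (le_lt_trans (jintn_le n m X))// ltry. Qed.

Let jintn_cvg m X : (fun n => fine (jint mu (corrn n) E m X)) @ \oo --> fine (jint mu corr E m X).
Proof.
apply: fine_cvg; rewrite fineK ?jint_corr_fin//.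
have mEm : measurable (tset E m) by exact: measurable_tset.
apply: (@dominated_cvg _ _ _ (tuple_measure mu m) _ mEm (fun n t => (corrn n (t ++ X))%:E) _ (fun t => (prodk (t ++ X))%:E)).
- by move=> n; apply/measurable_EFinP; exact: measurable_funS (measurable_corrn n X).
- by move=> t _; apply: cvg_EFin; [exact: nearW|exact: corr_cvg].
- by [].
- apply/integrableP; split; first by apply/measurable_EFinP; exact: measurable_funS (measurable_prodk X).
  under eq_integral do rewrite gee0_abs ?lee_fin ?prodk_ge0//.
  by have := jint_prodk m X; rewrite /jint => ->; rewrite ltry.
- by move=> n t _; have /andP[h1 h2] := corrn_le n (t ++ X); rewrite gee0_abs lee_fin.
Qed.

Definition jan X : R := limn (fun M => jalt mu corr E M X).

Let term m (x : \bar R) : R := (-1) ^+ m / m`!%:R * fine x.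

Let term_le m X (x : \bar R) : (0 <= x)%E -> (x <= (tau ^+ m * prodk X)%:E)%E -> `|term m x| <= prodk X * exp_coeff tau m.
Proof.
move=> x0 xle; rewrite /term normrM normrM normrX normrN1 expr1n mul1r /exp_coeff /=.
rewrite [leRHS](_ : _ = `|m`!%:R^-1| * (tau ^+ m * prodk X)); last by rewrite ger0_norm ?invr_ge0//; ring.
apply: ler_wpM2l => //; rewrite ger0_norm ?fine_ge0// -lee_fin fineK//.
by rewrite ge0_fin_numE//; apply: le_lt_trans xle _; rewrite ltry.
Qed.

Let expb_cvg X : cvgn (series (fun m => prodk X * exp_coeff tau m)).
Proof.
rewrite (_ : series _ = fun n => prodk X * series (exp_coeff tau) n); last by apply/funext => n; rewrite /series /= mulr_sumr.
apply: is_cvgMr; exact: is_cvg_series_exp_coeff.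
Qed.

Let seriesE X : series (fun m => term m (jint mu corr E m X)) = fun M => jalt mu corr E M X.
Proof. by apply/funext => M; rewrite /series /= big_mkord. Qed.

Lemma jalt_cvg X : (fun M => jalt mu corr E M X) @ \oo --> jan X.
Proof.
have [h _] := @tannery R (fun _ m => term m (jint mu corr E m X)) _ _ id
  (fun _ m => term_le (jint_ge0 m X) (jint_corr_le m X)) (fun m => @cvg_cst _ _ _ _ _) (@expb_cvg X) (fun n => leqnn n).
by rewrite /jan -seriesE.
Qed.

(** The number of terms [(N n + n).+1] exceeds the rank [N n], as the positivity of [Galt] requires,
    and tends to infinity with [n], as Tannery's theorem requires. *)
Let jan_cvgn X : (fun n => jalt mu (corrn n) E (N n + n).+1 X) @ \oo --> jan X.
Proof.
have al m : (fun n => term m (jint mu (corrn n) E m X)) @ \oo --> term m (jint mu corr E m X).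
  by apply: cvgM; [exact: cvg_cst|exact: jintn_cvg].
have [_] := @tannery R (fun n m => term m (jint mu (corrn n) E m X)) (fun m => term m (jint mu corr E m X)) _ (fun n => (N n + n).+1)
  (fun n m => term_le (jintn_ge0 n m X) (jintn_le n m X)) al (@expb_cvg X)
  (fun n => leqW (leq_addl _ _)).
by rewrite seriesE /jan; under eq_fun do rewrite big_mkord.
Qed.

Let exp_bound M X (F : nat -> \bar R) : (forall m, 0 <= F m)%E -> (forall m, F m <= (tau ^+ m * prodk X)%:E)%E ->
  `|\sum_(m < M) term m (F m)| <= expR tau * prodk X.
Proof.
move=> F0 Fle; apply: (le_trans (ler_norm_sum _ _ _)).
apply: (@le_trans _ _ (\sum_(m < M) prodk X * exp_coeff tau m)); first by apply: ler_sum => m _; exact: term_le.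
rewrite -mulr_sumr mulrC ler_wpM2r ?prodk_ge0// -(big_mkord xpredT (exp_coeff tau)).
rewrite /expR; apply: nondecreasing_cvgn_le; last exact: is_cvg_series_exp_coeff.
by apply: nondecreasing_series => m _ _; exact: exp_coeff_ge0.
Qed.

Lemma jalt_le M X : `|jalt mu corr E M X| <= expR tau * prodk X.
Proof. by apply: (@exp_bound M X (fun m => jint mu corr E m X)) => m; [exact: jint_ge0|exact: jint_corr_le]. Qed.

Lemma jan_le X : jan X <= expR tau * prodk X.
Proof.
apply: limr_le; first exact: cvgP (@jalt_cvg X).
by apply: nearW => M; apply: le_trans (jalt_le M X); exact: ler_norm.
Qed.

Lemma jan_perm X X' : perm_eq X X' -> jan X = jan X'.
Proof.
move=> XX; rewrite /jan; congr (limn _); apply/funext => M; apply: eq_bigr => m _; congr (_ * fine _).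
by apply: eq_integral => t _; congr (_%:E); apply: corr_perm; rewrite perm_cat2l.
Qed.

Let jalt_Galt n M p X : jalt mu (corrn n) E M (p :: X) = complex.Re (Galt mu (@phi n) E M p p X).
Proof.
rewrite /Galt (raddf_sum (@complex.Re R)); apply: eq_bigr => m _.
have Ere (x : R) (z : R[i]) : complex.Re (x%:C * z) = x * complex.Re z by case: z => u v /=; rewrite mul0r subr0.
rewrite [RHS]Ere; congr (_ * fine _); apply: eq_integral => t _; congr ((complex.Re _)%:E).
apply: kdet_perm; have := perm_map (fun z : T => (z, z)) (permEl (perm_catCA t [:: p] X)); exact.
Qed.

Let Nn n : (N n <= (N n + n).+1)%N. Proof. exact: leqW (leq_addr _ _). Qed.

(** Positivity comes from the polarized form, which singles out one particle [p]; for the empty list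
    it will be read off a probability, in [J_ge0]. *)
Lemma jan_ge0 p X : 0 <= jan (p :: X).
Proof.
rewrite -(cvg_lim _ (@jan_cvgn (p :: X)))//; apply: limr_ge; first exact: cvgP (@jan_cvgn (p :: X)).
apply: nearW => n; rewrite jalt_Galt; exact: (Galt_diag mE (mphi (n := n)) (phi_int (n := n)) (phi_on (n := n)) p X (Nn n)).1.
Qed.

(* The finite-rank approximations of [jan (p :: X)], as a Hermitian form in [p]. *)
Definition Japprox n p q X : R[i] := Galt mu (@phi n) E (N n + n).+1 p q X.

Lemma Japprox_cvg p X : (fun n => complex.Re (Japprox n p p X)) @ \oo --> jan (p :: X).
Proof. by have := @jan_cvgn (p :: X); under eq_fun do rewrite jalt_Galt. Qed.

Lemma measurable_Japprox n X : measurable_fun setT (fun p => complex.Re (Japprox n p p X)).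
Proof.
under eq_fun do rewrite /Japprox -jalt_Galt.
apply: measurable_sum => m; apply: measurable_funM; first exact: measurable_cst.
apply: measurableT_comp => //; have f0 Z : 0 <= corrn n Z by have /andP[] := corrn_le n Z.
exact: (@measurable_jint _ _ _ mu (corrn n) f0 (@corrn_perm n) (measurable_corrn n) E m X mE).
Qed.

Lemma Japprox_ge0 n p X : 0 <= complex.Re (Japprox n p p X) /\ Japprox n p p X = (complex.Re (Japprox n p p X))%:C.
Proof. exact: (Galt_diag mE (mphi (n := n)) (phi_int (n := n)) (phi_on (n := n)) p X (Nn n)). Qed.

Lemma Japprox_le n p X : complex.Re (Japprox n p p X) <= expR tau * prodk (p :: X).
Proof.
rewrite /Japprox -jalt_Galt; apply: (le_trans (ler_norm _)).
by apply: (@exp_bound _ _ (fun m => jint mu (corrn n) E m (p :: X))) => m; [exact: jintn_ge0|exact: jintn_le].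
Qed.

Lemma Japprox_cauchy_schwarz n p q X :
  normc (Japprox n p q X) ^+ 2 <= complex.Re (Japprox n p p X) * complex.Re (Japprox n q q X).
Proof. exact: (Galt_cauchy_schwarz mE (mphi (n := n)) (phi_int (n := n)) (phi_on (n := n)) p q X (Nn n)). Qed.

Lemma measurable_jint_cat (f : seq T -> R) : (forall Z, 0 <= f Z) ->
  (forall n X, measurable_fun setT (fun t : n.-tuple T => f (t ++ X))) ->
  forall m n X, measurable_fun setT (fun t : n.-tuple T => jint mu f E m (t ++ X)).
Proof.
move=> f0 fm m n X.
apply: (@measurable_integral_in _ _ _ _ R (tuple_measure mu m) (tset E m) (fun p : n.-tuple T * m.-tuple T => (f (p.2 ++ p.1 ++ X))%:E)) => [||p].
- exact: measurable_tset.
- rewrite (_ : (fun _ => _) = (fun t : (m + n).-tuple T => (f (t ++ X))%:E) \o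
    ((fun p : m.-tuple T * n.-tuple T => [tuple of p.1 ++ p.2]) \o (fun p : n.-tuple T * m.-tuple T => (p.2, p.1)))); last first.
    by apply/funext => p /=; rewrite catA.
  apply: measurableT_comp; first by apply/measurable_EFinP; exact: fm.
  apply: measurableT_comp; first exact: measurable_cat_tuple.
  exact: measurable_fun_pair measurable_snd measurable_fst.
- by rewrite lee_fin.
Qed.

Lemma measurable_jalt M n X : measurable_fun setT (fun t : n.-tuple T => jalt mu corr E M (t ++ X)).
Proof.
apply: measurable_sum => m; apply: measurable_funM; first exact: measurable_cst.
by apply: measurableT_comp => //; apply: measurable_jint_cat; [exact: corr_ge0|exact: measurable_corr].
Qed.

Lemma measurable_jan n X : measurable_fun setT (fun t : n.-tuple T => jan (t ++ X)).
Proof. by apply: (measurable_fun_cvg (fun M => @measurable_jalt M n X)) => t _; exact: jalt_cvg. Qed.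

Lemma integral_prodk_tset k : (\int[tuple_measure mu k]_(t in tset E k) (prodk t)%:E = (tau ^+ k)%:E)%E.
Proof.
have := jint_prodk k [::]; rewrite /prodk big_nil mulr1 => <-; apply: eq_integral => t _.
by rewrite cats0.
Qed.

Lemma integral_jan k (A : set (k.-tuple T)) : measurable A -> A `<=` tset E k ->
  (fun M => \int[tuple_measure mu k]_(t in A) (jalt mu corr E M t)%:E)%E @ \oo -->
  (\int[tuple_measure mu k]_(t in A) (jan t)%:E)%E.
Proof.
move=> mA AE; have mEk : measurable (tset E k) by exact: measurable_tset.
apply: (@dominated_cvg _ _ _ (tuple_measure mu k) _ mA (fun M t => (jalt mu corr E M t)%:E) _ (fun t => (expR tau * prodk t)%:E)).
- move=> M; apply/measurable_EFinP; apply: measurable_funS (@measurableT _ _) (@subsetT _ _) _.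
  by have := @measurable_jalt M k [::]; under eq_fun do rewrite cats0.
- by move=> t _; apply: cvg_EFin; [exact: nearW|exact: jalt_cvg].
- by [].
- have mp : measurable_fun setT (fun t : k.-tuple T => prodk t).
    by have := @measurable_prodk k [::]; under eq_fun do rewrite cats0.
  apply: (integrableS mEk mA AE); apply/integrableP; split.
    by apply/measurable_EFinP; apply: measurable_funM => //; exact: measurable_funS mp.
  under eq_integral do rewrite gee0_abs ?lee_fin ?mulr_ge0 ?expR_ge0 ?prodk_ge0// EFinM.
  rewrite ge0_integralZl//.
  + by rewrite integral_prodk_tset -EFinM ltry.
  + by apply/measurable_EFinP; exact: measurable_funS mp.
    + by move=> t _; rewrite lee_fin prodk_ge0.
- by move=> M t _; rewrite abse_EFin lee_fin jalt_le.
Qed.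

End janossy_density.

(** * Janossy densities are logarithmically subharmonic in each variable *)

Section janossy_submean.
Context (R : realType) (d : nat).
Local Notation V := (Clebesgue R d).
Local Notation Cd := 'rV[R[i]]_d.
Local Notation RR := (measurableTypeR R).

(** The integrals converge by domination on the closed polydisc. For the sublevel sets, a point with
    [u p < e * u q] satisfies the same strict inequality for all large [n], so Fatou's lemma bounds
    the volume term. *)
Lemma log_submean_cvg (U : set Cd) (un : nat -> Cd -> R) (u : Cd -> R) : open U ->
  (forall n, measurable_fun (U : set (Cspace R d)) (un n : Cspace R d -> RR)) ->
  (forall n z, U z -> 0 <= un n z) ->
  (forall z, U z -> (un ^~ z) @ \oo --> u z) ->
  (forall K, compact K -> K `<=` U -> exists C, forall n z, K z -> un n z <= C) ->
  (forall n q r, 0 < r -> closure (pdisc q r) `<=` U ->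
   ((un n q)%:E * V (pdisc q r) <= \int[V]_(p in pdisc q r) (un n p)%:E)%E /\
   forall e, 0 < e -> e < 1 ->
   ((un n q * - ln e)%:E * V [set p | pdisc q r p /\ (un n p < e * un n q)%R] <=
       \int[V]_(p in pdisc q r) (un n p)%:E)%E) ->
  log_submean U u.
Proof.
move=> oU mun un0 uncvg unb H.
have mu : measurable_fun (U : set (Cspace R d)) (u : Cspace R d -> RR) by exact: measurable_fun_cvg mun uncvg.
split => // [z Uz|q r r0 DU].
  by rewrite -(cvg_lim _ (uncvg z Uz))//; apply: limr_ge; [exact: cvgP (uncvg z Uz)|apply: nearW => n; exact: un0].
have DU' : pdisc q r `<=` U by apply: subset_trans DU; exact: subset_closure.
have mD : measurable (pdisc q r : set (Cspace R d)) by exact: measurable_pdisc.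
have Uq : U q by apply: DU'; exact: pdisc_center.
have cD : compact (closure (pdisc q r)).
  have h : r < r + 1 by rewrite ltrDl.
  by apply: compact_pdisc (closure_pdisc h); exact: closed_closure.
have [C HC] := unb _ cD DU.
have VD := Clebesgue_pdisc_fin q r; set v := fine (V (pdisc q r)).
have vE : V (pdisc q r) = v%:E by rewrite fineK// ge0_fin_numE.
have I1 : (fun n => \int[V]_(p in pdisc q r) (un n p)%:E)%E @ \oo --> (\int[V]_(p in pdisc q r) (u p)%:E)%E.
  apply: (@dominated_cvg _ _ _ V _ mD (fun n p => (un n p)%:E) _ (fun=> C%:E)) => //.
  - by move=> n; apply/measurable_EFinP; exact: measurable_funS (measurable_open oU) DU' (mun n).
  - by move=> p Dp; apply: cvg_EFin; [exact: nearW|apply: uncvg; exact: DU'].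
      - by apply/integrableP; split => //; rewrite integral_cst//= lte_mul_pinfty.
  - move=> n p Dp; rewrite gee0_abs ?lee_fin ?un0//; last exact: DU'.
    by apply: HC; exact: subset_closure.
split.
    have I2 : (fun n => (un n q)%:E * V (pdisc q r))%E @ \oo --> ((u q)%:E * V (pdisc q r))%E.
    rewrite vE; under eq_fun do rewrite -EFinM; rewrite -EFinM; apply: cvg_EFin; first exact: nearW.
    by apply: cvgM; [exact: uncvg|exact: cvg_cst].
    by apply: (lee_cvg_to I2 I1); apply: nearW => n; have [] := H n q r r0 DU.
move=> e e0 e1; have ln0 : 0 <= - ln e by rewrite oppr_ge0 ln_le0// ltW.
have mS n : measurable ([set p | pdisc q r p /\ un n p < e * un n q] : set (Cspace R d)).
  have := mun n; move=> /(measurable_funS (measurable_open oU) DU') h.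
  by have := h mD _ (measurable_itv `]-oo, (e * un n q)[); rewrite setIC; congr measurable; apply/seteqP; split => p /=;
    rewrite in_itv /= => -[].
have mSu : measurable ([set p | pdisc q r p /\ u p < e * u q] : set (Cspace R d)).
  have := mu; move=> /(measurable_funS (measurable_open oU) DU') h.
  by have := h mD _ (measurable_itv `]-oo, (e * u q)[); rewrite setIC; congr measurable; apply/seteqP; split => p /=;
    rewrite in_itv /= => -[].
have ind (A : set (Cspace R d)) (c : R) : measurable A -> A `<=` pdisc q r -> 0 <= c ->
    (\int[V]_(p in pdisc q r) (c * \1_A p)%:E = c%:E * V A)%E.
  move=> mA AD c0; under eq_integral do rewrite EFinM.
  rewrite ge0_integralZl//; first by rewrite integral_indic// setIidl.
  by apply/measurable_EFinP; exact: measurable_indic.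
have u0 z : U z -> 0 <= u z.
  by move=> Uz; rewrite -(cvg_lim _ (uncvg z Uz))//; apply: limr_ge; [exact: cvgP (uncvg z Uz)|apply: nearW => n; exact: un0].
have fin (h : Cd -> R) : measurable_fun (U : set (Cspace R d)) (h : Cspace R d -> RR) ->
    (forall p, pdisc q r p -> 0 <= h p <= C) -> (\int[V]_(p in pdisc q r) (h p)%:E)%E \is a fin_num.
  move=> mh h0; rewrite ge0_fin_numE; last by apply: integral_ge0 => p /h0 /andP[? _]; rewrite lee_fin.
  apply: (@le_lt_trans _ _ (\int[V]_(p in pdisc q r) C%:E)%E).
    apply: ge0_le_integral => //.
    - by move=> p /h0 /andP[? _]; rewrite lee_fin.
    - by apply/measurable_EFinP; exact: measurable_funS (measurable_open oU) DU' mh.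
    - by move=> p /h0 /andP[_ ?]; rewrite lee_fin.
    rewrite integral_cst//= lte_mul_pinfty ?lee_fin//; have /h0 /andP[? ?] := pdisc_center q r0; lra.
have unC n p : pdisc q r p -> 0 <= un n p <= C.
  by move=> Dp; rewrite un0 ?HC//; [exact: subset_closure|exact: DU'].
have uC p : pdisc q r p -> 0 <= u p <= C.
  move=> Dp; rewrite u0 /=; last exact: DU'.
  rewrite -(cvg_lim _ (uncvg p (DU' _ Dp)))//; apply: limr_le; first exact: cvgP (uncvg p (DU' _ Dp)).
  by apply: nearW => n; have /andP[] := unC n p Dp.
have fu := fin _ mu uC; have fun_ n := fin _ (mun n) (unC n).
apply/lee_addgt0Pr => eta eta0.
have [N0 HN0] : exists N0, forall n, (N0 <= n)%N -> (\int[V]_(p in pdisc q r) (un n p)%:E <= \int[V]_(p in pdisc q r) (u p)%:E + eta%:E)%E.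
  have h : (fun n => fine (\int[V]_(p in pdisc q r) (un n p)%:E)%E) @ \oo --> fine (\int[V]_(p in pdisc q r) (u p)%:E)%E.
    by apply: fine_cvg; rewrite fineK.
  have /cvgrPdist_le/(_ _ eta0)[N0 _ HN0] := h; exists N0 => n /HN0 /=.
    rewrite ler_norml => /andP[lo _]; rewrite -(fineK fu) -(fineK (fun_ n)) -EFinD lee_fin.
    by move: lo; set x := fine _; set y := fine _; lra.
have c0 : 0 <= u q * - ln e by rewrite mulr_ge0// u0.
have cn0 n : 0 <= un n q * - ln e by rewrite mulr_ge0// un0.
rewrite -ind//; last by move=> p [].
apply: (@fatou_epsilon _ _ _ V (pdisc q r) (fun n p => un n q * - ln e * \1_[set p | pdisc q r p /\ un n p < e * un n q] p) _ _ N0) => //.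
- by move=> n; apply: measurable_funM => //; exact: measurable_indic.
- by apply: measurable_funM => //; exact: measurable_indic.
- by move=> n x _; rewrite mulr_ge0.
- by move=> x _; rewrite mulr_ge0.
- move=> x Dx e' e'0; have Ux := DU' _ Dx.
  have [xS|xS] := pselect (pdisc q r x /\ u x < e * u q); last first.
    exists 0%N => n _; rewrite [leLHS](_ : _ = 0); last by rewrite indicE memNset// mulr0.
    by apply: addr_ge0; [apply: mulr_ge0|exact: ltW].
  have h1 : (fun n => un n q * - ln e) @ \oo --> u q * - ln e by apply: cvgM; [exact: uncvg|exact: cvg_cst].
  have h2 : (fun n => e * un n q - un n x) @ \oo --> e * u q - u x.
    by apply: cvgB; [apply: cvgM; [exact: cvg_cst|exact: uncvg]|exact: uncvg].
  have s0 : 0 < (e * u q - u x) / 2 by rewrite divr_gt0// subr_gt0; case: xS.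
  have /cvgrPdist_le/(_ _ e'0)[N1 _ HN1] := h1; have /cvgrPdist_le/(_ _ s0)[N2 _ HN2] := h2.
  exists (maxn N1 N2) => n; rewrite geq_max => /andP[n1 n2].
  have := HN1 n n1; have := HN2 n n2; rewrite /= !ler_norml => /andP[_ h3] /andP[_ h4].
  have xSn : pdisc q r x /\ un n x < e * un n q.
    by split => //; move: h3 s0; set a := e * u q; set b := e * un n q; lra.
  rewrite !indicE !mem_set// !mulr1; move: h4; set a := u q * _; set b := un n q * _; lra.
- move=> n nN; rewrite ind//; last by move=> p [].
  by apply: le_trans (HN0 n nN); have [_] := H n q r r0 DU; exact.
Qed.

Variables (U : set Cd) (w : Cd -> R).
Hypotheses (oU : open U) (mw : measurable_fun (U : set (Cspace R d)) (w : Cspace R d -> R)).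
Hypotheses (w0 : forall z, U z -> 0 < w z)
  (wi : forall (B : set (Cspace R d)) (mB : measurable B),
      relatively_compact U B -> (0 < V B)%E ->
      (0 < ess_inf (mrestr V mB) (fun z => (w z)%:E))%E).
Variable K : Cd -> Cd -> R[i].
Hypothesis hK : reproducing_kernel U w K.

(** The kernel taken with respect to [V] instead of the weighted measure: in a determinant the
    square roots collect into the product of the weights. *)
Definition wkern (x y : Cspace R d) : R[i] :=
  if ((x : Cd) \in U) && ((y : Cd) \in U) then K x y * (Num.sqrt (w x))%:C * (Num.sqrt (w y))%:C else 0.

Let N n := size (onb (appr U K n)).
Let phi n (i : 'I_(N n)) : Cspace R d -> R[i] := wt U w (nth (fun=> 0) (onb (appr U K n)) i).
Let S n := apprP oU mw w0 hK n.

Let mphi n i : cmeasurable setT (@phi n i).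
Proof. by apply: cmeasurable_wt => //; have [] := onb_A2 (S n) (ltn_ord i). Qed.

Let phi_int n i : (\int[V]_z (normc (@phi n i z) ^+ 2)%:E < +oo)%E.
Proof. by rewrite wt_int//; have [] := onb_A2 (S n) (ltn_ord i). Qed.

Let phi_on n i j : Cint V setT (fun z => @phi n i z * (@phi n j z)^*) = (i == j)%:R.
Proof. by have := onb_ip (S n) (ltn_ord i) (ltn_ord j); rewrite /ip => ->. Qed.

Let gramE n x y : U x -> U y -> gram (@phi n) x y = (K x y - res (appr U K n) x y) * (Num.sqrt (w x))%:C * (Num.sqrt (w y))%:C.
Proof.
move=> Ux Uy; have cs (a : R) : a%:C^* = a%:C :> R[i] by apply/eqP; rewrite eq_complex /= oppr0 !eqxx.
rewrite (res_K (S n)) addrAC subrr add0r !mulr_suml; apply: eq_bigr => i _.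
by rewrite /phi /wt !mem_set// rmorphM /= cs; ring.
Qed.

Let kk_cvg x y : ccvg (fun n => gram (@phi n) x y) (wkern x y).
Proof.
rewrite /wkern; case: ifPn => [/andP[/set_mem Ux /set_mem Uy]|h].
  under eq_fun do rewrite gramE//.
  apply: ccvgM; last exact: ccvg_cst.
  apply: ccvgM; last exact: ccvg_cst.
  rewrite -[X in ccvg _ X]subr0; have h := appr_cvg oU mw w0 wi hK Ux Uy.
  split; under eq_fun do rewrite raddfB /=; rewrite raddfB /=; apply: cvgB; try exact: cvg_cst; apply: norm_cvg0;
    apply: (squeeze_cvgr _ (@cvg_cst _ _ _ _ _) h); apply: nearW => n; rewrite normr_ge0 /=; [exact: normc_Re|exact: normc_Im].
rewrite (_ : (fun _ => _) = fun=> 0); first exact: ccvg_cst.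
apply/funext => n; rewrite /gram big1// => i _; rewrite /phi /wt.
by move: h; rewrite negb_and => /orP[/negbTE ->|/negbTE ->]; rewrite ?mul0r// conjC0 mulr0.
Qed.

Lemma wkern_diag x : U x -> complex.Re (wkern x x) = complex.Re (K x x) * w x.
Proof.
move=> Ux; rewrite /wkern !mem_set//= -mulrA -rmorphM /= -expr2 sqr_sqrtr ?(ltW (w0 Ux))//.
by case: (K x x) => a b /=; rewrite mulr0 subr0.
Qed.

Let phi_le n x : sqn (@phi n) x <= complex.Re (wkern x x).
Proof.
have [Ux|nU] := pselect (U x); last first.
  rewrite /sqn big1; last by move=> i _; rewrite /phi /wt memNset// normc0 expr0n.
  by rewrite /wkern memNset.
have := gram_diag (@phi n) x; rewrite gramE// -mulrA -rmorphM /= -expr2 sqr_sqrtr ?(ltW (w0 Ux))// => /(congr1 (@complex.Re R)) /= <-.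
rewrite wkern_diag//; have := appr_diag_ge0 oU mw w0 hK n Ux; move: (res _ x x) (K x x) => [a b] [a' b'] /= a0.
by rewrite mulr0 subr0 ler_wpM2r ?(ltW (w0 Ux))// gerDl oppr_le0.
Qed.

Lemma wkern_approx : exists (N : nat -> nat) (phi : forall n, 'I_(N n) -> Cspace R d -> R[i]),
  [/\ forall n i, cmeasurable setT (phi n i), forall n i, (\int[V]_z (normc (phi n i z) ^+ 2)%:E < +oo)%E,
    forall n i j, Cint V setT (fun z => phi n i z * (phi n j z)^*) = (i == j)%:R,
    forall x y, ccvg (fun n => gram (phi n) x y) (wkern x y) &
    forall n x, sqn (phi n) x <= complex.Re (wkern x x)].
Proof. by exists N, (@phi). Qed.

Lemma corr_wkern l (t : l.-tuple (Cspace R d)) : (forall i, U (tnth t i)) ->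
  corr wkern t = complex.Re (\det (\matrix_(i < l, j < l) K (tnth t i) (tnth t j))) * \prod_(i < l) w (tnth t i).
Proof.
move=> tU; pose s : 'rV[R[i]]_l := \row_i (Num.sqrt (w (tnth t i)))%:C.
have -> : corr wkern t = complex.Re (\det (diag_mx s *m (\matrix_(i < l, j < l) K (tnth t i) (tnth t j)) *m diag_mx s)).
  rewrite /corr (@kdetE _ _ _ _ l); last by rewrite size_map size_tuple.
  congr (complex.Re (\det _)); apply/matrixP => i j; rewrite mxE !(nth_map point) ?size_tuple//=.
  rewrite mul_mx_diag mul_diag_mx !mxE -!(tnth_nth point) /wkern !mem_set//=.
  by rewrite [_ * K _ _]mulrC.
rewrite !det_mulmx !det_diag [X in complex.Re X](_ : _ = \det (\matrix_(i < l, j < l) K (tnth t i) (tnth t j)) * (\prod_(i < l) w (tnth t i))%:C).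
  by case: (\det _) => a b /=; rewrite mulr0 subr0.
rewrite mulrAC mulrC; congr (_ * _); rewrite -big_split rmorph_prod; apply: eq_bigr => i _.
have e : Num.sqrt (w (tnth t i)) * Num.sqrt (w (tnth t i)) = w (tnth t i) by rewrite -expr2 sqr_sqrtr// ltW// w0.
by rewrite -[in RHS]e [RHS]rmorphM !mxE.
Qed.

Variables (E : set (Cspace R d)) (tau : R).
Hypotheses (mE : measurable E) (tauE : (\int[V]_(z in E) (complex.Re (wkern z z))%:E = tau%:E)%E).
Local Notation J := (jan V wkern E).
Local Notation kappa x := (complex.Re (wkern x x)).

Let measurable_Jcons s : measurable_fun setT (fun z => J (z :: s)).
Proof.
have h := @measurable_jan _ _ _ V N (@phi) wkern E tau mE mphi kk_cvg phi_le tauE 1 s.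
have h' := measurableT_comp h (@measurable_tuple_cons _ (Cspace R d) 0).
have := measurableT_comp h' (measurable_fun_pair (@measurable_id _ (Cspace R d) setT) (@measurable_cst _ _ _ _ setT [tuple])).
exact.
Qed.

Lemma Janossy_locint s : (forall B, compact B -> B `<=` U -> (\int[V]_(z in (B : set (Cspace R d))) (kappa z)%:E < +oo)%E) ->
  locint U (fun z => J (z :: s)).
Proof.
move=> kint; split.
- apply: (@measurable_funS _ _ _ _ setT) => //.
    exact: measurable_Jcons.
- by move=> z _; exact: (jan_ge0 mE mphi phi_int phi_on kk_cvg phi_le tauE).
- move=> B cB BU; have mB : measurable (B : set (Cspace R d)) by apply: measurable_closed; exact: compact_closed.
  have mkap := measurable_kappa mphi kk_cvg.
  have c0 : 0 <= expR tau * prodk wkern s by rewrite mulr_ge0 ?expR_ge0// (prodk_ge0 phi_le).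
  have k0 z : 0 <= kappa z by apply: le_trans (phi_le 0 z); exact: sqn_ge0.
  apply: (@le_lt_trans _ _ (\int[V]_(z in (B : set (Cspace R d))) ((expR tau * prodk wkern s)%:E * (kappa z)%:E))%E).
    apply: ge0_le_integral => //.
    - by move=> z _; rewrite lee_fin; exact: (jan_ge0 mE mphi phi_int phi_on kk_cvg phi_le tauE).
    - by apply/measurable_EFinP; exact: measurable_funS measurableT (@subsetT _ _) (measurable_Jcons s).
    - by apply: measurable_funeM; apply/measurable_EFinP; exact: measurable_funS mkap.
    - move=> z _; rewrite -EFinM lee_fin; apply: (le_trans (jan_le mE mphi kk_cvg phi_le tauE _)).
      by rewrite /prodk big_cons mulrCA mulrC.
  rewrite ge0_integralZl//.
  + by rewrite lte_mul_pinfty ?lee_fin//; exact: kint.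
  + by apply/measurable_EFinP; exact: measurable_funS mkap.
  + by move=> z _; rewrite lee_fin.
Qed.

(** The approximations [un] satisfy the inequalities by [holo_submean], applied to the polarized
    density divided by the square roots of the weights. Interpolation makes that quotient
    holomorphic in [p], and Cauchy-Schwarz for [Japprox] is the hypothesis on moduli. *)
Lemma Janossy_submean s : all (fun z => z \in U) s -> log_submean U (fun z => J (z :: s) / w z).
Proof.
move=> sU.
pose un n z := complex.Re (Japprox V (@phi) E n z z s) / w z.
have mwV : measurable_fun (U : set (Cspace R d)) (fun z : Cspace R d => (w z)^-1 : RR).
  apply: (eq_measurable_fun (fun z : Cspace R d => expR (0 - ln (w z)))).
    by move=> z /set_mem Uz; rewrite sub0r expRN lnK// posrE w0.
  apply: measurableT_comp => //; apply: measurable_funB; first exact: measurable_cst.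
  by apply: (measurableT_comp (@measurable_ln R) mw).
have mun n : measurable_fun (U : set (Cspace R d)) (un n : Cspace R d -> RR).
  apply: measurable_funM => //; apply: (@measurable_funS _ _ _ _ setT) => //.
      exact: (measurable_Japprox V mE mphi phi_le n s).
have un0 n z : U z -> 0 <= un n z.
  move=> Uz; rewrite /un divr_ge0 ?(ltW (w0 Uz))//.
  exact: (Japprox_ge0 mE mphi phi_int phi_on n z s).1.
apply: (log_submean_cvg oU mun un0).
- move=> z Uz; apply: cvgM; last exact: cvg_cst.
  exact: (Japprox_cvg mE mphi kk_cvg phi_le tauE).
(* Division by [w] cancels the weight in [kappa], and [K z z] is bounded on compact sets by
   [point_bound], applied to the kernel function at [z]. *)
- move=> B cB BU; have [C C0 HC] := point_bound oU mw w0 wi cB BU.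
  exists (expR tau * prodk wkern s * C) => n z Bz; have Uz := BU _ Bz.
  have p0 : 0 <= expR tau * prodk wkern s by rewrite mulr_ge0 ?expR_ge0// (prodk_ge0 phi_le).
    have S0 := S 0.
  rewrite /un ler_pdivrMr ?w0//; apply: (le_trans (Japprox_le mE mphi kk_cvg phi_le tauE n z s)).
  rewrite /prodk big_cons wkern_diag// [leLHS](_ : _ = expR tau * prodk wkern s * complex.Re (K z z) * w z); last by rewrite /prodk; ring.
  rewrite ler_wpM2r ?(ltW (w0 Uz))// ler_wpM2l//.
  have := HC _ _ (res_A2 S0 Uz) Bz; rewrite (res_ip S0 Uz Uz) /=.
  have K0 : 0 <= complex.Re (K z z) by have := appr_diag_ge0 oU mw w0 hK 0 Uz.
  have := normc_Re (K z z); rewrite ger0_norm// => h1 h2.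
  have h3 : complex.Re (K z z) ^+ 2 <= C * complex.Re (K z z).
    by apply: le_trans h2; rewrite ler_pXn2r ?nnegrE ?normc_ge0.
  move: K0; rewrite le_eqVlt => /orP[/eqP <- //|K0].
  by rewrite -(ler_pM2r K0) -expr2.
- move=> n q r r0 DU.
  have DU' : pdisc q r `<=` U by apply: subset_trans DU; exact: subset_closure.
  have Uq : U q by apply: DU'; exact: pdisc_center.
  pose G p := Japprox V (@phi) E n p q s.
  pose sq (z : Cd) : R := Num.sqrt (w z).
  have sq0 z : U z -> (sq z)%:C != 0 :> R[i].
    by move=> Uz; rewrite (inj_eq (@complexI R)) gt_eqF// sqrtr_gt0 w0.
  have GE p : U p -> G p = \sum_(a <- interp (appr U K n)) (a.2 p * (sq p)%:C / (sq a.1)%:C) * Japprox V (@phi) E n a.1 q s.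
    move=> Up; apply: (@Galt_span _ _ _ V (N n) (@phi n) E mE (mphi (n := n)) (phi_int (n := n)) (phi_on (n := n)) _ _ (fun a : Cd * (Cd -> R[i]) => a.1) (fun a => a.2 p * (sq p)%:C / (sq a.1)%:C)) => i.
    rewrite {1}/phi /wt mem_set// (interp_onb (S n) p (ltn_ord i)) mulr_suml; apply: eq_big_seq => a ha.
    have Ua := interp_pt (S n) ha; rewrite /phi /wt mem_set//.
        rewrite -/(sq p) -/(sq a.1); have := sq0 _ Ua; move: (sq a.1)%:C (sq p)%:C (a.2 p) (nth _ _ _ _) => x1 x2 x3 x4 x10.
    by field.
  (* The function [G p / (sq p * sq q)] written through the interpolation formula, in which the
     factor [sq p] has cancelled; this form is visibly holomorphic. *)
  pose h p := \sum_(a <- interp (appr U K n)) a.2 p * ((sq a.1)%:C^-1 * Japprox V (@phi) E n a.1 q s / (sq q)%:C).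
  have hE p : U p -> h p = G p / ((sq p)%:C * (sq q)%:C).
    move=> Up; rewrite GE// mulr_suml; apply: eq_bigr => a _.
    have p0 := sq0 _ Up; have q0 := sq0 _ Uq.
        by move: (_^-1) (Japprox _ _ _ _ _ _ _) => v1 v2; field; rewrite p0 q0.
  have nsq z : U z -> normc (sq z)%:C ^+ 2 = w z.
    by move=> Uz; rewrite normc_sqr /= expr0n addr0 sqr_sqrtr// ltW// w0.
  have nh p : U p -> normc (h p) ^+ 2 = normc (G p) ^+ 2 / (w p * w q).
    move=> Up; rewrite hE// -(nsq p Up) -(nsq q Uq) -exprMn -normcMr -exprVn.
    have z0 : (sq p)%:C * (sq q)%:C != 0 :> R[i] by rewrite mulf_neq0 ?sq0.
    have := normcMr (G p / ((sq p)%:C * (sq q)%:C)) ((sq p)%:C * (sq q)%:C); rewrite divfK// => ->.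
    by rewrite -exprMn mulfK// gt_eqF// normc_gt0.
  apply: (@holo_submean _ _ h) => //.
  - move=> z /DU' Uz; rewrite /h.
    elim: (interp _) (@interp_holo _ _ _ _ _ _ (S n)) => [|a L IH] hh.
      under eq_fun do rewrite big_nil; exact: differentiable_cst.
    under eq_fun do rewrite big_cons; apply: differentiableD; last by apply: IH => b hb; apply: hh; rewrite inE hb orbT.
    apply: differentiableM; last exact: differentiable_cst.
    by apply: (hh a) => //; rewrite mem_head.
  - exact: measurable_funS (measurable_open oU) DU' (mun n).
  - by move=> z /DU'; exact: un0.
  - move=> z /DU' Uz; rewrite nh// /un [leRHS](_ : _ = complex.Re (Japprox V (@phi) E n z z s) * complex.Re (Japprox V (@phi) E n q q s) / (w z * w q)); last first.
            by rewrite invfM mulrACA.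
    rewrite ler_wpM2r ?invr_ge0 ?mulr_ge0 ?(ltW (w0 _))//.
    exact: (Japprox_cauchy_schwarz mE mphi phi_int phi_on n z q s).
  - have [J0 JE] := Japprox_ge0 mE mphi phi_int phi_on n q s.
    apply/eqP; rewrite -(@eqrXn2 _ 2)// ?normc_ge0 ?un0// nh// /G JE normc_sqr /= expr0n addr0 /un.
    by rewrite exprMn exprVn expr2 -expr2.
Qed.

End janossy_submean.

(** * Configurations *)

Section ordered_selections.
Variable T : eqType.
Implicit Types (s t : seq T) (f : seq T -> nat).

Fixpoint osel l s : seq (seq T) :=
  if l is l'.+1 then flatten [seq map (cons x) (osel l' (rem x s)) | x <- s] else [:: [::]].

Definition ordsum l s f : nat := (\sum_(t <- osel l s) f t)%N.

Lemma ordsum0 s f : ordsum 0 s f = f [::].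
Proof. by rewrite /ordsum big_seq1. Qed.

Lemma ordsumS l s f : ordsum l.+1 s f = (\sum_(x <- s) ordsum l (rem x s) (fun t => f (x :: t)))%N.
Proof. by rewrite /ordsum big_flatten big_map; apply: eq_bigr => x _; rewrite big_map. Qed.

Lemma eq_ordsum l s f g : f =1 g -> ordsum l s f = ordsum l s g.
Proof. by move=> fg; apply: eq_bigr => t _. Qed.

Lemma mem_osel l s t : uniq s -> (t \in osel l s) = [&& size t == l, uniq t & all (mem s) t].
Proof.
elim: l s t => [|l IH] s t us; first by case: t => [|x t]; rewrite inE.
apply/flatten_mapP/idP => [[x xs /mapP[u]]|].
  rewrite IH ?rem_uniq// => /and3P[/eqP su uu au] ->; rewrite /= su eqxx uu xs /=.
  have au' y : y \in u -> (y != x) && (y \in s) by move=> yu; have := allP au y yu; rewrite /= mem_rem_uniq// inE.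
  rewrite andbT; apply/andP; split; first by apply/negP => /au'; rewrite eqxx.
  by apply/allP => y /au' /andP[].
case: t => [|x t] //=; rewrite eqSS => /and3P[st /andP[xt ut] /andP[xs at_]]; exists x => //.
apply/mapP; exists t => //; rewrite IH ?rem_uniq// st ut /=; apply/allP => y yt /=.
have /= ys := allP at_ y yt; rewrite mem_rem_uniq// inE ys andbT; by apply: contraNneq xt => <-.
Qed.

Lemma uniq_osel l s : uniq s -> uniq (osel l s).
Proof.
elim: l s => [|l IH] s us //=; move: (us).
have gen (u : seq T) : {subset u <= s} -> uniq u -> uniq (flatten [seq map (cons x) (osel l (rem x s)) | x <- u]).
  elim: u => [|x u IHu] //= us' /andP[xu uu]; rewrite cat_uniq IHu//; last by move=> y yu; apply: us'; rewrite inE yu orbT.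
  rewrite map_inj_uniq ?IH ?rem_uniq//=; last by move=> a b [].
  rewrite andbT; apply/hasPn => t /flatten_mapP[y yu /mapP[v _ ->]]; apply/mapP => -[v' _ [e _]].
  by move: xu; rewrite -e yu.
by apply: gen.
Qed.

Lemma ordsum_perm l s s' f : perm_eq s s' -> ordsum l s f = ordsum l s' f.
Proof.
elim: l s s' f => [|l IH] s s' f ss; first by rewrite !ordsum0.
rewrite !ordsumS (perm_big _ ss) /=; apply: eq_bigr => x _; apply: IH.
have [xs|xs] := boolP (x \in s).
  by rewrite -(perm_cons x) -(permPl (perm_to_rem xs)) (permPl ss) perm_to_rem// -(perm_mem ss).
by rewrite !rem_id -?(perm_mem ss).
Qed.

(** Once the first [k] positions are chosen, the other [m] can be chosen in [(size s - k) ^_ m]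
    ways, and [f] does not see them. *)
Lemma ordsum_take k m s f : ordsum (k + m) s (fun t => f (take k t)) = (ordsum k s f * (size s - k) ^_ m)%N.
Proof.
elim: k s f => [|k IH] s f.
  rewrite ordsum0 add0n subn0; under eq_ordsum do rewrite take0.
  elim: m s => [|m IHm] s; first by rewrite ordsum0 ffactn0 muln1.
  rewrite ordsumS; have -> : (\sum_(x <- s) ordsum m (rem x s) (fun _ => f [::]) = \sum_(x <- s) f [::] * (size s).-1 ^_ m)%N.
    by apply: eq_big_seq => x xs; rewrite IHm size_rem.
  by rewrite big_const_seq count_predT iter_addn_0 ffactnS mulnC mulnCA.
rewrite addSn !ordsumS big_distrl /=; apply: eq_big_seq => x xs.
by rewrite (IH _ (fun t => f (x :: t))) size_rem//; congr (_ * _ ^_ _)%N; case: (size s) => //= n; rewrite ?subSS ?sub0n.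
Qed.

Lemma ordsum_sym s f : (forall t t', perm_eq t t' -> f t = f t') -> ordsum (size s) s f = ((size s)`! * f s)%N.
Proof.
have [n] := ubnP (size s); elim: n s f => // n IH s f sn fP.
case sE : (size s) => [|k]; first by rewrite ordsum0 fact0 mul1n; case: s sE {sn}.
rewrite ordsumS; have -> : (\sum_(x <- s) ordsum k (rem x s) (fun t => f (x :: t)) = \sum_(x <- s) k`! * f s)%N.
  apply: eq_big_seq => x xs; have sr : size (rem x s) = k by rewrite size_rem// sE.
  rewrite -[X in ordsum X]sr IH ?sr//; last by move=> t t' tt; apply: fP; rewrite perm_cons.
    by congr (_ * _)%N; apply: fP; rewrite perm_sym perm_to_rem.
  by rewrite -ltnS -sE.
by rewrite big_const_seq count_predT iter_addn_0 sE factS mulnC mulnA.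
Qed.

End ordered_selections.

Lemma ordsum_map (T T' : eqType) (h : T -> T') l (s : seq T) f : ordsum l (map h s) f = ordsum l s (fun t => f (map h t)).
Proof.
elim: l s f => [|l IH] s f; first by rewrite !ordsum0.
rewrite !ordsumS big_map; apply: eq_big_seq => x xs.
rewrite -(IH _ (fun t => f (h x :: t))); apply: ordsum_perm.
rewrite -(perm_cons (h x)) perm_sym -(permPr (perm_to_rem (map_f h xs))) perm_sym.
by rewrite -map_cons; apply: perm_map; exact: perm_to_rem.
Qed.

Lemma alternating_ffact (R : realType) n : (0 < n)%N -> \sum_(m < n.+1) (-1) ^+ m / m`!%:R * (n ^_ m)%:R = 0 :> R.
Proof.
move=> n0; have := exprDn (1 : R) (-1) n; rewrite subrr expr0n gtn_eqF//= => e; rewrite [RHS]e.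
apply: eq_bigr => m _; rewrite expr1n mul1r -bin_ffact natrM -[RHS]mulr_natl; field.
by rewrite pnatr_eq0 -lt0n fact_gt0.
Qed.

Section configuration_points.
Context (R : realType) (d : nat).
Local Notation V := (Clebesgue R d).
Local Notation Cd := 'rV[R[i]]_d.
Variables (U : set Cd).
Implicit Types (X : configuration U) (B E : set Cd).

Definition pts X E : seq Cd := finite_support 0%N E X.

Lemma pts_uniq X E : uniq (pts X E). Proof. exact: finite_support_uniq. Qed.

Lemma mem_pts X E z : relatively_compact U E -> (z \in pts X E) = `[< E z /\ X z != 0%N >].
Proof.
move=> [cE EU]; rewrite /pts in_finite_support; last first.
  by apply: sub_finite_set (configuration_locally_finite X cE EU) => x [/subset_closure Ex /= /eqP Xx]; split.
by apply/idP/asboolP; rewrite inE => -[Ez Xz]; split => //; exact/eqP.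
Qed.

Lemma config_countE X E B : simple_config X -> relatively_compact U E -> B `<=` E ->
  config_count X B = count (fun z => `[< B z >]) (pts X E).
Proof.
move=> sX rE BE; rewrite /config_count -sum1_count.
rewrite -[RHS]big_filter; apply: etrans.
  apply: (@fsbigE nat 0%N addn _ B [seq z <- pts X E | `[< B z >]]); last first.
    - move=> z Bz; rewrite mem_filter mem_pts// negb_and => /orP[/asboolP //|/asboolP nz].
    by apply/eqP; apply: contra_notT nz => Xz; split => //; exact: BE.
  - by move=> z /=; rewrite mem_filter => /andP[/asboolP].
  - by rewrite filter_uniq// pts_uniq.
rewrite [LHS]big_mkcond; apply: eq_big_seq => z; rewrite mem_filter => /andP[/asboolP Bz].
  rewrite mem_pts// => /asboolP[_ Xz]; rewrite mem_set//.
  by have := sX z; case: (X z) Xz => [|[]].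
Qed.

Lemma config_count_pts X E : simple_config X -> relatively_compact U E -> config_count X E = size (pts X E).
Proof.
move=> sX rE; rewrite (config_countE sX rE (B := E))//.
by apply/eqP; rewrite -all_count; apply/allP => z; rewrite mem_pts// => /asboolP[Ez _]; apply/asboolP.
Qed.

Lemma config_tuplesE X E l (Q : set (seq Cd)) : simple_config X -> relatively_compact U E ->
  config_tuples R X [set t : l.-tuple Cd | (forall i, E (tnth t i)) /\ Q t] =
  (ordsum l (pts X E) (fun t => `[< Q t >] : nat))%:R%:E :> \bar R.
Proof.
move=> sX rE; set A := [set t | _].
pose ok (t : l.-tuple Cd) := uniq t && all (fun z => X z != 0%N) t.
(* In a simple configuration, the weight is [1] on tuples of distinct particles. At a repeated
   position some factor is at most [1 - 1], and at an unoccupied one it is [0], by truncated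
   subtraction. *)
have term (t : l.-tuple Cd) : (\prod_(i < l) (X (tnth t i) - \sum_(j < l | (j < i)%N) (tnth t j == tnth t i)))%N = ok t :> nat.
  have [/andP[ut at_]|] := boolP (ok t).
    rewrite big1// => i _; rewrite big1 ?subn0.
      have := allP at_ _ (mem_tnth i t); have := sX (tnth t i); by case: (X _) => [|[]].
    move=> j ji; apply/eqP; rewrite eqb0 !(tnth_nth 0) nth_uniq ?size_tuple//.
    by rewrite neq_ltn ji.
  rewrite negb_and => /orP[nu|].
    have [i [j [ji e]]] : exists i j : 'I_l, (j < i)%N /\ tnth t j = tnth t i.
      move/(uniqPn 0): nu => [i [j []]]; rewrite size_tuple => ij jl e.
      by exists (Ordinal jl), (Ordinal (ltn_trans ij jl)); split => //; rewrite !(tnth_nth 0).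
    rewrite (bigD1 i)//= (bigD1 j)//= e eqxx.
    by have := sX (tnth t i); case: (X _) => [|[|]] // _; rewrite ?sub0n ?mul0n// addSn subSS sub0n mul0n.
  rewrite -has_predC => /hasP[z /tnthP[i ->] /=]; rewrite negbK => /eqP Xz.
  by rewrite (bigD1 i)//= Xz sub0n mul0n.
have okE (t : l.-tuple Cd) : (forall i, E (tnth t i)) -> ok t = (tval t \in osel l (pts X E)).
  move=> tE; rewrite mem_osel ?pts_uniq// size_tuple eqxx /= /ok; congr (_ && _).
  apply: eq_in_all => z /tnthP[i ->] /=; rewrite mem_pts//.
  by apply/idP/asboolP => [|[]].
pose S : seq (l.-tuple Cd) := pmap insub [seq t <- osel l (pts X E) | `[< Q t >]].
have memS (t : l.-tuple Cd) : (t \in S) = (tval t \in osel l (pts X E)) && `[< Q t >].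
  by rewrite mem_pmap_sub /= mem_filter andbC.
have uS : uniq S by apply: pmap_sub_uniq; apply: filter_uniq; apply: uniq_osel; exact: pts_uniq.
have SA (t : l.-tuple Cd) : t \in S -> A t /\ ok t.
  rewrite memS => /andP[tS /asboolP Qt].
  have tE i : E (tnth t i).
    move: tS; rewrite mem_osel ?pts_uniq// => /and3P[_ _ /allP /(_ _ (mem_tnth i t))] /=.
    by rewrite mem_pts// => /asboolP[].
  by split => //; rewrite okE.
rewrite /config_tuples (esumID [set` S]); last by move=> t _; rewrite lee_fin.
rewrite [X in (_ + X)%E]esum1 ?adde0; last first.
  move=> t [[tE Qt] tS]; rewrite term (_ : ok t = false)//; apply/negbTE/negP => h; apply: tS.
  by rewrite /= memS -okE// h /=; exact/asboolP.
have -> : A `&` [set` S] = [set` S] by apply/seteqP; split => [t []//|t tS]; split => //; have [] := SA t tS.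
rewrite esum_fset; [|exact: finite_seq|by move=> t _; rewrite lee_fin].
rewrite -fsbig_seq// (eq_big_seq (fun=> 1%E)); last by move=> t tS; rewrite term (SA t tS).2.
rewrite sumEFin; congr (_%:E); rewrite big_const_seq count_predT iter_addr addr0; congr (_%:R).
rewrite size_pmap_sub count_filter /ordsum (eq_bigr (fun t => if `[< Q t >] then 1 else 0)%N); last by move=> t _; case: asboolP.
rewrite -big_mkcond sum1_count; apply: eq_in_count => t; rewrite mem_osel ?pts_uniq// => /and3P[st _ _].
by rewrite /= st.
Qed.

End configuration_points.

(** * Occupation numbers and their measurability *)

Section occupancies.
Context (R : realType) (d : nat).
Local Notation V := (Clebesgue R d).
Local Notation Cd := 'rV[R[i]]_d.
Variables (U : set Cd) (E : set Cd).
Hypotheses (cE : compact E) (EU : E `<=` U).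

Lemma relatively_compact_sub (A : set Cd) : A `<=` E -> relatively_compact U A.
Proof.
move=> AE; have cAE : closure A `<=` E.
  by have := closureS AE; have cEl : closed E by [exact: compact_closed]; rewrite -(closure_id E).1.
split; last exact: subset_trans EU.
by apply: subclosed_compact cE _ => //; exact: closed_closure.
Qed.

Let rE : relatively_compact U E. Proof. exact: relatively_compact_sub. Qed.

Section occupancy.
Variables (J : finType) (B : J -> set (Cspace R d)).
Implicit Types (X : configuration U).

Definition occupancy X : {ffun J -> nat} := [ffun j => config_count X (B j)].

Definition cnt (t : seq Cd) : {ffun J -> nat} := [ffun j => count (fun z => `[< B j z >]) t].

Lemma occupancyE X : simple_config X -> (forall j, B j `<=` E) -> occupancy X = cnt (pts X E).
Proof. by move=> sX BE; apply/ffunP => j; rewrite !ffunE (config_countE sX rE). Qed.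

Lemma cnt_perm t t' : perm_eq t t' -> cnt t = cnt t'.
Proof. by move=> tt; apply/ffunP => j; rewrite !ffunE; exact: permP. Qed.

Hypothesis mB : forall j, measurable (B j).

Lemma measurable_occupancy (N : set {ffun J -> nat}) : (forall j, relatively_compact U (B j)) ->
  measurable ([set X | N (occupancy X)] : set (Conf U)).
Proof.
move=> rB; pose F (f : {ffun J -> nat}) : set (Conf U) :=
  if pselect (N f) then \bigcap_(j in [set: J]) [set X : Conf U | config_count X (B j) = f j] else set0.
rewrite (_ : [set X | _] = \bigcup_f F f).
  apply: countable_bigcupT_measurable; first exact: countableP.
  move=> f; rewrite /F; case: (pselect (N f)) => /= Nf; last exact: measurable0.
  apply: fin_bigcap_measurable => // j _; apply: sub_sigma_algebra.
  by exists (B j), [set f j]; split => //; exact: mB.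
apply/seteqP; split => [X NX|X [f _]].
  exists (occupancy X) => //; rewrite /F; case: (pselect (N (occupancy X))) => //= _ j _ /=.
  by rewrite ffunE.
rewrite /F; case: (pselect (N f)) => //= Nf H; rewrite /= (_ : occupancy X = f)//.
by apply/ffunP => j; rewrite ffunE; exact: H.
Qed.

End occupancy.

Section selections.
Variables (J : finType) (B : J -> set (Cspace R d)).
Hypotheses (mB : forall j, measurable (B j)) (BE : forall j, B j `<=` E).

(** The count depends only on how many particles lie in each atom [C b] generated by the sets [B j].
    A list of atoms with these multiplicities is rebuilt from the occupation numbers, which are
    measurable, and the selections are counted in that list. *)
Lemma measurable_ordsum k (N : set {ffun J -> nat}) : exists g : Conf U -> nat,
  (forall Y, measurable (g @^-1` Y)) /\
  forall X, simple_config (X : configuration U) -> g X = ordsum k (pts X E) (fun t => `[< N (cnt B t) >] : nat).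
Proof.
pose sgn z : {ffun J -> bool} := [ffun j => `[< B j z >]].
pose C b : set (Cspace R d) := [set z | E z /\ sgn z = b].
pose vX X : {ffun {ffun J -> bool} -> nat} := [ffun b => config_count (X : configuration U) (C b)].
pose u (v : {ffun {ffun J -> bool} -> nat}) : seq {ffun J -> bool} := xget [::] [set u | forall b, count_mem b u = v b].
pose h (s : seq {ffun J -> bool}) : nat := `[< N [ffun j => count (fun b : {ffun J -> bool} => b j) s] >].
exists (fun X => ordsum k (u (vX X)) h); split => [Y|X sX].
  have mC b : measurable (C b).
    rewrite (_ : C b = (E : set (Cspace R d)) `&` \bigcap_(j in [set: J]) (if b j then B j else ~` B j)).
      apply: measurableI; first by apply: measurable_closed; exact: compact_closed.
      by apply: fin_bigcap_measurable => // j _; case: (b j) => //; exact: measurableC.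
    apply/seteqP; split => [z [Ez <-]|z [Ez H]]; split => //.
      by move=> j _; rewrite /sgn ffunE; case: asboolP.
    apply/ffunP => j; rewrite ffunE; have := H j I; case: (b j) => h1; first exact/asboolP.
    by apply/asboolP.
  have rC b : relatively_compact U (C b) by apply: relatively_compact_sub => z [].
  pose N' : set {ffun {ffun J -> bool} -> nat} := [set v | Y (ordsum k (u v) h)].
  exact: (measurable_occupancy mC N' rC).
have vE b : count_mem b (map sgn (pts X E)) = vX X b.
  rewrite /vX ffunE (config_countE sX rE); last by move=> z [].
  rewrite count_map; apply: eq_in_count => z; rewrite mem_pts// => /asboolP[Ez _].
  by rewrite /=; apply/eqP/asboolP => [|[]].
have [_ uE] : [set u | forall b, count_mem b u = vX X b] (u (vX X)) /\ forall b, count_mem b (u (vX X)) = vX X b.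
  have H : [set u | forall b, count_mem b u = vX X b] (u (vX X)) by apply: (@xgetPex _ [::]); exists (map sgn (pts X E)).
  by split.
rewrite (@ordsum_perm _ k (u (vX X)) (map sgn (pts X E))).
  rewrite ordsum_map; apply: eq_ordsum => t; rewrite /h; congr (nat_of_bool (asbool (N _))).
  by apply/ffunP => j; rewrite !ffunE count_map; apply: eq_count => z; rewrite /= ffunE.
by apply/allP => b _ /=; rewrite uE vE.
Qed.

End selections.
End occupancies.

Section null_sets.
Import HBNNSimple.

Context dT (T : measurableType dT) (R : realType) (mu : {measure set T -> \bar R}).

(** Meant for [config_tuples], whose measurability is not known. The integral is a supremum over
    simple functions below the integrand, and a simple function may be cut off on a measurable null
    set at no cost. *)
Lemma integral_negligible_eq (f g : T -> \bar R) : (forall x, 0 <= f x)%E -> (forall x, 0 <= g x)%E ->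
  {ae mu, forall x, f x = g x} -> (\int[mu]_x f x = \int[mu]_x g x)%E.
Proof.
suff le (f' g' : T -> \bar R) : (forall x, 0 <= f' x)%E -> (forall x, 0 <= g' x)%E ->
    {ae mu, forall x, f' x = g' x} -> (\int[mu]_x f' x <= \int[mu]_x g' x)%E.
  move=> f0 g0 fg; apply/eqP; rewrite eq_le !le//.
  by apply: filterS fg => x ->.
move=> f0 g0 [Z [mZ Z0 HZ]]; rewrite !ge0_integralTE//; apply: ge_ereal_sup => _ [h /= hf <-].
have mCZ : measurable (~` Z) by exact: measurableC.
apply: ereal_sup_ubound; exists (proj_nnsfun h mCZ) => /=.
  move=> x; rewrite mindicE; have [xZ|xZ] := pselect (Z x); first by rewrite memNset ?mulr0 //=; apply: contrapT.
  rewrite mem_set// mulr1; have <- : f' x = g' x by apply: contrapT => H; apply: xZ; exact: HZ.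
  exact: hf.
have sE (k : {nnsfun T >-> R}) : sintegral mu k = (\int[mu]_x (k x)%:E)%E by rewrite integral_nnsfun// patch_setT.
rewrite -[sintegral mu (_ \* _)]/(sintegral mu (proj_nnsfun h mCZ)) !sE; apply: ae_eq_integral => //.
- by apply/measurable_EFinP.
- by apply/measurable_EFinP.
exists Z; split => // x /= nH; apply: contrapT => nZ; apply: nH => _.
by rewrite mindicE mem_set// mulr1.
Qed.

End null_sets.

(** * Local events of the determinantal process *)

Section patterns.
Context (R : realType) (d : nat).
Local Notation Cd := 'rV[R[i]]_d.
Local Notation T := (Cspace R d).
Variables (J : finType) (B : J -> set T).
Hypothesis mB : forall j, measurable (B j).

Definition pattern (z : T) : {ffun J -> bool} := [ffun j => `[< B j z >]].

Lemma cnt_pattern (t : seq T) : cnt B t = [ffun j => count (fun b : {ffun J -> bool} => b j) (map pattern t)].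
Proof. by apply/ffunP => j; rewrite !ffunE count_map; apply: eq_count => z; rewrite /= ffunE. Qed.

Lemma measurable_pattern n (Q : set (seq {ffun J -> bool})) : measurable [set t : n.-tuple T | Q (map pattern t)].
Proof.
have mC b : measurable [set z | pattern z = b].
  rewrite (_ : [set _ | _] = \bigcap_(j in [set: J]) (if b j then B j else ~` B j)).
    by apply: fin_bigcap_measurable => // j _; case: (b j) => //; exact: measurableC.
  apply/seteqP; split => [z <-|z H].
    by move=> j _; rewrite /pattern ffunE; case: asboolP.
  apply/ffunP => j; rewrite ffunE; have := H j I; case: (b j) => h1; first exact/asboolP.
  by apply/asboolP.
pose F (b : n.-tuple {ffun J -> bool}) : set (n.-tuple T) :=
  if pselect (Q b) then \bigcap_(i in [set: 'I_n]) [set t | pattern (tnth t i) = tnth b i] else set0.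
rewrite (_ : [set t | _] = \bigcup_b F b).
  apply: countable_bigcupT_measurable; first exact: countableP.
  move=> b; rewrite /F; case: (pselect (Q b)) => /= Qb; last exact: measurable0.
  apply: fin_bigcap_measurable => // i _; rewrite -[X in measurable X]setTI.
      have := @measurable_tnth _ T n i measurableT [set z | pattern z = tnth b i] (mC (tnth b i)); exact.
have mE (t : n.-tuple T) : map pattern t = map_tuple pattern t by [].
apply/seteqP; split => [t /= Qt|t [b _]].
  exists (map_tuple pattern t) => //; rewrite /F; case: (pselect (Q (map_tuple pattern t))) => //= _ i _ /=.
  by rewrite tnth_map.
rewrite /F; case: (pselect (Q b)) => //= Qb H; rewrite /= mE (_ : map_tuple pattern t = b)//.
by apply: eq_from_tnth => i; rewrite tnth_map; exact: H.
Qed.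

End patterns.

Section point_process.
Context (R : realType) (d : nat).
Local Notation V := (Clebesgue R d).
Local Notation Cd := 'rV[R[i]]_d.
Local Notation T := (Cspace R d).
Variables (U : set Cd) (w : Cd -> R).
Hypotheses (oU : open U) (mw : measurable_fun (U : set T) (w : T -> R)).
Hypotheses (w0 : forall z, U z -> 0 < w z)
  (wi : forall (B : set T) (mB : measurable B),
      relatively_compact U B -> (0 < V B)%E ->
      (0 < ess_inf (mrestr V mB) (fun z => (w z)%:E))%E).
Variable K : Cd -> Cd -> R[i].
Hypothesis hK : reproducing_kernel U w K.
Variable P : probability (Conf U) R.
Hypothesis hP : determinantal w K P.
Local Notation kk := (wkern U w K).
Local Notation kappa x := (complex.Re (kk x x)).

Let rho0 Z : 0 <= corr kk Z.
Proof. by have [N [phi [_ _ _ c l]]] := wkern_approx oU mw w0 wi hK; exact: corr_ge0 c l Z. Qed.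

Let mrho m X : measurable_fun setT (fun t : m.-tuple T => corr kk (t ++ X)).
Proof. by have [N [phi [m1 _ _ c l]]] := wkern_approx oU mw w0 wi hK; exact: (@measurable_corr _ _ _ N phi kk m1 c m X). Qed.

Let mrho0 m : measurable_fun setT (fun t : m.-tuple T => corr kk t).
Proof. by have := @mrho m [::]; under eq_fun do rewrite cats0. Qed.

Let kappa0 x : 0 <= kappa x.
Proof. by have [N [phi [_ _ _ _ l]]] := wkern_approx oU mw w0 wi hK; apply: le_trans (l 0 x); exact: sqn_ge0. Qed.

Let mkappa : measurable_fun setT (fun x : T => kappa x).
Proof. by have [N [phi [m1 _ _ c _]]] := wkern_approx oU mw w0 wi hK; exact: measurable_kappa m1 c. Qed.

Lemma integral_config_tuples (E : set T) l (Q : set (seq T)) : E `<=` U ->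
  measurable E -> measurable [set t : l.-tuple T | Q t] ->
  (\int[P]_X config_tuples R (X : configuration U) [set t : l.-tuple Cd | (forall i, E (tnth t i)) /\ Q t] =
   \int[tuple_measure V l]_(t in [set t | tset E l t /\ Q t]) (corr kk t)%:E)%E.
Proof.
move=> EU mE mQ; have mA : measurable [set t : l.-tuple T | tset E l t /\ Q t].
  by apply: measurableI => //; exact: measurable_tset.
(* [determinantal] speaks of [l > 0] only. For [l = 0] both sides are [1] or [0], according to [Q
   [::]]. *)
case: l mQ mA => [|l] mQ mA; last first.
  have [_ /(_ l.+1 isT _ mA) H] := hP; apply: etrans H _.
  rewrite (_ : _ `&` _ = [set t : l.+1.-tuple T | tset E l.+1 t /\ Q t]); last first.
    by apply/seteqP; split => [t []//|t [tE Qt]]; split => // i; apply: EU; exact: tE.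
  apply: eq_integral => t /set_mem [tE _]; congr (_%:E).
  by rewrite corr_wkern// => i; apply: EU; exact: tE.
have c1 : corr kk [::] = 1 by rewrite /corr kdet_nil.
have [Q0|nQ] := pselect (Q [::]).
  rewrite (_ : [set t : 0.-tuple T | _] = tset E 0); last by apply/seteqP; split => [t []//|t tE]; split => //; rewrite tuple0.
  rewrite integral_tuple0 /= c1 (eq_integral (fun=> 1%E)); first by rewrite integral_cst// mul1e; exact: probability_setT.
  move=> X _; rewrite /config_tuples (_ : tset E 0 = [set [tuple]]).
    by rewrite esum_set1 big_ord0// lee_fin.
  by apply/seteqP; split => [t _|t ->]; [rewrite [t]tuple0|case=> i hi].
have e0 : [set t : 0.-tuple Cd | (forall i, E (tnth t i)) /\ Q t] = set0.
  by apply/seteqP; split => // t [_]; rewrite tuple0.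
rewrite [in RHS](_ : [set t : 0.-tuple T | _] = set0) ?integral_set0.
  by rewrite e0 (eq_integral (fun=> 0%E)) ?integral0// => X _; rewrite /config_tuples esum_set0.
exact: e0.
Qed.

Let ms (D : set T) n : measurable D -> measurable [set t : n.-tuple T | tset D n t].
Proof. exact: measurable_tset. Qed.

Lemma measurable_count_fun (E : set T) (phi : nat -> R) : measurable E -> relatively_compact U E ->
  measurable_fun setT (fun X : Conf U => phi (config_count (X : configuration U) E)).
Proof.
move=> mE rE _ Y mY; rewrite setTI; apply: sub_sigma_algebra.
by exists E, [set n | Y (phi n)]; split => //; exact: mE.
Qed.

Lemma simple_ae (Q : Conf U -> Prop) : (forall X : Conf U, simple_config (X : configuration U) -> Q X) -> {ae P, forall X, Q X}.
Proof.
move=> sQ; have [[Z [mZ Z0 HZ]] _] := hP; exists Z; split => // X nQ; apply: HZ.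
by apply: contra_not nQ; exact: sQ.
Qed.

Lemma factorial_moment (E : set T) l : measurable E -> relatively_compact U E ->
  (\int[P]_X ((config_count (X : configuration U) E) ^_ l)%:R%:E = \int[tuple_measure V l]_(t in tset E l) (corr kk t)%:E)%E.
Proof.
move=> mE rE; have EU : E `<=` U by move=> z /subset_closure; exact: rE.2.
have := @integral_config_tuples E l setT EU mE (@measurableT _ _).
rewrite (_ : [set t : l.-tuple T | _ /\ setT _] = tset E l); last by apply/seteqP; split => [t []|t tE].
move=> <-; apply: integral_negligible_eq => [X|X|].
- by rewrite lee_fin.
- by apply: esum_ge0 => t _; rewrite lee_fin.
apply: simple_ae => X sX; rewrite (_ : tset E l = [set t : l.-tuple Cd | (forall i, E (tnth t i)) /\ setT (tval t)]); last first.
  by apply/seteqP; split => [t tE|t []].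
rewrite (@config_tuplesE _ _ _ X E l setT sX rE); congr (_%:R%:E).
have := ordsum_take 0 l (pts X E) (fun=> 1%N); rewrite add0n ordsum0 mul1n subn0.
rewrite (config_count_pts sX rE) => <-; apply: eq_ordsum => t.
by rewrite asboolT.
Qed.

(** As [w] has no upper bound, finiteness is drawn from the process. On [Em m], where [kappa <= m],
    the count has a finite mean [tau], and by Hadamard's inequality its variance is at most [tau].
    With probability at least one half the count is at most [c], uniformly in [m], so Chebyshev's
    inequality bounds [tau] independently of [m]. *)
Lemma trace_fin (E : set Cd) : compact E -> E `<=` U -> (\int[V]_(z in (E : set T)) (kappa z)%:E < +oo)%E.
Proof.
move=> cE EU; have mE : measurable (E : set T) by apply: measurable_closed; exact: compact_closed.
have VE : (V E < +oo)%E by exact: compact_Clebesgue_fin.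
have rE : relatively_compact U E by apply: (relatively_compact_sub cE EU).
pose Em m : set T := E `&` [set z | kappa z <= m%:R].
have mEm m : measurable (Em m).
  by apply: measurableI => //; have := mkappa measurableT (measurable_itv `]-oo, m%:R]); rewrite setTI;
    congr measurable; apply/seteqP; split => z /=; rewrite in_itv.
have EmE m : Em m `<=` E by move=> z [].
have rEm m : relatively_compact U (Em m) by apply: (relatively_compact_sub cE EU).
pose nE (X : Conf U) := config_count (X : configuration U) E.
have [c Hc] : exists c : nat, ((2^-1)%:E <= P [set X | (nE X <= c)%N])%E.
  have mX c : measurable [set X : Conf U | (nE X <= c)%N].
    by apply: sub_sigma_algebra; exists E, [set n | (n <= c)%N]; split.
  have ndX : nondecreasing_seq (fun c => [set X : Conf U | (nE X <= c)%N]).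
    by move=> a b ab; apply/subsetPset => X /= /leq_trans; apply.
  have UX : \bigcup_c [set X : Conf U | (nE X <= c)%N] = setT by apply/seteqP; split => [//|X _]; exists (nE X) => //=.
  have := @nondecreasing_cvg_mu _ _ _ P _ mX (bigcupT_measurable _ mX) ndX; rewrite UX.
    have e1 : P [set: Conf U] = 1%E := probability_setT P.
  move=> h; have {h} : (fun c => P [set X : Conf U | (nE X <= c)%N]) @ \oo --> 1%E by rewrite -e1; exact: h.
  have half0 : 0 < 2^-1 :> R by rewrite invr_gt0.
  move=> /fine_cvgP[_ /cvgrPdist_le /(_ _ half0)[c _ /(_ c (leqnn c)) /= Hc]].
  exists c; rewrite -[leRHS]fineK ?lee_fin; last exact: fin_num_measure.
  by move: Hc; rewrite ler_norml => /andP[_]; set x := fine _; lra.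
have key m : (\int[V]_(z in Em m) (kappa z)%:E <= (2 * c%:R + 8)%:E)%E.
  have kV : (\int[V]_(z in Em m) (kappa z)%:E < +oo)%E.
    apply: (@le_lt_trans _ _ (\int[V]_(z in Em m) m%:R%:E)%E).
      apply: ge0_le_integral => //.
      - by move=> z _; rewrite lee_fin.
      - by apply/measurable_EFinP; exact: measurable_funS measurableT (@subsetT _ _) mkappa.
      - by move=> z [_ zm]; rewrite lee_fin.
    rewrite integral_cst// lte_mul_pinfty ?lee_fin//.
    by apply: le_lt_trans VE; apply: le_measure; rewrite ?inE//.
  set tau := fine (\int[V]_(z in Em m) (kappa z)%:E)%E.
  have tauE : (\int[V]_(z in Em m) (kappa z)%:E = tau%:E)%E.
    by rewrite fineK// ge0_fin_numE//; apply: integral_ge0 => z _; rewrite lee_fin.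
  have tau0 : 0 <= tau by rewrite fine_ge0//; apply: integral_ge0 => z _; rewrite lee_fin.
  pose n (X : Conf U) := config_count (X : configuration U) (Em m).
  have [N [phi [mphi _ _ kc kl]]] := wkern_approx oU mw w0 wi hK.
  have F2 : (\int[P]_X ((n X) ^_ 2)%:R%:E <= (tau ^+ 2)%:E)%E.
    rewrite factorial_moment// -(integral_prodk_tset (mEm m) mphi kc kl tauE 2).
    apply: ge0_le_integral => //; first exact: measurable_tset.
    - by move=> t _; rewrite lee_fin.
    - by apply/measurable_EFinP; exact: measurable_funS measurableT (@subsetT _ _) (@mrho0 2).
    - have := measurable_prodk mphi kc (m := 2) [::]; under eq_fun do rewrite cats0.
      by move=> h; apply/measurable_EFinP; exact: measurable_funS measurableT (@subsetT _ _) h.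
    - by move=> t _; rewrite lee_fin; exact: corr_le kc kl t.
  have F1 : (\int[P]_X ((n X)%:R)%:E = tau%:E)%E.
    rewrite -tauE; under eq_integral do rewrite -[n _]ffactn1.
    rewrite factorial_moment// integral_tuple_cons//.
    - apply: eq_integral => z _; rewrite integral_tuple0 /= /corr (@kdetE _ _ _ _ 1)//.
      by rewrite (mx11_scalar (\matrix_(i, j) _)) det_scalar1 mxE.
    - by apply/measurable_EFinP; exact: mrho0.
    - by move=> t; rewrite lee_fin.
  rewrite tauE lee_fin leNgt; apply/negP => tauc.
  have c0 : 0 <= c%:R :> R by [].
  pose S := [set X : Conf U | (nE X <= c)%N].
  have mS : measurable S by apply: sub_sigma_algebra; exists E, [set k | (k <= c)%N]; split.
  have mphi' f := @measurable_count_fun (Em m) f (mEm m) (rEm m).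
  (* As [n ^_ 2 + n = n ^ 2], this integrates [(tau - c) ^ 2 * 1_S <= (n - tau) ^ 2], valid because
     [n <= c < tau] on [S]; the cross term is moved to the left to keep both sides nonnegative. *)
  have H : (\int[P]_X (((tau - c%:R) ^+ 2 * \1_S X)%:E + (2 * tau * (n X)%:R)%:E) <=
      \int[P]_X ((((n X) ^_ 2)%:R)%:E + ((n X)%:R + tau ^+ 2)%:E))%E.
    apply: ae_ge0_le_integral => //.
    - move=> X _; rewrite -EFinD lee_fin; apply: addr_ge0; first by rewrite mulr_ge0 ?sqr_ge0.
      by rewrite !mulr_ge0.
    - apply: emeasurable_funD; apply/measurable_EFinP; first by apply: measurable_funM => //; exact: measurable_indic.
      exact: (mphi' (fun k => 2 * tau * k%:R)).
    - by move=> X _; rewrite -EFinD lee_fin !addr_ge0 ?sqr_ge0.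
    - by apply: emeasurable_funD; apply/measurable_EFinP; [exact: (mphi' (fun k => (k ^_ 2)%:R))|exact: (mphi' (fun k => k%:R + tau ^+ 2))].
    apply: simple_ae => X sX _; rewrite -!EFinD lee_fin.
    have e2 k : (k ^_ 2)%:R = k%:R * (k%:R - 1) :> R.
      by case: k => [|k]; [rewrite mul0r|rewrite ffactnS ffactn1 natrM -natr1 addrK].
    rewrite e2; have [XS|XS] := pselect (S X); last first.
      rewrite indicE memNset// mulr0 add0r; move: (n X)%:R => x.
      by have := sqr_ge0 (x - tau); rewrite sqrrB expr2; lra.
    have : (n X <= c)%N.
      apply: leq_trans XS; rewrite /n /nE !(config_countE sX rE)//.
      by apply: sub_count => z /asboolP /EmE Ez; exact/asboolP.
    rewrite indicE mem_set// mulr1 -(ler_nat R); move: (n X)%:R => x xc.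
    have : 0 <= (c%:R - x) * (2 * tau - c%:R - x) by rewrite mulr_ge0//; lra.
    nra.
  have i1 X : (0 <= ((n X ^_ 2)%:R)%:E :> \bar R)%E by rewrite lee_fin.
  have i2 : measurable_fun setT (fun X => ((n X ^_ 2)%:R)%:E : \bar R) by apply/measurable_EFinP; exact: (mphi' (fun k => (k ^_ 2)%:R)).
  have i3 X : (0 <= ((n X)%:R + tau ^+ 2)%:E)%E by rewrite lee_fin addr_ge0 ?sqr_ge0.
  have i4 : measurable_fun setT (fun X => ((n X)%:R + tau ^+ 2)%:E) by apply/measurable_EFinP; exact: (mphi' (fun k => k%:R + tau ^+ 2)).
  have i5 X : (0 <= ((tau - c%:R) ^+ 2 * \1_S X)%:E)%E by rewrite lee_fin mulr_ge0 ?sqr_ge0.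
  have i6 : measurable_fun setT (fun X => ((tau - c%:R) ^+ 2 * \1_S X)%:E).
    by apply/measurable_EFinP; apply: measurable_funM => //; exact: measurable_indic.
  have i7 X : (0 <= (2 * tau * (n X)%:R)%:E)%E by rewrite lee_fin !mulr_ge0.
  have i8 : measurable_fun setT (fun X => (2 * tau * (n X)%:R)%:E) by apply/measurable_EFinP; exact: (mphi' (fun k => 2 * tau * k%:R)).
  move: H; rewrite (ge0_integralD _ measurableT (fun X _ => i5 X) i6 (fun X _ => i7 X) i8).
  rewrite (ge0_integralD _ measurableT (fun X _ => i1 X) i2 (fun X _ => i3 X) i4).
  have -> : (\int[P]_X ((tau - c%:R) ^+ 2 * \1_S X)%:E = ((tau - c%:R) ^+ 2)%:E * P S)%E.
    under eq_integral do rewrite EFinM.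
    rewrite ge0_integralZl ?lee_fin ?sqr_ge0//; first by rewrite integral_indic// setIT.
    by apply/measurable_EFinP; exact: measurable_indic.
  have -> : (\int[P]_X (2 * tau * (n X)%:R)%:E = (2 * tau * tau)%:E)%E.
    under eq_integral do rewrite EFinM.
    rewrite ge0_integralZl ?lee_fin ?mulr_ge0//; first by rewrite F1 -EFinM.
    by apply/measurable_EFinP; exact: (mphi' (fun k => k%:R)).
  have -> : (\int[P]_X ((n X)%:R + tau ^+ 2)%:E = (tau + tau ^+ 2)%:E)%E.
    under eq_integral do rewrite EFinD.
    rewrite ge0_integralD//.
    + by rewrite F1 integral_cst// [X in (_ * X)%E]probability_setT mule1.
    + by apply/measurable_EFinP; exact: (mphi' (fun k => k%:R)).
    + by move=> X _; rewrite lee_fin sqr_ge0.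
  move=> /le_trans /(_ (leeD2r _ F2)).
  have : (((tau - c%:R) ^+ 2 * 2^-1)%:E <= ((tau - c%:R) ^+ 2)%:E * P S)%E.
    by rewrite EFinM lee_wpmul2l ?lee_fin ?sqr_ge0.
  move=> /(leeD2r (2 * tau * tau)%:E) /le_trans h /h; rewrite -!EFinD lee_fin.
  nra.
apply: (@le_lt_trans _ _ (2 * c%:R + 8)%:E); last exact: ltry.
apply: (@fatou_epsilon _ _ _ V (E : set T) (fun m z => kappa z * \1_(Em m) z) (fun z => kappa z) _ 0) => //.
- move=> m; apply: measurable_funM; first exact: measurable_funS measurableT (@subsetT _ _) mkappa.
  exact: measurable_indic.
- exact: measurable_funS measurableT (@subsetT _ _) mkappa.
- by move=> m z _; rewrite mulr_ge0.
- move=> z Ez e e0; exists (Num.truncn (kappa z)).+1 => m hm.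
  rewrite indicE mem_set ?mulr1 ?lerDl ?(ltW e0)//; split => //=.
  by apply: ltW; apply: lt_le_trans (truncnS_gt _) _; rewrite ler_nat.
- move=> m _; apply: le_trans (key m); rewrite le_eqVlt; apply/orP; left; apply/eqP.
  rewrite -[in RHS](setIidr (@EmE m)) integral_mkcondr; apply: eq_integral => z _.
  by rewrite patchE indicE; case: ifPn => zE; rewrite ?mulr1 ?mulr0.
Qed.

End point_process.

Lemma integral_lincomb d (T : measurableType d) (R : realType) (mu : {measure set T -> \bar R}) (D : set T)
    (F : nat -> T -> R) (c : nat -> R) M : measurable D -> (forall m, mu.-integrable D (EFin \o F m)) ->
  (\int[mu]_(x in D) (\sum_(m < M) c m * F m x)%:E = (\sum_(m < M) c m * fine (\int[mu]_(x in D) (F m x)%:E))%:E)%E.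
Proof.
move=> mD iF; suff [] : mu.-integrable D (EFin \o (fun x => \sum_(m < M) c m * F m x)) /\
  (\int[mu]_(x in D) (\sum_(m < M) c m * F m x)%:E = (\sum_(m < M) c m * fine (\int[mu]_(x in D) (F m x)%:E))%:E)%E by [].
elim: M => [|M [IH1 IH2]].
  split; last by rewrite big_ord0; under eq_integral do rewrite big_ord0; rewrite integral0.
  have := @integrable0 _ _ R mu D; apply: eq_integrable => // x _.
  by rewrite /= big_ord0.
have iM : mu.-integrable D (EFin \o (fun x => c M * F M x)).
  by have := integrableZl mD (c M) (iF M); apply: eq_integrable => // x _; rewrite /= EFinM.
split.
  by have := integrableD mD IH1 iM; apply: eq_integrable => // x _; rewrite /= big_ord_recr EFinD.
rewrite big_ord_recr /= EFinD -IH2; under eq_integral do rewrite big_ord_recr /= EFinD.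
rewrite integralD//; congr (_ + _)%E; under eq_integral do rewrite EFinM.
apply: (etrans (integralZl mD (iF M) (c M))).
by rewrite -[in LHS](fineK (integrable_fin_num mD (iF M))).
Qed.

(** * Alternating sums of falling factorials *)

Section alternating_counts.
Variable R : realType.

Let tail (c : nat -> R) q M : (q < M)%N -> \sum_(m < M) c m * (q ^_ m)%:R = \sum_(m < q.+1) c m * (q ^_ m)%:R.
Proof.
move=> qM; rewrite -!(big_mkord xpredT (fun m => c m * (q ^_ m)%:R)) (big_cat_nat _ qM)//= [X in _ + X = _](_ : _ = 0) ?addr0//.
by rewrite big_nat_cond big1// => m /andP[/andP[qm _] _]; rewrite ffact_small// mulr0.
Qed.

(** Terms with [m > q] vanish, so the sum is eventually [g] times the binomial expansion of
    [(1 - 1) ^ q]. *)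
Lemma alternating_count_cvg (g q : nat) :
  (fun M => \sum_(m < M) (-1) ^+ m / m`!%:R * (g * q ^_ m)%:R) @ \oo --> (if q == 0%N then g%:R else 0 : R).
Proof.
apply: cvg_near_cst; exists q.+1 => // M /= qM.
have -> : \sum_(m < M) (-1) ^+ m / m`!%:R * (g * q ^_ m)%:R = g%:R * \sum_(m < M) (-1) ^+ m / m`!%:R * (q ^_ m)%:R :> R.
  by rewrite mulr_sumr; apply: eq_bigr => m _; rewrite natrM; ring.
rewrite (tail (fun m => (-1) ^+ m / m`!%:R) qM); case: q qM => [|q] qM.
  by rewrite big_ord1 expr0 ffactn0 fact0 divr1 !mulr1.
by rewrite alternating_ffact// mulr0.
Qed.

(** This is [2 ^ q], a sum of binomial coefficients. *)
Definition count_bound q : R := \sum_(m < q.+1) m`!%:R^-1 * (q ^_ m)%:R.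

Lemma count_bound_tail q M : (q < M)%N -> \sum_(m < M) m`!%:R^-1 * (q ^_ m)%:R = count_bound q.
Proof. exact: (tail (fun m => m`!%:R^-1)). Qed.

Lemma alternating_count_le (g q M : nat) :
  `|\sum_(m < M) (-1) ^+ m / m`!%:R * (g * q ^_ m)%:R| <= g%:R * count_bound q.
Proof.
apply: (@le_trans _ _ (g%:R * \sum_(m < M) m`!%:R^-1 * (q ^_ m)%:R)).
  apply: (le_trans (ler_norm_sum _ _ _)); rewrite mulr_sumr; apply: ler_sum => m _.
  rewrite normrM [`|(g * _)%:R|]ger0_norm// normrM normrX normrN1 expr1n mul1r ger0_norm ?invr_ge0// natrM.
  by rewrite mulrCA.
rewrite ler_wpM2l// -(@count_bound_tail q (maxn q.+1 M)); last by rewrite leq_max leqnn.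
rewrite -!(big_mkord xpredT (fun m => m`!%:R^-1 * (q ^_ m)%:R)) [leRHS](big_cat_nat _ (leq_maxr q.+1 M))//= lerDl.
by apply: sumr_ge0 => m _; rewrite mulr_ge0 ?invr_ge0.
Qed.

End alternating_counts.

(** * Local events through Janossy densities *)

Section local_events.
Context (R : realType) (d : nat).
Local Notation V := (Clebesgue R d).
Local Notation Cd := 'rV[R[i]]_d.
Local Notation T := (Cspace R d).
Variables (U : set Cd) (w : Cd -> R).
Hypotheses (oU : open U) (mw : measurable_fun (U : set T) (w : T -> R)).
Hypotheses (w0 : forall z, U z -> 0 < w z)
  (wi : forall (B : set T) (mB : measurable B),
      relatively_compact U B -> (0 < V B)%E ->
      (0 < ess_inf (mrestr V mB) (fun z => (w z)%:E))%E).
Variable K : Cd -> Cd -> R[i].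
Hypothesis hK : reproducing_kernel U w K.
Variable P : probability (Conf U) R.
Hypothesis hP : determinantal w K P.
Local Notation kk := (wkern U w K).
Local Notation kappa x := (complex.Re (kk x x)).
Variable E : set Cd.
Hypotheses (cE : compact E) (EU : E `<=` U).
Local Notation J := (jan V kk (E : set T)).

Let mE : measurable (E : set T). Proof. by apply: measurable_closed; exact: compact_closed. Qed.
Let rE : relatively_compact U E. Proof. exact: (relatively_compact_sub cE EU). Qed.

Definition trace_mass : R := fine (\int[V]_(z in (E : set T)) (kappa z)%:E)%E.
Local Notation tau := trace_mass.

Let kappa0 x : 0 <= kappa x.
Proof. by have [N [phi [_ _ _ _ l]]] := wkern_approx oU mw w0 wi hK; apply: le_trans (l 0 x); exact: sqn_ge0. Qed.

Lemma trace_massE : (\int[V]_(z in (E : set T)) (kappa z)%:E = tau%:E)%E.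
Proof.
rewrite fineK// ge0_fin_numE; first exact: (trace_fin oU mw w0 wi hK hP cE EU).
by apply: integral_ge0 => z _; rewrite lee_fin.
Qed.

Let rho0 Z : 0 <= corr kk Z.
Proof. by have [N [phi [_ _ _ c l]]] := wkern_approx oU mw w0 wi hK; exact: corr_ge0 c l Z. Qed.

Let mrho m X : measurable_fun setT (fun t : m.-tuple T => corr kk (t ++ X)).
Proof. by have [N [phi [m1 _ _ c l]]] := wkern_approx oU mw w0 wi hK; exact: (@measurable_corr _ _ _ N phi kk m1 c m X). Qed.

Section patterned.
Variables (I : finType) (B : I -> set T).
Hypotheses (mB : forall j, measurable (B j)).

(** Events are predicates on the sequence of membership patterns rather than on counts: once the
    first particle is fixed, an event for the remaining particles of the same kind is left, which
    the inductions need. *)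
Definition pattern_ind (Q : set (seq {ffun I -> bool})) (s : seq T) : R := (`[< Q (map (pattern B) s) >] : nat)%:R.

Lemma measurable_pattern_ind n Q : measurable_fun setT (fun t : n.-tuple T => pattern_ind Q t).
Proof.
rewrite (_ : (fun _ => _) = \1_[set t : n.-tuple T | Q (map (pattern B) t)]); first by apply: measurable_indic; exact: measurable_pattern.
by apply/funext => t; rewrite indicE /pattern_ind; congr ((_ : nat)%:R); apply/asboolP/idP; rewrite inE.
Qed.

(** Only the first [k] particles are tested by [Q]; the other [m] range freely over [E] and produce
    one term of the Janossy series. *)
Lemma integral_split_corr k m Q Y :
  (\int[tuple_measure V (k + m)]_(t in tset (E : set T) (k + m)) (pattern_ind Q (take k t) * corr kk (t ++ Y))%:E =
   \int[tuple_measure V k]_(x in tset (E : set T) k) ((pattern_ind Q x)%:E * jint V (corr kk) (E : set T) m (x ++ Y)))%E.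
Proof.
have mtake n k' Q' : measurable_fun setT (fun t : n.-tuple T => pattern_ind Q' (take k' t)).
  have := @measurable_pattern_ind n [set s | Q' (take k' s)]; congr measurable_fun.
  by apply/funext => t; rewrite /pattern_ind map_take.
have jP m' X X' : perm_eq X X' -> jint V (corr kk) (E : set T) m' X = jint V (corr kk) (E : set T) m' X'.
  by move=> XX; apply: eq_integral => t _; congr (_%:E); apply: corr_perm; rewrite perm_cat2l.
elim: k Q Y => [|k IH] Q Y.
  rewrite integral_tuple0 /jint -ge0_integralZl//.
  - by apply: eq_integral => t _; rewrite take0.
  - exact: measurable_tset.
  - by apply/measurable_EFinP; exact: measurable_funS measurableT (@subsetT _ _) (mrho Y).
  - by move=> t _; rewrite lee_fin.
  - by rewrite lee_fin.
rewrite addSn integral_tuple_cons//; last first.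
- by move=> t; rewrite lee_fin mulr_ge0.
- by apply/measurable_EFinP; apply: measurable_funM; [exact: mtake|exact: mrho].
rewrite integral_tuple_cons//; last first.
- by move=> t; rewrite mule_ge0 ?lee_fin//; apply: integral_ge0 => s _; rewrite lee_fin.
- apply: emeasurable_funM; first by apply/measurable_EFinP; exact: measurable_pattern_ind.
  exact: (measurable_jint_cat V mE rho0 mrho).
apply: eq_integral => z _.
have := IH [set s | Q (pattern B z :: s)] (z :: Y) => H.
transitivity (\int[tuple_measure V (k + m)]_(t in tset (E : set T) (k + m)) (pattern_ind [set s | Q (pattern B z :: s)] (take k t) * corr kk (t ++ z :: Y))%:E)%E.
  apply: eq_integral => t _; congr ((_ * _)%:E); apply: corr_perm.
  exact: permEl (perm_catCA [:: z] t Y).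
rewrite H; apply: eq_integral => x _; congr (_ * _)%E; apply: jP.
exact: permEl (perm_catCA x [:: z] Y).
Qed.

Hypothesis BE : forall j, B j `<=` E.
Variables (N : set {ffun I -> nat}) (k : nat).

Let A : set (k.-tuple T) := [set t | tset (E : set T) k t /\ N (cnt B t)].
Let Q : set (seq {ffun I -> bool}) := [set s | N [ffun j => count (fun b : {ffun I -> bool} => b j) s]].

Let mA : measurable A.
Proof.
apply: measurableI; first exact: measurable_tset.
have := measurable_pattern mB (n := k) Q; congr measurable.
by apply/seteqP; split => t /=; rewrite /Q /= -cnt_pattern.
Qed.

(** Inclusion-exclusion on both sides. [F m] counts the tested selections of [k] particles followed
    by [m] arbitrary further ones, and its mean is an integral of [jint]. With the signs
    [(-1) ^ m / m!], these sums converge to the indicator of exactly [k] particles on one side and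
    to [J] on the other. *)
Lemma local_event_formula :
  (k`!%:R%:E * P [set X : Conf U | config_count (X : configuration U) E = k /\ N (occupancy B X)] =
   \int[tuple_measure V k]_(t in A) (J t)%:E)%E.
Proof.
have [M0 [phi [mphi _ _ kc kl]]] := wkern_approx oU mw w0 wi hK.
have tE := trace_massE.
have [g [mg gE]] := measurable_ordsum cE EU mB k N.
pose nE (X : Conf U) := config_count (X : configuration U) E.
pose F m (X : Conf U) : R := (g X * (nE X - k) ^_ m)%:R.
have tau0 : 0 <= tau by rewrite -lee_fin -tE; apply: integral_ge0 => z _; rewrite lee_fin.
have indQ t : pattern_ind Q t = (`[< N (cnt B t) >] : nat)%:R.
  by rewrite /pattern_ind /Q /= -cnt_pattern.
have mF m : measurable_fun setT (F m).
  rewrite (_ : F m = fun X => (g X)%:R * ((nE X - k) ^_ m)%:R); last by apply/funext => X; rewrite /F natrM.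
  apply: measurable_funM; last exact: (measurable_count_fun (fun n => ((n - k) ^_ m)%:R) mE rE).
  by move=> _ Y mY; rewrite setTI; exact: (mg [set n | Y (n%:R)]).
have F0 m X : 0 <= F m X by [].
pose Im m := (\int[tuple_measure V k]_(x in A) jint V (corr kk) (E : set T) m x)%E.
have j0 m X : (0 <= jint V (corr kk) (E : set T) m X)%E by apply: integral_ge0 => s _; rewrite lee_fin.
have FI m : (\int[P]_X (F m X)%:E = Im m)%E.
  transitivity (\int[P]_X config_tuples R (X : configuration U)
     [set t : (k + m).-tuple Cd | (forall i, E (tnth t i)) /\ N (cnt B (take k t))])%E.
    apply: integral_negligible_eq => [X|X|]; first by rewrite lee_fin.
      by apply: esum_ge0 => t _; rewrite lee_fin.
    apply: (simple_ae hP) => X sX.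
    rewrite (@config_tuplesE _ _ _ X E (k + m) [set s | N (cnt B (take k s))] sX rE) /=.
    by rewrite (ordsum_take k m (pts X E) (fun t => `[< N (cnt B t) >] : nat)) -(gE _ sX) -(config_count_pts sX rE).
  rewrite (integral_config_tuples w0 hP (Q := [set s | N (cnt B (take k s))]) EU mE); last first.
    have := measurable_pattern mB (n := k + m) [set s | Q (take k s)]; congr measurable.
    by apply/seteqP; split => t /=; rewrite /Q /= -map_take -cnt_pattern.
  transitivity (\int[tuple_measure V (k + m)]_(t in tset (E : set T) (k + m)) (pattern_ind Q (take k t) * corr kk (t ++ [::]))%:E)%E.
    rewrite (_ : [set t : (k + m).-tuple T | _] = tset (E : set T) (k + m) `&` [set t | N (cnt B (take k t))])//.
    rewrite integral_mkcondr; apply: eq_integral => t _; rewrite patchE indQ cats0.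
    by case: ifPn => h; [rewrite asboolT ?mul1r//; move/set_mem: h|rewrite asboolF ?mul0r//; move/negP: h; apply: contra_not => h; rewrite inE].
  rewrite integral_split_corr /Im (_ : A = tset (E : set T) k `&` [set t | N (cnt B t)])// integral_mkcondr.
  apply: eq_integral => t _; rewrite patchE indQ cats0.
  by case: ifPn => h; [rewrite asboolT ?mul1e//; move/set_mem: h|rewrite asboolF ?mul0e//; move/negP: h; apply: contra_not => h; rewrite inE].
have mj m : measurable_fun setT (fun x : k.-tuple T => jint V (corr kk) (E : set T) m x).
  by have := @measurable_jint_cat _ _ _ V _ mE _ rho0 mrho m k [::]; under eq_fun do rewrite cats0.
have jle m X := jint_corr_le mE mphi kc kl tE m X.
have Ile m : (Im m <= (tau ^+ m * tau ^+ k)%:E)%E.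
  apply: (@le_trans _ _ (\int[tuple_measure V k]_(x in tset (E : set T) k) ((tau ^+ m)%:E * (prodk kk x)%:E))%E).
    apply: (@le_trans _ _ (\int[tuple_measure V k]_(x in tset (E : set T) k) jint V (corr kk) (E : set T) m x)%E).
      apply: ge0_subset_integral => //; [exact: measurable_tset|exact: measurable_funS measurableT (@subsetT _ _) (mj m)|by move=> t []].
    apply: ge0_le_integral => //; first exact: measurable_tset.
    - exact: measurable_funS measurableT (@subsetT _ _) (mj m).
    - apply: measurable_funeM; apply/measurable_EFinP; have := measurable_prodk mphi kc (m := k) [::].
      under eq_fun do rewrite cats0; move=> h; exact: measurable_funS measurableT (@subsetT _ _) h.
  rewrite ge0_integralZl//.
  - by rewrite (integral_prodk_tset mE mphi kc kl tE).
  - exact: measurable_tset.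
  - have := measurable_prodk mphi kc (m := k) [::]; under eq_fun do rewrite cats0.
    by move=> h; apply/measurable_EFinP; exact: measurable_funS measurableT (@subsetT _ _) h.
  - by move=> t _; rewrite lee_fin; exact: (prodk_ge0 kl).
  - by rewrite lee_fin exprn_ge0.
have I0 m : (0 <= Im m)%E by apply: integral_ge0 => t _.
have Ifin m : Im m \is a fin_num by rewrite ge0_fin_numE//; apply: le_lt_trans (Ile m) _; exact: ltry.
have iF m : P.-integrable setT (EFin \o F m).
  apply/integrableP; split; first exact/measurable_EFinP.
  rewrite (eq_integral (fun X => (F m X)%:E)); first by rewrite FI -ge0_fin_numE.
  by move=> X _; rewrite /= ger0_norm.
(* A majorant of all the alternating sums; its integral is the series without signs, at most
   [expR tau * tau ^+ k]. *)
pose D (X : Conf U) : R := (g X)%:R * count_bound R (nE X - k).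
have cb0 q : 0 <= count_bound R q by apply: sumr_ge0 => m _; rewrite mulr_ge0 ?invr_ge0.
have mD : measurable_fun setT D.
  apply: measurable_funM; last exact: (measurable_count_fun (fun n => count_bound R (n - k)) mE rE).
  by move=> _ Y mY; rewrite setTI; exact: (mg [set n | Y (n%:R)]).
have Dint : (\int[P]_X (D X)%:E <= (expR tau * tau ^+ k)%:E)%E.
  apply: (@fatou_epsilon _ _ _ P setT (fun M X => \sum_(m < M) m`!%:R^-1 * F m X) D _ 0) => //.
  - by move=> M; apply: measurable_sum => m; apply: measurable_funM.
  - by move=> M X _; apply: sumr_ge0 => m _; rewrite mulr_ge0 ?invr_ge0.
  - by move=> X _; rewrite /D mulr_ge0.
  - move=> X _ e e0; exists (nE X - k).+1 => M qM; rewrite /D -(count_bound_tail R qM) mulr_sumr.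
    apply: ler_wpDr; first exact: ltW.
    by rewrite le_eqVlt; apply/orP; left; apply/eqP; apply: eq_bigr => m _; rewrite /F natrM; ring.
  - move=> M _; rewrite (@integral_lincomb _ _ _ P setT F (fun m => m`!%:R^-1) M measurableT iF) lee_fin.
    apply: (@le_trans _ _ (\sum_(m < M) exp_coeff tau m * tau ^+ k)).
      apply: ler_sum => m _; rewrite FI /exp_coeff /= mulrAC [leRHS]mulrC ler_wpM2l ?invr_ge0//.
      by rewrite -lee_fin fineK.
    rewrite -mulr_suml ler_wpM2r ?exprn_ge0// -(big_mkord xpredT (exp_coeff tau)).
    rewrite /expR; apply: nondecreasing_cvgn_le; last exact: is_cvg_series_exp_coeff.
    by apply: nondecreasing_series => m _ _; exact: exp_coeff_ge0.
pose h (X : Conf U) : R := if (nE X - k == 0)%N then (g X)%:R else 0.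
have mh : measurable_fun setT h.
  rewrite (_ : h = fun X => (g X)%:R * (nE X - k == 0)%N%:R).
    apply: measurable_funM; last exact: (measurable_count_fun (fun n => (n - k == 0)%N%:R) mE rE).
    by move=> _ Y mY; rewrite setTI; exact: (mg [set n | Y (n%:R)]).
  by apply/funext => X; rewrite /h; case: eqP; rewrite ?mulr1 ?mulr0.
have L1 : (fun M => \int[P]_X (\sum_(m < M) (-1) ^+ m / m`!%:R * F m X)%:E)%E @ \oo --> (\int[P]_X (h X)%:E)%E.
  apply: (@dominated_cvg _ _ _ P _ measurableT (fun M X => (\sum_(m < M) (-1) ^+ m / m`!%:R * F m X)%:E) _ (fun X => (D X)%:E)) => //.
  - by move=> M; apply/measurable_EFinP; apply: measurable_sum => m; exact: measurable_funM.
  - by move=> X _; apply: cvg_EFin; [exact: nearW|exact: alternating_count_cvg].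
  - apply/integrableP; split; first exact/measurable_EFinP.
    rewrite (eq_integral (fun X => (D X)%:E)); first by apply: le_lt_trans Dint _; exact: ltry.
    by move=> X _; rewrite /= ger0_norm// /D mulr_ge0.
  - by move=> M X _; rewrite abse_EFin lee_fin; exact: alternating_count_le.
have iJ m : (tuple_measure V k).-integrable A (EFin \o (fun x : k.-tuple T => fine (jint V (corr kk) (E : set T) m x))).
  have jf x := jint_corr_fin mE mphi kc kl tE m x.
  apply/integrableP; split.
    by apply/measurable_EFinP; apply: measurableT_comp => //; exact: measurable_funS measurableT (@subsetT _ _) (mj m).
  rewrite (eq_integral (fun x : k.-tuple T => jint V (corr kk) (E : set T) m x)); first by rewrite -/(Im m) -ge0_fin_numE.
  by move=> x _; rewrite /= ger0_norm ?fine_ge0// fineK.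
have L2 := integral_jan mE mphi kc kl tE mA (fun t tA => tA.1).
have e12 M : (\int[P]_X (\sum_(m < M) (-1) ^+ m / m`!%:R * F m X)%:E =
    \int[tuple_measure V k]_(t in A) (jalt V (corr kk) (E : set T) M t)%:E)%E.
  rewrite (@integral_lincomb _ _ _ P setT F (fun m => (-1) ^+ m / m`!%:R) M measurableT iF).
  rewrite /jalt (@integral_lincomb _ _ _ (tuple_measure V k) A (fun m (x : k.-tuple T) => fine (jint V (corr kk) (E : set T) m x)) (fun m => (-1) ^+ m / m`!%:R) M mA iJ).
  congr (_%:E); apply: eq_bigr => m _; congr (_ * fine _); rewrite FI; apply: eq_integral => t _.
  by rewrite fineK//; exact: (jint_corr_fin mE mphi kc kl tE).
have <- : (\int[P]_X (h X)%:E = \int[tuple_measure V k]_(t in A) (J t)%:E)%E.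
  by move: L1; under eq_fun do rewrite e12; move=> L1; rewrite -(cvg_lim _ L1)// -(cvg_lim _ L2).
pose S := [set X : Conf U | config_count (X : configuration U) E = k /\ N (occupancy B X)].
have mS : measurable S.
  apply: measurableI; last exact: (measurable_occupancy mB N (fun j => relatively_compact_sub cE EU (@BE j))).
  by apply: sub_sigma_algebra; exists E, [set k]; split.
transitivity (\int[P]_X (k`!%:R * \1_S X)%:E)%E.
  under eq_integral do rewrite EFinM.
  rewrite ge0_integralZl ?lee_fin//; first by rewrite integral_indic// setIT.
  by apply/measurable_EFinP; exact: measurable_indic.
apply: integral_negligible_eq => [X|X|].
- by rewrite lee_fin mulr_ge0.
- by rewrite lee_fin /h; case: ifP.
apply: (simple_ae hP) => X sX; congr (_%:E); rewrite /h (gE _ sX) /nE (config_count_pts sX rE) indicE subn_eq0.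
(* The truncated difference also vanishes for fewer than [k] particles, but then no selection of [k]
   exists. For exactly [k] particles, all [k!] orders pass or fail together. *)
have [sk|sk|sk] := ltngtP (size (pts X E)) k.
- rewrite memNset ?mulr0; last by case; rewrite (config_count_pts sX rE) => e; rewrite e ltnn in sk.
  rewrite /ordsum big1_seq// => t /andP[_]; rewrite mem_osel ?pts_uniq// => /and3P[/eqP st ut /allP at_].
  by have := uniq_leq_size ut at_; rewrite st leqNgt sk.
- by rewrite memNset ?mulr0//; case; rewrite (config_count_pts sX rE) => e; rewrite e ltnn in sk.
rewrite -[X in ordsum X]sk ordsum_sym; last by move=> t t' tt; rewrite (cnt_perm B tt).
rewrite sk natrM; congr (_ * (nat_of_bool _)%:R); rewrite -(occupancyE cE EU sX BE).
apply/idP/asboolP; rewrite inE; first by case.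
by split => //; rewrite (config_count_pts sX rE).
Qed.

End patterned.
End local_events.

(** * Moving all particles, one at a time *)

Section slices.
Context d (T : measurableType d) (R : realType) (mu : {sigma_finite_measure set T -> \bar R}).
Variables (E : set T) (h : seq T -> R) (n : nat).
Hypotheses (mE : measurable E) (h0 : forall s, 0 <= h s).
Hypothesis mh : measurable_fun setT (fun t : n.+1.-tuple T => h t).
Local Open Scope ereal_scope.

Let mh2 : measurable_fun setT (fun p : T * n.-tuple T => (h (p.1 :: p.2))%:E).
Proof.
apply/measurable_EFinP.
exact: (measurableT_comp mh (@measurable_tuple_cons _ T n)).
Qed.

Lemma measurable_slice : measurable_fun setT (fun z => \int[tuple_measure mu n]_(t in tset E n) (h (z :: t))%:E).
Proof.
apply: (@measurable_integral_in _ _ _ _ R (tuple_measure mu n) (tset E n) (fun p : T * n.-tuple T => (h (p.1 :: p.2))%:E)) => [||p].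
- exact: measurable_tset.
- exact: mh2.
- by rewrite lee_fin.
Qed.

Lemma measurable_fiber (t : n.-tuple T) : measurable_fun setT (fun z => h (z :: t)).
Proof.
have := measurableT_comp mh (measurableT_comp (@measurable_tuple_cons _ T n)
  (measurable_fun_pair (@measurable_id _ T setT) (@measurable_cst _ _ _ _ setT t))).
exact.
Qed.

Lemma measurable_fiber_integral (D : set T) : measurable D ->
  measurable_fun setT (fun t : n.-tuple T => \int[mu]_(z in D) (h (z :: t))%:E).
Proof.
move=> mD; apply: (@measurable_integral_in _ _ _ _ R mu D (fun p : n.-tuple T * T => (h (p.2 :: p.1))%:E)) => [||p].
- exact: mD.
- by apply: (measurableT_comp mh2 (measurable_fun_pair measurable_snd measurable_fst)).
- by rewrite lee_fin.
Qed.

Lemma slice_swap (D : set T) : measurable D ->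
  \int[mu]_(z in D) \int[tuple_measure mu n]_(t in tset E n) (h (z :: t))%:E =
  \int[tuple_measure mu n]_(t in tset E n) \int[mu]_(z in D) (h (z :: t))%:E.
Proof.
move=> mD; apply: (@tonelli_in _ _ _ _ _ mu (tuple_measure mu n) D (tset E n) (fun p => (h (p.1 :: p.2))%:E)) => //.
- exact: measurable_tset.
- by move=> p; rewrite lee_fin.
Qed.

End slices.

Lemma le_lincomb_eq (R : realType) (a a' b b' e e' c d : \bar R) : a = a' -> b = b' -> e = e' ->
  (a <= c * b + d * e)%E -> (a' <= c * b' + d * e')%E.
Proof. by move=> -> -> ->. Qed.

Lemma scale_sum (R : realType) (c a b : R) (x y : \bar R) : 0 <= a -> 0 <= b -> (0 <= x)%E -> (0 <= y)%E ->
  (c%:E * (a%:E * x + b%:E * y) = (c * a)%:E * x + (c * b)%:E * y)%E.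
Proof. by move=> a0 b0 x0 y0; rewrite ge0_muleDr ?mule_ge0 ?lee_fin// !muleA -!EFinM. Qed.

Lemma lee_regroup (R : realType) (a b c x u : \bar R) : (a <= c + b)%E -> (a + x + u <= b + x + (c + u))%E.
Proof. by move=> h; rewrite addeACA [(b + c)%E]addeC addeA; apply: leeD => //; exact: leeD. Qed.

Section peeling.

Context (R : realType) (d : nat).
Local Notation V := (Clebesgue R d).
Local Notation Cd := 'rV[R[i]]_d.
Local Notation T := (Cspace R d).
Variables (U : set Cd) (w : Cd -> R).
Hypotheses (oU : open U) (cU : connected U) (mw : measurable_fun (U : set T) (w : T -> R)).
Hypotheses (w0 : forall z, U z -> 0 < w z)
  (wi : forall (B : set T) (mB : measurable B),
      relatively_compact U B -> (0 < V B)%E ->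
      (0 < ess_inf (mrestr V mB) (fun z => (w z)%:E))%E).
Variable K : Cd -> Cd -> R[i].
Hypothesis hK : reproducing_kernel U w K.
Variable P : probability (Conf U) R.
Hypothesis hP : determinantal w K P.
Local Notation kk := (wkern U w K).
Local Notation kappa x := (complex.Re (kk x x)).

Section janossy_of_set.
Variable E : set Cd.
Hypotheses (cE : compact E) (EU : E `<=` U).
Local Notation J := (jan V kk (E : set T)).

Lemma J_ge0 s : 0 <= J s.
Proof.
have mE : measurable (E : set T) by apply: measurable_closed; exact: compact_closed.
have tE := trace_massE oU mw w0 wi hK hP cE EU.
(* For the empty list, [J] is the probability that [E] contains no particle, by
   [local_event_formula] with [k = 0]. *)
case: s => [|p s].
  have mv (i : void) : measurable ((fun=> set0 : set T) i) by [].
  have := local_event_formula oU mw w0 wi hK hP cE EU (B := fun _ : void => set0 : set T) mv (fun _ => sub0set _) setT 0.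
  rewrite (_ : [set t : 0.-tuple T | _] = tset (E : set T) 0); last by apply/seteqP; split => [t []|t tE'].
  by rewrite integral_tuple0 /= => h; rewrite -lee_fin -h mule_ge0 ?lee_fin.
have [N [phi [m1 m2 m3 c l]]] := wkern_approx oU mw w0 wi hK.
exact: (jan_ge0 mE m1 m2 m3 c l tE).
Qed.

Lemma measurable_J n s : measurable_fun setT (fun t : n.-tuple T => J (t ++ s)).
Proof.
have mE : measurable (E : set T) by apply: measurable_closed; exact: compact_closed.
have tE := trace_massE oU mw w0 wi hK hP cE EU.
have [N [phi [m1 m2 m3 c l]]] := wkern_approx oU mw w0 wi hK.
exact: (@measurable_jan _ _ _ V N phi kk (E : set T) _ mE m1 c l tE n s).
Qed.

Lemma J_locint s : locint U (fun z => J (z :: s)).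
Proof.
have mE : measurable (E : set T) by apply: measurable_closed; exact: compact_closed.
apply: (Janossy_locint oU mw w0 wi hK mE (trace_massE oU mw w0 wi hK hP cE EU)) => B cB BU.
exact: (trace_fin oU mw w0 wi hK hP cB BU).
Qed.

Lemma J_submean s : (forall z, z \in s -> U z) -> log_submean U (fun z => J (z :: s) / w z).
Proof.
move=> sU; have mE : measurable (E : set T) by apply: measurable_closed; exact: compact_closed.
apply: (Janossy_submean oU mw w0 wi hK mE (trace_massE oU mw w0 wi hK hP cE EU)).
by apply/allP => z /sU Uz; rewrite mem_set.
Qed.

End janossy_of_set.

Variables (F G : Cd -> Cd) (B0 : set Cd).
Hypotheses (FG : forall z, U z -> U (F z) /\ G (F z) = z) (cF : C1_on U F) (cG : C1_on U G).
Hypotheses (cB : compact B0) (BU : B0 `<=` U) (BF : forall z, B0 z -> B0 (F z)).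
Hypothesis Fid : forall z, U z -> ~ B0 z -> F z = z.
Variable L : R.
Hypothesis L0 : 0 < L.

Definition wild : set T := B0 `\` tame U w L.

Lemma measurable_wild : measurable wild.
Proof.
apply: measurableD; last exact: measurable_tame.
by apply: measurable_closed; exact: compact_closed.
Qed.

(** The event of at most [l] particles in [K1] and none in [wild], encoded by patterns: [true]
    stands for [K1] and [false] for [wild]. *)
Definition guard (K1 : set Cd) (l : nat) (s : seq T) : R :=
  pattern_ind (fun b : bool => if b then K1 : set T else wild)
    [set p | (count (fun f : {ffun bool -> bool} => f true) p <= l)%N /\ count (fun f : {ffun bool -> bool} => f false) p = 0%N] s.

Lemma guard_cons K1 l z s : guard K1 l (z :: s) =
  (~~ `[< wild z >])%:R * (if `[< K1 z >] then if l is l'.+1 then guard K1 l' s else 0 else guard K1 l s).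
Proof.
rewrite /guard /pattern_ind /= !ffunE; case: (asboolP (wild z)) => hw /=.
  by rewrite mul0r asboolF// => -[].
rewrite mul1r; case: (asboolP (K1 z)) => hz /=; last by rewrite !add0n.
case: l => [|l]; first by rewrite asboolF// => -[].
by rewrite add0n; congr (nat_of_bool _)%:R; apply: asbool_equiv_eq; rewrite add1n ltnS.
Qed.

(* [K1] counts the particles that can still move, which keeps the number of
   peeling steps, hence the constants [c l], independent of [E] and [m]. *)
Lemma peeling : exists K1 : set Cd, [/\ compact K1, K1 `<=` U, B0 `<=` K1 &
  forall delta : R, 0 < delta -> exists2 c : nat -> R, forall l, 1 <= c l &
  forall (E : set Cd), compact E -> E `<=` U -> K1 `<=` E ->
  forall (I : finType) (B B' : I -> set T), (forall i, measurable (B i)) -> (forall i, measurable (B' i)) ->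
  (forall z, U z -> pattern B' z = pattern B (F z)) ->
  forall m l Q (s : seq T), (forall z, z \in s -> E z) ->
  (\int[tuple_measure V m]_(t in tset (E : set T) m) (pattern_ind B' Q t * guard K1 l t * jan V kk (E : set T) (t ++ s))%:E <=
   (c l)%:E * \int[tuple_measure V m]_(t in tset (E : set T) m) (pattern_ind B Q t * jan V kk (E : set T) (t ++ s))%:E +
   (delta * l%:R)%:E * \int[tuple_measure V m]_(t in tset (E : set T) m) (jan V kk (E : set T) (t ++ s))%:E)%E].
Proof.
have [K1 [cK1 K1U BK1 H1]] := one_step oU cU mw w0 wi FG cF cG cB BU BF L0.
(* The constants of [one_step] are chosen for all [e] at once, because the recursion that defines
   [c] calls on them at varying [e]. *)
have [Cf HC] : exists Cf : R -> R, forall e, 0 < e -> 0 <= Cf e /\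
    forall j g : Cd -> R, locint U j -> log_submean U (fun z => j z / w z) -> unit_fun g ->
     (\int[V]_(z in (B0 : set T)) (g (F z) * \1_(tame U w L) z * j z)%:E <=
        e%:E * \int[V]_(z in (K1 : set T)) (j z)%:E + (Cf e)%:E * \int[V]_(z in (B0 : set T)) (g z * j z)%:E)%E.
  have ex (e : R) : exists C : R, 0 < e -> 0 <= C /\
    forall j g : Cd -> R, locint U j -> log_submean U (fun z => j z / w z) -> unit_fun g ->
     (\int[V]_(z in (B0 : set T)) (g (F z) * \1_(tame U w L) z * j z)%:E <=
        e%:E * \int[V]_(z in (K1 : set T)) (j z)%:E + C%:E * \int[V]_(z in (B0 : set T)) (g z * j z)%:E)%E.
    by have [e0|e0] := ltP 0 e; [have [C C0 HC] := H1 e e0; exists C|exists 0].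
  by have [Cf HCf] := choice ex; exists Cf.
exists K1; split => // delta delta0.
(* With [e = delta / c l] in [one_step], the factor [c l] inherited from the earlier particles turns
   the error of a new move into exactly [delta]. *)
pose c := fix c l : R := if l is l'.+1 then Num.max (c l') (c l' * Cf (delta / c l')) else 1.
have c1 l : 1 <= c l by elim: l => //= l IH; rewrite le_max IH.
have cp l : 0 < c l by exact: lt_le_trans ltr01 (c1 l).
exists c => // E cE EU K1E I B B' mB mB' BB m.
have mE : measurable (E : set T) by apply: measurable_closed; exact: compact_closed.
have mB0 : measurable (B0 : set T) by apply: measurable_closed; exact: compact_closed.
have mK1 : measurable (K1 : set T) by apply: measurable_closed; exact: compact_closed.
have J0 := J_ge0 cE EU; have mJ := measurable_J cE EU.
have p0 (B1 : I -> set T) Q s : 0 <= pattern_ind B1 Q s by [].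
have g0 l s : 0 <= guard K1 l s by [].
have mg n l : measurable_fun setT (fun t : n.-tuple T => guard K1 l t).
  by apply: measurable_pattern_ind => -[]; [exact: mK1|exact: measurable_wild].
have mp (B1 : I -> set T) n Q : (forall i, measurable (B1 i)) -> measurable_fun setT (fun t : n.-tuple T => pattern_ind B1 Q t).
  by move=> mB1; exact: measurable_pattern_ind.
elim: m => [|m IH] l Q s sE.
  rewrite !integral_tuple0 /= -!EFinM -EFinD lee_fin.
  have -> : guard K1 l [::] = 1 by rewrite /guard /pattern_ind asboolT.
  rewrite mulr1 (_ : pattern_ind B' Q [::] = pattern_ind B Q [::])// ler_wpDr ?mulr_ge0 ?(ltW delta0)//.
  by rewrite ler_peMl ?mulr_ge0.
have cons_perm z (t : m.-tuple T) : jan V kk (E : set T) (t ++ z :: s) = jan V kk (E : set T) (z :: t ++ s).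
  by apply: jan_perm; exact: permEl (perm_catCA t [:: z] s).
pose qz z : set (seq {ffun I -> bool}) := [set p | Q (z :: p)].
have pcons (B1 : I -> set T) z t : pattern_ind B1 Q (z :: t) = pattern_ind B1 (qz (pattern B1 z)) t by [].
pose h0 t : R := pattern_ind B Q t * jan V kk (E : set T) (t ++ s).
pose hM t : R := jan V kk (E : set T) (t ++ s).
pose hL t : R := pattern_ind B' Q t * guard K1 l t * jan V kk (E : set T) (t ++ s).
(* The intermediate event tests the first particle with [B'] and the others with [B]: the tail has
   been treated by induction, the head has not. Joining the two families gives this mixed event the
   form of a pattern event. *)
pose BI (i : I + I) : set T := match i with inl i => B' i | inr i => B i end.
have mBI i : measurable (BI i) by case: i.
pose QI : set (seq {ffun I + I -> bool}) :=
  [set p | Q ([ffun i => head [ffun=> false] p (inl i)] :: map (fun f : {ffun I + I -> bool} => [ffun i => f (inr i)]) (behead p))].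
pose nw z : R := (~~ `[< wild z >])%:R.
pose hI t : R := pattern_ind BI QI t * nw (head 0 t) * jan V kk (E : set T) (t ++ s).
have hIE z t : hI (z :: t) = pattern_ind B (qz (pattern B' z)) t * nw z * jan V kk (E : set T) (z :: t ++ s).
  rewrite /hI /=; congr (_ * _ * _); rewrite /pattern_ind /QI /qz /=; congr ((nat_of_bool `[< Q (_ :: _) >])%:R).
    by apply/ffunP => i; rewrite !ffunE.
  by rewrite -map_comp; apply: eq_map => y /=; apply/ffunP => i; rewrite !ffunE.
have nw01 z : 0 <= nw z by [].
have h00 t : 0 <= h0 t by rewrite mulr_ge0.
have hM0 t : 0 <= hM t by exact: J0.
have hL0 t : 0 <= hL t by rewrite !mulr_ge0.
have hI0 t : 0 <= hI t by rewrite !mulr_ge0.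
have mh0 : measurable_fun setT (fun t : m.+1.-tuple T => h0 t) by apply: measurable_funM; [exact: mp|exact: mJ].
have mhM : measurable_fun setT (fun t : m.+1.-tuple T => hM t) by exact: mJ.
have mhL : measurable_fun setT (fun t : m.+1.-tuple T => hL t).
  by apply: measurable_funM; [apply: measurable_funM; [exact: mp|exact: mg]|exact: mJ].
have mhI : measurable_fun setT (fun t : m.+1.-tuple T => hI t).
  apply: measurable_funM; [apply: measurable_funM; [exact: measurable_pattern_ind|]|exact: mJ].
  rewrite (_ : (fun _ => _) = (\1_(~` wild) : T -> R) \o (fun t : m.+1.-tuple T => tnth t ord0)).
    by apply: measurableT_comp; [apply: measurable_indic; apply: measurableC; exact: measurable_wild|exact: measurable_tnth].
  apply/funext => t /=; rewrite indicE (tnth_nth 0) /= nth0; congr (nat_of_bool _)%:R.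
  by apply/idP/idP => [/asboolPn hw|]; rewrite inE// => hw; apply/asboolPn.
pose S (h : seq T -> R) z := (\int[tuple_measure V m]_(t in tset (E : set T) m) (h (z :: t))%:E)%E.
have S0 h z : (forall t, 0 <= h t) -> (0 <= S h z)%E by move=> hh; apply: integral_ge0 => t _; rewrite lee_fin.
have mS (D : set T) (h : seq T -> R) : (forall t, 0 <= h t) -> measurable_fun setT (fun t : m.+1.-tuple T => h t) -> measurable_fun D (S h).
  by move=> hh mh; exact: measurable_funS measurableT (@subsetT _ _) (measurable_slice V mE hh mh).
have SE (h : seq T -> R) : (forall t, 0 <= h t) -> measurable_fun setT (fun t : m.+1.-tuple T => h t) ->
    (\int[tuple_measure V m.+1]_(t in tset (E : set T) m.+1) (h t)%:E = \int[V]_(z in (E : set T)) S h z)%E.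
  move=> hh mh; apply: (integral_tuple_cons V mE); first exact/measurable_EFinP.
  by move=> t; rewrite lee_fin.
have mS0 D := mS D h0 h00 mh0; have mSM D := mS D hM hM0 mhM; have mSI D := mS D hI hI0 mhI; have mSL D := mS D hL hL0 mhL.
rewrite (SE hL hL0 mhL) (SE h0 h00 mh0) (SE hM hM0 mhM).
pose SI z := (\int[tuple_measure V m]_(t in tset (E : set T) m) (pattern_ind B (qz (pattern B' z)) t * jan V kk (E : set T) (z :: t ++ s))%:E)%E.
have bnd z l' : E z -> (\int[tuple_measure V m]_(t in tset (E : set T) m)
     (pattern_ind B' (qz (pattern B' z)) t * guard K1 l' t * jan V kk (E : set T) (z :: t ++ s))%:E <=
     (c l')%:E * SI z + (delta * l'%:R)%:E * S hM z)%E.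
  move=> Ez; have sE' y : y \in z :: s -> E y by rewrite inE => /orP[/eqP -> //|/sE].
    have H := IH l' (qz (pattern B' z)) (z :: s) sE'.
    have E1 (f : m.-tuple T -> R) : (\int[tuple_measure V m]_(t in tset (E : set T) m) (f t * jan V kk (E : set T) (t ++ z :: s))%:E =
      \int[tuple_measure V m]_(t in tset (E : set T) m) (f t * jan V kk (E : set T) (z :: t ++ s))%:E)%E.
    by apply: eq_integral => t _; rewrite cons_perm.
  have E2 : (\int[tuple_measure V m]_(t in tset (E : set T) m) (jan V kk (E : set T) (t ++ z :: s))%:E = S hM z)%E.
    by apply: eq_integral => t _; rewrite cons_perm.
    exact: (le_lincomb_eq (E1 (fun t => pattern_ind B' (qz (pattern B' z)) t * guard K1 l' t)) (E1 (fun t => pattern_ind B (qz (pattern B' z)) t)) E2 H).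
have SIE z : E z -> ~ B0 z -> SI z = S h0 z.
  move=> Ez nB; have Uz := EU _ Ez; apply: eq_integral => t _; congr (_%:E).
  by rewrite /h0 pcons BB// Fid.
have SIw z : ~ wild z -> S hI z = SI z.
  by move=> nw'; apply: eq_integral => t _; rewrite hIE /nw asboolF// mulr1.
have SLw z : wild z -> S hL z = 0%E.
  move=> hw; rewrite /S -[RHS](@integral0 _ _ _ (tuple_measure V m) (tset (E : set T) m)); apply: eq_integral => t _.
  by rewrite /hL guard_cons asboolT// mul0r mulr0 mul0r.
have SLn z l' : ~ wild z -> (if `[< K1 z >] then l = l'.+1 else l = l') -> E z ->
    (S hL z <= (c l')%:E * SI z + (delta * l'%:R)%:E * S hM z)%E.
  move=> nw' hl Ez; apply: le_trans (bnd z l' Ez); rewrite le_eqVlt; apply/orP; left; apply/eqP.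
  apply: eq_integral => t _; rewrite /hL guard_cons asboolF//= mul1r; move: hl.
  by case: ifP => _ ->.
have wB z : wild z -> B0 z by case.
have d0 x : 0 <= delta * x%:R by rewrite mulr_ge0// ltW.
have c0 x : 0 <= c x by exact: ltW.
have EB0 : B0 `<=` E by move=> z /BK1 /K1E.
case: l @hL hL0 mhL mSL SLw SLn => [|l] hL hL0 mhL mSL SLw SLn.
    (* For [l = 0] the guard excludes particles from [K1], which contains [B0]; so [F] fixes the
       head, and no error arises. *)
    rewrite mulr0 mul0e adde0.
  have -> : ((c 0%N)%:E * \int[V]_(z in (E : set T)) S h0 z = \int[V]_(z in (E : set T)) ((c 0%N)%:E * S h0 z))%E.
    by rewrite ge0_integralZl ?lee_fin// => z _; exact: S0.
    apply: ge0_le_integral => //; try solve [by move=> z _; exact: S0|first [exact: mSL|exact: mS0|exact: mSM|exact: mSI]|by apply: measurable_funeM; first [exact: mSL|exact: mS0|exact: mSM|exact: mSI]].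
  - move=> z Ez; have [Kz|nK] := pselect (K1 z).
      rewrite (_ : S hL z = 0%E); first by rewrite mule_ge0 ?lee_fin ?S0.
      rewrite /S -[RHS](@integral0 _ _ _ (tuple_measure V m) (tset (E : set T) m)); apply: eq_integral => t _.
      by rewrite /hL guard_cons (asboolT Kz) mulr0 mulr0 mul0r.
    have nB : ~ B0 z by move=> /BK1.
    have nwz : ~ wild z by move=> /wB.
    by have := SLn z 0%N nwz; rewrite asboolF// => /(_ erefl Ez); rewrite mulr0 mul0e adde0 (SIE z Ez nB).
pose e := delta / c l; have e0 : 0 < e by rewrite divr_gt0.
have [C0 HC1] := HC e e0; set C := Cf e in C0 HC1.
have cS1 : c l <= c l.+1 by rewrite /= le_max lexx.
have cS2 : c l * C <= c l.+1 by rewrite /= le_max lexx orbT.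
(* The bound given by the induction hypothesis at a fixed head [z]. On [B0] the head is still to be
   moved; elsewhere [F z = z] and it is already in place. In [U2] one unit of the guard has been
   spent when [z] lies in [K1]. *)
pose U1 z := if z \in B0 then ((c l)%:E * S hI z)%E else ((c l.+1)%:E * S h0 z)%E.
pose U2 z := ((delta * (l.+1 - `[< K1 z >])%:R)%:E * S hM z)%E.
have mBool (D : set T) : measurable D -> measurable_fun setT (fun z => `[< D z >]).
    move=> mD; apply: (measurable_fun_bool true); rewrite (_ : _ `&` _ = D)//.
  by apply/seteqP; split => z /=; [move=> [_ /asboolP]|move=> Dz; split => //; exact/asboolP].
have mU1 (D : set T) : measurable_fun D U1.
  apply: (measurable_funS measurableT (@subsetT _ _)).
  rewrite (_ : U1 = fun z => if `[< B0 z >] then ((c l)%:E * S hI z)%E else ((c l.+1)%:E * S h0 z)%E); last by apply/funext => z; rewrite /U1 (_ : (z \in B0) = `[< B0 z >])//; apply/idP/asboolP; rewrite inE.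
  apply: measurable_fun_ifT; [exact: mBool|by apply: measurable_funeM; first [exact: mSL|exact: mS0|exact: mSM|exact: mSI]|by apply: measurable_funeM; first [exact: mSL|exact: mS0|exact: mSM|exact: mSI]].
have mU2 : measurable_fun (E : set T) U2.
  apply: (measurable_funS measurableT (@subsetT _ _)).
  rewrite (_ : U2 = fun z => if `[< K1 z >] then ((delta * l%:R)%:E * S hM z)%E else ((delta * l.+1%:R)%:E * S hM z)%E).
    by apply: measurable_fun_ifT; [exact: mBool|by apply: measurable_funeM; first [exact: mSL|exact: mS0|exact: mSM|exact: mSI]|by apply: measurable_funeM; first [exact: mSL|exact: mS0|exact: mSM|exact: mSI]].
  by apply/funext => z; rewrite /U2; case: asboolP => _; rewrite ?subn1 ?subn0.
have U10 z : (0 <= U1 z)%E by rewrite /U1; case: ifP => _; rewrite mule_ge0 ?lee_fin ?S0.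
have U20 z : (0 <= U2 z)%E by rewrite mule_ge0 ?lee_fin ?S0.
apply: (@le_trans _ _ (\int[V]_(z in (E : set T)) (U1 z + U2 z))%E).
    apply: ge0_le_integral => //; try solve [by move=> z _; exact: S0|first [exact: mSL|exact: mS0|exact: mSM|exact: mSI]|by apply: emeasurable_funD => //; exact: mU1].
  - move=> z Ez; have [hw|nwz] := pselect (wild z); first by rewrite SLw// adde_ge0.
    rewrite /U1 /U2; case: (asboolP (K1 z)) => hK1.
      have := SLn z l nwz; rewrite asboolT// => /(_ erefl Ez) h1; apply: (le_trans h1).
      rewrite subn1 leeD2r//; case: ifPn => [/set_mem Bz|/negP nB]; first by rewrite (SIw z nwz).
      rewrite (SIE z Ez); last by move=> Bz; apply: nB; rewrite inE.
      by rewrite lee_wpmul2r ?lee_fin ?S0.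
    have nB : ~ B0 z by move=> /BK1.
    by have := SLn z l.+1 nwz; rewrite asboolF// => /(_ erefl Ez) h1; rewrite memNset// subn0 -(SIE z Ez nB).
rewrite (ge0_integralD V mE (fun z _ => U10 z) (mU1 _) (fun z _ => U20 z) mU2).
(* The head is moved by [one_step] with the tail frozen, under the integral over the tail. *)
have step : (\int[V]_(z in (B0 : set T)) S hI z <= e%:E * \int[V]_(z in (K1 : set T)) S hM z + C%:E * \int[V]_(z in (B0 : set T)) S h0 z)%E.
  rewrite (slice_swap V mE hI0 mhI mB0) (slice_swap V mE hM0 mhM mK1) (slice_swap V mE h00 mh0 mB0).
  have mf (D : set T) (h : seq T -> R) : measurable D -> (forall t, 0 <= h t) -> measurable_fun setT (fun t : m.+1.-tuple T => h t) ->
    measurable_fun (tset (E : set T) m) (fun t : m.-tuple T => (\int[V]_(z in D) (h (z :: t))%:E)%E).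
    by move=> mD hh mh; exact: measurable_funS measurableT (@subsetT _ _) (measurable_fiber_integral V hh mh mD).
  have if0 (D : set T) (h : seq T -> R) (t : seq T) : (forall t, 0 <= h t) -> (0 <= \int[V]_(z in D) (h (z :: t))%:E)%E.
    by move=> hh; apply: integral_ge0 => z _; rewrite lee_fin.
  have mEm : measurable (tset (E : set T) m) by exact: measurable_tset.
  have Zl (D : set T) (h : seq T -> R) (a : R) : measurable D -> (forall t, 0 <= h t) -> measurable_fun setT (fun t : m.+1.-tuple T => h t) -> 0 <= a ->
    (a%:E * \int[tuple_measure V m]_(t in tset (E : set T) m) \int[V]_(z in D) (h (z :: t))%:E =
     \int[tuple_measure V m]_(t in tset (E : set T) m) (a%:E * \int[V]_(z in D) (h (z :: t))%:E))%E.
    by move=> mD hh mh a0; rewrite ge0_integralZl//; [exact: mf|move=> t _; exact: if0].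
  rewrite (Zl _ hM e mK1 hM0 mhM (ltW e0)) (Zl _ h0 C mB0 h00 mh0 C0).
  have n1 (t : m.-tuple T) : (0 <= e%:E * \int[V]_(z in (K1 : set T)) (hM (z :: t))%:E)%E by rewrite mule_ge0 ?lee_fin ?(ltW e0)//; exact: if0.
  have n2 (t : m.-tuple T) : (0 <= C%:E * \int[V]_(z in (B0 : set T)) (h0 (z :: t))%:E)%E by rewrite mule_ge0 ?lee_fin//; exact: if0.
  have m1 : measurable_fun (tset (E : set T) m) (fun t : m.-tuple T => (e%:E * \int[V]_(z in (K1 : set T)) (hM (z :: t))%:E)%E).
    by apply: measurable_funeM; exact: mf.
  have m2 : measurable_fun (tset (E : set T) m) (fun t : m.-tuple T => (C%:E * \int[V]_(z in (B0 : set T)) (h0 (z :: t))%:E)%E).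
    by apply: measurable_funeM; exact: mf.
  rewrite -(ge0_integralD _ mEm (fun t _ => n1 t) m1 (fun t _ => n2 t) m2).
  apply: ge0_le_integral => //; try solve [by move=> t _; exact: if0|exact: mf|exact: emeasurable_funD].
  move=> t tE; have tsU z : z \in tval t ++ s -> U z.
    by rewrite mem_cat => /orP[/tnthP[i ->]|/sE]; [exact: EU|exact: EU].
  have ug : unit_fun (fun z => pattern_ind B Q (z :: t)).
    split; first by apply: (measurable_fiber (n := m)); exact: mp.
    by move=> z; rewrite /pattern_ind; case: asboolP; rewrite /= ?lexx ?ler01.
  have := HC1 _ _ (J_locint cE EU (t ++ s)) (J_submean cE EU tsU) ug.
  rewrite (eq_integral (fun z => (hI (z :: t))%:E)) => [h1|z /set_mem Bz]; first exact: h1.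
  (* On [B0], not being wild is the same as being tame, which is how the indicator in [one_step]
     appears. *)
  rewrite hIE pcons; have Uz : U z := BU Bz; rewrite -BB// indicE; congr ((_ * _ * _)%:E).
  rewrite /nw; congr (nat_of_bool _)%:R; apply/idP/idP.
    by rewrite inE => ht; apply/asboolPn => -[].
  by move=> /asboolPn hw; rewrite inE; apply: contrapT => ht; apply: hw.
have split0 (h : T -> \bar R) : (forall z, 0 <= h z)%E -> measurable_fun (E : set T) h ->
   (\int[V]_(z in (E : set T)) h z = \int[V]_(z in (B0 : set T)) h z + \int[V]_(z in (E `\` B0 : set T)) h z)%E.
  move=> hh mh; rewrite -{1}(setDUK EB0) ge0_integral_setU//.
  - exact: measurableD.
  - by rewrite setDUK.
  - by apply/disj_setPS => z [? []].
rewrite (split0 U1 U10 (mU1 _)) (split0 (S h0) (fun z => S0 h0 z h00) (mS0 _)).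
have EU1 : (\int[V]_(z in (B0 : set T)) U1 z = (c l)%:E * \int[V]_(z in (B0 : set T)) S hI z)%E.
  rewrite -ge0_integralZl ?lee_fin//; try by move=> z _; exact: S0.
  by apply: eq_integral => z zB; rewrite /U1 zB.
have EU2 : (\int[V]_(z in (E `\` B0 : set T)) U1 z = (c l.+1)%:E * \int[V]_(z in (E `\` B0 : set T)) S h0 z)%E.
  rewrite -ge0_integralZl ?lee_fin//.
      by apply: eq_integral => z /set_mem [_ nB]; rewrite /U1 memNset.
  all: try solve [exact: measurableD|by move=> z _; exact: S0].
(* The error of the move, [delta] times the mass over [K1], makes up for the unit of the guard spent
   there: together they amount to [delta * (l + 1)]. *)
have EU3 : (delta%:E * \int[V]_(z in (K1 : set T)) S hM z + \int[V]_(z in (E : set T)) U2 z = (delta * l.+1%:R)%:E * \int[V]_(z in (E : set T)) S hM z)%E.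
  have -> : (delta%:E * \int[V]_(z in (K1 : set T)) S hM z = \int[V]_(z in (E : set T)) ((delta * `[< K1 z >]%:R)%:E * S hM z))%E.
    rewrite -ge0_integralZl ?lee_fin ?(ltW delta0)//; try by move=> z _; exact: S0.
        transitivity (\int[V]_(z in (E `&` K1 : set T)) (delta%:E * S hM z))%E; first by rewrite setIidr.
    rewrite integral_mkcondr; apply: eq_integral => z _; rewrite patchE.
    case: ifPn => [/set_mem Kz|/negP nK]; first by rewrite asboolT// mulr1.
    by rewrite asboolF ?mulr0 ?mul0e// => Kz; apply: nK; rewrite inE.
  have f0 z : (0 <= (delta * `[< K1 z >]%:R)%:E * S hM z)%E by rewrite mule_ge0 ?lee_fin ?S0.
  have mf : measurable_fun (E : set T) (fun z => ((delta * `[< K1 z >]%:R)%:E * S hM z)%E).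
    apply: (measurable_funS measurableT (@subsetT _ _)).
    rewrite (_ : (fun _ => _) = fun z => if `[< K1 z >] then ((delta * 1)%:E * S hM z)%E else ((delta * 0)%:E * S hM z)%E).
      by apply: measurable_fun_ifT; [exact: mBool|apply: measurable_funeM; exact: mSM|apply: measurable_funeM; exact: mSM].
    by apply/funext => z; case: asboolP.
  rewrite -(ge0_integralD V mE (fun z _ => f0 z) mf (fun z _ => U20 z) mU2).
  rewrite -ge0_integralZl ?lee_fin//; try by move=> z _; exact: S0.
  apply: eq_integral => z _; rewrite /U2 -ge0_muleDl ?lee_fin// -EFinD -mulrDr -natrD.
  by congr ((_ * _%:R)%:E * _)%E; case: asboolP => _ /=; rewrite ?add0n ?subn0// add1n subn1.
rewrite EU1 EU2 -EU3.
have x1 : (0 <= \int[V]_(z in (K1 : set T)) S hM z)%E by apply: integral_ge0 => z _; exact: S0.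
have x2 : (0 <= \int[V]_(z in (B0 : set T)) S h0 z)%E by apply: integral_ge0 => z _; exact: S0.
have x3 : (0 <= \int[V]_(z in (E `\` B0 : set T)) S h0 z)%E by apply: integral_ge0 => z _; exact: S0.
have key : ((c l)%:E * \int[V]_(z in (B0 : set T)) S hI z <= delta%:E * \int[V]_(z in (K1 : set T)) S hM z + (c l.+1)%:E * \int[V]_(z in (B0 : set T)) S h0 z)%E.
  apply: (le_trans (lee_wpmul2l _ step)); first by rewrite lee_fin.
  rewrite (scale_sum _ (ltW e0) C0 x1 x2); apply: leeD.
    by rewrite /e mulrC divfK// gt_eqF.
  by rewrite lee_wpmul2r// lee_fin.
have -> := ge0_muleDr (c l.+1)%:E x2 x3.
refine (lee_regroup _ _ key).
Qed.

End peeling.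

(** * Quasi-invariance *)

Section image_measure.
Context d (T : measurableType d) (R : realType) (P : probability T R).
Variable f : T -> T.
Hypothesis mf : measurable_fun setT f.
Local Open Scope ereal_scope.

(* Local approximation is done simultaneously for [P] and for its image. *)
Definition sum_with_image (_ : measurable_fun setT f) (A : set T) : \bar R := P A + P (f @^-1` A).

Local Notation mu := (sum_with_image mf).

Let mu0 : mu set0 = 0.
Proof. by rewrite /sum_with_image preimage_set0 !measure0 adde0. Qed.

Let mu_ge0 A : 0 <= mu A. Proof. by rewrite adde_ge0. Qed.

Let mu_sigma_additive : semi_sigma_additive mu.
Proof.
move=> A mA tA mUA; rewrite /sum_with_image.
have mfA i : measurable (f @^-1` A i) by rewrite -[X in measurable X]setTI; exact: mf.
have tfA : trivIset setT (fun i => f @^-1` A i).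
  move=> i j _ _ [x [/= xi xj]]; apply: (tA i j) => //; by exists (f x).
have h1 := @measure_semi_sigma_additive _ _ _ P A mA tA mUA.
have mUfA : measurable (\bigcup_i f @^-1` A i) by exact: bigcupT_measurable.
have h2 := @measure_semi_sigma_additive _ _ _ P _ mfA tfA mUfA.
rewrite preimage_bigcup; under eq_fun do rewrite big_split.
by apply: cvgeD => //; rewrite ge0_adde_def// inE.
Qed.

HB.instance Definition _ := isMeasure.Build _ _ _ mu mu0 mu_ge0 mu_sigma_additive.

Let mu_fin : fin_num_fun mu.
Proof.
move=> A mA; rewrite /sum_with_image fin_numD !fin_num_measure//.
by rewrite -[X in measurable X]setTI; exact: mf.
Qed.

HB.instance Definition _ := Measure_isFinite.Build _ _ _ mu mu_fin.

Lemma image_approximable (A : set (set T)) : A set0 -> A `<=` measurable -> (forall X, A X -> A (~` X)) ->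
  (forall X Y, A X -> A Y -> A (X `|` Y)) -> forall X, <<s A >> X -> forall e : R, (0 < e)%R ->
  exists Y, [/\ A Y, P (Y `\` X) < e%:E & P (f @^-1` (X `\` Y)) < e%:E].
Proof.
move=> A0 mA AC AU X sX e e0.
have [Y [AY h1 h2]] := @sigma_approximable _ _ _ (sum_with_image mf) A A0 mA AC AU X sX e e0.
exists Y; split => //.
  by apply: le_lt_trans h2; rewrite /sum_with_image leeDl.
by apply: le_lt_trans h1; rewrite /sum_with_image leeDr.
Qed.

End image_measure.

Section quasi_invariance.
Context (R : realType) (d : nat).
Local Notation V := (Clebesgue R d).
Local Notation Cd := 'rV[R[i]]_d.
Local Notation T := (Cspace R d).
Variables (U : set Cd).
Hypothesis oU : open U.

Let mU : measurable (U : set T). Proof. exact: measurable_open. Qed.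

(** Finite families of sets are allowed, so that these events form an algebra: a union is tested by
    the sum of the two families. *)
Definition local_event : set (set (Conf U)) := [set A | exists (I : finType) (B : I -> set T) (N : set {ffun I -> nat}),
  [/\ forall i, measurable (B i), forall i, relatively_compact U (B i) & A = [set X : Conf U | N (occupancy B X)]]].

Lemma local_event0 : local_event set0.
Proof.
by exists void, (fun=> set0), set0; split.
Qed.

Lemma local_eventC A : local_event A -> local_event (~` A).
Proof. by move=> [I [B [N [mB rB ->]]]]; exists I, B, (~` N). Qed.

Lemma local_eventU A A' : local_event A -> local_event A' -> local_event (A `|` A').
Proof.
move=> [I [B [N [mB rB ->]]]] [I' [B' [N' [mB' rB' ->]]]].
exists (I + I')%type, (fun i => match i with inl i => B i | inr i => B' i end),
  [set f | N [ffun i => f (inl i)] \/ N' [ffun i => f (inr i)]]; split => [[]|[]|] //.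
apply/seteqP; split => X /=;
  have -> : [ffun i => occupancy (fun i => match i with inl i => B i | inr i => B' i end) X (inl i)] = occupancy B X
    by [apply/ffunP => i; rewrite !ffunE];
  have -> : [ffun i => occupancy (fun i => match i with inl i => B i | inr i => B' i end) X (inr i)] = occupancy B' X
    by [apply/ffunP => i; rewrite !ffunE]; by [].
Qed.

Lemma measurable_local_event : local_event `<=` measurable.
Proof. by move=> A [I [B [N [mB rB ->]]]]; exact: measurable_occupancy. Qed.

Lemma local_event_generates (A : set (Conf U)) : measurable A -> <<s local_event >> A.
Proof.
apply: sub_sigma_algebra2 => _ [B [N [mB rB ->]]].
exists unit, (fun=> B), [set f | N (f tt)]; split => //.
by apply/seteqP; split => X /=; rewrite ffunE.
Qed.

Section diffeomorphism.
Variables (F : Cd -> Cd) (hF : Diffc U F).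

Definition pullback (B : set T) : set T := (U : set T) `&` F @^-1` B.

Lemma measurable_pullback B : measurable B -> measurable (pullback B).
Proof. by move=> mB; have [[G [_ _ cF _]] _] := hF; exact: (measurable_fun_C1 oU cF). Qed.

Lemma relatively_compact_pullback B : relatively_compact U B -> relatively_compact U (pullback B).
Proof.
move=> [cB BU]; have [[G [FG GF _ cG]] _] := hF.
have cGB : compact (G @` closure B).
  apply: continuous_compact cB; apply: continuous_in_subspaceT => z.
  by rewrite inE => /BU Uz; exact: C1_on_continuous cG Uz.
apply: (relatively_compact_sub cGB) => [_ [z /BU /GF[Uz _] <-]//|z [Uz Bz]].
by exists (F z); [exact: subset_closure|have [] := FG z Uz].
Qed.

Lemma image_multiplicityE (G : Cd -> Cd) (X : configuration U) z :
  (forall z, U z -> U (F z) /\ G (F z) = z) -> (forall z, U z -> U (G z) /\ F (G z) = z) -> U z ->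
  image_multiplicity F X z = X (G z).
Proof.
move=> FG GF Uz; rewrite /image_multiplicity (_ : [set y | _] = [set G z]) ?fsbig_set1//.
apply/seteqP; split => [y [Uy <-]|_ ->]; first by have [_ ->] := FG y Uy.
by have [] := GF z Uz.
Qed.

Lemma config_count_image (X : configuration U) (B : set T) : B `<=` U ->
  config_count (config_image hF X) B = config_count X (pullback B).
Proof.
move=> BU; have [[G [FG GF _ _]] _] := hF; rewrite /config_count.
have bij : set_bij (pullback B) B F.
  split => [z [_ Bz]//|x y /set_mem[Ux _] /set_mem[Uy _] e|z Bz].
    by have [_ <-] := FG x Ux; have [_ <-] := FG y Uy; rewrite e.
  by have [Uz Fz] := GF z (BU z Bz); exists (G z) => //; split => //; rewrite /= Fz.
transitivity (\big[addn/0%N]_(z \in B) X (G z)).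
  by apply: eq_fsbigr => z /set_mem Bz; rewrite /= (image_multiplicityE X FG GF (BU z Bz)).
rewrite (reindex_fsbig F (pullback B) B (fun z => X (G z)) bij); apply: eq_fsbigr => z /set_mem [Uz _].
by have [_ ->] := FG z Uz.
Qed.

Lemma occupancy_image (X : configuration U) (I : finType) (B : I -> set T) : (forall i, B i `<=` U) ->
  occupancy B (config_image hF X) = occupancy (fun i => pullback (B i)) X.
Proof. by move=> BU; apply/ffunP => i; rewrite !ffunE config_count_image. Qed.

Lemma measurable_config_image : measurable_fun setT (config_image hF : Conf U -> Conf U).
Proof.
apply: (measurability (@config_events _ U : set (set (Conf U))) erefl) => _ [_ [B [N [mB rB ->]]] <-].
rewrite setTI; apply: sub_sigma_algebra; exists (pullback B), N; split.
- exact: measurable_pullback.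
- exact: relatively_compact_pullback.
- apply/seteqP; split => X /=; rewrite config_count_image//; by apply: subset_trans rB.2; exact: subset_closure.
Qed.

Lemma Diffc_inverse : exists G, [/\ Diffc U G, (forall z, U z -> U (F z) /\ G (F z) = z) & forall z, U z -> U (G z) /\ F (G z) = z].
Proof.
have [[G [FG GF cF cG]] rF] := hF; exists G; split => //; split; first by exists F.
rewrite (_ : [set z | _] = [set z | U z /\ F z <> z])//; apply/seteqP; split => z [Uz h]; split => // e; apply: h.
  by rewrite -{1}e; have [_ ->] := FG z Uz.
by rewrite -{1}e; have [_ ->] := GF z Uz.
Qed.

End diffeomorphism.

Lemma config_eq (X Y : configuration U) : (forall z, X z = Y z) -> X = Y.
Proof.
case: X Y => [m mU' mf] [m' mU2 mf'] /= e.
have em : m = m' by apply/funext.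
by subst m'; congr Configuration; exact: Prop_irrelevance.
Qed.

Lemma config_imageK F G (hF : Diffc U F) (hG : Diffc U G) : (forall z, U z -> U (F z) /\ G (F z) = z) ->
  (forall z, U z -> U (G z) /\ F (G z) = z) -> forall X, config_image hF (config_image hG X) = X.
Proof.
move=> FG GF X; apply: config_eq => z.
have out (Y : configuration U) : ~ U z -> Y z = 0%N.
  by move=> nU; apply/eqP; apply: contra_notT nU; exact: configuration_supp.
have [Uz|nU] := pselect (U z); last by rewrite !out.
have [UG FGz] := GF z Uz.
by rewrite /= (image_multiplicityE _ FG GF Uz) /= (image_multiplicityE X GF FG UG) FGz.
Qed.

End quasi_invariance.

(** * Rare events and decomposition by particle number *)

Lemma exhaustion d (T : measurableType d) (R : realType) (P : probability T R) (X : nat -> set T) (e : R) :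
  (forall n, measurable (X n)) -> nondecreasing_seq X -> (forall x, exists n, X n x) -> 0 < e ->
  exists n, (P (~` X n) < e%:E)%E.
Proof.
move=> mX ndX cov e0.
have cvX := @nondecreasing_cvg_mu _ _ _ P _ mX (bigcupT_measurable _ mX) ndX.
have UX : \bigcup_n X n = setT by apply/seteqP; split => // x _; have [n Xn] := cov x; exists n.
have e1 : P (\bigcup_n X n) = 1%E by rewrite UX; exact: probability_setT.
have := eq_ind _ (fun l : \bar R => P (X n) @[n --> \oo] --> l) cvX _ e1.
move=> /fine_cvgP[_ /cvgrPdist_lt /(_ e e0) [n _ /(_ n (leqnn n)) h]]; exists n.
rewrite probability_setC// -[P (X n)]fineK ?fin_num_measure//.
by rewrite -EFinB lte_fin; apply: le_lt_trans h; exact: ler_norm.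
Qed.

Lemma finite_bounded (R : realType) (A : Type) (w : A -> R) (D : set A) : finite_set D ->
  exists n : nat, forall z, D z -> w z <= n%:R.
Proof.
elim/Pchoice: A => A in w D *; move=> /finite_seqP[s ->]; elim: s => [|z s [n hn]]; first by exists 0%N.
exists (maxn n (Num.bound `|w z|)) => y; rewrite /= inE => /predU1P[->|ys].
  apply: (@le_trans _ _ (Num.bound `|w z|)%:R); last by rewrite ler_nat leq_maxr.
  by apply: (le_trans (ler_norm _)); apply/ltW/archi_boundP.
by apply: le_trans (hn _ ys) _; rewrite ler_nat leq_maxl.
Qed.

Section mass.
Context (R : realType) (d : nat).
Local Notation V := (Clebesgue R d).
Local Notation Cd := 'rV[R[i]]_d.
Local Notation T := (Cspace R d).
Variables (U : set Cd) (P : probability (Conf U) R).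

Lemma measurable_config_count (E : set T) (N : set nat) : measurable E -> relatively_compact U E ->
  measurable ([set X | N (config_count X E)] : set (Conf U)).
Proof. by move=> mE rE; apply: sub_sigma_algebra; exists E, N; split. Qed.

Lemma mass_by_count (E : set T) (S : set (Conf U)) : measurable E -> relatively_compact U E -> measurable S ->
  P S = (\sum_(0 <= k <oo) P [set X | config_count (X : configuration U) E = k /\ S X])%E.
Proof.
move=> mE rE mS.
have mA k : measurable ([set X | config_count X E = k] : set (Conf U)) by exact: (@measurable_config_count E [set k]).
transitivity (P (\bigcup_(k in setT) [set X : Conf U | config_count (X : configuration U) E = k /\ S X])).
  congr (P _); apply/seteqP; split => [X SX|X [k _ []//]].
  by exists (config_count (X : configuration U) E).
rewrite measure_bigcup.
- by apply: eq_eseriesl => k; rewrite in_setT.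
- by move=> k _; exact: (measurableI _ _ (mA k) mS).
- by move=> i j _ _ [X [[<- _] [<- _]]].
Qed.

Lemma count_tight (E : set T) (e : R) : measurable E -> relatively_compact U E -> 0 < e ->
  exists l, (P [set X | ~ (config_count (X : configuration U) E <= l)%N] < e%:E)%E.
Proof.
move=> mE rE e0; apply: (@exhaustion _ _ _ P ( fun l => [set X : Conf U | (config_count (X : configuration U) E <= l)%N])) => //.
- by move=> l; exact: (@measurable_config_count E [set k | (k <= l)%N]).
- by move=> m n mn; apply/subsetPset => X /= h; exact: leq_trans mn.
- by move=> X; exists (config_count (X : configuration U) E) => /=.
Qed.

Variables (w : Cd -> R).
Hypotheses (oU : open U) (mw : measurable_fun (U : set T) (w : T -> R)).

(** A configuration has finitely many particles in the compact set [B0], so [w] is bounded on them;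
    continuity of [P] then gives a level [L]. *)
Lemma wild_rare (B0 : set Cd) (e : R) : compact B0 -> B0 `<=` U -> 0 < e ->
  exists L : R, 0 < L /\ (P [set X | ~ (config_count (X : configuration U) (wild U w B0 L) = 0%N)] < e%:E)%E.
Proof.
move=> cB BU e0.
pose Z n := [set X : Conf U | config_count (X : configuration U) (wild U w B0 n.+1%:R) = 0%N].
have mZ n : measurable (Z n).
  apply: (@measurable_config_count _ [set 0%N]); first exact: measurable_wild.
  by apply: (relatively_compact_sub cB BU) => z [].
(* Intersecting over all later indices makes the sequence increasing by construction. *)
have mI n : measurable (\bigcap_m Z (n + m)%N) by exact: bigcapT_measurable.
have ndI : nondecreasing_seq (fun n => \bigcap_m Z (n + m)%N).
  move=> m n mn; apply/subsetPset => X hX i _.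
  by have := hX (n - m + i)%N I; rewrite /Z /= addnA subnKC.
have covI X : exists n, (\bigcap_m Z (n + m)%N) X.
  have [n hn] := finite_bounded w (configuration_locally_finite (X : configuration U) cB BU).
  exists n => m _; rewrite /Z /= /config_count fsbig1// => z [Bz ht].
  apply/eqP; apply: contra_notT ht => Xz; split; first exact: BU.
  by apply: (le_trans (hn z (conj Bz Xz))); rewrite ler_nat; lia.
have [n h] := @exhaustion _ _ _ P (fun n => \bigcap_m Z (n + m)%N) e mI ndI covI e0.
exists n.+1%:R; split; first by rewrite ltr0n.
apply: le_lt_trans h; apply: le_measure.
- by rewrite inE; apply: measurableC; exact: mZ.
- by rewrite inE; exact: measurableC.
- by move=> X /= nX hX; apply: nX; have := hX 0%N I; rewrite addn0.
Qed.

End mass.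

Lemma le_combine_eq (R : realType) (a a' b b' e e' c d : \bar R) : a = a' -> b = b' -> e = e' ->
  (a <= c * b + d * e)%E -> (a' <= c * b' + d * e')%E.
Proof. by move=> -> -> ->. Qed.

(** [q] will be [k!]; the error [e / (l + 1)] for each of [l] moves adds up to at most [e]. *)
Lemma le_cancel_factor (R : realType) (x y z : \bar R) (q c e : R) (l : nat) : x \is a fin_num -> y \is a fin_num -> z \is a fin_num ->
  (0 <= z)%E -> 0 < q -> 0 <= e -> (q%:E * x <= c%:E * (q%:E * y) + (e / l.+1%:R * l%:R)%:E * (q%:E * z))%E ->
  (x <= c%:E * y + e%:E * z)%E.
Proof.
move=> /fineK <- /fineK <- /fineK <-; rewrite -!EFinM -!EFinD !lee_fin.
move: (fine x) (fine y) (fine z) => {x y z} x y z z0 q0 e0 h.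
have le : e / l.+1%:R * l%:R <= e.
  by rewrite mulrAC ler_pdivrMr ?ltr0n// ler_wpM2l// ler_nat.
rewrite -(ler_pM2l q0); apply: (le_trans h).
have -> : c * (q * y) + e / l.+1%:R * l%:R * (q * z) = q * (c * y + e / l.+1%:R * l%:R * z) by ring.
by rewrite ler_pM2l// lerD2l ler_wpM2r.
Qed.

(** * Comparison of a local event with its preimage *)

Section comparison.
Context (R : realType) (d : nat).
Local Notation V := (Clebesgue R d).
Local Notation Cd := 'rV[R[i]]_d.
Local Notation T := (Cspace R d).
Variables (U : set Cd) (w : Cd -> R).
Hypotheses (oU : open U) (cU : connected U) (mw : measurable_fun (U : set T) (w : T -> R)).
Hypotheses (w0 : forall z, U z -> 0 < w z)
  (wi : forall (B : set (Cspace R d)) (mB : measurable B),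
      relatively_compact U B -> (0 < Clebesgue R d B)%E ->
      (0 < ess_inf (mrestr (Clebesgue R d) mB) (fun z => (w z)%:E))%E).
Variable K : Cd -> Cd -> R[i].
Hypothesis hK : reproducing_kernel U w K.
Variable P : probability (Conf U) R.
Hypothesis hP : determinantal w K P.

Section conditional_density.
Variable E : set Cd.
Hypotheses (cE : compact E) (EU : E `<=` U).
Local Notation J := (jan V (wkern U w K) (E : set T)).

Lemma local_event_integral (I : finType) (B : I -> set T) (N : set {ffun I -> nat}) k :
  (forall j, measurable (B j)) -> (forall j, B j `<=` E) ->
  (k`!%:R%:E * P [set X | config_count (X : configuration U) E = k /\ N (occupancy B X)] =
   \int[tuple_measure V k]_(t in tset (E : set T) k) (((`[< N (cnt B t) >] : nat)%:R * J (t ++ [::]))%:E))%E.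
Proof.
move=> mB BE; rewrite (local_event_formula oU mw w0 wi hK hP cE EU mB BE).
rewrite (_ : [set t | _] = tset (E : set T) k `&` [set t : k.-tuple T | N (cnt B t)])//.
rewrite integral_mkcondr; apply: eq_integral => t _; rewrite patchE cats0.
case: ifPn => [/set_mem h|/negP nh]; first by rewrite asboolT// mul1r.
by rewrite asboolF ?mul0r// => h; apply: nh; rewrite inE.
Qed.

End conditional_density.

Variables (F G : Cd -> Cd) (B0 : set Cd).
Hypotheses (FG : forall z, U z -> U (F z) /\ G (F z) = z) (cF : C1_on U F) (cG : C1_on U G).
Hypotheses (cB : compact B0) (BU : B0 `<=` U) (BF : forall z, B0 z -> B0 (F z)).
Hypothesis Fid : forall z, U z -> ~ B0 z -> F z = z.

Local Notation B' B := (fun i => pullback U F (B i)).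

Lemma compact_relatively (A : set Cd) : compact A -> A `<=` U -> relatively_compact U A.
Proof. by move=> cA AU; exact: (relatively_compact_sub cA AU). Qed.

Lemma compact_measurableC (A : set Cd) : compact A -> measurable (A : set T).
Proof. by move=> cA; apply: measurable_closed; exact: compact_closed. Qed.

(** The order of the quantifiers is the point: [L], [K1], [l] and [c] are fixed before [E] and the
    event, so [E] may be enlarged to carry any local event. Summing over the number of particles in
    [E] turns the integral inequality of [peeling] into one for probabilities. *)
Lemma guarded_comparison (e : R) : 0 < e ->
  exists L : R, exists K1 : set Cd, exists l : nat, exists c : R, [/\ compact K1, K1 `<=` U & 0 <= c /\ [/\
   (P [set X | ~ (config_count (X : configuration U) (wild U w B0 L) = 0%N)] < e%:E)%E,
   (P [set X | ~ (config_count (X : configuration U) K1 <= l)%N] < e%:E)%E &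
   forall E, compact E -> E `<=` U -> K1 `<=` E -> forall (I : finType) (B : I -> set T),
    (forall i, measurable (B i)) -> (forall i, B i `<=` E) -> (forall i, B' B i `<=` E) -> (forall i, measurable (B' B i)) ->
    forall N : set {ffun I -> nat},
    (P [set X : Conf U | [/\ N (occupancy (B' B) X), (config_count (X : configuration U) K1 <= l)%N & config_count (X : configuration U) (wild U w B0 L) = 0%N]] <=
     c%:E * P [set X | N (occupancy B X)]  + e%:E)%E]].
Proof.
move=> e0; have [L [L0 hL]] := wild_rare P oU mw cB BU e0.
have [K1 [cK1 K1U B1 hp]] := peeling oU cU mw w0 wi hK hP FG cF cG cB BU BF Fid L0.
have mK1 := compact_measurableC cK1; have rK1 := compact_relatively cK1 K1U.
have [l hl] := count_tight P mK1 rK1 e0.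
have [|c c1 hc] := hp (e / l.+1%:R); first by rewrite divr_gt0.
have cl0 : 0 <= c l by apply: le_trans (c1 l); exact: ler01.
exists L, K1, l, (c l); split => //; split => //; split => // E cE EU K1E I B mB BE BE' mB' N.
have mE := compact_measurableC cE; have rE := compact_relatively cE EU.
have mW := measurable_wild oU mw cB L.
(* The tested sets, [K1] and [wild] in a single family: the guarded event becomes a local event, to
   which [local_event_integral] applies. *)
pose W : I + bool -> set T := fun i => match i with inl i => B' B i | inr b => if b then (K1 : set T) else wild U w B0 L end.
have mW' i : measurable (W i) by case: i => [i|[]] /=; [exact: mB'|exact: mK1|exact: mW].
have WE i : W i `<=` E.
  case: i => [i|[]] /=; [exact: BE'|exact: K1E|].
  by move=> z [Bz _]; exact/K1E/B1.
pose NW : set {ffun I + bool -> nat} := [set f | [/\ N [ffun i => f (inl i)], (f (inr true) <= l)%N & f (inr false) = 0%N]].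
have EW : [set X : Conf U | [/\ N (occupancy (B' B) X), (config_count (X : configuration U) K1 <= l)%N & config_count (X : configuration U) (wild U w B0 L) = 0%N]] = [set X | NW (occupancy W X)].
  apply/seteqP; split => X; rewrite /NW /= !ffunE /=;
  (have -> : [ffun i => occupancy W X (inl i)] = occupancy (B' B) X by apply/ffunP => i; rewrite !ffunE); by [].
have fac (k : nat) : (0 < k`!%:R :> R) by rewrite ltr0n fact_gt0.
pose Q : set (seq {ffun I -> bool}) := [set p | N [ffun j => count (fun b : {ffun I -> bool} => b j) p]].
have pB z : U z -> pattern (B' B) z = pattern B (F z).
  by move=> Uz; apply/ffunP => i; rewrite !ffunE; apply: asbool_equiv_eq; split => [[]|].
have patE (I' : finType) (C : I' -> set T) (M : set {ffun I' -> nat}) (t : seq T) :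
    pattern_ind C [set p | M [ffun j => count (fun b : {ffun I' -> bool} => b j) p]] t = (`[< M (cnt C t) >] : nat)%:R :> R.
  by rewrite cnt_pattern.
have guardedE k (t : k.-tuple T) : t \in tset (E : set T) k ->
    (pattern_ind (B' B) Q t * guard U w B0 L K1 l t * jan V (wkern U w K) (E : set T) (t ++ [::]))%:E =
    (((`[< NW (cnt W t) >] : nat)%:R * jan V (wkern U w K) (E : set T) (t ++ [::]))%:E : \bar R).
  move=> _; congr ((_ * _)%:E); rewrite patE.
  have -> : guard U w B0 L K1 l t = (`[< (cnt W t (inr true) <= l)%N /\ cnt W t (inr false) = 0%N >] : nat)%:R.
    have cW b : cnt W t (inr b) = count (fun p : {ffun bool -> bool} => p b) (map (pattern (fun b : bool => if b then (K1 : set T) else wild U w B0 L)) t).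
      by rewrite count_map ffunE; apply: eq_count => z /=; rewrite ffunE.
    by rewrite !cW.
  rewrite -natrM mulnb -asbool_and; congr ((nat_of_bool _)%:R); apply: asbool_equiv_eq; rewrite /NW /=.
  have -> : [ffun i => cnt W t (inl i)] = cnt (B' B) t by apply/ffunP => i; rewrite !ffunE.
  by split => [[? []]|[]].
have plainE k (t : k.-tuple T) : t \in tset (E : set T) k ->
    (pattern_ind B Q t * jan V (wkern U w K) (E : set T) (t ++ [::]))%:E =
    (((`[< N (cnt B t) >] : nat)%:R * jan V (wkern U w K) (E : set T) (t ++ [::]))%:E : \bar R).
  by move=> _; rewrite patE.
have freeE k (t : k.-tuple T) : t \in tset (E : set T) k ->
    (jan V (wkern U w K) (E : set T) (t ++ [::]))%:E =
    (((`[< setT (cnt B t) >] : nat)%:R * jan V (wkern U w K) (E : set T) (t ++ [::]))%:E : \bar R).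
  by move=> _; rewrite asboolT// mul1r.
have key k : (P [set X | config_count (X : configuration U) E = k /\ NW (occupancy W X)] <=
   (c l)%:E * P [set X | config_count (X : configuration U) E = k /\ N (occupancy B X)] + e%:E * P [set X | config_count (X : configuration U) E = k /\ setT (occupancy B X)])%E.
    have step := hc E cE EU K1E I B (B' B) mB mB' pB k l Q [::] (fun z zs => False_ind (E z) (notF zs)).
  have h1 := local_event_integral cE EU NW k mW' WE.
  have h2 := local_event_integral cE EU N k mB BE.
  have h3 := local_event_integral cE EU setT k mB BE.
  have h := le_combine_eq (eq_trans (eq_integral _ _ (guardedE k)) (esym h1)) (eq_trans (eq_integral _ _ (plainE k)) (esym h2))
    (eq_trans (eq_integral _ _ (freeE k)) (esym h3)) step.
  have mA1 : measurable ([set X | config_count X E = k /\ NW (occupancy W X)] : set (Conf U)).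
    by apply: (measurableI [set X : Conf U | config_count (X : configuration U) E = k]); [exact: (measurable_config_count [set k] mE rE)|
      apply: measurable_occupancy => // i; exact: (relatively_compact_sub cE EU)].
  have mA2 (M : set {ffun I -> nat}) : measurable ([set X | config_count X E = k /\ M (occupancy B X)] : set (Conf U)).
    by apply: (measurableI [set X : Conf U | config_count (X : configuration U) E = k]); [exact: (measurable_config_count [set k] mE rE)|
      apply: measurable_occupancy => // i; exact: (relatively_compact_sub cE EU)].
  exact: (@le_cancel_factor _ _ _ _ _ _ _ l (fin_num_measure P _ mA1) (fin_num_measure P _ (mA2 N)) (fin_num_measure P _ (mA2 setT)) (measure_ge0 _ _) (fac k) (ltW e0) h).
rewrite EW (mass_by_count P mE rE (measurable_occupancy mW' _ _)); last by move=> i; exact: (relatively_compact_sub cE EU).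
rewrite (mass_by_count P mE rE (measurable_occupancy mB _ _)); last by move=> i; exact: (relatively_compact_sub cE EU).
have hT : (\sum_(0 <= k <oo) P [set X | config_count (X : configuration U) E = k /\ setT (occupancy B X)] = 1)%E.
  transitivity (P setT); last exact: probability_setT.
  by rewrite (mass_by_count P mE rE measurableT).
apply: le_trans (lee_nneseries _ (fun k _ => key k)) _ => //.
rewrite nneseriesD; try by move=> k _; rewrite ?mule_ge0 ?lee_fin ?(ltW e0).
by rewrite !nneseriesZl ?hT ?mule1.
Qed.

End comparison.

Lemma relatively_compact_cover (X : topologicalType) (U : set X) (I : finType) (B : I -> set X) :
  (forall i, relatively_compact U (B i)) -> exists E, [/\ compact E, E `<=` U & forall i, B i `<=` E].
Proof.
move=> rB; exists (\big[setU/set0]_(i : I) closure (B i)); split.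
- by apply: bigsetU_compact => i _; have [] := rB i.
- apply: (big_ind (fun A => A `<=` U)) => [z []|A A' AU A'U z [/AU|/A'U]|i _] //; by have [] := rB i.
- by move=> i z Bz; rewrite (bigD1 i)//=; left; exact: subset_closure.
Qed.

Section quasi_invariance.
Context (R : realType) (d : nat).
Local Notation V := (Clebesgue R d).
Local Notation Cd := 'rV[R[i]]_d.
Local Notation T := (Cspace R d).
Variables (U : set Cd) (w : Cd -> R).
Hypotheses (oU : open U) (cU : connected U) (mw : measurable_fun (U : set T) (w : T -> R)).
Hypotheses (w0 : forall z, U z -> 0 < w z)
  (wi : forall (B : set (Cspace R d)) (mB : measurable B),
      relatively_compact U B -> (0 < Clebesgue R d B)%E ->
      (0 < ess_inf (mrestr (Clebesgue R d) mB) (fun z => (w z)%:E))%E).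
Variable K : Cd -> Cd -> R[i].
Hypothesis hK : reproducing_kernel U w K.
Variable P : probability (Conf U) R.
Hypothesis hP : determinantal w K P.

Lemma local_event_image_le (F : Cd -> Cd) (hF : Diffc U F) (e : R) : 0 < e ->
  exists2 c : R, 0 <= c & forall S, @local_event R d U S ->
  (P ((config_image hF : Conf U -> Conf U) @^-1` S) <= c%:E * P S + e%:E)%E.
Proof.
move=> e0; have [[G [FG GF cF cG]] [cB BU]] := hF.
pose B0 := closure [set z | U z /\ F z <> z].
have Fid z : U z -> ~ B0 z -> F z = z.
  move=> Uz nB; apply: contrapT => Fz; apply: nB; exact: subset_closure.
(* If [F z] were outside [B0], it would be fixed by [F], and injectivity would give [F z = z], a
   point of [B0]. *)
have BF z : B0 z -> B0 (F z).
  move=> Bz; have Uz := BU _ Bz; apply: contrapT => nB.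
  have [UFz e1] := FG z Uz; have e2 := Fid _ UFz nB.
  by apply: nB; have [_ e3] := FG _ UFz; rewrite e2 e1 in e3; rewrite -e3.
have e30 : 0 < e / 3 by rewrite divr_gt0.
have [L [K1 [l [c [cK1 K1U [c0 [hL hl hc]]]]]]] := guarded_comparison oU cU mw w0 wi hK hP FG cF cG cB BU BF Fid e30.
exists c => // _ [I [B [N [mB rB ->]]]].
have rB' i := relatively_compact_pullback hF (rB i).
have mB' i := measurable_pullback oU hF (mB i).
have [E1 [cE1 E1U BE1]] := relatively_compact_cover rB.
have [E2 [cE2 E2U BE2]] := relatively_compact_cover rB'.
(* [E] has to contain [K1], as well as the sets that test the configuration after the move and their
   pullbacks, which test it before. *)
pose E := K1 `|` (E1 `|` E2).
have cE : compact E by do 2 apply: compactU => //.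
have EU : E `<=` U by move=> z [/K1U|[/E1U|/E2U]].
have h := hc E cE EU (fun z Kz => or_introl Kz) I B mB
  (fun i z Bz => or_intror (or_introl (BE1 i z Bz))) (fun i z Bz => or_intror (or_intror (BE2 i z Bz))) mB' N.
have mW : measurable (wild U w B0 L) by exact: measurable_wild.
have rW : relatively_compact U (wild U w B0 L) by apply: (relatively_compact_sub cB BU) => z [].
have mK : measurable (K1 : set T) by exact: compact_measurableC.
have rK : relatively_compact U K1 by exact: compact_relatively.
set S1 := [set X : Conf U | [/\ _, _ & _]] in h.
set Sw := [set X : Conf U | ~ _] in hL; set SK := [set X : Conf U | ~ _] in hl.
have mSw : measurable Sw by exact: (measurable_config_count [set k | ~ (k = 0%N)] mW rW).
have mSK : measurable SK by exact: (measurable_config_count [set k | ~ (k <= l)%N] mK rK).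
have mN' : measurable ([set X | N (occupancy (fun i => pullback U F (B i)) X)] : set (Conf U)) by exact: measurable_occupancy.
have mS1 : measurable S1.
  rewrite (_ : S1 = [set X : Conf U | N (occupancy (fun i => pullback U F (B i)) X)] `&` (~` SK `&` ~` Sw)).
    by apply: measurableI => //; apply: measurableI; exact: measurableC.
  apply/seteqP; split => [X [h1 h2 h3]|X [h1 [/contrapT h2 /contrapT h3]]]; last by split.
  by split => //; split => n; exact: n.
have -> : (config_image hF : Conf U -> Conf U) @^-1` [set X : Conf U | N (occupancy B X)] =
    [set X : Conf U | N (occupancy (fun i => pullback U F (B i)) X)].
  apply/seteqP; split => X /=; rewrite (occupancy_image hF)// => i z Bz; exact/E1U/(BE1 i).
have step : (P [set X : Conf U | N (occupancy (fun i => pullback U F (B i)) X)] <= P S1 + P (SK `|` Sw))%E.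
  apply: (@le_trans _ _ (P (S1 `|` (SK `|` Sw)))).
    apply: le_measure; rewrite ?inE//; first by apply: measurableU => //; exact: measurableU.
    move=> X NX; have [hk|] := pselect ((config_count (X : configuration U) K1 <= l)%N); last by right; left.
    by have [hw|] := pselect (config_count (X : configuration U) (wild U w B0 L) = 0%N); [left|right; right].
  by apply: measureU2 => //; exact: measurableU.
apply: (le_trans step).
have -> : (c%:E * P [set X | N (occupancy B X)] + e%:E = (c%:E * P [set X | N (occupancy B X)] + (e / 3)%:E) + ((e / 3)%:E + (e / 3)%:E))%E.
  by rewrite -addeA -!EFinD; congr (_ + _%:E)%E; field.
apply: leeD; first exact: h.
apply: (le_trans (measureU2 _ mSK mSw)); apply: leeD; exact: ltW.
Qed.

Lemma config_image_null (F : Cd -> Cd) (hF : Diffc U F) (A : set (Conf U)) : measurable A -> P A = 0%E ->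
  P ((config_image hF : Conf U -> Conf U) @^-1` A) = 0%E.
Proof.
move=> mA A0; set f := (config_image hF : Conf U -> Conf U).
have mf : measurable_fun setT f := measurable_config_image oU hF.
have mfS S : measurable S -> measurable (f @^-1` S) by move=> mS; rewrite -[X in measurable X]setTI; exact: mf.
apply/eqP; rewrite eq_le measure_ge0 andbT; apply/lee_addgt0Pr => e e0; rewrite add0e.
have e30 : 0 < e / 3 by rewrite divr_gt0.
have [c c0 hc] := local_event_image_le hF e30.
(* Three shares of [e / 3]: the approximation of [A] seen through the image, the factor [c] times
   the mass of [Y], and the additive error of [local_event_image_le]. *)
pose eta := Num.min (e / 3) (e / 3 / (c + 1)).
have eta0 : 0 < eta by rewrite lt_min e30 divr_gt0// ltr_wpDl.
have [Y [lY h1 h2]] := image_approximable P mf (@local_event0 R d U) (@measurable_local_event R d U)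
  (@local_eventC R d U) (@local_eventU R d U) (local_event_generates mA) eta0.
have mY := measurable_local_event lY.
have PY : (P Y <= eta%:E)%E.
  apply: le_trans (ltW h1); apply: (@le_trans _ _ (P ((Y `\` A) `|` A))).
    by apply: le_measure; rewrite ?inE//; [apply: measurableU => //; exact: measurableD|move=> x Yx; have [|] := pselect (A x); [right|left]].
  have e1 : (P (Y `\` A) + P A <= P (Y `\` A))%E by rewrite A0 adde0.
  exact: (le_trans (measureU2 _ (measurableD mY mA) mA) e1).
apply: (@le_trans _ _ (P (f @^-1` (A `\` Y)) + P (f @^-1` Y))%E).
  apply: (le_trans _ (measureU2 _ (mfS _ (measurableD mA mY)) (mfS _ mY))).
  apply: le_measure; rewrite ?inE; [exact: mfS|by apply: measurableU; apply: mfS => //; exact: measurableD|].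
  by move=> x Ax; have [|] := pselect (Y (f x)); [right|left].
apply: (@le_trans _ _ (eta%:E + (c%:E * eta%:E + (e / 3)%:E))%E).
  apply: leeD; first exact: ltW.
  by apply: (le_trans (hc _ lY)); apply: leeD => //; apply: lee_wpmul2l; rewrite ?lee_fin.
rewrite -EFinM -!EFinD lee_fin.
have a1 : eta <= e / 3 by rewrite ge_min lexx.
have a2 : c * eta <= e / 3.
  apply: (@le_trans _ _ ((c + 1) * eta)); first by rewrite ler_wpM2r ?(ltW eta0)// lerDl.
  by rewrite mulrC -ler_pdivlMr ?ltr_wpDl// ge_min lexx orbT.
by lra.
Qed.

Lemma determinantal_quasi_invariant : Diffc_quasi_invariant P.
Proof.
move=> F hF; have [G [hG FG GF]] := Diffc_inverse hF.
have dom (Q1 Q2 : set (Conf U) -> \bar R) : (forall A, measurable A -> Q2 A = 0%E -> Q1 A = 0%E) -> Q1 `<< Q2.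
    by move=> h D hD A mA AD; apply: h => //; exact: hD.
split; apply: dom => A mA; first exact: config_image_null.
move=> h; have mfA : measurable ((config_image hF : Conf U -> Conf U) @^-1` A).
  by rewrite -[X in measurable X]setTI; exact: (measurable_config_image oU hF).
rewrite -(config_image_null hG mfA h); congr (P _); apply/seteqP; split => X /=; by rewrite (config_imageK hF hG FG GF).
Qed.

End quasi_invariance.

Theorem corollary2p1 (R : realType) (d : nat) (U : set 'rV[R[i]]_d)
    (hU0 : U !=set0) (hUo : open U) (hUc : connected U)
    (hUb : exists f : 'rV[R[i]]_d -> R[i],
      [/\ holomorphic_on U f,
          exists M : R, forall z, U z -> normc (f z) <= M
        & exists z1 z2, [/\ U z1, U z2 & f z1 <> f z2]])
    (w : 'rV[R[i]]_d -> R)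
    (hwm : measurable_fun (U : set (Cspace R d)) (w : Cspace R d -> R))
    (hw0 : forall z, U z -> 0 < w z)
    (hwi : forall (B : set (Cspace R d)) (mB : measurable B),
      relatively_compact U B -> (0 < Clebesgue R d B)%E ->
      (0 < ess_inf (mrestr (Clebesgue R d) mB) (fun z => (w z)%:E))%E)
    (hA : exists f, bergman U w f /\ exists2 z, U z & f z <> 0)
    (K : 'rV[R[i]]_d -> 'rV[R[i]]_d -> R[i])
    (hK : reproducing_kernel U w K)
    (P : probability (Conf U) R)
    (hP : determinantal w K P) :
  Diffc_quasi_invariant P.
Proof. exact: (determinantal_quasi_invariant hUo hUc hwm hw0 hwi hK hP). Qed.
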